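(* Let $1<\alpha\le2$, $\sigma\in\mathbb{R}$ and $s<0$. Consider the initial value problem $$-i\partial_tu+(-\Delta)^{\frac\alpha2}u=\sigma\,(|\cdot|^{-\alpha}*|u|^2)\,u,\qquad u(0,\cdot)=\varphi,$$ on $[0,T]\times\mathbb{R}^3$ with $T>0$. If the flow map $\varphi\mapsto u$ exists (in a small neighborhood of the origin) as a map from $H^s_{rad}(\mathbb{R}^3)$ to $C([0,T],H^s_{rad}(\mathbb{R}^3))$, then it fails to be $C^3$ at the origin.
   Context: The unknown $u$ is a complex-valued function of $(t,x)$ with $x\in\mathbb{R}^3$; the flow map sends the initial datum $\varphi$ to the corresponding solution $u$. $H^s_{rad}(\mathbb{R}^3)$ is the subspace of radial elements of the Sobolev space $H^s(\mathbb{R}^3)$, i.e. those $\varphi\in H^s(\mathbb{R}^3)$ for which there is $\varphi_0:[0,\infty)\to\mathbb{C}$ with $\varphi(x)=\varphi_0(|x|)$ for a.e. $x$, equipped with the norm $\|\cdot\|_{H^s}$. $(-\Delta)^{\alpha/2}$ is the spatial Fourier multiplier with symbol $|\xi|^\alpha$, and $*$ is convolution in $x\in\mathbb{R}^3$.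
   Formalization: The case σ=0 is excluded: there the flow is the free linear evolution, a bounded linear map, hence smooth, so the claim fails; also, for s<0, H^s_rad is read as the closure in H^s of the radial functions it contains. *)

(* Defs.v *)
From HB Require Import structures.
From mathcomp Require Import all_boot all_order all_algebra.
From mathcomp Require Import all_classical all_reals all_analysis.
From mathcomp.real_closed Require Export complex.

Set Implicit Arguments.
Unset Strict Implicit.
Unset Printing Implicit Defensive.

Import Order.TTheory GRing.Theory Num.Theory numFieldNormedType.Exports.
Import ComplexField.Normc.

Local Open Scope classical_set_scope.
Local Open Scope complex_scope.
Local Open Scope ring_scope.

Definition R3 (R : realType) : Type := (R * R * R)%type.

HB.instance Definition _ (R : realType) := NormedModule.on (R3 R).
(* The Borel sets, in the form in which they carry the product of the Lebesgue
   measures of the library. *)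
HB.instance Definition _ (R : realType) := Measurable.copy (R3 R)
  (measurableTypeR R * measurableTypeR R * measurableTypeR R)%type.

Section Space.
Context {R : realType}.
Implicit Types x y : R3 R.

Definition lebesgue_prod : {measure set
    (measurableTypeR R * measurableTypeR R * measurableTypeR R)%type -> \bar R} :=
  ((@lebesgue_measure R \x @lebesgue_measure R) \x @lebesgue_measure R)%E.

Definition leb3 : {measure set (R3 R) -> \bar R} := lebesgue_prod.

Definition dot x y : R := x.1.1 * y.1.1 + x.1.2 * y.1.2 + x.2 * y.2.

(* The library norm of R * R * R is the sup norm; this is |x|. *)
Definition eucl x : R := Num.sqrt (dot x x).

End Space.

Section ComplexFunctions.
Context d (T : measurableType d) (R : realType).
Implicit Types (mu : {measure set T -> \bar R}) (D : set T) (f : T -> R[i]).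

Definition cmeasurable f :=
  measurable_fun setT (fun x => complex.Re (f x)) /\
  measurable_fun setT (fun x => complex.Im (f x)).

Definition cintegrable mu D f :=
  mu.-integrable D (fun x => (complex.Re (f x))%:E) /\
  mu.-integrable D (fun x => (complex.Im (f x))%:E).

Definition cintegral mu D f : R[i] :=
  Rintegral mu D (fun x => complex.Re (f x)) +i*
  Rintegral mu D (fun x => complex.Im (f x)).

End ComplexFunctions.

Section Distributions.
Context {R : realType}.

Definition iter_derive (vs : seq (R3 R)) (f : R3 R -> R) : R3 R -> R :=
  foldr (fun v (g : R3 R -> R) x => 'D_v g x) f vs.

Definition smooth (f : R3 R -> R) :=
  forall vs : seq (R3 R), continuous (iter_derive vs f) /\
    forall x v, derivable (iter_derive vs f) x v.

Record test := Test {
  test_fun :> R3 R -> R;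
  test_smooth : smooth test_fun;
  test_support : compact (closure [set x | test_fun x != 0]) }.

(* A distribution is recorded by its values on the real-valued test functions;
   its values on complex-valued ones follow by linearity. *)
Definition distr : Type := test -> R[i].
HB.instance Definition _ := GRing.Lmodule.on distr.

Implicit Types (S : distr) (f F : R3 R -> R[i]).

(* S is the distribution given by the locally integrable function f. *)
Definition represents S f :=
  cmeasurable f /\
  forall eta : test,
    cintegrable leb3 setT (fun x => f x * (eta x)%:C) /\
    S eta = cintegral leb3 setT (fun x => f x * (eta x)%:C).

(* The Fourier transform is unitary:
     (2 pi)^(-3/2) \int exp(- i x.xi) f(x) dx,
   and this is its inverse. *)
Definition inv_fourier_test (eta : test) (xi : R3 R) : R[i] :=
  ((2 * pi) `^ (- (3 / 2)))%:C *
  cintegral leb3 setT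
    (fun x => (cos (dot x xi) * eta x) +i* (sin (dot x xi) * eta x)).

Definition weighted_L2_norm (s : R) F : \bar R :=
  'N[leb3]_2%:E[(fun xi =>
     ((1 + eucl xi ^+ 2) `^ (s / 2) * normc (F xi))%R%:E)]%E.

(* S is a tempered distribution whose Fourier transform is the function F.
   A function in some weighted L^2 space is determined almost everywhere by
   these pairings, compactly supported test functions being dense among the
   Schwartz functions. *)
Definition has_fourier S F :=
  [/\ cmeasurable F,
      exists k : R, (weighted_L2_norm k F < +oo)%E
    & forall eta : test,
        S eta = cintegral leb3 setT (fun xi => F xi * inv_fourier_test eta xi)].

Definition fourier S : R3 R -> R[i] := xget (fun=> 0) [set F | has_fourier S F].

(* All the F with has_fourier S F agree almost everywhere; the norm is +oo when
   there is no such F. *)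
Definition Hs_norm (s : R) S : \bar R :=
  ereal_inf [set weighted_L2_norm s F | F in [set F | has_fourier S F]].

Definition Hs (s : R) : set distr := [set S | (Hs_norm s S < +oo)%E].

Definition radial_function f :=
  exists f0 : R -> R[i], {ae leb3, forall x, f x = f0 (eucl x)}.

(* For s < 0 not every element of H^s is a function: H^s_rad is the closure in
   H^s of the radial functions it contains. *)
Definition Hs_rad (s : R) : set distr :=
  [set S | Hs s S /\
    forall eps : R, 0 < eps ->
      exists S', [/\ Hs s S',
                     exists2 f, represents S' f & radial_function f
                   & (Hs_norm s (S - S')%R < eps%:E)%E]].

Definition frac_laplacian (alpha : R) S : distr := fun eta =>
  cintegral leb3 setT
    (fun xi => (eucl xi `^ alpha)%:C * fourier S xi * inv_fourier_test eta xi).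

End Distributions.
Arguments test : clear implicits.
Arguments distr : clear implicits.

Section Equation.
Context {R : realType}.

(* A map on [0, T] is represented by a function on R, whose values off [0, T]
   are irrelevant. *)
Definition CHs_rad (s T : R) : set (R -> distr R) :=
  [set u | (forall t, t \in `[0, T] -> Hs_rad s (u t)) /\
    forall t, t \in `[0, T] -> forall eps : R, 0 < eps ->
      exists2 delta : R, 0 < delta &
        forall t', t' \in `[0, T] -> `|t' - t| < delta ->
          (Hs_norm s (u t' - u t)%R < eps%:E)%E].

Definition CHs_norm (s T : R) (u : R -> distr R) : \bar R :=
  ereal_sup [set Hs_norm s (u t) | t in `[0, T]].

(* (|.|^-alpha * |f|^2)(x), possibly infinite. *)
Definition potential (alpha : R) (f : R3 R -> R[i]) (x : R3 R) : \bar R :=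
  (\int[leb3]_y (eucl (x - y)%R `^ (- alpha) * normc (f y) ^+ 2)%R%:E)%E.

Definition hartree (alpha : R) (f : R3 R -> R[i]) (x : R3 R) : R[i] :=
  (fine (potential alpha f x))%:C * f x.

(* u is given by a function f(t, x) whose Hartree nonlinearity is locally
   integrable, and the equation holds in the sense of distributions, integrated
   from 0 to t. *)
Definition distributional_solution (alpha sigma s T : R) (u : R -> distr R) :=
  CHs_rad s T u /\
  exists f : R -> R3 R -> R[i],
    [/\ cmeasurable (fun p : measurableTypeR R * R3 R => f p.1 p.2),
        {ae lebesgue_measure, forall t : R,
           t \in `[0, T] -> represents (u t) (f t)},
        forall eta : test R,
          (\int[lebesgue_measure]_(t in `[0%R, T]) \int[leb3]_x
             (potential alpha (f t) x * (normc (f t x) * `|eta x|)%:E) < +oo)%E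
      & forall (eta : test R) (t : R), t \in `[0, T] ->
          - 'i * (u t eta - u 0 eta) +
          cintegral lebesgue_measure `[0, t]
            (fun tau => frac_laplacian alpha (u tau) eta) =
          sigma%:C *
          cintegral lebesgue_measure `[0, t]
            (fun tau => cintegral leb3 setT
               (fun x => hartree alpha (f tau) x * (eta x)%:C))].

(* The nonlinearity has no meaning for a general u in C([0, T], H^s) when s < 0,
   so limits in C([0, T], H^s) of distributional solutions are solutions too. *)
Definition solution (alpha sigma s T : R) (phi : distr R) (u : R -> distr R) :=
  [/\ CHs_rad s T u, u 0 = phi
    & forall eps : R, 0 < eps ->
        exists2 v, distributional_solution alpha sigma s T v &
          (CHs_norm s T (v - u)%R < eps%:E)%E].

Definition regular_solution (alpha sigma s T : R) (phi : distr R)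
    (u : R -> distr R) :=
  [/\ distributional_solution alpha sigma s T u, u 0 = phi
    & forall k : R, CHs_rad k T u].

(* Phi is the flow map on the ball of radius r of H^s_rad.  Uniqueness of the
   solution is required only in the form that a regular solution on [0, T], when
   there is one, is the solution selected by Phi. *)
Definition flow_map (alpha sigma s T r : R) (Phi : distr R -> R -> distr R) :=
  forall phi, Hs_rad s phi -> (Hs_norm s phi < r%:E)%E ->
    solution alpha sigma s T phi (Phi phi) /\
    forall u, regular_solution alpha sigma s T phi u ->
      {in `[0, T], Phi phi =1 u}.

End Equation.

(* X is a subspace of V, nV and nW are extended-valued (semi)norms.  Derivatives
   are over the reals: u |-> |u|^2 is not holomorphic. *)
Section C3.
Context {R : realType} {V W : lmodType R[i]}.
Variables (X : set V) (nV : V -> \bar R) (nW : W -> \bar R).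

Definition real_linear_on (A : V -> W) :=
  forall (a : R) h k, X h -> X k -> A (a%:C *: h + k) = a%:C *: A h + A k.

Definition bounded_linear (A : V -> W) :=
  real_linear_on A /\
  exists M : R, forall h, X h -> (nW (A h) <= M%:E * nV h)%E.

Definition bounded_bilinear (A : V -> V -> W) :=
  [/\ forall h, X h -> real_linear_on (A h),
      forall k, X k -> real_linear_on (fun h => A h k)
    & exists M : R, forall h k, X h -> X k ->
        (nW (A h k) <= M%:E * (nV h * nV k))%E].

Definition bounded_trilinear (A : V -> V -> V -> W) :=
  [/\ forall h k, X h -> X k -> real_linear_on (A h k),
      forall h l, X h -> X l -> real_linear_on (fun k => A h k l),
      forall k l, X k -> X l -> real_linear_on (fun h => A h k l)
    & exists M : R, forall h k l, X h -> X k -> X l ->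
        (nW (A h k l) <= M%:E * (nV h * nV k * nV l))%E].

(* Three times Frechet differentiable on a ball around the origin, with third
   derivative continuous at the origin.  The i-th derivatives are taken in the
   operator norm of bounded i-linear maps on X. *)
Definition C3_at_origin (Phi : V -> W) :=
  exists2 rho : R, 0 < rho &
  exists (D1 : V -> V -> W) (D2 : V -> V -> V -> W) (D3 : V -> V -> V -> V -> W),
    (forall phi, X phi -> (nV phi < rho%:E)%E ->
      [/\ bounded_linear (D1 phi), bounded_bilinear (D2 phi),
          bounded_trilinear (D3 phi)
        & forall eps : R, 0 < eps -> exists2 delta : R, 0 < delta &
            forall h, X h -> (nV h < delta%:E)%E ->
            [/\ (nW (Phi (phi + h)%R - Phi phi - D1 phi h)%R
                   <= eps%:E * nV h)%E,
                forall k, X k ->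
                  (nW (D1 (phi + h)%R k - D1 phi k - D2 phi h k)%R
                     <= eps%:E * (nV h * nV k))%E
              & forall k l, X k -> X l ->
                  (nW (D2 (phi + h)%R k l - D2 phi k l - D3 phi h k l)%R
                     <= eps%:E * (nV h * nV k * nV l))%E]]) /\
    (forall eps : R, 0 < eps -> exists2 delta : R, 0 < delta &
       forall phi, X phi -> (nV phi < delta%:E)%E ->
         forall h k l, X h -> X k -> X l ->
           (nW (D3 phi h k l - D3 0%R h k l)%R
              <= eps%:E * (nV h * nV k * nV l))%E).

End C3.

(* Main.v *)
(* In the unknown W = e^(it|xi|^alpha) u^, with datum eps phi on the Fourier
   side, the equation becomes an integral equation whose nonlinearity is
   trilinear convolution with the Fourier transform of |x|^(-alpha).  That
   kernel is a positive superposition of Gaussians, which makes the weight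
   e^(-|xi|) (1 + |xi|)^(-6) stable under the nonlinearity; a Picard iteration
   then gives, for a weighted phi and small eps, a regular solution
     e^(-it|xi|^alpha) (eps phi + i sigma eps^3 B(t)) + O(eps^5).
   If the flow were C^3 at the origin, its third differential along phi would be
   6 times the cubic term, hence ||B(t)||_s <= K ||phi||_s^3.  Take phi to be the
   indicator of lambda <= |xi| <= 2 lambda and t of order lambda^(-alpha): all the
   resonance phases stay below 1/2, nothing cancels in B, and B is at least of
   order lambda^3 on a cube of side of order lambda.  So lambda^(2s + 9) is
   bounded by a multiple of lambda^(6s + 9), which fails as lambda grows since
   s < 0. *)
From HB Require Import structures.
Require Import Defs.
From mathcomp Require Import all_boot all_order all_algebra.
From mathcomp Require Import all_classical all_reals all_analysis.
From mathcomp Require Import measurable_realfun ring lra.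
Import Order.TTheory GRing.Theory Num.Theory numFieldNormedType.Exports.
Import ComplexField.Normc.
Local Open Scope classical_set_scope.
Local Open Scope complex_scope.
Local Open Scope ring_scope.
Set Implicit Arguments.
Unset Strict Implicit.
Unset Printing Implicit Defensive.

(** * Complex-valued integrals *)

(** Since the nonlinearity has no meaning on negative Sobolev spaces, the abstract flow is
    accessible only through its clause on regular solutions; this is why explicit solutions lying in
    every [H^k] at once have to be built. The exponential factor of the weight puts them there, and
    it absorbs the symbol at the price of half its rate. Radiality is carried along as invariance
    under rotations. Differentiability is used through scalars only: evaluation at a time and at a
    test function is bounded on the spaces involved, so the flow along a line through the origin
    becomes a function of one real variable. To return from these scalars to a norm, the Fourier
    transform of a distribution must be determined almost everywhere by its values on test
    functions. Power count: at frequency [lambda] the kernel has size [lambda^(alpha - 3)], the two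
    convolution integrals contribute [lambda^6] and the time integral [lambda^(-alpha)], which
    explains the size of the cubic term; the squared norms carry a further [lambda^(2 s + 3)] from
    weight and volume. *)

Section ComplexNorm.
Context {R : realType}.
Implicit Types (x y : R) (z w : R[i]).

Lemma normc_real x : normc x%:C = `|x|.
Proof. by rewrite /= expr0n addr0 sqrtr_sqr. Qed.

Lemma normc_ge0 z : 0 <= normc z.
Proof. by case: z => a b; exact: sqrtr_ge0. Qed.

Lemma normc_conj z : normc z^* = normc z.
Proof. by case: z => a b /=; rewrite sqrrN. Qed.

Lemma normr_Re_le z : `|complex.Re z| <= normc z.
Proof. by case: z => a b /=; rewrite -sqrtr_sqr ler_wsqrtr// lerDl sqr_ge0. Qed.

Lemma normr_Im_le z : `|complex.Im z| <= normc z.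
Proof. by case: z => a b /=; rewrite -sqrtr_sqr ler_wsqrtr// lerDr sqr_ge0. Qed.

Lemma normc_le_ReIm z : normc z <= `|complex.Re z| + `|complex.Im z|.
Proof.
case: z => a b /=; rewrite -[leRHS]ger0_norm ?addr_ge0// -sqrtr_sqr ler_wsqrtr//.
by rewrite sqrrD !real_normK ?num_real// -addrA lerD2l lerDr mulrn_wge0// mulr_ge0.
Qed.

Lemma normcB z w : normc (z - w) <= normc z + normc w.
Proof. by rewrite (le_trans (le_normcD z (- w)))// lerD2l (@normcN _ w). Qed.

Lemma ReD z w : complex.Re (z + w) = complex.Re z + complex.Re w.
Proof. by case: z; case: w. Qed.
Lemma ImD z w : complex.Im (z + w) = complex.Im z + complex.Im w.
Proof. by case: z; case: w. Qed.
Lemma ReN z : complex.Re (- z) = - complex.Re z. Proof. by case: z. Qed.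
Lemma ImN z : complex.Im (- z) = - complex.Im z. Proof. by case: z. Qed.
Lemma ReM z w : complex.Re (z * w) =
  complex.Re z * complex.Re w - complex.Im z * complex.Im w.
Proof. by case: z; case: w. Qed.
Lemma ImM z w : complex.Im (z * w) =
  complex.Re z * complex.Im w + complex.Im z * complex.Re w.
Proof. by case: z => a b; case: w => c d /=. Qed.
Lemma complex_eqP z w : complex.Re z = complex.Re w ->
  complex.Im z = complex.Im w -> z = w.
Proof. by case: z => a b; case: w => c d /= -> ->. Qed.

Definition cis x : R[i] := cos x +i* sin x.

Lemma cisD x y : cis (x + y) = cis x * cis y.
Proof. by apply: complex_eqP; rewrite ?ReM ?ImM/= ?cosD ?sinD//; ring. Qed.

Lemma cis0 : cis 0 = 1.
Proof. by rewrite /cis cos0 sin0. Qed.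

Lemma cisN x : cis (- x) = (cis x)^*.
Proof. by rewrite /cis cosN sinN. Qed.

Lemma normc_cis x : normc (cis x) = 1.
Proof. by rewrite /= cos2Dsin2 sqrtr1. Qed.

(** Mean value theorem, the derivative being bounded by 1. *)
Lemma cos_lipschitz x y : `|cos x - cos y| <= `|x - y|.
Proof.
wlog xy : x y / x < y.
  move=> H; have [/H//|/H|->] := ltgtP x y; last by rewrite !subrr.
  by rewrite distrC (distrC y).
have [|c _ e] := @MVT R cos (-%R \o sin) x y xy.
  by apply: continuous_subspaceT; exact: continuous_cos.
rewrite distrC e /= mulNr normrN.
rewrite normrM (distrC y) ler_piMl// ler_norml.
by rewrite sin_geN1 sin_le1.
Qed.

Lemma sin_lipschitz x y : `|sin x - sin y| <= `|x - y|.
Proof.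
by have := cos_lipschitz (x - pi / 2) (y - pi / 2); rewrite -!cosBpihalf //; congr (_ <= `| _ |); ring.
Qed.

(** The factor 2 comes from adding the real and the imaginary part instead of measuring a chord;
    sharp constants are of no interest here. *)
Lemma cis_lipschitz x y : normc (cis x - cis y) <= 2 * `|x - y|.
Proof.
rewrite (le_trans (normc_le_ReIm _))//= mulr2n mulrDl !mul1r.
by rewrite lerD ?cos_lipschitz ?sin_lipschitz.
Qed.

End ComplexNorm.

(** * Measurability, integrability and linearity for complex-valued functions *)

Section Integration.
Context d (T : measurableType d) (R : realType).
Variable mu : {measure set T -> \bar R}.
Implicit Types (f g : T -> R[i]) (h : T -> R) (c : R[i]).

Lemma cmeasurable_cst c : cmeasurable (fun _ : T => c).
Proof. by split; exact: measurable_cst. Qed.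

Lemma cmeasurable_real h : measurable_fun setT h -> cmeasurable (fun x => (h x)%:C).
Proof. by split=> //=; exact: measurable_cst. Qed.

Lemma cmeasurableD f g : cmeasurable f -> cmeasurable g ->
  cmeasurable (fun x => f x + g x).
Proof.
move=> [f1 f2] [g1 g2]; split.
  by under eq_fun do rewrite ReD; exact: measurable_funD.
by under eq_fun do rewrite ImD; exact: measurable_funD.
Qed.

Lemma cmeasurableN f : cmeasurable f -> cmeasurable (fun x => - f x).
Proof.
move=> [f1 f2]; split.
  by under eq_fun do rewrite ReN; exact: measurableT_comp.
by under eq_fun do rewrite ImN; exact: measurableT_comp.
Qed.

Lemma cmeasurableB f g : cmeasurable f -> cmeasurable g ->
  cmeasurable (fun x => f x - g x).
Proof. by move=> mf mg; apply: cmeasurableD => //; exact: cmeasurableN. Qed.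

Lemma cmeasurableM f g : cmeasurable f -> cmeasurable g ->
  cmeasurable (fun x => f x * g x).
Proof.
move=> [f1 f2] [g1 g2]; split.
  by under eq_fun do rewrite ReM; apply: measurable_funB; exact: measurable_funM.
by under eq_fun do rewrite ImM; apply: measurable_funD; exact: measurable_funM.
Qed.

Lemma cmeasurable_conj f : cmeasurable f -> cmeasurable (fun x => (f x)^*).
Proof.
move=> [f1 f2]; split.
  by rewrite [X in measurable_fun _ X](_ : _ = fun x => complex.Re (f x))//; apply/funext => x; case: (f x).
rewrite [X in measurable_fun _ X](_ : _ = fun x => - complex.Im (f x)).
  exact: measurableT_comp.
by apply/funext => x; case: (f x).
Qed.

Lemma cmeasurable_cis h : measurable_fun setT h -> cmeasurable (fun x => cis (h x)).
Proof.
move=> mh; split => /=; apply: measurableT_comp => //;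
  apply: continuous_measurable_fun; [exact: continuous_cos|exact: continuous_sin].
Qed.

Lemma measurable_normc f : cmeasurable f -> measurable_fun setT (fun x => normc (f x)).
Proof.
move=> [f1 f2].
rewrite [X in measurable_fun _ X](_ : _ = fun x => Num.sqrt (complex.Re (f x) ^+ 2 + complex.Im (f x) ^+ 2)).
  apply: measurableT_comp; first exact: (continuous_measurable_fun (@sqrt_continuous R)).
  by apply: measurable_funD; exact: measurable_funX.
by apply/funext => x; case: (f x).
Qed.

Lemma integrable_bound h1 h : measurable_fun setT h1 ->
  mu.-integrable setT (EFin \o h) -> (forall x, `|h1 x| <= h x) ->
  mu.-integrable setT (EFin \o h1).
Proof.
move=> m1 ih le; apply: (le_integrable measurableT _ _ ih).
  exact/measurable_EFinP.
move=> x _ /=; rewrite lee_fin (le_trans (le x))// ler_norm //.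
Qed.

Lemma cintegrable_bound f h : cmeasurable f -> mu.-integrable setT (EFin \o h) ->
  (forall x, normc (f x) <= h x) -> cintegrable mu setT f.
Proof.
move=> [f1 f2] ih le; split; apply: (integrable_bound _ ih) => // x;
  rewrite (le_trans _ (le x))// ?normr_Re_le ?normr_Im_le//.
Qed.

Lemma cintegrable_cmeasurable f : cintegrable mu setT f -> cmeasurable f.
Proof.
by move=> [/measurable_int/measurable_EFinP ? /measurable_int/measurable_EFinP ?].
Qed.

Lemma cintegrable_normc f : cintegrable mu setT f ->
  mu.-integrable setT (fun x => (normc (f x))%:E).
Proof.
move=> if_; have [i1 i2] := if_.
apply: (@integrable_bound _ (fun x => `|complex.Re (f x)| + `|complex.Im (f x)|)).
- exact/measurable_normc/cintegrable_cmeasurable.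
- rewrite (_ : _ \o _ = (fun x => `|(complex.Re (f x))%:E| + `|(complex.Im (f x))%:E|)%E)//.
  by apply: integrableD => //; exact: integrable_abse.
- by move=> x; rewrite ger0_norm ?normc_ge0// normc_le_ReIm.
Qed.

Lemma cintegrableP f : cintegrable mu setT f <->
  cmeasurable f /\ (\int[mu]_x (normc (f x))%:E < +oo)%E.
Proof.
split=> [i|[m i]].
  split; first exact: cintegrable_cmeasurable.
  have /integrableP[_] := cintegrable_normc i.
  by under eq_integral do rewrite abse_EFin ger0_norm ?normc_ge0//.
apply: (@cintegrable_bound _ (fun x => normc (f x))) => //.
apply/integrableP; split; first exact/measurable_EFinP/measurable_normc.
by under eq_integral do rewrite /= ger0_norm ?normc_ge0//.
Qed.

Lemma eq_cintegral f g : f =1 g -> cintegral mu setT f = cintegral mu setT g.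
Proof. by move=> /funext ->. Qed.

Lemma cintegralD f g : cintegrable mu setT f -> cintegrable mu setT g ->
  cintegral mu setT (fun x => f x + g x) = cintegral mu setT f + cintegral mu setT g.
Proof.
move=> [f1 f2] [g1 g2]; rewrite /cintegral; apply: complex_eqP; rewrite ?ReD ?ImD/=.
  by under eq_Rintegral do rewrite ReD; rewrite RintegralD.
by under eq_Rintegral do rewrite ImD; rewrite RintegralD.
Qed.

Lemma cintegrableD f g : cintegrable mu setT f -> cintegrable mu setT g ->
  cintegrable mu setT (fun x => f x + g x).
Proof.
move=> [f1 f2] [g1 g2]; split.
  by under eq_fun do rewrite ReD EFinD; exact: integrableD.
by under eq_fun do rewrite ImD EFinD; exact: integrableD.
Qed.

Lemma cintegrableZ c f : cintegrable mu setT f ->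
  cintegrable mu setT (fun x => c * f x).
Proof.
move=> /[dup] /cintegrableP[m _] i; apply: (@cintegrable_bound _ (fun x => normc c * normc (f x))).
- by apply: cmeasurableM => //; exact: cmeasurable_cst.
- rewrite (_ : _ \o _ = (fun x => (normc c)%:E * (normc (f x))%:E)%E)//.
  by apply: integrableZl => //; exact: cintegrable_normc.
- by move=> x; rewrite normcM.
Qed.

Lemma cintegrable_conj f : cintegrable mu setT f ->
  cintegrable mu setT (fun x => (f x)^*).
Proof.
move=> /[dup] /cintegrableP[m _] i; apply: (@cintegrable_bound _ (fun x => normc (f x))).
- exact: cmeasurable_conj.
- exact: cintegrable_normc.
- by move=> x; rewrite normc_conj.
Qed.

Lemma cintegrableN f : cintegrable mu setT f ->
  cintegrable mu setT (fun x => - f x).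
Proof.
by move=> /(cintegrableZ (-1)); under eq_fun do rewrite mulN1r.
Qed.

Lemma cintegrableB f g : cintegrable mu setT f -> cintegrable mu setT g ->
  cintegrable mu setT (fun x => f x - g x).
Proof. by move=> ? ?; apply: cintegrableD => //; exact: cintegrableN. Qed.

Lemma cintegralZ c f : cintegrable mu setT f ->
  cintegral mu setT (fun x => c * f x) = c * cintegral mu setT f.
Proof.
move=> [i1 i2]; rewrite /cintegral; apply: complex_eqP; rewrite ?ReM ?ImM/=.
  under eq_Rintegral do rewrite ReM; rewrite RintegralB// ?RintegralZl//.
    exact: (integrableZl measurableT _ i1).
  exact: (integrableZl measurableT _ i2).
under eq_Rintegral do rewrite ImM; rewrite RintegralD// ?RintegralZl//.
  exact: (integrableZl measurableT _ i2).
exact: (integrableZl measurableT _ i1).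
Qed.

Lemma cintegralZr c f : cintegrable mu setT f ->
  cintegral mu setT (fun x => f x * c) = cintegral mu setT f * c.
Proof. by move=> i; under eq_cintegral do rewrite mulrC; rewrite cintegralZ// mulrC. Qed.

Lemma cintegralN f : cintegrable mu setT f ->
  cintegral mu setT (fun x => - f x) = - cintegral mu setT f.
Proof.
by move=> i; rewrite -mulN1r -cintegralZ//; under [RHS]eq_cintegral do rewrite mulN1r.
Qed.

Lemma cintegralB f g : cintegrable mu setT f -> cintegrable mu setT g ->
  cintegral mu setT (fun x => f x - g x) = cintegral mu setT f - cintegral mu setT g.
Proof. by move=> ? ?; rewrite cintegralD ?cintegralN//; exact: cintegrableN. Qed.

Lemma cintegral_conj f : cintegrable mu setT f ->
  cintegral mu setT (fun x => (f x)^*) = (cintegral mu setT f)^*.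
Proof.
move=> [i1 i2]; rewrite /cintegral /=; apply: complex_eqP => /=.
  by apply: eq_Rintegral => x _; case: (f x).
rewrite -mulN1r -RintegralZl//.
by apply: eq_Rintegral => x _; case: (f x) => /= a b; rewrite mulN1r.
Qed.

Lemma cintegral_real h :
  cintegral mu setT (fun x => (h x)%:C) = (Rintegral mu setT h)%:C.
Proof. by rewrite /cintegral /= Rintegral_cst// mul0r. Qed.

(* The factor 2 spares the rotation argument and is harmless in all the estimates. *)
Lemma normc_cintegral f h : cintegrable mu setT f -> mu.-integrable setT (EFin \o h) ->
  (forall x, normc (f x) <= h x) ->
  normc (cintegral mu setT f) <= 2 * Rintegral mu setT h.
Proof.
move=> [i1 i2] ih le; rewrite (le_trans (normc_le_ReIm _))//= mulr2n mulrDl mul1r.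
rewrite lerD// (le_trans (le_normr_Rintegral _ _))// le_Rintegral//.
- exact: (integrable_abse i1).
- by move=> x _; rewrite (le_trans (normr_Re_le _)).
- exact: (integrable_abse i2).
- by move=> x _; rewrite (le_trans (normr_Im_le _)).
Qed.

End Integration.

(** * Measurable dependence on parameters and Fubini's theorem for complex integrals *)

Section Fubini.
Context d1 d2 (T1 : measurableType d1) (T2 : measurableType d2) (R : realType).
Variables (m1 : {sigma_finite_measure set T1 -> \bar R}).
Variables (m2 : {sigma_finite_measure set T2 -> \bar R}).
Implicit Types (f : T1 * T2 -> R[i]) (h : T1 * T2 -> R).

Lemma measurable_pairl x h : measurable_fun setT h -> measurable_fun setT (fun y => h (x, y)).
Proof. by move=> mh; apply: (measurableT_comp mh); exact: measurable_pair1. Qed.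

Lemma measurable_pairr y h : measurable_fun setT h -> measurable_fun setT (fun x => h (x, y)).
Proof. by move=> mh; apply: (measurableT_comp mh); exact: measurable_pair2. Qed.

(** The value is [fine] of a difference of two Tonelli integrals, each measurable in the parameter;
    this description is valid at every parameter, whether or not the inner integral converges. *)
Lemma measurable_Rintegral_param h : measurable_fun setT h ->
  measurable_fun setT (fun x => Rintegral m2 setT (fun y => h (x, y))).
Proof.
move=> mh.
have mh' : measurable_fun setT (EFin \o h) by exact/measurable_EFinP.
have Hp := @measurable_fun_fubini_tonelli_F _ _ _ _ _ m2 _ (measurable_funepos mh') (funepos_ge0 _).
have Hn := @measurable_fun_fubini_tonelli_F _ _ _ _ _ m2 _ (measurable_funeneg mh') (funeneg_ge0 _).
rewrite (_ : (fun x => _) = fine \o (fun x => (fubini_F m2 (EFin \o h)^\+ x -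
    fubini_F m2 (EFin \o h)^\- x)%E)); last first.
  apply/funext => ?; rewrite /Rintegral integralE /=.
  by congr (fine (_ - _)%E); apply: eq_integral => ? _; rewrite ?funeposE ?funenegE.
by apply: measurableT_comp => //; exact: emeasurable_funB.
Qed.

Lemma measurable_Rintegral_paramr h : measurable_fun setT h ->
  measurable_fun setT (fun y => Rintegral m1 setT (fun x => h (x, y))).
Proof.
move=> mh.
have mh' : measurable_fun setT (EFin \o h) by exact/measurable_EFinP.
have Hp := @measurable_fun_fubini_tonelli_G _ _ _ _ _ m1 _ (measurable_funepos mh') (funepos_ge0 _).
have Hn := @measurable_fun_fubini_tonelli_G _ _ _ _ _ m1 _ (measurable_funeneg mh') (funeneg_ge0 _).
rewrite (_ : (fun y => _) = fine \o (fun y => (fubini_G m1 (EFin \o h)^\+ y -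
    fubini_G m1 (EFin \o h)^\- y)%E)); last first.
  apply/funext => ?; rewrite /Rintegral integralE /=.
  by congr (fine (_ - _)%E); apply: eq_integral => ? _; rewrite ?funeposE ?funenegE.
by apply: measurableT_comp => //; exact: emeasurable_funB.
Qed.

Lemma cmeasurable_pairl x f : cmeasurable f -> cmeasurable (fun y => f (x, y)).
Proof.
by move=> [f1 f2]; split; [exact: (measurable_pairl x f1)|exact: (measurable_pairl x f2)].
Qed.

Lemma cmeasurable_pairr y f : cmeasurable f -> cmeasurable (fun x => f (x, y)).
Proof.
by move=> [f1 f2]; split; [exact: (measurable_pairr y f1)|exact: (measurable_pairr y f2)].
Qed.

Lemma cmeasurable_cintegral f : cmeasurable f ->
  cmeasurable (fun x => cintegral m2 setT (fun y => f (x, y))).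
Proof.
by move=> [f1 f2]; split; [exact: (measurable_Rintegral_param f1)|
  exact: (measurable_Rintegral_param f2)].
Qed.

(** Tonelli: a bound on the inner integrals by an integrable function of the outer variable
    suffices. In this form the estimates that are uniform in one variable apply directly. *)
Lemma integrable_prod h (G : T1 -> R) : measurable_fun setT h ->
  m1.-integrable setT (EFin \o G) ->
  (forall x, (\int[m2]_y `|h (x, y)|%:E <= (G x)%:E)%E) ->
  (m1 \x m2)%E.-integrable setT (EFin \o h).
Proof.
move=> mh iG le; apply/integrable12ltyP; first exact/measurable_EFinP.
apply: (@le_lt_trans _ _ (\int[m1]_x `|G x|%:E)%E); last by case/integrableP: iG.
apply: ge0_le_integral => //.
- by move=> x _; exact: integral_ge0.
- apply: (@measurable_fun_fubini_tonelli_F _ _ _ _ _ _ (fun z => `|(h z)%:E|)%E) => //.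
  by apply/measurable_EFinP; exact: measurableT_comp.
- by apply/measurable_EFinP; apply: measurableT_comp => //; apply/measurable_EFinP; case/integrableP: iG.
- by move=> x _; rewrite (le_trans (le x))// lee_fin ler_norm.
Qed.

Lemma cintegrable_prod f (h : T1 * T2 -> R) (G : T1 -> R) : cmeasurable f ->
  (forall z, normc (f z) <= h z) -> measurable_fun setT h ->
  m1.-integrable setT (EFin \o G) ->
  (forall x, (\int[m2]_y (h (x, y))%:E <= (G x)%:E)%E) ->
  cintegrable (m1 \x m2)%E setT f.
Proof.
move=> mf le mh iG leG; have h0 z : 0 <= h z by rewrite (le_trans _ (le z))// normc_ge0.
apply: (cintegrable_bound mf _ le).
apply: (integrable_prod mh iG) => x; rewrite (le_trans _ (leG x))//.
by under eq_integral do rewrite ger0_norm//.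
Qed.

Lemma integrable_prodM (g1 : T1 -> R) (g2 : T2 -> R) :
  m1.-integrable setT (EFin \o g1) -> m2.-integrable setT (EFin \o g2) ->
  (m1 \x m2)%E.-integrable setT (fun z => (g1 z.1 * g2 z.2)%:E).
Proof.
move=> i1 i2.
have [/measurable_EFinP mg1 _] := integrableP _ _ _ i1.
have [/measurable_EFinP mg2 _] := integrableP _ _ _ i2.
apply: (@integrable_prod _ (fun x => `|g1 x| * Rintegral m2 setT (fun y => `|g2 y|))).
- by apply: measurable_funM; apply: measurableT_comp.
- rewrite (_ : _ \o _ = (fun x => `|(g1 x)%:E| * (Rintegral m2 setT (fun y => `|g2 y|))%:E)%E)//.
  by apply: integrableZr => //; exact: integrable_abse.
- move=> x; under eq_integral do rewrite normrM EFinM.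
  rewrite [leLHS](_ : _ = \int[m2]_y (`|g1 x|%:E * `|g2 y|%:E))%E//.
  rewrite ge0_integralZl//; last first.
    by apply/measurable_EFinP; exact: measurableT_comp.
  rewrite EFinM /Rintegral fineK//.
  exact: (integrable_fin_num _ (integrable_abse i2)).
Qed.

Section Real.
Variable h : T1 * T2 -> R.
Hypothesis ih : (m1 \x m2)%E.-integrable setT (EFin \o h).

Let mh : measurable_fun setT h.
Proof. by have [/measurable_EFinP] := integrableP _ _ _ ih. Qed.

(** On a null set of [x] the inner integral may diverge, and there [Rintegral] takes a default
    value; hence an equality almost everywhere only. *)
Let eqae1 : ae_eq m1 setT (fubini_F m2 (EFin \o h))
  (fun x => (Rintegral m2 setT (fun y => h (x, y)))%:E).
Proof.
have : {ae m1, forall x, m2.-integrable setT (fun y => (h (x, y))%:E)}.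
  exact: (ae_integrable1 ih).
apply: filterS => x ix _; rewrite /fubini_F /Rintegral fineK//.
exact: integrable_fin_num.
Qed.

Let eqae2 : ae_eq m2 setT (fubini_G m1 (EFin \o h))
  (fun y => (Rintegral m1 setT (fun x => h (x, y)))%:E).
Proof.
have : {ae m2, forall y, m1.-integrable setT (fun x => (h (x, y))%:E)}.
  exact: (ae_integrable2 ih).
apply: filterS => x ix _; rewrite /fubini_G /Rintegral fineK//.
exact: integrable_fin_num.
Qed.

Lemma integrable_Rintegral1 : m1.-integrable setT
  (EFin \o (fun x => Rintegral m2 setT (fun y => h (x, y)))).
Proof.
have mI : measurable_fun setT (EFin \o (fun x => Rintegral m2 setT (fun y => h (x, y)))).
  exact/measurable_EFinP/measurable_Rintegral_param.
apply/integrableP; split=> //.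
have [mF lt] := integrableP _ _ _ (integrable_fubini_F ih).
rewrite (ae_eq_integral (fun x => `|fubini_F m2 (EFin \o h) x|)%E)//.
- exact: measurableT_comp.
- exact: measurableT_comp.
- by apply: filterS eqae1 => x /(_ I) /= ->.
Qed.

Lemma Rintegral12 : Rintegral m1 setT (fun x => Rintegral m2 setT (fun y => h (x, y)))
  = Rintegral (m1 \x m2)%E setT h.
Proof.
rewrite [RHS]/Rintegral -(integral12_prod_meas1 ih) [LHS]/Rintegral; congr fine.
apply/esym/ae_eq_integral => //.
- exact: (measurable_fubini_F ih).
- exact/measurable_EFinP/measurable_Rintegral_param.
Qed.

Lemma Rintegral21 : Rintegral m2 setT (fun y => Rintegral m1 setT (fun x => h (x, y)))
  = Rintegral (m1 \x m2)%E setT h.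
Proof.
rewrite [RHS]/Rintegral -(integral21_prod_meas1 ih) [LHS]/Rintegral; congr fine.
apply/esym/ae_eq_integral => //.
- exact: (measurable_fubini_G ih).
- exact/measurable_EFinP/measurable_Rintegral_paramr.
Qed.

End Real.

Section Complex.
Variable f : T1 * T2 -> R[i].
Hypothesis fi : cintegrable (m1 \x m2)%E setT f.

Lemma cintegrable1 : cintegrable m1 setT (fun x => cintegral m2 setT (fun y => f (x, y))).
Proof. by case: fi => f1 f2; split => /=; [exact: (integrable_Rintegral1 f1)|exact: (integrable_Rintegral1 f2)]. Qed.

Lemma cintegral12 : cintegral m1 setT (fun x => cintegral m2 setT (fun y => f (x, y)))
  = cintegral (m1 \x m2)%E setT f.
Proof. by case: fi => f1 f2; rewrite /cintegral /= (Rintegral12 f1) (Rintegral12 f2). Qed.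

Lemma cintegral21 : cintegral m2 setT (fun y => cintegral m1 setT (fun x => f (x, y)))
  = cintegral (m1 \x m2)%E setT f.
Proof. by case: fi => f1 f2; rewrite /cintegral /= (Rintegral21 f1) (Rintegral21 f2). Qed.

Lemma cfubini : cintegral m1 setT (fun x => cintegral m2 setT (fun y => f (x, y))) =
  cintegral m2 setT (fun y => cintegral m1 setT (fun x => f (x, y))).
Proof. by rewrite cintegral12 cintegral21. Qed.

End Complex.

End Fubini.

(** * Lebesgue measure on R^3 *)

Section SigmaFiniteProduct.
Context d1 d2 (T1 : measurableType d1) (T2 : measurableType d2) (R : realType).
Variable m1 : {sigma_finite_measure set T1 -> \bar R}.
Variable m2 : {sigma_finite_measure set T2 -> \bar R}.

(** Both exhaustions increase, so the rectangles [F n] times [G n] with one common index already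
    cover the product. *)
Lemma product_sigma_finite : sigma_finite setT (m1 \x m2)%E.
Proof.
have /sigma_finiteP[F [UF incrF finF]] := sigma_finiteT m1.
have /sigma_finiteP[G [UG incrG finG]] := sigma_finiteT m2.
exists (fun n => F n `*` G n) => [|n]; last first.
  have [mF oF] := finF n; have [mG oG] := finG n; split; first exact: measurableX.
  by rewrite product_measure1E// lte_mul_pinfty// ge0_fin_numE.
apply/esym/seteqP; split=> // -[x y] _.
have [n _ Fnx] : (\bigcup_n F n) x by rewrite -UF.
have [k _ Gky] : (\bigcup_n G n) y by rewrite -UG.
exists (maxn n k) => //; split => /=.
  by have /subsetPset := incrF n (maxn n k) (leq_maxl _ _); exact.
by have /subsetPset := incrG k (maxn n k) (leq_maxr _ _); exact.
Qed.

(** Packing sigma-finiteness with the product measure lets products be iterated, first to reach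
    three dimensions and then for Fubini on pairs of points. *)
Definition sprod : {sigma_finite_measure set (T1 * T2)%type -> \bar R} :=
  HB.pack (m1 \x m2)%E (Measure_isSigmaFinite.Build _ _ _ (m1 \x m2)%E product_sigma_finite).

End SigmaFiniteProduct.

Definition leb2 {R : realType} : {sigma_finite_measure set (measurableTypeR R * measurableTypeR R)%type -> \bar R} :=
  sprod lebesgue_measure lebesgue_measure.
Definition vol {R : realType} : {sigma_finite_measure set (R3 R) -> \bar R} :=
  sprod leb2 lebesgue_measure.

Lemma leb3E {R : realType} : @leb3 R = vol. Proof. by []. Qed.

(** * Measure-preserving maps and transport of integrals *)

Section MeasurePreserving.
Context d (T : measurableType d) (R : realType) (mu : {measure set T -> \bar R}).
Implicit Types phi psi : T -> T.

(** Phrased with integrals of nonnegative functions rather than with measures of sets: composition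
    is then immediate, and maps acting on one coordinate are handled by Tonelli. *)
Definition preserving phi := measurable_fun setT phi /\
  forall f : T -> \bar R, measurable_fun setT f -> (forall x, 0 <= f x)%E ->
    (\int[mu]_x f (phi x) = \int[mu]_x f x)%E.

Lemma preserving_comp phi psi : preserving phi -> preserving psi ->
  preserving (fun x => phi (psi x)).
Proof.
move=> [m1 p1] [m2 p2]; split; first exact: measurableT_comp.
move=> f mf f0; rewrite (p2 (fun x => f (phi x)))// ?p1//; exact: measurableT_comp.
Qed.

Lemma preserving_integral phi (f : T -> \bar R) : preserving phi ->
  measurable_fun setT f -> (\int[mu]_x f (phi x) = \int[mu]_x f x)%E.
Proof.
move=> [mphi p] mf; rewrite integralE [RHS]integralE; congr (_ - _)%E.
  rewrite -(p _ (measurable_funepos mf) (funepos_ge0 _)).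
  by apply: eq_integral => x _; rewrite !funeposE.
rewrite -(p _ (measurable_funeneg mf) (funeneg_ge0 _)).
by apply: eq_integral => x _; rewrite !funenegE.
Qed.

Lemma preserving_Rintegral phi (f : T -> R) : preserving phi ->
  measurable_fun setT f -> Rintegral mu setT (fun x => f (phi x)) = Rintegral mu setT f.
Proof.
move=> p mf; rewrite /Rintegral (@preserving_integral phi (EFin \o f))//.
exact/measurable_EFinP.
Qed.

Lemma preserving_cintegral phi (f : T -> R[i]) : preserving phi ->
  cmeasurable f -> cintegral mu setT (fun x => f (phi x)) = cintegral mu setT f.
Proof.
move=> p [m1 m2]; rewrite /cintegral.
by rewrite (preserving_Rintegral p m1) (preserving_Rintegral p m2).
Qed.

Lemma preserving_integrable phi (f : T -> R) : preserving phi ->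
  mu.-integrable setT (EFin \o f) -> mu.-integrable setT (fun x => (f (phi x))%:E).
Proof.
move=> p /integrableP[/measurable_EFinP mf i].
apply/integrableP; split; first by apply/measurable_EFinP/measurableT_comp => //; case: p.
rewrite (@preserving_integral phi (fun x => `|(f x)%:E|)%E)//.
by apply/measurable_EFinP; exact: measurableT_comp.
Qed.

Lemma preserving_cintegrable phi (f : T -> R[i]) : preserving phi ->
  cintegrable mu setT f -> cintegrable mu setT (fun x => f (phi x)).
Proof.
by move=> p [i1 i2]; split; [exact: (preserving_integrable p i1)|
  exact: (preserving_integrable p i2)].
Qed.

End MeasurePreserving.

(** * Translations and reflection of the line *)

Section Line.
Context {R : realType}.
Notation leb := (@lebesgue_measure R).

(** Lebesgue measure is the only measure giving half-open intervals their length, so it coincides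
    with its pushforward under [phi]. *)
Lemma preserving_uniq (phi : R -> R) : measurable_fun setT phi ->
  (forall a b : R, a < b -> leb (phi @^-1` `]a, b]) = (b - a)%:E) ->
  preserving leb phi.
Proof.
move=> mphi H; split => // f mf f0.
have mphi' : @measurable_fun _ _ (measurableTypeR R) (measurableTypeR R) setT phi := mphi.
pose mu : {measure set (measurableTypeR R) -> \bar R} :=
  measure_function_pushforward__canonical__measure_function_Measure leb mphi'.
have e (A : set (measurableTypeR R)) : measurable A -> leb A = mu A.
  move=> mA; apply: (@lebesgue_measure_unique _ mu) => // X [[a b] /= _ <-].
  rewrite /mu /= /pushforward; have [ab|ba] := ltP a b.
    by rewrite H// lebesgue_measure_itv/= lte_fin ab.
  by rewrite set_itv_ge ?preimage_set0 ?measure0// bnd_simp -leNgt.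
rewrite [RHS](@eq_measure_integral _ _ _ setT mu) => [|A mA _]; last exact: e.
have := @ge0_integral_pushforward _ _ (measurableTypeR R) (measurableTypeR R) R phi mphi' leb
  setT f measurableT mf (fun y _ => f0 y).
by rewrite preimage_setT => ->.
Qed.

Lemma preserving_add (a : R) : preserving leb (fun x => x + a).
Proof.
apply: preserving_uniq => [|b c bc]; first exact: measurable_funD.
rewrite (_ : _ @^-1` _ = `]b - a, c - a]%classic).
  by rewrite lebesgue_measure_itv/= lte_fin ltrD2r bc; congr (_%:E); ring.
by apply/seteqP; split => x /=; rewrite !in_itv/= ltrBlDr lerBrDr.
Qed.

Lemma preserving_opp : preserving leb (fun x => - x).
Proof.
apply: preserving_uniq => [|b c bc]; first exact: measurableT_comp.
rewrite (_ : _ @^-1` _ = `[- c, - b[%classic).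
  by rewrite lebesgue_measure_itv/= lte_fin ltrN2 bc; congr (_%:E); ring.
by apply/seteqP; split => x /=; rewrite !in_itv/= ltrNr lerNl andbC.
Qed.

End Line.

(** * Invariance of volume under translations, reflection and plane rotations *)

Section Vol.
Context {R : realType}.
Notation leb := (@lebesgue_measure R).
Implicit Types (f : R3 R -> \bar R).

Lemma measurable_c1 : measurable_fun setT (fun x : R3 R => x.1.1).
Proof. exact: (measurableT_comp measurable_fst measurable_fst). Qed.
Lemma measurable_c2 : measurable_fun setT (fun x : R3 R => x.1.2).
Proof. exact: (measurableT_comp measurable_snd measurable_fst). Qed.
Lemma measurable_c3 : measurable_fun setT (fun x : R3 R => x.2).
Proof. exact: measurable_snd. Qed.

Lemma measurable_mk3 d (T : measurableType d) (f g h : T -> R) :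
  measurable_fun setT f -> measurable_fun setT g -> measurable_fun setT h ->
  measurable_fun setT (fun t => (f t, g t, h t) : R3 R).
Proof. by move=> ? ? ?; do 2!apply: measurable_fun_pair => //. Qed.

(** One of three orders of integration, each with a different coordinate innermost: a map that moves
    a single coordinate is treated with that coordinate integrated first. *)
Lemma vol_cba f : measurable_fun setT f -> (forall x, 0 <= f x)%E ->
  (\int[vol]_x f x = \int[leb]_a \int[leb]_b \int[leb]_c f (a, b, c))%E.
Proof.
move=> mf f0.
have mF : measurable_fun setT (fun z => \int[leb]_c f (z, c))%E.
  exact: (@measurable_fun_fubini_tonelli_F _ _ _ _ _ leb f mf f0).
rewrite (@fubini_tonelli1 _ _ _ _ _ leb2 leb f mf f0).
rewrite (@fubini_tonelli1 _ _ _ _ _ leb leb (fun z => \int[leb]_c f (z, c))%E mF)//.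
by move=> z; exact: integral_ge0.
Qed.

Lemma vol_abc f : measurable_fun setT f -> (forall x, 0 <= f x)%E ->
  (\int[vol]_x f x = \int[leb]_c \int[leb]_b \int[leb]_a f (a, b, c))%E.
Proof.
move=> mf f0.
rewrite (@fubini_tonelli2 _ _ _ _ _ leb2 leb f mf f0); apply: eq_integral => c _.
have mf' : measurable_fun setT (fun z => f (z, c)).
  by apply: (measurableT_comp mf); exact: measurable_pair2.
exact: (@fubini_tonelli2 _ _ _ _ _ leb leb (fun z => f (z, c)) mf').
Qed.

Lemma vol_bac f : measurable_fun setT f -> (forall x, 0 <= f x)%E ->
  (\int[vol]_x f x = \int[leb]_c \int[leb]_a \int[leb]_b f (a, b, c))%E.
Proof.
move=> mf f0.
rewrite (@fubini_tonelli2 _ _ _ _ _ leb2 leb f mf f0); apply: eq_integral => c _.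
have mf' : measurable_fun setT (fun z => f (z, c)).
  by apply: (measurableT_comp mf); exact: measurable_pair2.
exact: (@fubini_tonelli1 _ _ _ _ _ leb leb (fun z => f (z, c)) mf').
Qed.

Lemma measurable_slice1 f b c : measurable_fun setT f ->
  measurable_fun setT (fun a => f (a, b, c)).
Proof. by move=> mf; apply: (measurableT_comp mf); exact: measurable_mk3. Qed.
Lemma measurable_slice2 f a c : measurable_fun setT f ->
  measurable_fun setT (fun b => f (a, b, c)).
Proof. by move=> mf; apply: (measurableT_comp mf); exact: measurable_mk3. Qed.
Lemma measurable_slice3 f a b : measurable_fun setT f ->
  measurable_fun setT (fun c => f (a, b, c)).
Proof. by move=> mf; apply: (measurableT_comp mf); exact: measurable_mk3. Qed.

(** The first coordinate moves by a map of the line that may depend on the other two. This covers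
    translations and shears, out of which all the isometries needed are composed. *)
Lemma preserving1 (h : R -> R -> R -> R) :
  measurable_fun setT (fun x : R3 R => h x.1.2 x.2 x.1.1) ->
  (forall b c, preserving leb (h b c)) ->
  preserving vol (fun x : R3 R => (h x.1.2 x.2 x.1.1, x.1.2, x.2) : R3 R).
Proof.
move=> mh ph.
have mp : measurable_fun setT (fun x : R3 R => (h x.1.2 x.2 x.1.1, x.1.2, x.2) : R3 R).
  exact: (measurable_mk3 mh measurable_c2 measurable_c3).
split => // f mf f0; rewrite vol_abc//; last exact: (measurableT_comp mf mp).
rewrite (vol_abc mf f0); apply: eq_integral => c _; apply: eq_integral => b _ /=.
have [_ p] := ph b c; rewrite (p (fun a => f (a, b, c)))//; exact: measurable_slice1.
Qed.

Lemma preserving2 (h : R -> R -> R -> R) :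
  measurable_fun setT (fun x : R3 R => h x.1.1 x.2 x.1.2) ->
  (forall a c, preserving leb (h a c)) ->
  preserving vol (fun x : R3 R => (x.1.1, h x.1.1 x.2 x.1.2, x.2) : R3 R).
Proof.
move=> mh ph.
have mp : measurable_fun setT (fun x : R3 R => (x.1.1, h x.1.1 x.2 x.1.2, x.2) : R3 R).
  exact: (measurable_mk3 measurable_c1 mh measurable_c3).
split => // f mf f0; rewrite vol_bac//; last exact: (measurableT_comp mf mp).
rewrite (vol_bac mf f0); apply: eq_integral => c _; apply: eq_integral => a _ /=.
have [_ p] := ph a c; rewrite (p (fun b => f (a, b, c)))//; exact: measurable_slice2.
Qed.

Lemma preserving3 (h : R -> R -> R -> R) :
  measurable_fun setT (fun x : R3 R => h x.1.1 x.1.2 x.2) ->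
  (forall a b, preserving leb (h a b)) ->
  preserving vol (fun x : R3 R => (x.1.1, x.1.2, h x.1.1 x.1.2 x.2) : R3 R).
Proof.
move=> mh ph.
have mp : measurable_fun setT (fun x : R3 R => (x.1.1, x.1.2, h x.1.1 x.1.2 x.2) : R3 R).
  exact: (measurable_mk3 measurable_c1 measurable_c2 mh).
split => // f mf f0; rewrite vol_cba//; last exact: (measurableT_comp mf mp).
rewrite (vol_cba mf f0); apply: eq_integral => a _; apply: eq_integral => b _ /=.
have [_ p] := ph a b; rewrite (p (fun c => f (a, b, c)))//; exact: measurable_slice3.
Qed.

Lemma preserving_translation (v : R3 R) : preserving vol (fun x => x + v).
Proof.
have p1 := @preserving1 (fun b c a => a + v.1.1) (measurable_funD measurable_c1 (measurable_cst _))
  (fun _ _ => preserving_add _).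
have p2 := @preserving2 (fun a c b => b + v.1.2) (measurable_funD measurable_c2 (measurable_cst _))
  (fun _ _ => preserving_add _).
have p3 := @preserving3 (fun a b c => c + v.2) (measurable_funD measurable_c3 (measurable_cst _))
  (fun _ _ => preserving_add _).
have -> : (fun x : R3 R => x + v) = (fun x => (x.1.1 + v.1.1, x.1.2 + v.1.2, x.2 + v.2)).
  by apply/funext => -[[a b] c]; case: v {p1 p2 p3} => -[].
exact: (preserving_comp p1 (preserving_comp p2 p3)).
Qed.

Lemma preserving_reflection : preserving (@vol R) (fun x => - x).
Proof.
have p1 := @preserving1 (fun b c a => - a) (measurableT_comp (@oppr_measurable R _) measurable_c1)
  (fun _ _ => preserving_opp).
have p2 := @preserving2 (fun a c b => - b) (measurableT_comp (@oppr_measurable R _) measurable_c2)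
  (fun _ _ => preserving_opp).
have p3 := @preserving3 (fun a b c => - c) (measurableT_comp (@oppr_measurable R _) measurable_c3)
  (fun _ _ => preserving_opp).
have -> : (fun x : R3 R => - x) = (fun x => (- x.1.1, - x.1.2, - x.2)).
  by apply/funext => -[[a b] c].
exact: (preserving_comp p1 (preserving_comp p2 p3)).
Qed.

Definition rot12 (c s : R) (x : R3 R) : R3 R :=
  (c * x.1.1 + s * x.1.2, c * x.1.2 - s * x.1.1, x.2).
Definition rot13 (c s : R) (x : R3 R) : R3 R :=
  (c * x.1.1 + s * x.2, x.1.2, c * x.2 - s * x.1.1).

(* A plane rotation of angle different from pi is a product of three shears. *)
Lemma preserving_rot12 (c s : R) : c ^+ 2 + s ^+ 2 = 1 -> preserving vol (rot12 c s).
Proof.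
wlog c1 : c s / c + 1 != 0.
  (* The half turn, for which the shear parameter would be infinite, is the square of a quarter
     turn. *)
  move=> H cs; have [c1|] := eqVneq (c + 1) 0; last by move=> c1; exact: H.
  have -> : c = -1 by lra.
  have s0 : s = 0 by apply/eqP; rewrite -sqrf_eq0; apply/eqP; move: cs; rewrite (_ : c = -1); [move=> ?; lra|lra].
  have p : preserving vol (rot12 0 1) by apply: H; [rewrite add0r oner_eq0|lra].
  rewrite s0 (_ : rot12 _ _ = fun x => rot12 0 1 (rot12 0 1 x)); first exact: preserving_comp.
  by apply/funext => -[[x1 x2] x3]; rewrite /rot12/=; congr (_, _, _); ring.
(* [t] is the tangent of half the angle: shear by [t] along the first axis, by [- s] along the
   second, then by [t] again. *)
move=> cs; pose t := s / (c + 1).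
have p1 : preserving vol (fun x : R3 R => (x.1.1 + t * x.1.2, x.1.2, x.2) : R3 R).
  apply: (@preserving1 (fun b c a => a + t * b)).
    by apply: measurable_funD measurable_c1 (measurable_funM (measurable_cst _) measurable_c2).
  by move=> *; exact: preserving_add.
have p2 : preserving vol (fun x : R3 R => (x.1.1, x.1.2 + (- s) * x.1.1, x.2) : R3 R).
  apply: (@preserving2 (fun a c b => b + (- s) * a)).
    by apply: measurable_funD measurable_c2 (measurable_funM (measurable_cst _) measurable_c1).
  by move=> *; exact: preserving_add.
rewrite (_ : rot12 c s = (fun x => (fun x : R3 R => (x.1.1 + t * x.1.2, x.1.2, x.2) : R3 R)
    ((fun x : R3 R => (x.1.1, x.1.2 + (- s) * x.1.1, x.2) : R3 R)
    ((fun x : R3 R => (x.1.1 + t * x.1.2, x.1.2, x.2) : R3 R) x)))).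
  exact: (preserving_comp p1 (preserving_comp p2 p1)).
have e : t * (c + 1) = s by rewrite /t divfK.
have e2 : 1 - t * s = c.
  by apply: (mulIf c1); rewrite mulrBl mulrAC e; move: cs; lra.
apply/funext => -[[x1 x2] x3]; rewrite /rot12/=; congr (_, _, _).
  have -> : x1 + t * x2 + t * (x2 + - s * (x1 + t * x2)) = (1 - t * s) * x1 + t * ((1 - t * s) + 1) * x2 by ring.
  by rewrite e2 e.
have -> : x2 + - s * (x1 + t * x2) = (1 - t * s) * x2 - s * x1 by ring.
by rewrite e2.
Qed.

(** The same three shears in the plane of the first and third coordinates. *)
Lemma preserving_rot13 (c s : R) : c ^+ 2 + s ^+ 2 = 1 -> preserving vol (rot13 c s).
Proof.
wlog c1 : c s / c + 1 != 0.
  move=> H cs; have [c1|] := eqVneq (c + 1) 0; last by move=> c1; exact: H.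
  have -> : c = -1 by lra.
  have s0 : s = 0 by apply/eqP; rewrite -sqrf_eq0; apply/eqP; move: cs; rewrite (_ : c = -1); [move=> ?; lra|lra].
  have p : preserving vol (rot13 0 1) by apply: H; [rewrite add0r oner_eq0|lra].
  rewrite s0 (_ : rot13 _ _ = fun x => rot13 0 1 (rot13 0 1 x)); first exact: preserving_comp.
  by apply/funext => -[[x1 x2] x3]; rewrite /rot13/=; congr (_, _, _); ring.
move=> cs; pose t := s / (c + 1).
have p1 : preserving vol (fun x : R3 R => (x.1.1 + t * x.2, x.1.2, x.2) : R3 R).
  apply: (@preserving1 (fun b c a => a + t * c)).
    by apply: measurable_funD measurable_c1 (measurable_funM (measurable_cst _) measurable_c3).
  by move=> *; exact: preserving_add.
have p2 : preserving vol (fun x : R3 R => (x.1.1, x.1.2, x.2 + (- s) * x.1.1) : R3 R).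
  apply: (@preserving3 (fun a b c => c + (- s) * a)).
    by apply: measurable_funD measurable_c3 (measurable_funM (measurable_cst _) measurable_c1).
  by move=> *; exact: preserving_add.
rewrite (_ : rot13 c s = (fun x => (fun x : R3 R => (x.1.1 + t * x.2, x.1.2, x.2) : R3 R)
    ((fun x : R3 R => (x.1.1, x.1.2, x.2 + (- s) * x.1.1) : R3 R)
    ((fun x : R3 R => (x.1.1 + t * x.2, x.1.2, x.2) : R3 R) x)))).
  exact: (preserving_comp p1 (preserving_comp p2 p1)).
have e : t * (c + 1) = s by rewrite /t divfK.
have e2 : 1 - t * s = c.
  by apply: (mulIf c1); rewrite mulrBl mulrAC e; move: cs; lra.
apply/funext => -[[x1 x2] x3]; rewrite /rot13/=; congr (_, _, _).
  have -> : x1 + t * x3 + t * (x3 + - s * (x1 + t * x3)) = (1 - t * s) * x1 + t * ((1 - t * s) + 1) * x3 by ring.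
  by rewrite e2 e.
have -> : x3 + - s * (x1 + t * x3) = (1 - t * s) * x3 - s * x1 by ring.
by rewrite e2.
Qed.

Lemma measurable_funB3 d (T : measurableType d) (f g : T -> R3 R) :
  measurable_fun setT f -> measurable_fun setT g -> measurable_fun setT (fun t => f t - g t).
Proof.
move=> mf mg.
have m1 (h : R3 R -> R) (mh : measurable_fun setT h) := measurableT_comp mh mf.
have m2 (h : R3 R -> R) (mh : measurable_fun setT h) := measurableT_comp mh mg.
by apply: measurable_mk3; apply: measurable_funB; [exact: (m1 _ measurable_c1)|exact: (m2 _ measurable_c1)
 |exact: (m1 _ measurable_c2)|exact: (m2 _ measurable_c2)|exact: (m1 _ measurable_c3)|exact: (m2 _ measurable_c3)].
Qed.

Lemma vol_prod (f g h : R -> R) : measurable_fun setT f -> measurable_fun setT g ->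
  measurable_fun setT h -> (forall x, 0 <= f x) -> (forall x, 0 <= g x) -> (forall x, 0 <= h x) ->
  (\int[vol]_x (f x.1.1 * g x.1.2 * h x.2)%:E =
   \int[leb]_x (f x)%:E * \int[leb]_x (g x)%:E * \int[leb]_x (h x)%:E)%E.
Proof.
move=> mf mg mh f0 g0 h0.
have If : (0 <= \int[leb]_x (f x)%:E)%E by apply: integral_ge0 => x _; rewrite lee_fin.
have Ig : (0 <= \int[leb]_x (g x)%:E)%E by apply: integral_ge0 => x _; rewrite lee_fin.
have Ih : (0 <= \int[leb]_x (h x)%:E)%E by apply: integral_ge0 => x _; rewrite lee_fin.
have Emf : measurable_fun setT (fun x => (f x)%:E) by exact/measurable_EFinP.
have Emg : measurable_fun setT (fun x => (g x)%:E) by exact/measurable_EFinP.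
have Emh : measurable_fun setT (fun x => (h x)%:E) by exact/measurable_EFinP.
rewrite vol_cba; last 2 first.
- by apply/measurable_EFinP; apply: measurable_funM; [apply: measurable_funM|];
    [exact: (measurableT_comp mf measurable_c1)|exact: (measurableT_comp mg measurable_c2)|
     exact: (measurableT_comp mh measurable_c3)].
- by move=> x; rewrite lee_fin !mulr_ge0.
have E1 a b : (\int[leb]_c (f a * g b * h c)%:E = (f a)%:E * ((g b)%:E * \int[leb]_c (h c)%:E))%E.
  under eq_integral do rewrite EFinM.
  rewrite ge0_integralZl//; last by rewrite lee_fin mulr_ge0.
    by rewrite EFinM muleA.
  by move=> *; rewrite lee_fin.
have E2 a : (\int[leb]_b ((f a)%:E * ((g b)%:E * \int[leb]_c (h c)%:E)) =
    (f a)%:E * (\int[leb]_b (g b)%:E * \int[leb]_c (h c)%:E))%E.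
  rewrite ge0_integralZl//.
  - by rewrite ge0_integralZr// => *; rewrite lee_fin.
  - by apply: emeasurable_funM.
  - by move=> *; rewrite mule_ge0// lee_fin.
  - by rewrite lee_fin.
transitivity (\int[leb]_a ((f a)%:E * (\int[leb]_b (g b)%:E * \int[leb]_c (h c)%:E)))%E.
  by apply: eq_integral => a _; rewrite -E2; apply: eq_integral => b _; exact: E1.
rewrite ge0_integralZr//; first by rewrite muleA.
- by move=> *; rewrite lee_fin.
- exact: mule_ge0.
Qed.

End Vol.

Lemma derive1_val (R : realType) (f : R -> R) (x df : R) :
  is_derive x 1 f df -> derive1 f x = df.
Proof. by move=> [_ <-]; rewrite derive1E. Qed.

Lemma is_derive_addl (R : realType) (y a : R) : is_derive a 1 (fun a => y + a) 1.
Proof.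
have := is_deriveD (is_derive_cst y a (1 : R)) (is_derive_id a (1 : R)).
by rewrite add0r.
Qed.

(** * Gaussians and the Riesz kernel *)

Section Gaussian.
Context {R : realType}.
Notation leb := (@lebesgue_measure R).

Implicit Types q x y xi : R.

(** The standard majorant on the line: its integral is exactly [pi], it controls the scales of the
    Riesz kernel, and a product of three of them dominates the spatial weight. *)
Definition cauchy (x : R) : R := (1 + x ^+ 2)^-1.

Lemma cauchy_ge0 x : 0 <= cauchy x.
Proof. by rewrite invr_ge0 addr_ge0// sqr_ge0. Qed.

Lemma cauchy_continuous : continuous cauchy.
Proof.
move=> x; apply: cvgV; first by rewrite gt_eqF// ltr_pwDl// sqr_ge0.
by apply: cvgD; [exact: cvg_cst|exact: exprn_continuous].
Qed.

Lemma integral_cauchy : (\int[leb]_x (cauchy x)%:E = pi%:E)%E.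
Proof.
rewrite ge0_symfun_integralT//; [|exact: cauchy_ge0|exact: cauchy_continuous|]; last first.
  by move=> x /=; rewrite /cauchy sqrrN.
rewrite (_ : [set x | 0 <= x] = `[0, +oo[%classic); last first.
  by apply/seteqP; split => x/=; rewrite in_itv/= andbT.
rewrite -[X in (_ * X)%E](_ : (pi / 2)%:E = _).
  by rewrite -EFinM mulrC divfK.
by rewrite -integral0y_oneDsqr.
Qed.

Lemma integrable_cauchy : leb.-integrable setT (EFin \o cauchy).
Proof.
apply/integrableP; split.
  by apply/measurable_EFinP; apply: continuous_measurable_fun; exact: cauchy_continuous.
under eq_integral do rewrite /= ger0_norm ?cauchy_ge0//.
by rewrite integral_cauchy ltry.
Qed.

Definition gauss (q x : R) : R := expR (- (q * x ^+ 2)).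

Lemma gauss_ge0 q x : 0 <= gauss q x. Proof. exact: expR_ge0. Qed.

Lemma measurable_gauss q : measurable_fun setT (gauss q).
Proof.
apply: (measurableT_comp (continuous_measurable_fun (@continuous_expR R))).
apply: measurableT_comp => //; apply: measurable_funM => //.
Qed.

Lemma measurable_cos_scale x : measurable_fun setT (fun y : R => cos (x * y)).
Proof.
apply: (measurableT_comp (continuous_measurable_fun (@continuous_cos R))).
exact: measurable_funM.
Qed.

Lemma measurable_sin_scale x : measurable_fun setT (fun y : R => sin (x * y)).
Proof.
apply: (measurableT_comp (continuous_measurable_fun (@continuous_sin R))).
exact: measurable_funM.
Qed.

Lemma integral_gauss q : 0 < q -> (\int[leb]_x (gauss q x)%:E = (Num.sqrt (pi / q))%:E)%E.
Proof.
(* [gauss q] is an unnormalised normal density of standard deviation [s], whose total mass is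
   known. *)
move=> q0; pose s := (Num.sqrt (2 * q))^-1.
have q2 : 0 < 2 * q by rewrite mulr_gt0.
have s0 : s != 0 by rewrite invr_eq0 gt_eqF// sqrtr_gt0.
have s2 : s ^+ 2 = (2 * q)^-1 by rewrite exprVn sqr_sqrtr// ltW.
have e x : normal_pdf 0 s x = (Num.sqrt (pi / q))^-1 * gauss q x.
  transitivity (normal_peak s * normal_fun 0 s x); first by rewrite normal_pdfE.
  rewrite /normal_peak /normal_fun /gauss s2; congr (_^-1 * expR _).
    by congr Num.sqrt; rewrite -mulr_natr; field; rewrite gt_eqF.
  by rewrite subr0 -mulr_natr; field; rewrite gt_eqF.
have := integral_normal_pdf 0 s; under eq_integral do rewrite e EFinM.
have p0 : 0 < Num.sqrt (pi / q) by rewrite sqrtr_gt0 divr_gt0// pi_gt0.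
rewrite ge0_integralZl//; last 2 first.
- by apply/measurable_EFinP; exact: measurable_gauss.
- by move=> x _; rewrite lee_fin gauss_ge0.
move=> /(congr1 (fun z => (Num.sqrt (pi / q))%:E * z)%E).
by rewrite muleA -EFinM mulfV ?gt_eqF// mul1e mule1.
Qed.

Lemma integrable_gauss q : 0 < q -> leb.-integrable setT (EFin \o gauss q).
Proof.
move=> q0; apply/integrableP; split; first by apply/measurable_EFinP; exact: measurable_gauss.
under eq_integral do rewrite /= ger0_norm ?gauss_ge0//.
by rewrite integral_gauss// ltry.
Qed.

Lemma Rintegral_gauss q : 0 < q -> Rintegral leb setT (gauss q) = Num.sqrt (pi / q).
Proof. by move=> q0; rewrite /Rintegral integral_gauss. Qed.

(** Half of the exponent is spent on the polynomial factor: [|x|] is at most [1 + x ^+ 2], hence at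
    most a multiple of [1 + q / 2 * x ^+ 2], hence of the exponential of the second term. *)
Lemma normM_gauss q x : 0 < q -> `|x| * gauss q x <= (1 + 2 / q) * gauss (q / 2) x.
Proof.
move=> q0.
have -> : gauss q x = gauss (q / 2) x * gauss (q / 2) x by rewrite /gauss -expRD; congr expR; field.
rewrite mulrA ler_wpM2r ?gauss_ge0// /gauss expRN.
rewrite ler_pdivrMr ?expR_gt0//.
have h1 := expR_ge1Dx (q / 2 * x ^+ 2).
have h2 : `|x| <= 1 + x ^+ 2.
  have := sqr_ge0 (`|x| - 1); rewrite sqrrB real_normK ?num_real// expr1n mulr1 => h.
  by have := normr_ge0 x; lra.
have h3 : 1 + x ^+ 2 <= (1 + 2 / q) * (1 + q / 2 * x ^+ 2).
  rewrite (_ : (1 + 2 / q) * (1 + q / 2 * x ^+ 2) = 1 + x ^+ 2 + (2 / q + q / 2 * x ^+ 2)); last by field; rewrite gt_eqF.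
  have : 0 <= 2 / q by rewrite divr_ge0// ltW.
  have : 0 <= q / 2 * x ^+ 2 by rewrite mulr_ge0 ?sqr_ge0// divr_ge0// ltW.
  by lra.
by rewrite (le_trans h2)// (le_trans h3)// ler_wpM2l// addr_ge0// divr_ge0// ltW.
Qed.

Lemma integrable_norm_gauss q : 0 < q -> leb.-integrable setT (EFin \o (fun x => `|x| * gauss q x)).
Proof.
move=> q0; apply: (@integrable_bound _ _ _ leb _ (fun x => (1 + 2 / q) * gauss (q / 2) x)).
- exact: (measurable_funM (@normr_measurable R _) (measurable_gauss q)).
- have /(integrableZl measurableT (1 + 2 / q)) : leb.-integrable setT (EFin \o gauss (q / 2)).
    by apply: integrable_gauss; rewrite divr_gt0.
  exact.
- by move=> x; rewrite ger0_norm ?mulr_ge0 ?gauss_ge0// normM_gauss.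
Qed.

Lemma is_derive_gauss q x : is_derive x 1 (gauss q) (- (2 * q * x) * gauss q x).
Proof.
have h : is_derive x 1 (fun x => - (q * x ^+ 2)) (- (2 * q * x)).
  apply: is_deriveN; apply: is_derive_eq.
  by rewrite /GRing.scale/=; ring.
have := is_derive1_comp (f := expR) (g := fun x => - (q * x ^+ 2)) (x := x) _ h.
move=> /(_ _ (is_derive_expR _)) h2.
apply: is_derive_eq.
by rewrite /gauss mulrC.
Qed.

(** A majorant uniform over shifts of length at most 1, as domination under the integral sign
    requires; it rests on [(x + a) ^+ 2 >= x ^+ 2 / 2 - a ^+ 2]. *)
Lemma gauss_shift q x a : 0 < q -> `|a| <= 1 -> gauss q (x + a) <= expR q * gauss (q / 2) x.
Proof.
move=> q0 a1; rewrite /gauss -expRD ler_expR.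
have a2 : a ^+ 2 <= 1 by rewrite -real_normK ?num_real// expr_le1.
have h : x ^+ 2 / 2 - a ^+ 2 <= (x + a) ^+ 2.
  have := sqr_ge0 (x / 2 + a); have := sqr_ge0 x.
  rewrite (_ : (x + a) ^+ 2 = x ^+ 2 / 2 - a ^+ 2 + 2 * (x / 2 + a) ^+ 2); last by field.
  by move=> *; lra.
have : q * (x ^+ 2 / 2 - 1) <= q * (x + a) ^+ 2 by rewrite ler_pM2l//; lra.
by move=> ?; lra.
Qed.

(* Differentiating the translation invariant integral of [g] replaces an
   integration by parts over the whole line. *)
Lemma integral_derive_sin_gauss q xi : 0 < q ->
  Rintegral leb setT (fun y => (- (2 * q * y)) * gauss q y * sin (xi * y) +
    gauss q y * (xi * cos (xi * y))) = 0.
Proof.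
move=> q0; pose g y := gauss q y * sin (xi * y).
pose g' y := (- (2 * q * y)) * gauss q y * sin (xi * y) + gauss q y * (xi * cos (xi * y)).
have dg y : is_derive y 1 g (g' y).
  have d1 := is_derive_gauss q y.
  have d2 : is_derive y 1 (fun y => sin (xi * y)) (xi * cos (xi * y)).
    have h : is_derive y 1 (fun y => xi * y) xi.
      by apply: is_derive_eq; rewrite /GRing.scale/= mulr1.
    have := is_derive1_comp (f := sin) (g := fun y => xi * y) (x := y) _ h.
    by move=> /(_ _ (is_derive_sin _)); rewrite mulrC.
  apply: is_derive_eq; rewrite /GRing.scale /g' /=; ring.
have cg : continuous g by move=> y; apply/differentiable_continuous/derivable1_diffP; case: (dg y).
have mg : measurable_fun setT g by exact: continuous_measurable_fun.
have ig : leb.-integrable setT (EFin \o g).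
  apply: (integrable_bound _ (integrable_gauss q0)) => [|y]; first exact: mg.
  rewrite normrM (ger0_norm (gauss_ge0 _ _)) ler_piMr ?gauss_ge0// ler_norml.
  by rewrite sin_geN1 sin_le1.
pose f a y := g (y + a).
have df (a y : R) : derive1 (fun a => f a y) a = g' (y + a).
  have h := is_derive_addl y a.
  have := is_derive1_comp (f := g) (g := fun a => y + a) (x := a) (dg _) h.
  by rewrite mulr1 => /derive1_val.
have gb y a : `|a| <= 1 -> `|g' (y + a)| <= (2 * q * (1 + 2 / q)) * (expR (q / 2) * gauss (q / 2 / 2) y) + `|xi| * (expR q * gauss (q / 2) y).
  move=> a1; rewrite (le_trans (ler_normD _ _))// lerD//.
    rewrite !normrM normrN normrM (ger0_norm (gauss_ge0 _ _)) (@ger0_norm _ (2 * q)) ?mulr_ge0 ?(ltW q0)//.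
    apply: (@le_trans _ _ (2 * q * `|y + a| * gauss q (y + a))).
      rewrite ler_piMr ?mulr_ge0 ?gauss_ge0 ?(ltW q0)// ler_norml.
      by rewrite sin_geN1 sin_le1.
    rewrite -(mulrA (2 * q)) -(mulrA (2 * q)) ler_wpM2l ?mulr_ge0 ?(ltW q0)//.
    rewrite (le_trans (normM_gauss _ q0))// ler_wpM2l ?gauss_shift// ?divr_gt0//.
    by rewrite addr_ge0// divr_ge0// (ltW q0).
  rewrite !normrM (ger0_norm (gauss_ge0 _ _)) mulrCA ler_wpM2l//.
  apply: (@le_trans _ _ (gauss q (y + a))); last exact: gauss_shift.
  rewrite ler_piMr ?gauss_ge0// ler_norml.
  by rewrite cos_geN1 cos_le1.
have iG1 : leb.-integrable setT (EFin \o (fun y => (2 * q * (1 + 2 / q)) * (expR (q / 2) * gauss (q / 2 / 2) y))).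
  rewrite (_ : _ \o _ = fun y => ((2 * q * (1 + 2 / q) * expR (q / 2))%:E * (gauss (q / 2 / 2) y)%:E)%E).
    by apply: integrableZl => //; apply: integrable_gauss; rewrite !divr_gt0.
  by apply/funext => y /=; rewrite -EFinM mulrA.
have iG2 : leb.-integrable setT (EFin \o (fun y => `|xi| * (expR q * gauss (q / 2) y))).
  rewrite (_ : _ \o _ = fun y => ((`|xi| * expR q)%:E * (gauss (q / 2) y)%:E)%E).
    by apply: integrableZl => //; apply: integrable_gauss; rewrite !divr_gt0.
  by apply/funext => y /=; rewrite -EFinM mulrA.
have iG := integrableD measurableT iG1 iG2.
have b0 : `](-1), 1[%classic (0 : R) by rewrite /= in_itv/=; lra.
have := @differentiation_under_integral R _ _ leb f setT measurableT 0 (-1) 1 b0.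
move=> /(_ _ _ (fun y => (2 * q * (1 + 2 / q)) * (expR (q / 2) * gauss (q / 2 / 2) y) + `|xi| * (expR q * gauss (q / 2) y))).
have -> : (fun x' : R => Rintegral leb setT (fun y => f x' y)) = (fun=> Rintegral leb setT g).
  by apply/funext => a; rewrite /f (preserving_Rintegral (preserving_add a) mg).
rewrite derive1_cst => H; rewrite [RHS]H.
- apply: eq_Rintegral => y _; rewrite /partial1of2 df addr0 //.
- by move=> a _; exact: (preserving_integrable (preserving_add a) ig).
- move=> a y _ _.
  have h := is_derive_addl y a.
  by have [] := is_derive1_comp (f := g) (g := fun a => y + a) (x := a) (dg _) h.
- move=> y; rewrite addr_ge0//; last by rewrite !mulr_ge0// expR_ge0.
  rewrite mulr_ge0 ?mulr_ge0 ?expR_ge0 ?(ltW q0)//.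
  by rewrite addr_ge0// divr_ge0// (ltW q0).
- exact: iG.
- by move=> a y; rewrite /= in_itv/= => /andP[a1 a2] _; rewrite /partial1of2 df gb// ler_norml !ltW.
Qed.

(** As a function of the frequency the transform [J] solves [J' = - (x / (2 q)) J]: differentiation
    under the integral brings out a factor [y], which [integral_derive_sin_gauss] trades for the
    frequency. Hence [J] times the inverse Gaussian is constant, and its value at 0 is the mass. *)
Lemma fourier_gauss_cos q xi : 0 < q ->
  Rintegral leb setT (fun y => gauss q y * cos (xi * y)) =
  Num.sqrt (pi / q) * expR (- (xi ^+ 2 / (4 * q))).
Proof.
move=> q0; pose J xi := Rintegral leb setT (fun y => gauss q y * cos (xi * y)).
have mcos := measurable_cos_scale; have msin := measurable_sin_scale.
have igc x : leb.-integrable setT (fun y => (gauss q y * cos (x * y))%:E).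
  apply: (integrable_bound _ (integrable_gauss q0)).
    by apply: measurable_funM (measurable_gauss q) (mcos _).
  move=> y; rewrite normrM (ger0_norm (gauss_ge0 _ _)) ler_piMr ?gauss_ge0// ler_norml.
  by rewrite cos_geN1 cos_le1.
have igs x : leb.-integrable setT (fun y => (y * gauss q y * sin (x * y))%:E).
  apply: (integrable_bound _ (integrable_norm_gauss q0)).
    by apply: measurable_funM (msin _); apply: measurable_funM (measurable_gauss q).
  move=> y; rewrite !normrM (ger0_norm (gauss_ge0 _ _)) ler_piMr ?mulr_ge0 ?gauss_ge0// ler_norml.
  by rewrite sin_geN1 sin_le1.
have dcos y x : is_derive x 1 (fun x => gauss q y * cos (x * y)) (- (y * gauss q y * sin (x * y))).
  have h : is_derive x 1 (fun x => x * y) y.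
    by apply: is_derive_eq; rewrite /GRing.scale/= mulr1 mulr0 add0r.
  have := is_derive1_comp (f := cos) (g := fun x => x * y) (x := x) _ h.
  move=> /(_ _ (is_derive_cos _)) h2.
  by apply: is_derive_eq; rewrite /GRing.scale/=; ring.
have dJ x : is_derive x 1 J (- (x / (2 * q)) * J x).
  have bx : `](x - 1), (x + 1)[%classic x by rewrite /= in_itv/=; lra.
  have H1 (a : R) : `](x - 1), (x + 1)[%classic a -> leb.-integrable setT (EFin \o (fun y => gauss q y * cos (a * y))).
    by move=> _; exact: igc.
  have H2 (a y : R) : `](x - 1), (x + 1)[%classic a -> setT y -> derivable (fun a : R => gauss q y * cos (a * y)) a 1.
    by move=> _ _; case: (dcos y a).
  have H3 (y : R) : 0 <= `|y| * gauss q y by rewrite mulr_ge0// gauss_ge0.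
  have H4 (a y : R) : `](x - 1), (x + 1)[%classic a -> setT y ->
    `|partial1of2 (fun a y : R => gauss q y * cos (a * y)) a y| <= `|y| * gauss q y.
    move=> _ _; rewrite /partial1of2 (derive1_val (dcos y a)) normrN !normrM.
    rewrite (ger0_norm (gauss_ge0 _ _)) ler_piMr ?mulr_ge0 ?gauss_ge0// ler_norml.
    by rewrite sin_geN1 sin_le1.
  have D := @derivable_under_integral R _ _ leb (fun a y : R => gauss q y * cos (a * y)) setT measurableT x _ _ bx H1 H2 _ H3 (integrable_norm_gauss q0) H4.
  have E := @differentiation_under_integral R _ _ leb (fun a y : R => gauss q y * cos (a * y)) setT measurableT x _ _ bx H1 H2 _ H3 (integrable_norm_gauss q0) H4.
  apply: DeriveDef => //; rewrite -derive1E E.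
  have : Rintegral leb setT (fun y => (- (2 * q)) * (y * gauss q y * sin (x * y)) +
      x * (gauss q y * cos (x * y))) = 0.
    by rewrite -[RHS](integral_derive_sin_gauss x q0); apply: eq_Rintegral => y _; ring.
  rewrite RintegralD//; last 2 first.
  - exact: (integrableZl measurableT _ (igs x)).
  - exact: (integrableZl measurableT _ (igc x)).
  have Z1 r := @RintegralZl _ _ R leb setT (fun y : R => y * gauss q y * sin (x * y)) r measurableT (igs x).
  have Z2 r := @RintegralZl _ _ R leb setT (fun y : R => gauss q y * cos (x * y)) r measurableT (igc x).
  rewrite Z1 Z2.
  rewrite -/(J x) => e.
  under eq_Rintegral => y _.
    rewrite /partial1of2 (derive1_val (dcos y x)) -mulN1r; over.
  rewrite Z1.
  set S := Rintegral _ _ _ in e *.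
  have -> : S = x * J x / (2 * q).
    have q2 : 2 * q != 0 by rewrite gt_eqF// mulr_gt0.
    by apply: (mulfI q2); rewrite [RHS]mulrC divfK//; lra.
  ring.
have dE x : is_derive x 1 (fun x : R => expR (x ^+ 2 / (4 * q))) (x / (2 * q) * expR (x ^+ 2 / (4 * q))).
  have h : is_derive x 1 (fun x => x ^+ 2 / (4 * q)) (x / (2 * q)).
    apply: is_derive_eq; rewrite /GRing.scale/= ; field; rewrite gt_eqF//.
  have := is_derive1_comp (f := expR) (g := fun x => x ^+ 2 / (4 * q)) (x := x) _ h.
  by move=> /(_ _ (is_derive_expR _)); rewrite (mulrC (x / _)).
have cst : J xi * expR (xi ^+ 2 / (4 * q)) = J 0 * expR (0 ^+ 2 / (4 * q)).
  apply: (is_derive_0_is_cst (f := fun x => J x * expR (x ^+ 2 / (4 * q)))) => x.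
  have := dJ x; have := dE x => ? ?.
  by apply: is_derive_eq; rewrite /GRing.scale/=; ring.
rewrite expr0n mul0r expR0 mulr1 in cst.
rewrite -/(J xi) expRN -(Rintegral_gauss q0).
apply: (@mulIf _ (expR (xi ^+ 2 / (4 * q)))); first by rewrite gt_eqF// expR_gt0.
rewrite cst divfK ?gt_eqF ?expR_gt0//; apply: eq_Rintegral => y _.
by rewrite mul0r cos0 mulr1.
Qed.

Lemma fourier_gauss q xi : 0 < q ->
  cintegral leb setT (fun y => (gauss q y)%:C * cis (y * xi)) =
  (Num.sqrt (pi / q) * expR (- (xi ^+ 2 / (4 * q))))%:C.
Proof.
move=> q0; rewrite /cintegral -(fourier_gauss_cos xi q0); apply: complex_eqP => /=.
  by apply: eq_Rintegral => y _; rewrite mul0r subr0 (mulrC y).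
set g := fun y => _.
have mg : measurable_fun setT g.
  rewrite (_ : g = fun y => gauss q y * sin (y * xi)).
    apply: measurable_funM (measurable_gauss q) _.
    by under eq_fun do rewrite mulrC; exact: measurable_sin_scale.
  by apply/funext => y; rewrite /g mul0r addr0.
(* The imaginary part is odd, so reflection shows that it equals its own opposite. *)
have := preserving_Rintegral preserving_opp mg.
rewrite (_ : (fun x => g (- x)) = fun x => - 1 * g x); last first.
  by apply/funext => x; rewrite /g /gauss sqrrN !mulNr sinN; ring.
rewrite RintegralZl//; first by move=> ?; lra.
apply: (integrable_bound _ (integrable_gauss q0)) => [|y]; first exact: mg.
rewrite /g mul0r addr0 normrM (ger0_norm (gauss_ge0 _ _)) ler_piMr ?gauss_ge0// ler_norml.
by rewrite sin_geN1 sin_le1.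
Qed.

Lemma cintegrable_gauss q xi : 0 < q ->
  cintegrable leb setT (fun y => (gauss q y)%:C * cis (y * xi)).
Proof.
move=> q0; apply: (cintegrable_bound _ (integrable_gauss q0)).
  apply: cmeasurableM; first by apply: cmeasurable_real; exact: measurable_gauss.
  by apply: cmeasurable_cis; apply: measurable_funM.
by move=> y; rewrite normcM normc_real normc_cis mulr1 ger0_norm ?gauss_ge0.
Qed.

End Gaussian.

(** * Norms, polynomial weights and Gaussians in three dimensions *)

Section Weights.
Context {R : realType}.
Notation leb := (@lebesgue_measure R).
Implicit Types (x y : R3 R) (q v : R).

Lemma normR3E x : `|x| = Num.max (Num.max `|x.1.1| `|x.1.2|) `|x.2|.
Proof. by []. Qed.

Lemma norm_c1 x : `|x.1.1| <= `|x|.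
Proof. by rewrite normR3E !le_max lexx. Qed.
Lemma norm_c2 x : `|x.1.2| <= `|x|.
Proof. by rewrite normR3E !le_max lexx orbT. Qed.
Lemma norm_c3 x : `|x.2| <= `|x|.
Proof. by rewrite normR3E !le_max lexx orbT. Qed.

Lemma measurable_norm3 : measurable_fun setT (fun x => `|x|).
Proof.
under eq_fun do rewrite normR3E.
apply: measurable_maxr; first apply: measurable_maxr.
- exact: (measurableT_comp (@normr_measurable R _) measurable_c1).
- exact: (measurableT_comp (@normr_measurable R _) measurable_c2).
- exact: (measurableT_comp (@normr_measurable R _) measurable_c3).
Qed.

Lemma measurable_dot d (T : measurableType d) (f g : T -> R3 R) :
  measurable_fun setT f -> measurable_fun setT g -> measurable_fun setT (fun t => dot (f t) (g t)).
Proof.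
move=> mf mg.
have m1 (h : R3 R -> R) (mh : measurable_fun setT h) := measurableT_comp mh mf.
have m2 (h : R3 R -> R) (mh : measurable_fun setT h) := measurableT_comp mh mg.
exact: (measurable_funD (measurable_funD (measurable_funM (m1 _ measurable_c1) (m2 _ measurable_c1))
  (measurable_funM (m1 _ measurable_c2) (m2 _ measurable_c2)))
  (measurable_funM (m1 _ measurable_c3) (m2 _ measurable_c3))).
Qed.

Lemma measurable_eucl : measurable_fun setT (fun x : R3 R => eucl x).
Proof.
apply: (measurableT_comp (continuous_measurable_fun (@sqrt_continuous R))).
exact: (measurable_dot (@measurable_id _ _ _) (@measurable_id _ _ _)).
Qed.

Lemma dot_ge0 x : 0 <= dot x x.
Proof. by rewrite /dot -!expr2 !addr_ge0 ?sqr_ge0. Qed.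

Lemma eucl_ge0 x : 0 <= eucl x. Proof. exact: sqrtr_ge0. Qed.

Lemma sqr_eucl x : eucl x ^+ 2 = dot x x.
Proof. by rewrite sqr_sqrtr// dot_ge0. Qed.

(** The optimal constant is the square root of 3; 2 keeps later arithmetic rational. The library
    norm is the one used for weights and cubes, [eucl] the one in the symbol. *)
Lemma eucl_le x : eucl x <= 2 * `|x|.
Proof.
rewrite -(@ler_pXn2r _ 2) ?nnegrE ?eucl_ge0 ?mulr_ge0// sqr_eucl /dot -!expr2.
have n0 := normr_ge0 x.
have h (a : R) : `|a| <= `|x| -> a ^+ 2 <= `|x| ^+ 2.
  by move=> ax; rewrite -(real_normK (num_real a)) ler_pXn2r ?nnegrE.
have := h _ (norm_c1 x); have := h _ (norm_c2 x); have := h _ (norm_c3 x).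
by rewrite exprMn; have := sqr_ge0 `|x|; lra.
Qed.

Lemma norm_le_eucl x : `|x| <= eucl x.
Proof.
have h (a : R) : a ^+ 2 <= dot x x -> `|a| <= eucl x.
  by move=> ax; rewrite -sqrtr_sqr ler_wsqrtr.
rewrite normR3E !ge_max !h// /dot -!expr2.
- by rewrite lerDr addr_ge0 ?sqr_ge0.
- by rewrite -addrA addrCA lerDl addr_ge0 ?sqr_ge0.
- by rewrite -addrA lerDl addr_ge0 ?sqr_ge0.
Qed.

Lemma eucl_eq0 x : (eucl x == 0) = (x == 0).
Proof.
apply/eqP/eqP => [e0|->]; last by rewrite /eucl /dot /= !mul0r !addr0 sqrtr0.
by apply/eqP; rewrite -normr_le0 -e0 norm_le_eucl.
Qed.

Lemma dotDl x y z : dot (x + y) z = dot x z + dot y z.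
Proof. by rewrite /dot /=; ring. Qed.
Lemma dotNl x z : dot (- x) z = - dot x z.
Proof. by rewrite /dot /=; ring. Qed.
Lemma dotDr x y z : dot z (x + y) = dot z x + dot z y.
Proof. by rewrite /dot /=; ring. Qed.
Lemma dotNr x z : dot z (- x) = - dot z x.
Proof. by rewrite /dot /=; ring. Qed.
Lemma dotC x y : dot x y = dot y x.
Proof. by rewrite /dot; ring. Qed.

(** The power 6 allots a square to each of the three coordinates, which makes the weight integrable
    by comparison with a product of [cauchy] factors. *)
Definition wgt x : R := (1 + `|x|) ^- 6.

Lemma norm1_gt0 x : 0 < 1 + `|x|.
Proof. by rewrite ltr_pwDl. Qed.

Lemma wgt_gt0 x : 0 < wgt x.
Proof. by rewrite invr_gt0 exprn_gt0// norm1_gt0. Qed.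

Lemma wgt_ge0 x : 0 <= wgt x. Proof. exact/ltW/wgt_gt0. Qed.

Lemma wgtN x : wgt (- x) = wgt x.
Proof. by rewrite /wgt normrN. Qed.

Lemma wgt_le1 x : wgt x <= 1.
Proof. by rewrite invf_le1 ?exprn_gt0 ?norm1_gt0// exprn_ege1// lerDl. Qed.

Lemma measurable_wgt : measurable_fun setT wgt.
Proof.
rewrite (_ : wgt = (fun t : R => (1 + `|t|) ^- 6) \o (fun x => `|x|)); last first.
  by apply/funext => x; rewrite /wgt /= normr_id.
apply: measurableT_comp measurable_norm3; apply: continuous_measurable_fun => t.
apply: cvgV; first by rewrite gt_eqF// exprn_gt0// ltr_pwDl.
by apply: (@cvg_comp _ _ _ (fun t => 1 + `|t|) (fun t => t ^+ 6)); [
  apply: cvgD; [exact: cvg_cst|exact: norm_continuous]|exact: exprn_continuous].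
Qed.

(** The larger of [1 + |x|] and [1 + |y|] is at least half of [1 + |x + y|], so one of the two
    weights is at most [2 ^ 6 = 64] times the weight of the sum. *)
Lemma wgt_mul x y : wgt x * wgt y <= 64 * wgt (x + y) * (wgt x + wgt y).
Proof.
have A0 := norm1_gt0 x; have B0 := norm1_gt0 y; have C0 := norm1_gt0 (x + y).
have CAB : 1 + `|x + y| <= (1 + `|x|) + (1 + `|y|) by have := ler_normD x y; lra.
rewrite /wgt; set A := 1 + `|x| in A0 CAB *; set B := 1 + `|y| in B0 CAB *.
set C := 1 + `|x + y| in C0 CAB *.
have h : C ^+ 6 <= 64 * (A ^+ 6 + B ^+ 6).
  have A6 : 0 <= A ^+ 6 by rewrite exprn_ge0// ltW.
  have B6 : 0 <= B ^+ 6 by rewrite exprn_ge0// ltW.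
  have [AB|BA] := leP A B.
    have : C ^+ 6 <= (2 * B) ^+ 6 by rewrite ler_pXn2r ?nnegrE//; lra.
    by rewrite exprMn => ?; lra.
  have : C ^+ 6 <= (2 * A) ^+ 6 by rewrite ler_pXn2r ?nnegrE//; lra.
  by rewrite exprMn => ?; lra.
have -> : 64 * C ^- 6 * (A ^- 6 + B ^- 6) = A ^- 6 * B ^- 6 * (64 * (A ^+ 6 + B ^+ 6) / C ^+ 6).
  by field; rewrite !gt_eqF.
by rewrite ler_pMr ?mulr_gt0 ?invr_gt0 ?exprn_gt0// ler_pdivlMr ?exprn_gt0// mul1r.
Qed.

Lemma wgt_cauchy x : wgt x <= cauchy x.1.1 * cauchy x.1.2 * cauchy x.2.
Proof.
have h (a : R) : `|a| <= `|x| -> (1 + `|x|) ^- 2 <= cauchy a.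
  move=> ax; rewrite /cauchy lef_pV2 ?posrE ?exprn_gt0 ?norm1_gt0//; last by rewrite ltr_pwDl// sqr_ge0.
  have : a ^+ 2 <= `|x| ^+ 2 by rewrite -(real_normK (num_real a)) ler_pXn2r ?nnegrE.
  by have := normr_ge0 x; lra.
rewrite (_ : wgt x = (1 + `|x|) ^- 2 * (1 + `|x|) ^- 2 * (1 + `|x|) ^- 2).
  have p0 : 0 <= (1 + `|x|) ^- 2 by rewrite invr_ge0 exprn_ge0// ltW// norm1_gt0.
  rewrite ler_pM ?mulr_ge0// ?ler_pM ?h ?norm_c1 ?norm_c2 ?norm_c3//.
by rewrite /wgt -!invfM -!exprD.
Qed.

Lemma integral_wgt_shift (a : R3 R) : (\int[vol]_x (wgt (x - a))%:E <= (pi ^+ 3)%:E)%E.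
Proof.
have [_ p] := preserving_translation (- a).
rewrite (p (EFin \o wgt)); [|by apply/measurable_EFinP; exact: measurable_wgt|by move=> x; rewrite lee_fin wgt_ge0].
have mc := continuous_measurable_fun (@cauchy_continuous R).
apply: (@le_trans _ _ (\int[vol]_x (cauchy x.1.1 * cauchy x.1.2 * cauchy x.2)%:E)%E).
  apply: ge0_le_integral => //.
  - by move=> x _; rewrite lee_fin wgt_ge0.
  - by apply/measurable_EFinP; exact: measurable_wgt.
  - by apply/measurable_EFinP; apply: measurable_funM; [apply: measurable_funM|];
      [exact: (measurableT_comp mc measurable_c1)|exact: (measurableT_comp mc measurable_c2)|
       exact: (measurableT_comp mc measurable_c3)].
  - by move=> x _; rewrite lee_fin wgt_cauchy.
rewrite vol_prod// ?integral_cauchy; try (by move=> ?; exact: cauchy_ge0).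
by rewrite -!EFinM !exprS expr0 mulr1 mulrA.
Qed.

Definition gauss3 q x := gauss q x.1.1 * gauss q x.1.2 * gauss q x.2.

Lemma gauss3E q x : gauss3 q x = expR (- (q * dot x x)).
Proof. by rewrite /gauss3 /gauss -!expRD /dot; congr expR; ring. Qed.

Lemma gauss3_ge0 q x : 0 <= gauss3 q x.
Proof. by rewrite gauss3E expR_ge0. Qed.

Lemma gauss3N q x : gauss3 q (- x) = gauss3 q x.
Proof. by rewrite !gauss3E; congr expR; rewrite /dot /=; ring. Qed.

Lemma gauss3_le1 q x : 0 <= q -> gauss3 q x <= 1.
Proof. by move=> q0; rewrite gauss3E -expR0 ler_expR oppr_le0 mulr_ge0// dot_ge0. Qed.

Lemma measurable_gauss3 q : measurable_fun setT (gauss3 q).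
Proof.
have mg := measurable_gauss q.
by apply: measurable_funM; [apply: measurable_funM|];
      [exact: (measurableT_comp mg measurable_c1)|exact: (measurableT_comp mg measurable_c2)|
       exact: (measurableT_comp mg measurable_c3)].
Qed.

Lemma integral_gauss3 q : 0 < q -> (\int[vol]_x (gauss3 q x)%:E = (Num.sqrt (pi / q) ^+ 3)%:E)%E.
Proof.
move=> q0; rewrite vol_prod ?integral_gauss//; try exact: measurable_gauss; try exact: gauss_ge0.
by rewrite -!EFinM !exprS expr0 mulr1 mulrA.
Qed.

Lemma integrable_gauss3 q : 0 < q -> vol.-integrable setT (EFin \o gauss3 q).
Proof.
move=> q0; apply/integrableP; split; first by apply/measurable_EFinP; exact: measurable_gauss3.
under eq_integral do rewrite /= ger0_norm ?gauss3_ge0//.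
by rewrite integral_gauss3// ltry.
Qed.

Lemma cintegral_vol_prod (f g h : R -> R[i]) : cintegrable leb setT f ->
  cintegrable leb setT g -> cintegrable leb setT h ->
  cintegral vol setT (fun x => f x.1.1 * g x.1.2 * h x.2) =
  cintegral leb setT f * cintegral leb setT g * cintegral leb setT h.
Proof.
move=> fi gi hi.
have fgi : cintegrable leb2 setT (fun z => f z.1 * g z.2).
  apply: (cintegrable_bound _ (integrable_prodM (cintegrable_normc fi) (cintegrable_normc gi))).
    apply: cmeasurableM.
      by case/cintegrableP: fi => -[f1 f2] _; split; [exact: (measurableT_comp f1 measurable_fst)|exact: (measurableT_comp f2 measurable_fst)].
    by case/cintegrableP: gi => -[f1 f2] _; split; [exact: (measurableT_comp f1 measurable_snd)|exact: (measurableT_comp f2 measurable_snd)].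
  by move=> z; rewrite normcM.
have fghi : cintegrable vol setT (fun x => f x.1.1 * g x.1.2 * h x.2).
  apply: (cintegrable_bound _ (integrable_prodM (cintegrable_normc fgi) (cintegrable_normc hi))).
    apply: cmeasurableM.
      by case/cintegrableP: fgi => -[f1 f2] _; split; [exact: (measurableT_comp f1 measurable_fst)|exact: (measurableT_comp f2 measurable_fst)].
    by case/cintegrableP: hi => -[f1 f2] _; split; [exact: (measurableT_comp f1 measurable_snd)|exact: (measurableT_comp f2 measurable_snd)].
  by move=> z; rewrite normcM.
have := cintegral12 (m1 := leb2) (m2 := leb) fghi.
rewrite /= => <-; under eq_cintegral do rewrite cintegralZ//.
rewrite cintegralZr//; congr (_ * _).
have := cintegral12 (m1 := leb) (m2 := leb) fgi.
rewrite /= => <-; under eq_cintegral do rewrite cintegralZ//.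
by rewrite cintegralZr.
Qed.

Lemma fourier_gauss3 q x : 0 < q ->
  cintegral vol setT (fun y => (gauss3 q y)%:C * cis (dot y x)) =
  (Num.sqrt (pi / q) ^+ 3 * gauss3 (4 * q)^-1 x)%:C.
Proof.
move=> q0.
have e y : (gauss3 q y)%:C * cis (dot y x) =
    ((gauss q y.1.1)%:C * cis (y.1.1 * x.1.1)) * ((gauss q y.1.2)%:C * cis (y.1.2 * x.1.2)) *
    ((gauss q y.2)%:C * cis (y.2 * x.2)).
  by rewrite /dot !cisD /gauss3 !rmorphM/=; ring.
under eq_cintegral do rewrite e.
rewrite (cintegral_vol_prod (cintegrable_gauss _ q0) (cintegrable_gauss _ q0) (cintegrable_gauss _ q0)).
rewrite !fourier_gauss// -!rmorphM/=; congr (_%:C).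
have e2 (a : R) : expR (- (a ^+ 2 / (4 * q))) = gauss (4 * q)^-1 a by rewrite /gauss mulrC.
by rewrite !e2 /gauss3; ring.
Qed.

End Weights.

(** * The Riesz kernel as a superposition of Gaussians *)

Section Kernel.
Context {R : realType}.
Notation leb := (@lebesgue_measure R).
Implicit Types (x y a : R3 R) (q v t : R).

(** The bound is uniform in the centre [a] because [wgt_mul] leaves the kernel integrated against
    weights centred at two different points, one of them arbitrary. *)
Definition kernel_bound (C : R) (k : R3 R -> R) :=
  [/\ measurable_fun setT k, forall x, 0 <= k x
    & forall a, (\int[vol]_x (k x * wgt (x - a))%:E <= C%:E)%E].

Lemma kernel_bound1 : kernel_bound (pi ^+ 3) (fun=> 1).
Proof.
split=> [|x|a]; [exact: measurable_cst|exact: ler01|].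
by under eq_integral do rewrite mul1r; exact: integral_wgt_shift.
Qed.

Lemma expR_norm_cauchy v : expR (- (`|v| / 2)) <= 8 * cauchy v.
Proof.
rewrite expRN /cauchy ler_pdivlMr ?ltr_pwDl ?sqr_ge0// mulrC ler_pdivrMr ?expR_gt0//.
have v0 : 0 <= `|v| / 2 by rewrite divr_ge0.
(* The quadratic term of the exponential series gives [1 + v ^+ 2 / 8], whence the constant 8. *)
have := @expR_ge1Dxn R _ 1 v0.
rewrite (_ : 2`!%:R = 2 :> R)// (_ : (`|v| / 2) ^+ 2 = v ^+ 2 / 4); last first.
  by rewrite -(real_normK (num_real v)); field.
by lra.
Qed.

Variable alpha : R.
Hypotheses (alpha1 : 1 < alpha) (alpha2 : alpha <= 2).

(** Up to constants, the Fourier transform of [expR (v * (alpha / 2))] times the Gaussian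
    [gauss3 (expR v)], that is, of one slice of the Riesz kernel. Transforming the Gaussian yields
    the factor [expR (- 3 v / 2)], which turns [alpha] into [alpha - 3]. *)
Definition heat v x : R := expR (v * ((alpha - 3) / 2)) * gauss3 (expR (- v) / 4) x.

Lemma heat_ge0 v x : 0 <= heat v x.
Proof. by rewrite mulr_ge0 ?expR_ge0 ?gauss3_ge0. Qed.

Lemma measurable_heat v : measurable_fun setT (heat v).
Proof. exact: (measurable_funM (measurable_cst _) (measurable_gauss3 _)). Qed.

Lemma measurable_heat2 : measurable_fun setT (fun z : R3 R * measurableTypeR R => heat z.2 z.1).
Proof.
have me := continuous_measurable_fun (@continuous_expR R).
apply: measurable_funM.
  by apply: (measurableT_comp me); exact: (measurable_funM measurable_snd (measurable_cst _)).
under eq_fun do rewrite gauss3E.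
apply: (measurableT_comp me); apply: measurableT_comp => //; apply: measurable_funM.
  apply: measurable_funM => //; apply: (measurableT_comp me).
  exact: (measurableT_comp (@oppr_measurable R _) measurable_snd).
exact: (measurable_dot measurable_fst measurable_fst).
Qed.

Lemma sqrt_expR v : Num.sqrt (expR v) = expR (v / 2).
Proof.
rewrite -[in LHS](_ : (expR (v / 2)) ^+ 2 = expR v) ?sqrtr_sqr ?ger0_norm ?expR_ge0//.
by rewrite -expRM_natl; congr expR; field.
Qed.

Definition heatC : R := 8 * (Num.sqrt (4 * pi) ^+ 3 + pi ^+ 3).

Lemma heatC_ge0 : 0 <= heatC.
Proof. by rewrite mulr_ge0// addr_ge0// exprn_ge0// ?sqrtr_ge0// pi_ge0. Qed.

(** For [v <= 0] the weight is bounded by 1 and the Gaussian is integrated: what remains is of order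
    [expR (v * alpha / 2)], and [alpha > 1] gives decay. For [v > 0] the Gaussian is bounded by 1
    and the weight is integrated: [expR (v * (alpha - 3) / 2)] decays since [alpha <= 2]. [heatC]
    adds the constants of the two cases. *)
Lemma heat_bound v : kernel_bound (heatC * cauchy v) (heat v).
Proof.
split=> [|x|a]; [exact: measurable_heat|exact: heat_ge0|].
have q0 : 0 < expR (- v) / 4 by rewrite divr_gt0 ?expR_gt0.
have [v0|v0] := leP v 0.
  apply: (@le_trans _ _ (\int[vol]_x ((expR (v * ((alpha - 3) / 2)))%:E * (gauss3 (expR (- v) / 4) x)%:E))%E).
    apply: ge0_le_integral => //.
    - by move=> x _; rewrite lee_fin mulr_ge0 ?heat_ge0 ?wgt_ge0.
    - apply/measurable_EFinP; apply: measurable_funM (measurable_heat v) _.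
      by apply: (measurableT_comp measurable_wgt); exact: measurable_funB3.
    - by apply/measurable_EFinP; exact: measurable_heat.
    - by move=> x _; rewrite -EFinM lee_fin /heat ler_piMr ?wgt_le1// mulr_ge0 ?expR_ge0 ?gauss3_ge0.
  rewrite ge0_integralZl//; last 2 first.
  - by apply/measurable_EFinP; exact: measurable_gauss3.
  - by move=> x _; rewrite lee_fin gauss3_ge0.
  rewrite integral_gauss3// -EFinM lee_fin.
  rewrite (_ : pi / _ = 4 * pi * expR v); last by rewrite expRN; field; rewrite gt_eqF// expR_gt0.
  rewrite sqrtrM ?mulr_ge0 ?pi_ge0// sqrt_expR exprMn -expRM_natl mulrCA -expRD.
  apply: (@le_trans _ _ (Num.sqrt (4 * pi) ^+ 3 * expR (- (`|v| / 2)))).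
    rewrite ler_wpM2l ?exprn_ge0 ?sqrtr_ge0// ler_expR ler0_norm//.
    have : v * (alpha - 1) <= 0 by rewrite mulr_le0_ge0// subr_ge0 ltW.
    by lra.
  rewrite (le_trans (ler_wpM2l _ (expR_norm_cauchy v))) ?exprn_ge0 ?sqrtr_ge0// /heatC.
  rewrite [leRHS](_ : _ = Num.sqrt (4 * pi) ^+ 3 * (8 * cauchy v) + pi ^+ 3 * (8 * cauchy v)); last by ring.
  by rewrite lerDl !mulr_ge0 ?cauchy_ge0 ?exprn_ge0 ?pi_ge0.
apply: (@le_trans _ _ (\int[vol]_x ((expR (v * ((alpha - 3) / 2)))%:E * (wgt (x - a))%:E))%E).
  have mw : measurable_fun setT (fun x : R3 R => wgt (x - a)).
    by apply: (measurableT_comp measurable_wgt); exact: measurable_funB3.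
  apply: ge0_le_integral => //.
  - by move=> x _; rewrite lee_fin mulr_ge0 ?heat_ge0 ?wgt_ge0.
  - by apply/measurable_EFinP; apply: measurable_funM (measurable_heat v) mw.
  - by apply/measurable_EFinP; exact: measurable_funM.
  - move=> x _; rewrite -EFinM lee_fin /heat ler_wpM2r ?wgt_ge0// ler_piMr ?expR_ge0//.
    by rewrite gauss3_le1// ltW.
rewrite ge0_integralZl//; last 2 first.
- apply/measurable_EFinP; apply: (measurableT_comp measurable_wgt); exact: measurable_funB3.
- by move=> x _; rewrite lee_fin wgt_ge0.
apply: (@le_trans _ _ ((expR (- (`|v| / 2)))%:E * (pi ^+ 3)%:E)%E).
  apply: lee_pmul; rewrite ?lee_fin ?expR_ge0//; last exact: integral_wgt_shift.
    by apply: integral_ge0 => x _; rewrite lee_fin wgt_ge0.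
  rewrite ler_expR gtr0_norm//.
  have : v * (alpha - 2) <= 0 by rewrite mulr_ge0_le0 ?subr_le0// ltW.
  by lra.
rewrite -EFinM lee_fin mulrC (le_trans (ler_wpM2l _ (expR_norm_cauchy v))) ?exprn_ge0 ?pi_ge0//.
rewrite /heatC.
rewrite [leRHS](_ : _ = Num.sqrt (4 * pi) ^+ 3 * (8 * cauchy v) + pi ^+ 3 * (8 * cauchy v)); last by ring.
by rewrite lerDr !mulr_ge0 ?cauchy_ge0 ?exprn_ge0 ?sqrtr_ge0.
Qed.

(** After the substitution of [expR v] for the variable of integration, the integral of this
    function is Euler's Gamma at [alpha / 2]. *)
Definition riesz_fun v : R := expR (v * (alpha / 2) - expR v).
Definition riesz_cst : R := Rintegral leb setT riesz_fun.

Lemma riesz_fun_le v : riesz_fun v <= 8 * cauchy v.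
Proof.
apply: (le_trans _ (expR_norm_cauchy v)); rewrite ler_expR.
have [v0|v0] := leP v 0.
  have : v * (alpha - 1) <= 0 by rewrite mulr_le0_ge0// subr_ge0 ltW.
  by rewrite ler0_norm//; have := expR_ge0 v; lra.
have : v * (alpha - 2) <= 0 by rewrite mulr_ge0_le0 ?subr_le0// ltW.
rewrite gtr0_norm//.
have h := expR_ge1Dx (v / 2).
have : (1 + v / 2) ^+ 2 <= expR (v / 2) ^+ 2 by rewrite ler_pXn2r ?nnegrE ?expR_ge0//; lra.
rewrite -expRM_natl (_ : 2%:R * (v / 2) = v); last by field.
by have := sqr_ge0 (v / 2 - 1); lra.
Qed.

Lemma measurable_riesz_fun : measurable_fun setT riesz_fun.
Proof.
have me := continuous_measurable_fun (@continuous_expR R).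
apply: (measurableT_comp me); apply: measurable_funB; last exact: me.
exact: measurable_funM.
Qed.

Lemma integrable_riesz_fun : leb.-integrable setT (EFin \o riesz_fun).
Proof.
apply: (@integrable_bound _ _ _ leb _ (fun v => 8 * cauchy v)).
- exact: measurable_riesz_fun.
- exact: (integrableZl measurableT _ integrable_cauchy).
- by move=> v; rewrite ger0_norm ?expR_ge0// riesz_fun_le.
Qed.

Lemma riesz_cst_gt0 : 0 < riesz_cst.
Proof.
rewrite -lte_fin /riesz_cst /Rintegral fineK; last exact: (integrable_fin_num _ integrable_riesz_fun).
have m01 : measurable (`[0, 1]%classic : set (measurableTypeR R)) by exact: measurable_itv.
have ms : measurable_fun setT (EFin \o riesz_fun).
  by apply/measurable_EFinP; exact: measurable_riesz_fun.
have h1 : (\int[leb]_(v in `[0%R, 1%R]) (riesz_fun v)%:E <= \int[leb]_v (riesz_fun v)%:E)%E.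
  by apply: ge0_subset_integral => // v _; rewrite lee_fin expR_ge0.
apply: (lt_le_trans _ h1).
have h2 : (\int[leb]_(v in `[0%R, 1%R]) (expR (- expR 1))%:E <= \int[leb]_(v in `[0%R, 1%R]) (riesz_fun v)%:E)%E.
  apply: ge0_le_integral => //.
  - exact: (measurable_funS measurableT (@subsetT _ _) ms).
  - move=> v /=; rewrite in_itv/= => /andP[v0 v1]; rewrite lee_fin ler_expR.
    have : expR v <= expR 1 by rewrite ler_expR.
    have : 0 <= v * alpha by rewrite mulr_ge0// (le_trans _ (ltW alpha1)).
    by lra.
apply: (lt_le_trans _ h2).
rewrite integral_cst//.
have m1 : lebesgue_measure (`[0, 1]%classic : set R) = 1%E.
  by rewrite lebesgue_measure_itv/= lte_fin ltr01 oppr0 adde0.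
by rewrite [X in (_ * X)%E](_ : _ = 1%E)// mule1 lte_fin expR_gt0.
Qed.

(** Translating [v] by [w = 2 ln t] absorbs [t ^+ 2] into [expR v] and leaves the power
    [t ^ (- alpha)] outside a translation-invariant integral. *)
Lemma riesz_formula t : 0 < t ->
  (\int[leb]_v (expR (v * (alpha / 2) - expR v * t ^+ 2))%:E = (riesz_cst * t `^ (- alpha))%:E)%E.
Proof.
move=> t0; pose w := 2 * ln t.
have e v : expR (v * (alpha / 2) - expR v * t ^+ 2) = t `^ (- alpha) * riesz_fun (v + w).
  rewrite /powR gt_eqF// /riesz_fun -expRD; congr expR.
  have -> : expR (v + w) = expR v * t ^+ 2.
    by rewrite expRD /w expRM_natl lnK.
  by rewrite /w; field.
under eq_integral do rewrite e EFinM.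
have mr : measurable_fun setT (fun v => (riesz_fun (v + w))%:E).
  apply/measurable_EFinP; apply: (measurableT_comp measurable_riesz_fun).
  exact: measurable_funD.
rewrite ge0_integralZl//; last 2 first.
- by move=> v _; rewrite lee_fin expR_ge0.
- by rewrite lee_fin powR_ge0.
have [_ p] := preserving_add w.
rewrite (p (EFin \o riesz_fun)); last 2 first.
- by apply/measurable_EFinP; exact: measurable_riesz_fun.
- by move=> v; rewrite lee_fin expR_ge0.
rewrite mulrC EFinM /riesz_cst /Rintegral fineK//; last exact: (integrable_fin_num _ integrable_riesz_fun).
Qed.

End Kernel.

(** * Weighted convolution estimates and the convolution theorem *)

Section Convolution.
Context {R : realType}.
Notation leb := (@lebesgue_measure R).
Implicit Types (x y a : R3 R) (q v t beta : R) (F G P Q : R3 R -> R[i]).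

(* [wgt] alone makes the convolution of two weights integrable; the exponential
   factor is submultiplicative, so it passes through convolutions unchanged. *)
Definition vwgt beta x : R := expR (- (beta * `|x|)) * wgt x.

Lemma vwgt_ge0 beta x : 0 <= vwgt beta x.
Proof. by rewrite mulr_ge0 ?expR_ge0 ?wgt_ge0. Qed.

Lemma vwgtN beta x : vwgt beta (- x) = vwgt beta x.
Proof. by rewrite /vwgt wgtN normrN. Qed.

Lemma vwgt_le beta x : 0 <= beta -> vwgt beta x <= wgt x.
Proof.
by move=> b0; rewrite ler_piMl ?wgt_ge0// -expR0 ler_expR oppr_le0 mulr_ge0.
Qed.

Lemma measurable_vwgt beta : measurable_fun setT (vwgt beta).
Proof.
apply: measurable_funM measurable_wgt.
apply: (measurableT_comp (continuous_measurable_fun (@continuous_expR R))).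
apply: measurableT_comp => //.
exact: (measurable_funM (measurable_cst _) measurable_norm3).
Qed.

Lemma integrable_wgt : vol.-integrable setT (EFin \o @wgt R).
Proof.
apply/integrableP; split; first by apply/measurable_EFinP; exact: measurable_wgt.
under eq_integral do rewrite /= ger0_norm ?wgt_ge0//.
have := integral_wgt_shift (0 : R3 R); under [X in (X <= _)%E -> _]eq_integral do rewrite subr0.
by move=> h; rewrite (le_lt_trans h)// ltry.
Qed.

Lemma integrable_vwgt beta : 0 <= beta -> vol.-integrable setT (EFin \o vwgt beta).
Proof.
move=> b0; apply: (integrable_bound _ integrable_wgt); first exact: measurable_vwgt.
by move=> x; rewrite ger0_norm ?vwgt_ge0// vwgt_le.
Qed.

Lemma vwgt_mul beta x y : 0 <= beta ->
  vwgt beta x * vwgt beta y <= 64 * vwgt beta (x + y) * (wgt x + wgt y).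
Proof.
move=> b0; rewrite /vwgt mulrACA -expRD.
rewrite [leRHS](_ : _ = expR (- (beta * `|x + y|)) * (64 * wgt (x + y) * (wgt x + wgt y))); last by ring.
rewrite ler_pM ?expR_ge0 ?mulr_ge0 ?wgt_ge0 ?wgt_mul// ler_expR.
by rewrite -opprD lerN2 -mulrDr ler_wpM2l// ler_normD.
Qed.

Definition conv P Q x : R[i] := cintegral vol setT (fun y => P y * Q (x - y)).
(** Complex conjugation seen on the Fourier side: the conjugate of the inverse transform of [F] is
    the inverse transform of [tilde F]. *)
Definition tilde F x : R[i] := (F (- x))^*.

Lemma cmeasurable_comp d d' (T : measurableType d) (T' : measurableType d') (g : T -> T') (f : T' -> R[i]) :
  cmeasurable f -> measurable_fun setT g -> cmeasurable (fun s => f (g s)).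
Proof. by move=> [f1 f2] mg; split; [exact: (measurableT_comp f1 mg)|exact: (measurableT_comp f2 mg)]. Qed.

Lemma measurable_opp3 : measurable_fun setT (fun x : R3 R => - x).
Proof. by case: (@preserving_reflection R). Qed.

Lemma cmeasurable_tilde F : cmeasurable F -> cmeasurable (tilde F).
Proof.
move=> mF; apply: cmeasurable_conj.
exact: (cmeasurable_comp mF measurable_opp3).
Qed.

(** The extra parameter, later the time, travels along because time integrals require joint
    measurability in time and frequency. *)
Lemma cmeasurable_conv2 d (T : measurableType d) (P Q : T * R3 R -> R[i]) :
  cmeasurable P -> cmeasurable Q ->
  cmeasurable (fun z : T * R3 R => conv (fun y => P (z.1, y)) (fun y => Q (z.1, y)) z.2).
Proof.
move=> mP mQ.
apply: (@cmeasurable_cintegral _ _ (T * R3 R)%type (R3 R) R vol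
  (fun w : T * R3 R * R3 R => P (w.1.1, w.2) * Q (w.1.1, w.1.2 - w.2))).
have m11 : measurable_fun setT (fun w : T * R3 R * R3 R => w.1.1).
  exact: (measurableT_comp measurable_fst measurable_fst).
have m12 : measurable_fun setT (fun w : T * R3 R * R3 R => w.1.2).
  exact: (measurableT_comp measurable_snd measurable_fst).
have m2 : measurable_fun setT (fun w : T * R3 R * R3 R => w.2) by exact: measurable_snd.
apply: cmeasurableM.
  exact: (cmeasurable_comp mP (measurable_fun_pair m11 m2)).
exact: (cmeasurable_comp mQ (measurable_fun_pair m11 (measurable_funB3 m12 m2))).
Qed.

Lemma cmeasurable_conv P Q : cmeasurable P -> cmeasurable Q -> cmeasurable (conv P Q).
Proof.
move=> mP mQ.
have := @cmeasurable_conv2 _ (R3 R) (fun z => P z.2) (fun z => Q z.2)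
  (cmeasurable_comp mP measurable_snd) (cmeasurable_comp mQ measurable_snd).
exact: (@cmeasurable_pairl _ _ (R3 R) (R3 R) R 0).
Qed.

(** [2 * 64 * 2]: the loss in [normc_cintegral], the constant of [wgt_mul], and one kernel integral
    for each of the two centres. *)
Definition convC : R := 256.
Lemma convC_ge0 : 0 <= convC. Proof. exact: ler0n. Qed.

Section ConvBound.
Variables (C beta M1 M2 : R) (k : R3 R -> R) (P Q : R3 R -> R[i]).
Hypotheses (kb : kernel_bound C k) (b0 : 0 <= beta) (M10 : 0 <= M1) (M20 : 0 <= M2).
Hypotheses (mP : cmeasurable P) (mQ : cmeasurable Q).
Hypothesis leP : forall x, normc (P x) <= M1 * (k x * vwgt beta x).
Hypothesis leQ : forall x, normc (Q x) <= M2 * vwgt beta x.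

Let D x y := 64 * M1 * M2 * vwgt beta x * (k y * wgt (y - 0) + k y * wgt (y - x)).

Let leD x y : normc (P y * Q (x - y)) <= D x y.
Proof.
have [mk k0 _] := kb.
rewrite normcM (le_trans (ler_pM (normc_ge0 _) (normc_ge0 _) (leP y) (leQ (x - y))))//.
have := vwgt_mul y (x - y) b0; rewrite (addrC y) subrK => h.
rewrite /D -(wgtN (y - x)) opprB subr0 [leLHS](_ : _ = M1 * M2 * k y * (vwgt beta y * vwgt beta (x - y))); last by ring.
rewrite (le_trans (ler_wpM2l _ h)) ?mulr_ge0//.
by rewrite [leRHS](_ : _ = M1 * M2 * k y * (64 * vwgt beta x * (wgt y + wgt (x - y)))); last by ring.
Qed.

Let intk a : vol.-integrable setT (fun y => (k y * wgt (y - a))%:E).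
Proof.
have [mk k0 lek] := kb.
apply/integrableP; split.
  apply/measurable_EFinP; apply: measurable_funM mk _.
  by apply: (measurableT_comp measurable_wgt); exact: measurable_funB3.
under eq_integral do rewrite /= ger0_norm ?mulr_ge0 ?wgt_ge0//.
by rewrite (le_lt_trans (lek a))// ltry.
Qed.

Let intk_le a : Rintegral vol setT (fun y => k y * wgt (y - a)) <= C.
Proof.
have [mk k0 lek] := kb.
by rewrite -lee_fin /Rintegral fineK//; exact: (integrable_fin_num _ (intk a)).
Qed.

Let intD x : vol.-integrable setT (EFin \o D x).
Proof.
have := integrableD measurableT (intk 0) (intk x).
by move=> /(integrableZl measurableT (64 * M1 * M2 * vwgt beta x)).
Qed.

Lemma cintegrable_conv_integrand x : cintegrable vol setT (fun y => P y * Q (x - y)).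
Proof.
apply: (cintegrable_bound _ (intD x) (leD x)).
apply: cmeasurableM => //; apply: (cmeasurable_comp mQ).
exact: measurable_funB3.
Qed.

(** Only one factor carries the possibly singular [k]. The product of the two weights releases the
    weight at [x], and what is left under the integral is [k] against polynomial weights centred at
    [0] and at [x], each bounded by [C]. *)
Lemma normc_conv x : normc (conv P Q x) <= convC * C * M1 * M2 * vwgt beta x.
Proof.
apply: (le_trans (normc_cintegral (cintegrable_conv_integrand x) (intD x) (leD x))).
have i0 := intk 0; have ix := intk x.
have iD := integrableD measurableT i0 ix.
have -> : Rintegral vol setT (D x) = 64 * M1 * M2 * vwgt beta x *
    (Rintegral vol setT (fun y => k y * wgt (y - 0)) + Rintegral vol setT (fun y => k y * wgt (y - x))).
  by rewrite -RintegralD// -RintegralZl.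
rewrite [leRHS](_ : _ = 2 * (64 * M1 * M2 * vwgt beta x * (C + C))); last by rewrite /convC; ring.
apply: ler_wpM2l => //; apply: ler_wpM2l; first by rewrite mulr_ge0 ?vwgt_ge0 ?mulr_ge0.
by rewrite lerD.
Qed.

End ConvBound.

Section IntegrableConv.
Variables P Q : R3 R -> R[i].
Hypotheses (iP : cintegrable vol setT P) (iQ : cintegrable vol setT Q).

Let mP : cmeasurable P. Proof. exact: (cintegrable_cmeasurable iP). Qed.
Let mQ : cmeasurable Q. Proof. exact: (cintegrable_cmeasurable iQ). Qed.

Lemma cintegrable_prod_shift : cintegrable (vol \x vol)%E setT
  (fun z : R3 R * R3 R => P z.1 * Q (z.2 - z.1)).
Proof.
have mPQ : cmeasurable (fun z : R3 R * R3 R => P z.1 * Q (z.2 - z.1)).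
  apply: cmeasurableM; first exact: (cmeasurable_comp mP measurable_fst).
  exact: (cmeasurable_comp mQ (measurable_funB3 measurable_snd measurable_fst)).
have nQ := cintegrable_normc iQ.
apply: (@cintegrable_prod _ _ _ _ _ vol vol _ (fun z => normc (P z.1 * Q (z.2 - z.1)))
  (fun x => normc (P x) * Rintegral vol setT (fun y => normc (Q y)))) => //.
- exact: measurable_normc.
- rewrite (_ : _ \o _ = fun x => ((normc (P x))%:E * (Rintegral vol setT (fun y => normc (Q y)))%:E)%E)//.
  by apply: integrableZr => //; exact: cintegrable_normc.
- move=> x; under eq_integral do rewrite /= normcM EFinM.
  rewrite ge0_integralZl//; last 3 first.
  + apply/measurable_EFinP; apply: (measurableT_comp (measurable_normc mQ)).
    exact: measurable_funB3.
  + by move=> y _; rewrite lee_fin normc_ge0.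
  + by rewrite lee_fin normc_ge0.
  have [_ p] := preserving_translation (- x).
  rewrite (p (fun y => (normc (Q y))%:E)); last 2 first.
  + by apply/measurable_EFinP; exact: measurable_normc.
  + by move=> y; rewrite lee_fin normc_ge0.
  by rewrite EFinM /Rintegral fineK//; exact: (integrable_fin_num _ nQ).
Qed.

(** Translating the integral of [Q] by [y] produces the missing phase [cis (dot x y)], and Fubini
    exchanges the two integrals. Integrability of the inner integrand at every [z] allows the phase
    to be factored out pointwise. *)
Lemma cintegral_conv_cis x : (forall z, cintegrable vol setT (fun y => P y * Q (z - y))) ->
  cintegral vol setT (fun y => P y * cis (dot x y)) * cintegral vol setT (fun y => Q y * cis (dot x y)) =
  cintegral vol setT (fun y => conv P Q y * cis (dot x y)).
Proof.
move=> iz.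
have mcis : cmeasurable (fun y => cis (dot x y)).
  by apply: cmeasurable_cis; exact: measurable_dot.
have iPc : cintegrable vol setT (fun y => P y * cis (dot x y)).
  apply: (cintegrable_bound _ (cintegrable_normc iP)); first exact: cmeasurableM.
  by move=> y; rewrite normcM normc_cis mulr1.
have iQc : cintegrable vol setT (fun y => Q y * cis (dot x y)).
  apply: (cintegrable_bound _ (cintegrable_normc iQ)); first exact: cmeasurableM.
  by move=> y; rewrite normcM normc_cis mulr1.
have iPQ : cintegrable (vol \x vol)%E setT (fun z : R3 R * R3 R => P z.1 * Q (z.2 - z.1) * cis (dot x z.2)).
  apply: (cintegrable_bound _ (cintegrable_normc cintegrable_prod_shift)).
    apply: cmeasurableM; first exact: (cintegrable_cmeasurable cintegrable_prod_shift).
    exact: (cmeasurable_comp mcis measurable_snd).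
  by move=> z; rewrite normcM normc_cis mulr1.
rewrite -cintegralZr//.
transitivity (cintegral vol setT (fun y => cintegral vol setT (fun z => P y * Q (z - y) * cis (dot x z)))).
  apply: eq_cintegral => y.
  rewrite -(preserving_cintegral (preserving_translation (- y)) (cintegrable_cmeasurable iQc)) -cintegralZ.
    apply: eq_cintegral => z; rewrite dotDr dotNr cisD.
    have : cis (dot x y) * cis (- dot x y) = 1 by rewrite -cisD subrr cis0.
    move=> e; transitivity (P y * Q (z - y) * cis (dot x z) * (cis (dot x y) * cis (- dot x y))).
      by ring.
    by rewrite e mulr1.
  exact: (preserving_cintegrable (preserving_translation (- y)) iQc).
have := cfubini iPQ => /= ->; apply: eq_cintegral => z.
exact: cintegralZr.
Qed.

End IntegrableConv.

End Convolution.

Local Arguments normc : simpl never.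

(** * The Hartree nonlinearity on the Fourier side *)

Section InverseFourier.
Context {R : realType}.
Notation leb := (@lebesgue_measure R).
Implicit Types (x y a : R3 R) (q v t beta : R) (F G P Q : R3 R -> R[i]).

Definition fourier_cst : R := (2 * pi) `^ (- (3 / 2)).

Definition ift F x : R[i] :=
  fourier_cst%:C * cintegral vol setT (fun xi => F xi * cis (dot x xi)).

Lemma fourier_cst_gt0 : 0 < fourier_cst.
Proof. by rewrite powR_gt0// mulr_gt0// pi_gt0. Qed.

Lemma inv_fourier_testE (eta : test R) xi :
  inv_fourier_test eta xi =
  fourier_cst%:C * cintegral vol setT (fun x => (eta x)%:C * cis (dot x xi)).
Proof.
rewrite /inv_fourier_test leb3E; congr (_ * _); apply: eq_cintegral => x.
by apply: complex_eqP; rewrite /= ?mul0r ?subr0 ?addr0 mulrC.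
Qed.

Lemma cmeasurable_cis_dot x : cmeasurable (fun y => cis (dot x y)).
Proof. by apply: cmeasurable_cis; exact: measurable_dot. Qed.

Lemma cintegrable_cis F x : cintegrable vol setT F ->
  cintegrable vol setT (fun y => F y * cis (dot x y)).
Proof.
move=> iF; apply: (cintegrable_bound _ (cintegrable_normc iF)).
  by apply: cmeasurableM; [exact: (cintegrable_cmeasurable iF)|exact: cmeasurable_cis_dot].
by move=> y; rewrite normcM normc_cis mulr1.
Qed.

Lemma cintegrable_tilde F : cintegrable vol setT F -> cintegrable vol setT (tilde F).
Proof.
move=> iF; apply: cintegrable_conj.
exact: (preserving_cintegrable preserving_reflection iF).
Qed.

Lemma cintegral_conj_cis F x : cintegrable vol setT F ->
  (cintegral vol setT (fun y => F y * cis (dot x y)))^* =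
  cintegral vol setT (fun y => tilde F y * cis (dot x y)).
Proof.
move=> iF; rewrite -cintegral_conj; last exact: cintegrable_cis.
have m := cintegrable_cmeasurable (cintegrable_cis x (cintegrable_tilde iF)).
rewrite -(preserving_cintegral preserving_reflection m); apply: eq_cintegral => y.
by rewrite /tilde opprK rmorphM/= -cisN dotNr.
Qed.

Lemma cmeasurable_ift2 d (T : measurableType d) (F : T * R3 R -> R[i]) : cmeasurable F ->
  cmeasurable (fun z : T * R3 R => ift (fun xi => F (z.1, xi)) z.2).
Proof.
move=> mF; apply: cmeasurableM; first exact: cmeasurable_cst.
apply: (@cmeasurable_cintegral _ _ (T * R3 R)%type (R3 R) R vol
  (fun w : T * R3 R * R3 R => F (w.1.1, w.2) * cis (dot w.1.2 w.2))).
have m11 : measurable_fun setT (fun w : T * R3 R * R3 R => w.1.1).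
  exact: (measurableT_comp measurable_fst measurable_fst).
have m12 : measurable_fun setT (fun w : T * R3 R * R3 R => w.1.2).
  exact: (measurableT_comp measurable_snd measurable_fst).
have m2 : measurable_fun setT (fun w : T * R3 R * R3 R => w.2) by exact: measurable_snd.
apply: cmeasurableM; first exact: (cmeasurable_comp mF (measurable_fun_pair m11 m2)).
exact: (cmeasurable_cis (measurable_dot m12 m2)).
Qed.

Lemma cmeasurable_ift F : cmeasurable F -> cmeasurable (ift F).
Proof.
move=> mF.
have := @cmeasurable_ift2 _ (R3 R) (fun z => F z.2) (cmeasurable_comp mF measurable_snd).
exact: (@cmeasurable_pairl _ _ (R3 R) (R3 R) R 0).
Qed.

Definition ift_bound F : R := 2 * fourier_cst * Rintegral vol setT (fun y => normc (F y)).

Lemma normc_ift F x : cintegrable vol setT F -> normc (ift F x) <= ift_bound F.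
Proof.
move=> iF; rewrite normcM normc_real ger0_norm ?(ltW fourier_cst_gt0)//.
rewrite [leRHS](_ : _ = fourier_cst * (2 * Rintegral vol setT (fun y => normc (F y)))); last first.
  by rewrite /ift_bound; ring.
rewrite ler_wpM2l ?(ltW fourier_cst_gt0)//.
apply: (normc_cintegral (cintegrable_cis x iF) (cintegrable_normc iF)) => y.
by rewrite normcM normc_cis mulr1.
Qed.

(** Fubini. It moves the pairing of a function with a test function to the frequency side, where
    [has_fourier] is formulated. *)
Lemma ift_pairing F G : cintegrable vol setT F -> cintegrable vol setT G ->
  cintegral vol setT (fun x => ift F x * G x) =
  cintegral vol setT (fun xi => F xi *
    (fourier_cst%:C * cintegral vol setT (fun x => G x * cis (dot x xi)))).
Proof.
move=> iF iG.
have mF := cintegrable_cmeasurable iF; have mG := cintegrable_cmeasurable iG.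
have i2 : cintegrable (vol \x vol)%E setT
    (fun z : R3 R * R3 R => fourier_cst%:C * (F z.2 * G z.1 * cis (dot z.1 z.2))).
  apply: cintegrableZ.
  apply: (cintegrable_bound _ (integrable_prodM (cintegrable_normc iG) (cintegrable_normc iF))).
    apply: cmeasurableM.
      by apply: cmeasurableM; [exact: (cmeasurable_comp mF measurable_snd)|exact: (cmeasurable_comp mG measurable_fst)].
    exact: (cmeasurable_cis (measurable_dot measurable_fst measurable_snd)).
  by move=> z; rewrite !normcM normc_cis mulr1 mulrC.
transitivity (cintegral vol setT (fun x => cintegral vol setT
    (fun xi => fourier_cst%:C * (F xi * G x * cis (dot x xi))))).
  apply: eq_cintegral => x; rewrite /ift -mulrA -[in LHS]cintegralZr; last exact: cintegrable_cis.
  rewrite -cintegralZ; last first.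
    rewrite (_ : (fun y => _) = fun y => G x * (F y * cis (dot x y))); last by apply/funext => y; rewrite mulrC.
    by apply: cintegrableZ; exact: cintegrable_cis.
  by apply: eq_cintegral => xi; ring.
have := cfubini i2 => /= ->; apply: eq_cintegral => xi.
have iGc : cintegrable vol setT (fun x => G x * cis (dot x xi)).
  by under eq_fun do rewrite dotC; exact: cintegrable_cis.
rewrite -cintegralZ// -cintegralZ; last exact: cintegrableZ.
by apply: eq_cintegral => x; ring.
Qed.

Lemma realCM (r s : R) : (r * s)%:C = r%:C * s%:C.
Proof. exact: rmorphM. Qed.

Lemma conjcM (z w : R[i]) : (z * w)^* = z^* * w^*.
Proof. exact: rmorphM. Qed.

Lemma mul_conj_normc (z : R[i]) : z * z^* = (normc z ^+ 2)%:C.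
Proof.
case: z => a b; apply: complex_eqP => /=; last by rewrite mulrN mulrC addNr.
by rewrite sqr_sqrtr ?addr_ge0 ?sqr_ge0//; ring.
Qed.

Lemma cintegrable_vwgt F M beta : 0 <= beta -> cmeasurable F ->
  (forall x, normc (F x) <= M * vwgt beta x) -> cintegrable vol setT F.
Proof.
move=> b0 mF le; apply: (cintegrable_bound mF _ le).
exact: (integrableZl measurableT M (integrable_vwgt b0)).
Qed.

Lemma normc_tilde F M beta : (forall x, normc (F x) <= M * vwgt beta x) ->
  forall x, normc (tilde F x) <= M * vwgt beta x.
Proof. by move=> le x; rewrite normc_conj (le_trans (le _))// vwgtN. Qed.

(** Averaging a transform with a Gaussian damps the original by the transformed Gaussian. It serves
    twice: to compute the potential one scale at a time, and to prove that a function with vanishing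
    transform vanishes. *)
Lemma cintegral_gauss3_conv A q x : cintegrable vol setT A -> 0 < q ->
  cintegral vol setT (fun y => (gauss3 q (x - y))%:C *
    cintegral vol setT (fun h => A h * cis (dot y h))) =
  cintegral vol setT (fun h => (Num.sqrt (pi / q) ^+ 3 * gauss3 (4 * q)^-1 h)%:C *
    (A h * cis (dot x h))).
Proof.
move=> iA q0.
have mA := cintegrable_cmeasurable iA.
have gE y : gauss3 q (x - y) = gauss3 q (y - x) by rewrite -(gauss3N _ (y - x)) opprB.
have mg : cmeasurable (fun y => (gauss3 q (y - x))%:C).
  by apply: cmeasurable_real; apply: (measurableT_comp (measurable_gauss3 q)); exact: measurable_funB3.
have ig : vol.-integrable setT (fun y => (gauss3 q (y - x))%:E).
  exact: (preserving_integrable (preserving_translation (- x)) (integrable_gauss3 q0)).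
have i2 : cintegrable (vol \x vol)%E setT (fun z : R3 R * R3 R =>
    (gauss3 q (z.1 - x))%:C * (A z.2 * cis (dot z.1 z.2))).
  apply: (cintegrable_bound _ (integrable_prodM ig (cintegrable_normc iA))).
    apply: cmeasurableM; first exact: (cmeasurable_comp mg measurable_fst).
    apply: cmeasurableM; first exact: (cmeasurable_comp mA measurable_snd).
    exact: (cmeasurable_cis (measurable_dot measurable_fst measurable_snd)).
  by move=> z; rewrite !normcM normc_cis mulr1 normc_real ger0_norm// gauss3_ge0.
transitivity (cintegral vol setT (fun y => cintegral vol setT (fun h =>
   (gauss3 q (y - x))%:C * (A h * cis (dot y h))))).
  apply: eq_cintegral => y; rewrite gE cintegralZ//; exact: cintegrable_cis.
have := cfubini i2 => /= ->; apply: eq_cintegral => h.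
have icg : cintegrable vol setT (fun y => (gauss3 q y)%:C * cis (dot y h)).
  apply: (cintegrable_bound _ (integrable_gauss3 q0)).
    apply: cmeasurableM; first by apply: cmeasurable_real; exact: measurable_gauss3.
    by under eq_fun do rewrite dotC; exact: cmeasurable_cis_dot.
  by move=> y; rewrite normcM normc_cis mulr1 normc_real ger0_norm// gauss3_ge0.
rewrite -(fourier_gauss3 h q0).
rewrite -(preserving_cintegral (preserving_translation (- x)) (cintegrable_cmeasurable icg)).
rewrite -cintegralZr; last exact: (preserving_cintegrable (preserving_translation (- x)) icg).
apply: eq_cintegral => y; rewrite dotDl dotNl cisD.
have e : cis (dot x h) * cis (- dot x h) = 1 by rewrite -cisD subrr cis0.
transitivity ((gauss3 q (y - x))%:C * (A h * cis (dot y h)) * (cis (dot x h) * cis (- dot x h))).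
  by rewrite e mulr1.
by ring.
Qed.

Lemma measurable_R3_set1 x : measurable [set x].
Proof.
have ms (r : R) : measurable ([set r] : set (measurableTypeR R)) by exact: measurable_set1.
rewrite (_ : [set x] = ([set x.1.1] `*` [set x.1.2]) `*` [set x.2]).
  exact: (measurableX (measurableX (ms x.1.1) (ms x.1.2)) (ms x.2)).
by apply/seteqP; split => [y /= ->//|[[y1 y2] y3] /= [[-> ->] ->]]; case: x => -[].
Qed.

Lemma vol_set1 x : vol [set x] = 0%E.
Proof.
have ms (r : R) : measurable ([set r] : set (measurableTypeR R)) by exact: measurable_set1.
rewrite (_ : [set x] = ([set x.1.1] `*` [set x.1.2]) `*` [set x.2]).
  have := @product_measure1E _ _ _ _ R leb2 leb _ _ (measurableX (ms x.1.1) (ms x.1.2)) (ms x.2).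
  by move=> /= ->; rewrite lebesgue_measure_set1 mule0.
by apply/seteqP; split => [y /= ->//|[[y1 y2] y3] /= [[-> ->] ->]]; case: x => -[].
Qed.

Lemma fine_le (z : \bar R) : (0 <= z)%E -> ((fine z)%:E <= z)%E.
Proof. by case: z => [r| |] //= _; rewrite ?lexx ?leey. Qed.

(* Both sides vanish when [h] is not integrable. *)
Lemma ge0_RintegralZr d (T : measurableType d) (mu : {measure set T -> \bar R}) (h : T -> R) (r : R) :
  measurable_fun setT h -> (forall s, 0 <= h s) ->
  Rintegral mu setT (fun s => h s * r) = Rintegral mu setT h * r.
Proof.
move=> mh h0.
have mhE : measurable_fun setT (EFin \o h) by exact/measurable_EFinP.
have pos (c : R) : 0 <= c -> Rintegral mu setT (fun s => h s * c) = Rintegral mu setT h * c.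
  move=> c0; rewrite /Rintegral; under eq_integral do rewrite EFinM.
  rewrite ge0_integralZr//; last by move=> s _; rewrite lee_fin.
  have : (0 <= \int[mu]_s (h s)%:E)%E by apply: integral_ge0 => s _; rewrite lee_fin.
  case: (\int[mu]_s _)%E => [t| |] //= _.
  have [->|cn0] := eqVneq c 0; first by rewrite mule0 mul0r.
  by rewrite gt0_mulye ?mul0r// lte_fin lt_neqAle eq_sym cn0.
have [r0|r0] := leP 0 r; first exact: pos.
have := pos (- r); rewrite oppr_ge0 => /(_ (ltW r0)); rewrite mulrN => /(congr1 -%R).
rewrite opprK => <-; rewrite /Rintegral -fineN -integral_ge0N.
  by congr fine; apply: eq_integral => s _; rewrite mulrN EFinN oppeK.
by move=> s _; rewrite lee_fin mulr_ge0// oppr_ge0 ltW.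
Qed.

Lemma ge0_cintegralZr d (T : measurableType d) (mu : {measure set T -> \bar R}) (h : T -> R) (c : R[i]) :
  measurable_fun setT h -> (forall s, 0 <= h s) ->
  cintegral mu setT (fun s => (h s)%:C * c) = (Rintegral mu setT h)%:C * c.
Proof.
move=> mh h0; apply: complex_eqP; rewrite ?ReM ?ImM/= mul0r ?subr0 ?addr0 -ge0_RintegralZr//.
  by apply: eq_Rintegral => s _; rewrite ReM/= mul0r subr0.
by apply: eq_Rintegral => s _; rewrite ImM/= mul0r addr0.
Qed.

Lemma conj_ift F y : cintegrable vol setT F ->
  (ift F y)^* = fourier_cst%:C * cintegral vol setT (fun h => tilde F h * cis (dot y h)).
Proof.
move=> iF; rewrite /ift conjcM; congr (_ * _); first exact: conjc_real.
exact: cintegral_conj_cis.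
Qed.

(** * The Hartree potential as a multiplication by [kern] in frequency *)

Section Potential.
Variable alpha : R.
Hypotheses (alpha1 : 1 < alpha) (alpha2 : alpha <= 2).

(** The factors come from the Riesz formula, from the two unitary constants in the square of [ift],
    and from the transform of a Gaussian. *)
Definition kern_cst : R :=
  (riesz_cst alpha)^-1 * fourier_cst ^+ 2 * Num.sqrt pi ^+ 3.

Lemma kern_cst_gt0 : 0 < kern_cst.
Proof.
by rewrite !mulr_gt0// ?invr_gt0 ?riesz_cst_gt0 ?exprn_gt0 ?sqrtr_gt0 ?pi_gt0 ?fourier_cst_gt0.
Qed.

(* The Fourier transform of the Riesz kernel [|x|^(-alpha)], up to normalisation:
   a multiple of [|h|^(alpha - 3)] written as a superposition of Gaussians. *)
Definition kern (h : R3 R) : R := kern_cst * Rintegral leb setT (fun v => heat alpha v h).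

Definition kernC : R := kern_cst * (heatC * pi).

Lemma integrable_heat_wgt a :
  (leb \x vol)%E.-integrable setT (fun z : measurableTypeR R * R3 R => (heat alpha z.1 z.2 * wgt (z.2 - a))%:E).
Proof.
have mh : measurable_fun setT (fun z : measurableTypeR R * R3 R => heat alpha z.1 z.2 * wgt (z.2 - a)).
  apply: measurable_funM.
    exact: (measurableT_comp (measurable_heat2 alpha) (@measurable_swap _ _ _ _)).
  by apply: (measurableT_comp measurable_wgt); apply: measurable_funB3 => //; exact: measurable_snd.
apply: (@integrable_prod _ _ _ _ _ leb vol _ (fun v => heatC * cauchy v)) => //.
  exact: (integrableZl measurableT _ integrable_cauchy).
move=> v; have [_ h0 hb] := heat_bound alpha1 alpha2 v.
rewrite (eq_integral (fun y => (heat alpha v y * wgt (y - a))%:E)) => [|y _]; first exact: hb.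
by rewrite /= ger0_norm// mulr_ge0 ?heat_ge0 ?wgt_ge0.
Qed.

Lemma kern_bound : kernel_bound kernC kern.
Proof.
have mk : measurable_fun setT kern.
  apply: measurable_funM => //.
  exact: (@measurable_Rintegral_param _ _ (R3 R) (measurableTypeR R) R leb _ (measurable_heat2 alpha)).
have k0 x : 0 <= kern x.
  by rewrite mulr_ge0 ?(ltW kern_cst_gt0)// Rintegral_ge0// => v _; rewrite heat_ge0.
split=> // a.
pose f (z : R3 R * measurableTypeR R) := (heat alpha z.2 z.1 * wgt (z.1 - a))%:E.
have mf : measurable_fun setT f.
  apply/measurable_EFinP; apply: measurable_funM; first exact: measurable_heat2.
  by apply: (measurableT_comp measurable_wgt); apply: measurable_funB3 => //; exact: measurable_fst.
have f0 z : (0 <= f z)%E by rewrite lee_fin mulr_ge0 ?heat_ge0 ?wgt_ge0.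
have mh x : measurable_fun setT (fun v => (heat alpha v x)%:E).
  by apply/measurable_EFinP; exact: (measurable_pairl x (measurable_heat2 alpha)).
have h0 x v : setT v -> (0 <= (heat alpha v x)%:E)%E by rewrite lee_fin heat_ge0.
apply: (@le_trans _ _ (\int[vol]_x (kern_cst%:E * \int[leb]_v f (x, v)))%E).
  apply: ge0_le_integral => //.
  - by move=> x _; rewrite lee_fin mulr_ge0 ?k0 ?wgt_ge0.
  - apply/measurable_EFinP; apply: measurable_funM mk _.
    by apply: (measurableT_comp measurable_wgt); exact: measurable_funB3.
  - apply: emeasurable_funM => //; exact: (measurable_fun_fubini_tonelli_F f mf f0).
  move=> x _; rewrite /f /=.
  under eq_integral do rewrite EFinM.
  rewrite ge0_integralZr//; last 3 first.
  - exact: mh.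
  - exact: h0.
  - by rewrite lee_fin wgt_ge0.
  rewrite /kern EFinM EFinM -muleA lee_wpmul2l ?lee_fin ?(ltW kern_cst_gt0)//.
  rewrite lee_wpmul2r ?lee_fin ?wgt_ge0// /Rintegral.
  (* An inequality in place of an equality: at the origin the integral over the scales diverges and
     [kern] takes the default value there. *)
  by apply: fine_le; apply: integral_ge0 => v _; rewrite lee_fin heat_ge0.
rewrite ge0_integralZl//; last 3 first.
- exact: (measurable_fun_fubini_tonelli_F f mf f0).
- by move=> x _; exact: integral_ge0.
- by rewrite lee_fin ltW// kern_cst_gt0.
have -> : kernC%:E = (kern_cst%:E * (heatC%:E * pi%:E))%E by rewrite /kernC !EFinM.
apply: lee_wpmul2l; first by rewrite lee_fin (ltW kern_cst_gt0).
have := @fubini_tonelli _ _ _ _ R vol leb f mf f0 => ->.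
apply: (@le_trans _ _ (\int[leb]_v (heatC%:E * (cauchy v)%:E))%E).
  apply: ge0_le_integral => //.
  - by move=> v _; apply: integral_ge0.
  - exact: (measurable_fun_fubini_tonelli_G f mf f0).
  - apply: measurable_funeM; apply/measurable_EFinP.
    exact: (continuous_measurable_fun (@cauchy_continuous R)).
  - by move=> v _; have [_ _] := heat_bound alpha1 alpha2 v; rewrite -EFinM; exact.
rewrite ge0_integralZl//.
- by rewrite integral_cauchy.
- by apply/measurable_EFinP; exact: (continuous_measurable_fun (@cauchy_continuous R)).
- by move=> v _; rewrite lee_fin cauchy_ge0.
- by rewrite lee_fin heatC_ge0.
Qed.

Variables (beta M : R) (F : R3 R -> R[i]).
Hypotheses (b0 : 0 <= beta) (M0 : 0 <= M) (mF : cmeasurable F).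
Hypothesis leF : forall x, normc (F x) <= M * vwgt beta x.

(** The autocorrelation, which up to the factor [fourier_cst ^+ 2] is what represents the squared
    modulus of [ift F] as a Fourier integral. *)
Definition corr F := conv F (tilde F).
Definition nonlin F := conv (fun h => (kern h)%:C * corr F h) F.

Let iF : cintegrable vol setT F. Proof. exact: (cintegrable_vwgt b0 mF leF). Qed.

Let leF1 x : normc (F x) <= M * (1 * vwgt beta x). Proof. by rewrite mul1r. Qed.

Let mT := cmeasurable_tilde mF.
Let leT := normc_tilde leF.

Lemma cmeasurable_corr : cmeasurable (corr F).
Proof. exact: cmeasurable_conv. Qed.

Lemma normc_corr x : normc (corr F x) <= convC * pi ^+ 3 * M * M * vwgt beta x.
Proof. exact: (normc_conv kernel_bound1 b0 M0 M0 mF mT leF1 leT). Qed.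

Let M2 := convC * pi ^+ 3 * M * M.
Let M20 : 0 <= M2. Proof. by rewrite /M2 mulr_ge0 ?mulr_ge0 ?exprn_ge0 ?pi_ge0 ?convC_ge0. Qed.

Let iA : cintegrable vol setT (corr F).
Proof. exact: (cintegrable_vwgt b0 cmeasurable_corr normc_corr). Qed.

Let mk : cmeasurable (fun h => (kern h)%:C).
Proof. by have [mk _ _] := kern_bound; exact: cmeasurable_real. Qed.

Let mkA : cmeasurable (fun h => (kern h)%:C * corr F h).
Proof. by apply: cmeasurableM => //; exact: cmeasurable_corr. Qed.

Let lekA x : normc ((kern x)%:C * corr F x) <= M2 * (kern x * vwgt beta x).
Proof.
have [_ k0 _] := kern_bound.
rewrite normcM normc_real ger0_norm// mulrCA ler_wpM2l//; exact: normc_corr.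
Qed.

Let ikA : cintegrable vol setT (fun h => (kern h)%:C * corr F h).
Proof.
have [mk' k0 kb] := kern_bound.
apply: (@cintegrable_bound _ _ _ vol _ (fun x => M2 * (kern x * wgt (x - 0)))) => //.
  have i0 : vol.-integrable setT (fun x => (kern x * wgt (x - 0))%:E); last first.
    exact: (integrableZl measurableT M2 i0).
  apply/integrableP; split.
    apply/measurable_EFinP; apply: measurable_funM mk' _.
    by apply: (measurableT_comp measurable_wgt); exact: measurable_funB3.
  rewrite (eq_integral (fun x => (kern x * wgt (x - 0))%:E)) => [|x _].
    by rewrite (le_lt_trans (kb 0))// ltry.
  by rewrite /= ger0_norm// mulr_ge0 ?wgt_ge0.
move=> x; rewrite (le_trans (lekA x))// subr0 ler_wpM2l// ler_wpM2l ?vwgt_le//.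
Qed.

Lemma cmeasurable_nonlin : cmeasurable (nonlin F).
Proof. exact: cmeasurable_conv. Qed.

Lemma normc_nonlin x : normc (nonlin F x) <= convC * kernC * M2 * M * vwgt beta x.
Proof. exact: (normc_conv kern_bound b0 M20 M0 mkA mF lekA leF). Qed.

Lemma sqr_normc_ift y : (normc (ift F y) ^+ 2)%:C =
  (fourier_cst ^+ 2)%:C * cintegral vol setT (fun h => corr F h * cis (dot y h)).
Proof.
rewrite -mul_conj_normc conj_ift// /ift.
rewrite mulrACA cintegral_conv_cis//.
- by rewrite -rmorphM.
- exact: cintegrable_tilde.
- move=> z; exact: (cintegrable_conv_integrand kernel_bound1 b0 M0 M0 mF mT leF1 leT).
Qed.

(** The Riesz formula writes the potential as a double integral over [y] and the scale [v]. For a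
    fixed scale [cintegral_gauss3_conv] evaluates the integral over [y]; integrating over the scales
    then assembles [kern]. The real [V] records that the potential is finite at every point. *)
Lemma potential_ift x : exists2 V : R, potential alpha (ift F) x = V%:E &
  V%:C = cintegral vol setT (fun h => (kern h)%:C * corr F h * cis (dot x h)).
Proof.
pose f := ift F; pose A := corr F.
have mf : cmeasurable f by exact: cmeasurable_ift.
have mnf : measurable_fun setT (fun y => normc (f y)) by exact: measurable_normc.
pose g := (riesz_cst alpha)^-1.
have g0 : 0 < g by rewrite invr_gt0 riesz_cst_gt0.
pose U (z : R3 R * measurableTypeR R) := g * expR (z.2 * (alpha / 2)) * gauss3 (expR z.2) (x - z.1) * normc (f z.1) ^+ 2.
have UE y v : U (y, v) = g * expR (v * (alpha / 2)) * gauss3 (expR v) (x - y) * normc (f y) ^+ 2 by [].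
have U0 z : 0 <= U z.
  by rewrite !mulr_ge0 ?(ltW g0) ?expR_ge0 ?gauss3_ge0 ?exprn_ge0 ?normc_ge0.
have mU : measurable_fun setT U.
  have me := continuous_measurable_fun (@continuous_expR R).
  apply: measurable_funM; last first.
    by apply: measurable_funX; exact: (measurableT_comp mnf measurable_fst).
  apply: measurable_funM.
    apply: measurable_funM => //; apply: (measurableT_comp me).
    exact: (measurable_funM measurable_snd (measurable_cst _)).
  under eq_fun do rewrite gauss3E.
  apply: (measurableT_comp me); apply: measurableT_comp => //; apply: measurable_funM.
    exact: (measurableT_comp me measurable_snd).
  have mB : measurable_fun setT (fun z : R3 R * measurableTypeR R => x - z.1).
    by apply: measurable_funB3 => //; exact: measurable_fst.
  exact: measurable_dot.
have mUE : measurable_fun setT (fun z => (U z)%:E) by exact/measurable_EFinP.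
have UE0 z : (0 <= (U z)%:E)%E by rewrite lee_fin.
have pot : potential alpha f x = (\int[vol]_y \int[leb]_v (U (y, v))%:E)%E.
  rewrite /potential leb3E; apply: ae_eq_integral => //.
  - apply/measurable_EFinP; apply: measurable_funM; last exact: measurable_funX.
    apply: (measurableT_comp (measurable_powR (- alpha))).
    apply: (measurableT_comp measurable_eucl); exact: measurable_funB3.
  - exact: (measurable_fun_fubini_tonelli_F _ mUE UE0).
  (* The Riesz formula needs a positive distance; the single point [y = x] has measure zero. *)
  exists [set x]; split; [exact: measurable_R3_set1|exact: vol_set1|].
  move=> y nE; have [//|/eqP yx] := pselect (y = x); exfalso; apply: nE => _.
  have t0 : 0 < eucl (x - y).
    by rewrite lt_neqAle eucl_ge0 eq_sym eucl_eq0 subr_eq0 eq_sym yx.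
  have := riesz_formula alpha1 alpha2 t0 => e.
  have E : (eucl (x - y) `^ (- alpha) * normc (f y) ^+ 2)%:E =
      ((g * normc (f y) ^+ 2)%:E * (riesz_cst alpha * eucl (x - y) `^ (- alpha))%:E)%E.
    by rewrite -EFinM; congr (_%:E); rewrite /g; field; rewrite gt_eqF// riesz_cst_gt0.
  rewrite [LHS]E -e -ge0_integralZl//; last 2 first.
  - apply/measurable_EFinP; apply: (measurableT_comp (continuous_measurable_fun (@continuous_expR R))).
    apply: measurable_funB; first exact: measurable_funM.
    apply: measurable_funM => //; exact: (continuous_measurable_fun (@continuous_expR R)).
  - by rewrite lee_fin mulr_ge0 ?(ltW g0)// exprn_ge0// normc_ge0.
  apply: eq_integral => v _; rewrite -EFinM; congr (_%:E).
  by rewrite UE gauss3E sqr_eucl expRD; ring.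
pose H v := cintegral vol setT (fun h => (heat alpha v h)%:C * (kern_cst%:C * (corr F h * cis (dot x h)))).
have iU v : vol.-integrable setT (fun y => (U (y, v))%:E).
  have q0 := expR_gt0 v.
  have ig : vol.-integrable setT (fun y => (gauss3 (expR v) (y - x))%:E).
    exact: (preserving_integrable (preserving_translation (- x)) (integrable_gauss3 q0)).
  have := integrableZl measurableT (g * expR (v * (alpha / 2)) * ift_bound F ^+ 2) ig.
  move=> /(@integrable_bound _ _ _ vol); apply.
    exact: (measurable_pairr v mU).
  move=> y; rewrite ger0_norm// UE -(gauss3N _ (y - x)) opprB.
  rewrite [leRHS](_ : _ = g * expR (v * (alpha / 2)) * gauss3 (expR v) (x - y) * ift_bound F ^+ 2); last by ring.
  rewrite ler_wpM2l ?mulr_ge0 ?(ltW g0) ?expR_ge0 ?gauss3_ge0//.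
  have B0 : 0 <= ift_bound F by rewrite (le_trans (normc_ge0 _) (normc_ift y iF)).
  by rewrite ler_pXn2r ?nnegrE ?normc_ge0// normc_ift.
(* The integral at one scale: the square becomes a Fourier integral of [corr F], and the Gaussian
   average becomes a Gaussian factor in frequency, namely [heat]. *)
have HE v : (Rintegral vol setT (fun y => U (y, v)))%:C = H v.
  have q0 := expR_gt0 v.
  rewrite -cintegral_real.
  transitivity (cintegral vol setT (fun y => (g * expR (v * (alpha / 2)) * fourier_cst ^+ 2)%:C *
    ((gauss3 (expR v) (x - y))%:C * cintegral vol setT (fun h => corr F h * cis (dot y h))))).
    apply: eq_cintegral => y; have e1 : (U (y, v))%:C = (g * expR (v * (alpha / 2)) * gauss3 (expR v) (x - y))%:C *
        (normc (ift F y) ^+ 2)%:C by exact: realCM.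
    by rewrite e1 sqr_normc_ift !realCM; ring.
  rewrite cintegralZ; last first.
    apply: (@cintegrable_bound _ _ _ vol _ (fun y => ift_bound (corr F) / fourier_cst * gauss3 (expR v) (y - x))).
    - apply: cmeasurableM.
        apply: cmeasurable_real; apply: (measurableT_comp (measurable_gauss3 _)); exact: measurable_funB3.
      have := cmeasurable_ift cmeasurable_corr => mi.
      rewrite (_ : (fun y => _) = fun y => (fourier_cst^-1)%:C * ift (corr F) y).
        by apply: cmeasurableM => //; exact: cmeasurable_cst.
      apply/funext => y; rewrite /ift mulrA -rmorphM mulVf ?rmorph1 ?mul1r//.
      by rewrite gt_eqF// fourier_cst_gt0.
    - have ig := preserving_integrable (preserving_translation (- x)) (integrable_gauss3 q0).
      exact: (integrableZl measurableT (ift_bound (corr F) / fourier_cst) ig).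
    - move=> y; rewrite normcM normc_real ger0_norm ?gauss3_ge0// -(gauss3N _ (y - x)) opprB mulrC.
      rewrite ler_wpM2r ?gauss3_ge0// ler_pdivlMr ?fourier_cst_gt0//.
      rewrite -[leLHS]/(normc _ * _) (le_trans _ (normc_ift y iA))// /ift normcM normc_real.
      by rewrite ger0_norm ?(ltW fourier_cst_gt0)// mulrC.
  rewrite cintegral_gauss3_conv// -cintegralZ; last first.
    apply: (@cintegrable_bound _ _ _ vol _ (fun h => Num.sqrt (pi / expR v) ^+ 3 * normc (corr F h))).
    - apply: cmeasurableM; last by apply: cmeasurableM; [exact: cmeasurable_corr|exact: cmeasurable_cis_dot].
      apply: cmeasurable_real; apply: measurable_funM => //; exact: measurable_gauss3.
    - exact: (integrableZl measurableT _ (cintegrable_normc iA)).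
    - move=> h; rewrite !normcM normc_cis mulr1 normc_real ger0_norm; last first.
        by rewrite mulr_ge0 ?gauss3_ge0// exprn_ge0// sqrtr_ge0.
      have G1 : gauss3 (4 * expR v)^-1 h <= 1.
        by apply: gauss3_le1; rewrite invr_ge0 mulr_ge0// expR_ge0.
      apply: ler_wpM2r; first exact: normc_ge0.
      by rewrite -[leRHS]mulr1 ler_wpM2l// exprn_ge0// sqrtr_ge0.
  apply: eq_cintegral => h.
  have -> : (heat alpha v h)%:C * (kern_cst%:C * (corr F h * cis (dot x h))) =
     (heat alpha v h * kern_cst)%:C * (corr F h * cis (dot x h)) by rewrite realCM mulrA.
  pose a1 := g * expR (v * (alpha / 2)) * fourier_cst ^+ 2.
  pose a2 := Num.sqrt (pi / expR v) ^+ 3 * gauss3 (4 * expR v)^-1 h.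
  have -> : heat alpha v h * kern_cst = a1 * a2; last by rewrite (realCM a1 a2); exact: mulrA.
  rewrite /a1 /a2 /heat /kern_cst -/g.
  have -> : (4 * expR v)^-1 = expR (- v) / 4 by rewrite expRN invfM mulrC.
  rewrite sqrtrM ?pi_ge0// -expRN sqrt_expR exprMn -[expR (- v / 2) ^+ 3]expRM_natl.
  have -> : expR (v * ((alpha - 3) / 2)) = expR (v * (alpha / 2)) * expR (3%:R * (- v / 2)).
    by rewrite -expRD; congr expR; field.
  by ring.
have iH : cintegrable (leb \x vol)%E setT (fun z : measurableTypeR R * R3 R =>
    (heat alpha z.1 z.2)%:C * (kern_cst%:C * (corr F z.2 * cis (dot x z.2)))).
  have i0 := integrableZl measurableT (kern_cst * M2) (integrable_heat_wgt 0).
  apply: (@cintegrable_bound _ _ _ _ _ (fun z : measurableTypeR R * R3 R => kern_cst * M2 * (heat alpha z.1 z.2 * wgt (z.2 - 0))) _ i0).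
    apply: cmeasurableM.
      apply: cmeasurable_real.
      exact: (measurableT_comp (measurable_heat2 alpha) (@measurable_swap _ _ _ _)).
    apply: cmeasurableM; first exact: cmeasurable_cst.
    have mm : cmeasurable (fun h => corr F h * cis (dot x h)).
      by apply: cmeasurableM; [exact: cmeasurable_corr|exact: cmeasurable_cis_dot].
    exact: (cmeasurable_comp mm measurable_snd).
  move=> [v h] /=; rewrite !normcM normc_cis mulr1 !normc_real ger0_norm ?heat_ge0//.
  rewrite ger0_norm ?(ltW kern_cst_gt0)// mulrCA -mulrA ler_wpM2l ?(ltW kern_cst_gt0)//.
  rewrite [leRHS]mulrCA ler_wpM2l ?heat_ge0// subr0.
  by rewrite (le_trans (normc_corr h))// ler_wpM2l// vwgt_le.
have iI := cintegrable1 iH.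
pose I v := Rintegral vol setT (fun y => U (y, v)).
have IE : (fun v => cintegral vol setT (fun h => (heat alpha (v, h).1 (v, h).2)%:C *
    (kern_cst%:C * (corr F (v, h).2 * cis (dot x (v, h).2))))) = fun v => (I v)%:C.
  by apply/funext => v; rewrite /I HE.
have I0 v : 0 <= I v by apply: Rintegral_ge0 => y _.
have intI : leb.-integrable setT (EFin \o I).
  have [i _] : cintegrable leb setT (fun v => (I v)%:C) by rewrite -IE; exact: iI.
  exact: i.
exists (Rintegral leb setT I).
  rewrite -/f pot (@fubini_tonelli _ _ _ _ R vol leb _ mUE UE0) /=.
  rewrite /Rintegral fineK; last exact: (integrable_fin_num _ intI).
  apply: eq_integral => v _; rewrite /I /Rintegral fineK//.
  exact: (integrable_fin_num _ (iU v)).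
rewrite -cintegral_real -IE (cfubini iH); apply: eq_cintegral => h /=.
have mh : measurable_fun setT (fun v => heat alpha v h).
  exact: (measurable_pairl h (measurable_heat2 alpha)).
have hh v : 0 <= heat alpha v h by exact: heat_ge0.
have := @ge0_cintegralZr _ _ leb _ (kern_cst%:C * (corr F h * cis (dot x h))) mh hh => ->.
have kE : (kern h)%:C = kern_cst%:C * (Rintegral leb setT (fun v => heat alpha v h))%:C by exact: realCM.
have aux (c1 c2 c3 c4 : R[i]) : c1 * (c2 * (c3 * c4)) = c2 * c1 * c3 * c4 by ring.
by rewrite kE; exact: aux.
Qed.

Lemma hartree_ift x : hartree alpha (ift F) x = ift (nonlin F) x.
Proof.
rewrite /hartree; have [V -> /= ->] := potential_ift x.
rewrite /ift mulrCA cintegral_conv_cis// => z.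
exact: (cintegrable_conv_integrand kern_bound b0 M20 M0 mkA mF lekA leF).
Qed.

End Potential.

End InverseFourier.

(** * Test functions *)

Section FlatFunction.
Context {R : realType}.
Implicit Types (n : nat) (t : R).

(** The inverse powers are included so that the family is stable: the derivative of [flat n] is a
    combination of [flat n.+2] and [flat n.+1], at the origin as well. *)
Definition flat n t : R := if 0 < t then t^-1 ^+ n * expR (- t^-1) else 0.

Lemma flat_ge0 n t : 0 <= flat n t.
Proof.
rewrite /flat; case: ifP => // t0; by rewrite mulr_ge0 ?expR_ge0// exprn_ge0// invr_ge0 ltW.
Qed.

Lemma flat_gt0 t : (0 < flat 0 t) = (0 < t).
Proof. by rewrite /flat; case: ifP => //; rewrite ?ltxx// expr0 mul1r expR_gt0. Qed.

(** From one term of the exponential series at [t^-1]. The quadratic bound makes the difference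
    quotient at the origin tend to zero, which is the only delicate point of differentiability. *)
Lemma flat_le n t : flat n t <= n.+2`!%:R * t ^+ 2.
Proof.
rewrite /flat; case: ifPn => [t0|_]; last by rewrite mulr_ge0// sqr_ge0.
have x0 : 0 < t^-1 by rewrite invr_gt0.
have h : t^-1 ^+ n.+2 / n.+2`!%:R <= expR t^-1.
  have := @expR_ge1Dxn R t^-1 n.+1 (ltW x0); lra.
have f0 : 0 < n.+2`!%:R :> R by rewrite ltr0n fact_gt0.
rewrite expRN ler_pdivrMr ?expR_gt0//.
have -> : t^-1 ^+ n = t^-1 ^+ n.+2 * t ^+ 2.
  by rewrite -addn2 exprD -mulrA -exprMn mulVf ?gt_eqF// expr1n mulr1.
rewrite [leRHS](mulrAC _ _ (expR _)) ler_wpM2r ?sqr_ge0//.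
by move: h; rewrite ler_pdivrMr// mulrC.
Qed.

Lemma is_derive_flat_pos n t : 0 < t ->
  is_derive t 1 (fun z => z^-1 ^+ n * expR (- z^-1))
    (t^-1 ^+ n.+2 * expR (- t^-1) - n%:R * (t^-1 ^+ n.+1 * expR (- t^-1))).
Proof.
move=> t0; have tn0 : t != 0 by rewrite gt_eqF.
have dV : is_derive t 1 (fun z : R => z^-1) (- t ^- 2).
  by have := @is_deriveV R id t 1 1 tn0 (is_derive_id _ _); rewrite /GRing.scale/= mulr1.
elim: n => [|n IH].
  have dE : is_derive t 1 (fun z : R => expR (- z^-1)) (expR (- t^-1) * - - t ^- 2).
    exact: (@is_derive1_comp R expR (fun z => - z^-1)).
  rewrite (_ : (fun z => _) = fun z : R => expR (- z^-1)); last first.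
    by apply/funext => z; rewrite expr0 mul1r.
  by apply: is_derive_eq; rewrite mul0r subr0 opprK exprVn mulrC.
rewrite (_ : (fun z => _) = (fun z : R => z^-1) * (fun z => z^-1 ^+ n * expR (- z^-1))); last first.
  by apply/funext => z; rewrite exprS -mulrA.
apply: is_derive_eq; rewrite /GRing.scale /= -exprVn -[n.+1%:R]natr1 !exprS; ring.
Qed.

Lemma is_derive_flat n t :
  is_derive t 1 (flat n) (flat n.+2 t - n%:R * flat n.+1 t).
Proof.
have [t0|t0|->] := ltgtP t 0.
- apply: (@near_eq_is_derive _ _ _ (fun=> 0)).
    near=> z; rewrite /flat ifF//; apply/negbTE; rewrite -leNgt ltW//.
    by near: z; exact: lt_nbhsl.
    have f0 m : flat m t = 0 by rewrite /flat ifF// lt_gtF.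
  by rewrite !f0 mulr0 subr0; exact: is_derive_cst.
- apply: (@near_eq_is_derive _ _ _ (fun z : R => z^-1 ^+ n * expR (- z^-1))).
    near=> z; rewrite /flat ifT//; near: z; exact: lt_nbhsr.
  by rewrite /flat t0; exact: is_derive_flat_pos.
have -> : flat n.+2 0 - n%:R * flat n.+1 0 = 0 :> R by rewrite /flat ltxx mulr0 subr0.
have c : h^-1 *: ((flat n \o shift 0) (h *: 1) - flat n 0) @[h --> 0^'] --> (0 : R).
  have f0 : flat n 0 = 0 :> R by rewrite /flat ltxx.
  have lim : (n.+2`!%:R * `|h| : R) @[h --> (0 : R)^'] --> (0 : R).
    have c : {for (0 : R), continuous (fun h : R => n.+2`!%:R * `|h| : R)}.
      by apply: cvgM; [exact: cvg_cst|exact: norm_continuous].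
    have := @cvg_trans _ _ _ _ (cvg_fmap2 (@cvg_within _ (nbhs (0 : R)) _ (fun x : R => x != 0))) c.
    by rewrite /= normr0 mulr0; exact.
  apply: norm_cvg0; apply: (@squeeze_cvgr _ _ _ _ (fun=> 0) _ _ _ _ _ lim) => //; last exact: cvg_cst.
  near=> h; rewrite normr_ge0/= f0 subr0 /GRing.scale/= mulr1 addr0 normrM normfV.
  have h0 : h != 0 by near: h; exact: nbhs_dnbhs_neq.
  rewrite ler_pdivrMl ?normr_gt0// ger0_norm ?flat_ge0// (le_trans (flat_le _ _))//.
  by rewrite [leRHS]mulrCA -normrM -expr2 ger0_norm ?sqr_ge0.
by apply: DeriveDef; [apply/cvg_ex; exists 0; exact: c|apply/cvg_lim => //; exact: c].
Unshelve. all: end_near. Qed.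

Lemma continuous_flat n : continuous (flat n).
Proof.
move=> t; apply: differentiable_continuous; apply/derivable1_diffP.
by have [] := is_derive_flat n t.
Qed.

End FlatFunction.

(** * A class of functions closed under directional derivatives *)

Section ElementaryFunctions.
Context {R : realType}.
Implicit Types (f : R3 R -> R) (x v w a : R3 R).

Lemma is_derive_line f x v (df : R) :
  is_derive (0 : R) 1 (fun h : R => f (h *: v + x)) df -> is_derive x v f df.
Proof.
have e : (fun h : R => h^-1 *: ((f \o shift x) (h *: v) - f x)) =
    (fun h : R => h^-1 *: (((fun h : R => f (h *: v + x)) \o shift 0) (h *: 1) -
      (fun h : R => f (h *: v + x)) 0)).
  apply/funext => h; congr (_ *: _) => /=.
  by rewrite addr0 [h *: 1]mulr1 scale0r add0r.
move=> [d1 d2]; apply: DeriveDef; first by rewrite /derivable e.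
by rewrite /derive e.
Qed.

Lemma is_derive_along f x v (h : R) (df : R) :
  is_derive (h *: v + x) v f df -> is_derive h 1 (fun h : R => f (h *: v + x)) df.
Proof.
have e : (fun k : R => k^-1 *: ((f \o shift (h *: v + x)) (k *: v) - f (h *: v + x))) =
    (fun k : R => k^-1 *: (((fun h : R => f (h *: v + x)) \o shift h) (k *: 1) -
      (fun h : R => f (h *: v + x)) h)).
  by apply/funext => k; congr (_ *: _) => /=; rewrite [k *: 1]mulr1 scalerDl addrA.
move=> [d1 d2]; apply: DeriveDef; first by rewrite /derivable -e.
by rewrite /derive -e.
Qed.

(** Smoothness quantifies over all lists of directions; membership in a class that each directional
    derivative preserves turns it into an induction on the list. *)
Inductive elementary : (R3 R -> R) -> Prop :=
| elementary_cst c : elementary (fun=> c)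
| elementary_flat n w (b : R) : elementary (fun x => flat n (dot w x + b))
| elementaryD f h : elementary f -> elementary h -> elementary (fun x => f x + h x)
| elementaryM f h : elementary f -> elementary h -> elementary (fun x => f x * h x).

Lemma dotZr w x (a : R) : dot w (a *: x) = a * dot w x.
Proof. by rewrite /dot /= /GRing.scale /=; ring. Qed.

Lemma continuous_dot w : continuous (dot w).
Proof.
move=> x; have c1 : {for x, continuous (fun y : R3 R => y.1.1)}.
  by apply: (@continuous_comp _ _ _ fst fst); exact: cvg_fst.
have c2 : {for x, continuous (fun y : R3 R => y.1.2)}.
  by apply: (@continuous_comp _ _ _ fst snd); [exact: cvg_fst|exact: cvg_snd].
have c3 : {for x, continuous (fun y : R3 R => y.2)} by exact: cvg_snd.
by apply: cvgD; [apply: cvgD|]; apply: cvgM => //; exact: cvg_cst.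
Qed.

Lemma elementary_derive f v : elementary f ->
  exists2 df, elementary df & forall x, is_derive x v f (df x).
Proof.
elim=> [c|n w b|g h _ [dg eg ig] _ [dh eh ih]|g h eg [dg eg' ig] eh [dh eh' ih]].
- by exists (fun=> 0); [exact: elementary_cst|move=> x; exact: is_derive_cst].
- exists (fun x => dot w v * (flat n.+2 (dot w x + b) + (- n%:R) * flat n.+1 (dot w x + b))).
    apply: elementaryM; first exact: elementary_cst.
    apply: elementaryD; first exact: elementary_flat.
    by apply: elementaryM; [exact: elementary_cst|exact: elementary_flat].
  move=> x; apply: is_derive_line.
  have dl : is_derive (0 : R) 1 (fun h : R => dot w (h *: v + x) + b) (dot w v).
    rewrite (_ : (fun h => _) = fun h : R => h * dot w v + (dot w x + b)); last first.
      by apply/funext => h; rewrite dotDr dotZr -addrA.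
    by apply: is_derive_eq; rewrite /GRing.scale /= mulr0 add0r mulr1 addr0.
  have df := is_derive_flat n (dot w (0 *: v + x) + b).
  have := @is_derive1_comp R (flat n) (fun h : R => dot w (h *: v + x) + b) 0 _ _ df dl.
  move/is_derive_eq; apply; rewrite scale0r add0r; ring.
- exists (fun x => dg x + dh x); first exact: elementaryD.
  by move=> x; exact: is_deriveD.
exists (fun x => g x * dh x + h x * dg x).
  by apply: elementaryD; apply: elementaryM.
by move=> x; exact: is_deriveM.
Qed.

Lemma elementary_continuous f : elementary f -> continuous f.
Proof.
elim=> [c|n w b|g h _ cg _ ch|g h _ cg _ ch] x; first exact: cvg_cst.
- apply: (@continuous_comp _ _ _ (fun x => dot w x + b) (flat n)); last exact: continuous_flat.
  by apply: cvgD; [exact: continuous_dot|exact: cvg_cst].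
- by apply: cvgD; [exact: cg|exact: ch].
- by apply: cvgM; [exact: cg|exact: ch].
Qed.

Lemma elementary_smooth f : elementary f -> smooth f.
Proof.
move=> ef vs; have e : elementary (iter_derive vs f).
  elim: vs => //= v vs IH; have [dg eg ig] := elementary_derive v IH.
  rewrite (_ : (fun x => _) = dg)//; apply/funext => x.
  by have [_ ->] := ig x.
split; first exact: elementary_continuous.
by move=> x v; have [dg _ ig] := elementary_derive v e; have [] := ig x.
Qed.

End ElementaryFunctions.

(** * Measurability of test functions and decay of their transforms *)

Section TestFunctions.
Context {R : realType}.
Implicit Types (eta : test R) (x v xi : R3 R).

(** The measurable sets are those of a product, not by definition those generated by the open sets.
    The bridge is that an open set is the union of the boxes with rational centre and radius
    [n.+1%:R^-1] contained in it, of which there are countably many. *)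
Lemma measurable_continuous (f : R3 R -> R) : continuous f -> measurable_fun setT f.
Proof.
move=> cf; apply: (measurability _ (RGenOpens.measurableE R)) => _ [_ [a [b ->] <-]].
rewrite setTI.
have oU : open (f @^-1` `]a, b[%classic).
  by move/continuousP : cf; apply; exact: interval_open.
set U := f @^-1` _ in oU *.
pose box (i : rat * rat * rat * nat) : set (R3 R) :=
  [set x | `|x - (ratr i.1.1.1, ratr i.1.1.2, ratr i.1.2)| < i.2.+1%:R^-1].
have mbox i : measurable (box i).
  have m := measurableT_comp measurable_norm3 (proj1 (preserving_translation
    (- (ratr i.1.1.1, ratr i.1.1.2, ratr i.1.2) : R3 R))).
  have := measurable_fun_ltr m (@measurable_cst _ _ (R3 R) R setT i.2.+1%:R^-1).
  by rewrite -[X in measurable X]setTI; exact.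
have -> : U = \bigcup_(i : rat * rat * rat * nat)
    (if `[<box i `<=` U>] then box i else set0).
  apply/seteqP; split=> [x Ux|x [i _]]; last first.
    by case: asboolP => // bU bx; exact: bU.
  have /nbhs_ballP[e /= e0 be] := open_nbhs_nbhs (conj oU Ux).
  have [n ne] : exists n : nat, n.+1%:R^-1 < e / 2.
    by have := @near_infty_natSinv_lt R (PosNum (divr_gt0 e0 (ltr0Sn R 1))) => -[n _ /(_ n (leqnn n))]; exists n.
  have n0 : 0 < n.+1%:R^-1 :> R by rewrite invr_gt0.
  have q (y : R) : exists r : rat, `|y - ratr r| < n.+1%:R^-1.
    move: (n.+1%:R^-1) n0 => d d0; have [|r] := @rat_in_itvoo R (y - d) (y + d); first lra.
    by rewrite in_itv/= => /andP[h1 h2]; exists r; rewrite ltr_norml; lra.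
  have [r1 h1] := q x.1.1; have [r2 h2] := q x.1.2; have [r3 h3] := q x.2.
  have xb : box (r1, r2, r3, n) x by rewrite /box /= normR3E /= !gt_max h1 h2 h3.
  exists (r1, r2, r3, n) => //; rewrite asboolT// => y yb.
  suff : `|x - y| < e by move=> xy; apply: be; rewrite -ball_normE.
  move: xb yb; rewrite /box /=; set q0 : R3 R := (_, _, _) => xb yb.
  have := ler_normB (x - q0) (y - q0); rewrite opprB addrA subrK => le1.
  by move: (n.+1%:R^-1) ne xb yb => d; lra.
by apply: countable_bigcupT_measurable => // i; case: ifP => // _; exact: measurable0.
Qed.

Lemma test_continuous eta : continuous eta.
Proof. by have [] := @test_smooth _ eta [::]. Qed.

Lemma measurable_test eta : measurable_fun setT eta.
Proof. by apply: measurable_continuous; exact: test_continuous. Qed.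

Lemma test_bounded eta : exists M r : R,
  [/\ 0 <= M, 0 <= r, forall x, `|eta x| <= M & forall x, r < `|x| -> eta x = 0].
Proof.
have cK := @test_support _ eta; set K := closure _ in cK.
have [r [_ hr]] := compact_bounded cK.
have cf : {within K, continuous eta}.
  by apply: continuous_subspaceT; exact: test_continuous.
have [M [_ hM]] := compact_bounded (continuous_compact cf cK).
have M0 : 0 <= `|M| + 1 by rewrite addr_ge0.
exists (`|M| + 1), (`|r| + 1); split => //.
  move=> x; have [->|e0] := eqVneq (eta x) 0; first by rewrite normr0.
  apply: hM; first by rewrite (le_lt_trans (ler_norm _))// ltrDl.
  by exists x => //; exact: subset_closure.
move=> x; apply: contraPP => /eqP e0; apply/negP; rewrite -leNgt.
by apply: hr; [rewrite (le_lt_trans (ler_norm _))// ltrDl|exact: subset_closure].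
Qed.

(** Uniform over shifts [h] of size at most 1, so as to serve as a majorant when the translated
    integral is differentiated in [h]. *)
Lemma test_wgt eta v : exists2 M, 0 <= M &
  forall x (h : R), `|h| <= 1 -> `|eta (h *: v + x)| <= M * wgt x.
Proof.
have [M [r [M0 r0 hM hr]]] := test_bounded eta.
have A0 : 0 <= M * (1 + r + `|v|) ^+ 6 by rewrite mulr_ge0// exprn_ge0// addr_ge0// addr_ge0.
exists (M * (1 + r + `|v|) ^+ 6) => // x h h1.
have [lt|le] := ltP r `|h *: v + x|; first by rewrite hr// normr0 mulr_ge0// wgt_ge0.
rewrite (le_trans (hM _))// /wgt -mulrA ler_peMr// -expr_div_n exprn_ege1//.
rewrite ler_pdivlMr ?norm1_gt0// mul1r -addrA lerD2l.
have -> : x = (h *: v + x) - h *: v by rewrite addrC addKr.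
rewrite (le_trans (ler_normB _ _))// lerD// normrZ ler_piMl//.
Qed.

Lemma integrable_test eta : vol.-integrable setT (EFin \o eta).
Proof.
have [M M0 le] := test_wgt eta 0.
have iw : vol.-integrable setT (EFin \o (fun x : R3 R => M * wgt x)).
  exact: (integrableZl measurableT M (@integrable_wgt R)).
apply: (integrable_bound _ iw); first exact: measurable_test.
by move=> x; have := le x 0; rewrite scale0r add0r normr0; apply.
Qed.

Lemma iter_derive_rcons vs v (f : R3 R -> R) :
  iter_derive vs (fun x => 'D_v f x) = iter_derive (rcons vs v) f.
Proof. by rewrite /iter_derive foldr_rcons. Qed.

Lemma derive_test_smooth eta v : smooth (fun x => 'D_v eta x).
Proof. by move=> vs; rewrite iter_derive_rcons; exact: (@test_smooth _ eta). Qed.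

Lemma derive_test_support eta v : compact (closure [set x | 'D_v eta x != 0]).
Proof.
apply: (subclosed_compact (@closed_closure _ _) (@test_support _ eta)).
rewrite [X in _ `<=` X](closure_id _).1; last exact: closed_closure.
apply: closureS => x /=; apply: contraPP => nx.
suff -> : 'D_v eta x = 0 by rewrite eqxx.
have nb : nbhs x (~` closure [set x | eta x != 0]).
  by apply: open_nbhs_nbhs; split=> //; apply: closed_openC; exact: closed_closure.
rewrite (@near_eq_derive _ _ _ _ (fun=> 0)) ?derive_cst//.
apply: filterS nb => y ny; have [//|e0] := eqVneq (eta y) 0.
by case: ny; exact: subset_closure.
Qed.

Definition derive_test eta v : test R :=
  @Test R (fun x => 'D_v eta x) (@derive_test_smooth eta v) (@derive_test_support eta v).

(** In place of an integration by parts: the integral of a directional derivative is the derivative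
    at 0 of the integral of the translates. *)
Lemma Rintegral_derive_test eta v (k : R3 R -> R) : measurable_fun setT k ->
  (forall x, `|k x| <= 1) -> forall D : R,
  is_derive (0 : R) 1 (fun h => Rintegral vol setT (fun x => eta (h *: v + x) * k x)) D ->
  Rintegral vol setT (fun x => derive_test eta v x * k x) = D.
Proof.
move=> mk k1 D [dD eD].
have [M M0 hM] := test_wgt (derive_test eta v) v.
have [M' M'0 hM'] := test_wgt eta v.
have me (e : test R) (h : R) : measurable_fun setT (fun x => e (h *: v + x) * k x).
  apply: measurable_funM => //; apply: (measurableT_comp (measurable_test e)).
  rewrite (_ : +%R _ = fun x => x + h *: v); last by apply/funext => x; rewrite addrC.
  exact: (proj1 (preserving_translation (h *: v))).
have iw (c : R) : vol.-integrable setT (EFin \o (fun x : R3 R => c * wgt x)).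
  exact: (integrableZl measurableT c (@integrable_wgt R)).
have df h x : derivable (fun h : R => eta (h *: v + x) * k x) h 1 /\
    'D_1 (fun h : R => eta (h *: v + x) * k x) h = derive_test eta v (h *: v + x) * k x.
  have d : is_derive (h *: v + x) v eta ('D_v eta (h *: v + x)).
    by apply: DeriveDef; [have [_] := @test_smooth _ eta [::]; apply|].
  have d1 := is_derive_along d.
  have [dd ->] : is_derive h 1 (fun h : R => eta (h *: v + x) * k x) ('D_v eta (h *: v + x) * k x).
    by apply: is_derive_eq; rewrite /GRing.scale/= mulr0 add0r mulrC.
  by [].
rewrite -eD -derive1E.
pose f (h : R) x := eta (h *: v + x) * k x.
have i0 : (`]-1, 1[%classic : set R) 0 by rewrite /= in_itv/= ltrN10 ltr01.
have lt1 (h : R) : (`]-1, 1[%classic : set R) h -> `|h| <= 1.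
  by rewrite /= in_itv /= => /andP[h1 h2]; rewrite ler_norml; lra.
have H1 (h : R) : (`]-1, 1[%classic : set R) h -> vol.-integrable setT (EFin \o f h).
  move=> h1; apply: (integrable_bound _ (iw M')); first exact: me.
  by move=> x; rewrite normrM (le_trans (ler_piMr _ (k1 x)))// hM' ?lt1.
have H2 (h : R) x : (`]-1, 1[%classic : set R) h -> setT x -> derivable (f^~ x) h 1.
  by move=> _ _; exact: (df h x).1.
have H3 x : 0 <= M * wgt x by rewrite mulr_ge0// wgt_ge0.
have H4 (h : R) x : (`]-1, 1[%classic : set R) h -> setT x -> `|partial1of2 f h x| <= M * wgt x.
  move=> h1 _; rewrite partial1of2E (df h x).2.
  by rewrite normrM (le_trans (ler_piMr _ (k1 x)))// hM// lt1.
rewrite (@differentiation_under_integral _ _ _ vol f setT measurableT 0 (-1) 1 i0 H1 H2 _ H3 (iw M) H4).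
by apply: eq_Rintegral => x _; rewrite partial1of2E (df 0 x).2 scale0r add0r.
Qed.

Lemma Rintegral_shift (v : R3 R) (f : R3 R -> R) : measurable_fun setT f ->
  Rintegral vol setT (fun x => f (v + x)) = Rintegral vol setT f.
Proof.
move=> mf; rewrite -(preserving_Rintegral (preserving_translation v) mf).
by apply: eq_Rintegral => x _; rewrite addrC.
Qed.

(** Moving the translation from [eta] onto the trigonometric factor gives an explicit function of
    [h], with real part and imaginary part mixed by a rotation of angle [h * k]; its derivative at 0
    produces the factor. *)
Lemma inv_fourier_derive_test eta v xi :
  inv_fourier_test (derive_test eta v) xi =
  - ('i * (dot v xi)%:C) * inv_fourier_test eta xi.
Proof.
rewrite !inv_fourier_testE.
set k := dot v xi.
pose C := Rintegral vol setT (fun x => eta x * cos (dot x xi)).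
pose S := Rintegral vol setT (fun x => eta x * sin (dot x xi)).
have E (e : test R) : cintegral vol setT (fun x => (e x)%:C * cis (dot x xi)) =
    Rintegral vol setT (fun x => e x * cos (dot x xi)) +i* Rintegral vol setT (fun x => e x * sin (dot x xi)).
  by rewrite /cintegral; congr (_ +i* _); apply: eq_Rintegral => x _; rewrite /= ?mul0r ?subr0 ?addr0.
have mdx : measurable_fun setT (fun x : R3 R => dot x xi).
  by apply: measurable_dot; [exact: measurable_id|exact: measurable_cst].
have mc : measurable_fun setT (fun x : R3 R => cos (dot x xi)).
  exact: (measurableT_comp (continuous_measurable_fun (@continuous_cos R)) mdx).
have ms : measurable_fun setT (fun x : R3 R => sin (dot x xi)).
  exact: (measurableT_comp (continuous_measurable_fun (@continuous_sin R)) mdx).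
have iM (g : R3 R -> R) : measurable_fun setT g -> (forall x, `|g x| <= 1) ->
    vol.-integrable setT (EFin \o (fun x => eta x * g x)).
  move=> mg g1; apply: (integrable_bound _ (integrable_norm (integrable_test eta))).
    by apply: measurable_funM => //; exact: measurable_test.
  by move=> x; rewrite normrM ler_piMr.
have c1 x : `|cos (dot x xi)| <= 1 by rewrite ler_norml cos_geN1 cos_le1.
have s1 x : `|sin (dot x xi)| <= 1 by rewrite ler_norml sin_geN1 sin_le1.
have ic := iM _ mc c1; have is' := iM _ ms s1.
have mt (h : R) : measurable_fun setT (fun x => eta (h *: v + x)).
  apply: (measurableT_comp (measurable_test eta)).
  rewrite (_ : +%R _ = fun x => x + h *: v); last by apply/funext => x; rewrite addrC.
  exact: (proj1 (preserving_translation (h *: v))).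
have e1 (h : R) x : h *: v + (- (h *: v) + x) = x by rewrite addrA subrr add0r.
have e2 (h : R) x : dot (- (h *: v) + x) xi = dot x xi - h * k.
  by rewrite dotDl dotNl dotC dotZr (dotC xi) addrC.
have iZ (f : R3 R -> R) (a : R) : vol.-integrable setT (EFin \o f) ->
    vol.-integrable setT (EFin \o (fun x => a * f x)).
  by move=> i; exact: (integrableZl measurableT a i).
have dlin : is_derive (0 : R) 1 (fun h : R => h * k) k.
  by apply: is_derive_eq; rewrite /GRing.scale /= mulr0 add0r mulr1.
have dcos : is_derive (0 : R) 1 (fun h : R => cos (h * k)) 0.
  have := @is_derive1_comp R (@cos R) (fun h : R => h * k) 0 _ _ (is_derive_cos _) dlin.
  by rewrite mul0r sin0 oppr0 mul0r.
have dsin : is_derive (0 : R) 1 (fun h : R => sin (h * k)) k.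
  have := @is_derive1_comp R (@sin R) (fun h : R => h * k) 0 _ _ (is_derive_sin _) dlin.
  by rewrite mul0r cos0 mul1r.
have Dc : is_derive (0 : R) 1
    (fun h => Rintegral vol setT (fun x => eta (h *: v + x) * cos (dot x xi))) (k * S).
  rewrite (_ : (fun h => _) = fun h : R => cos (h * k) * C + sin (h * k) * S); last first.
    apply/funext => h; rewrite -(@Rintegral_shift (- (h *: v))); last exact: measurable_funM.
    rewrite /C /S -!RintegralZl// -RintegralD//; [|exact: iZ|exact: iZ].
    by apply: eq_Rintegral => x _; rewrite e1 e2 cosB; ring.
  by apply: is_derive_eq; rewrite /GRing.scale/=; ring.
have Ds : is_derive (0 : R) 1
    (fun h => Rintegral vol setT (fun x => eta (h *: v + x) * sin (dot x xi))) (- k * C).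
  rewrite (_ : (fun h => _) = fun h : R => cos (h * k) * S + - sin (h * k) * C); last first.
    apply/funext => h; rewrite -(@Rintegral_shift (- (h *: v))); last exact: measurable_funM.
    rewrite /C /S -!RintegralZl// -RintegralD//; [|exact: iZ|exact: iZ].
    by apply: eq_Rintegral => x _; rewrite e1 e2 sinB; ring.
  by apply: is_derive_eq; rewrite /GRing.scale/=; ring.
rewrite !E -/C -/S (Rintegral_derive_test mc c1 Dc) (Rintegral_derive_test ms s1 Ds).
rewrite mulrCA; congr (_ * _); apply: complex_eqP => /=; ring.
Qed.

Lemma cintegrable_test eta : cintegrable vol setT (fun x => (eta x)%:C).
Proof.
apply: (cintegrable_bound (cmeasurable_real (measurable_test eta)) (integrable_norm (integrable_test eta))).
by move=> x; rewrite normc_real.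
Qed.

(** Induction on the power, for all test functions at once: differentiating along each coordinate
    axis gains the corresponding coordinate of [xi], and the norm is the largest of the three. *)
Lemma test_decay n eta : exists2 M : R, 0 <= M &
  forall xi, (1 + `|xi|) ^+ n * normc (inv_fourier_test eta xi) <= M.
Proof.
elim: n eta => [|n IH] eta.
  pose f x := (eta x)%:C.
  have i0 : 0 <= ift_bound f.
    rewrite /ift_bound !mulr_ge0 ?(ltW fourier_cst_gt0)// Rintegral_ge0// => x _; exact: normc_ge0.
  exists (ift_bound f) => // xi; rewrite expr0 mul1r inv_fourier_testE.
  have := normc_ift xi (cintegrable_test eta); rewrite /ift.
  by under eq_cintegral do rewrite dotC.
have [M0 M00 H0] := IH eta.
have [M1 M10 H1] := IH (derive_test eta (1, 0, 0)).
have [M2 M20 H2] := IH (derive_test eta (0, 1, 0)).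
have [M3 M30 H3] := IH (derive_test eta (0, 0, 1)).
exists (M0 + (M1 + M2 + M3)); first by rewrite !addr_ge0.
move=> xi.
have D v : normc (inv_fourier_test (derive_test eta v) xi) = `|dot v xi| * normc (inv_fourier_test eta xi).
  have ni : normc ('i : R[i]) = 1 by rewrite /normc /= expr0n expr1n add0r sqrtr1.
  by rewrite inv_fourier_derive_test normcM normcN normcM ni mul1r normc_real.
have D1 : dot (1, 0, 0) xi = xi.1.1 by rewrite /dot /= !mul0r mul1r !addr0.
have D2 : dot (0, 1, 0) xi = xi.1.2 by rewrite /dot /= !mul0r mul1r addr0 add0r.
have D3 : dot (0, 0, 1) xi = xi.2 by rewrite /dot /= !mul0r mul1r !add0r.
have h0 := H0 xi; have h1 := H1 xi; have h2 := H2 xi; have h3 := H3 xi.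
rewrite D D1 in h1; rewrite D D2 in h2; rewrite D D3 in h3.
move: h0 h1 h2 h3; set N := normc _; set P := _ ^+ n => h0 h1 h2 h3.
have P0 : 0 <= P by rewrite exprn_ge0// ltW// norm1_gt0.
have PN : 0 <= P * N by rewrite mulr_ge0// normc_ge0.
rewrite exprS -/P -mulrA mulrDl mul1r lerD//.
have -> : `|xi| = Num.max (Num.max `|xi.1.1| `|xi.1.2|) `|xi.2| by exact: normR3E.
have m1 : 0 <= `|xi.1.1| * (P * N) by rewrite mulr_ge0.
have m2 : 0 <= `|xi.1.2| * (P * N) by rewrite mulr_ge0.
have m3 : 0 <= `|xi.2| * (P * N) by rewrite mulr_ge0.
move: h1 h2 h3; rewrite !(mulrCA P) => h1 h2 h3.
by rewrite /Num.max; case: ifP => _; [|case: ifP => _]; lra.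
Qed.

End TestFunctions.

(** The single tool for lower bounds: a nonnegative integrand is kept only on a set of known measure
    where it is large. *)
Lemma Rintegral_ge_set d (T : measurableType d) (R : realType) (mu : {measure set T -> \bar R})
    (f : T -> R) (A : set T) (c m : R) : measurable A ->
  mu A = m%:E -> mu.-integrable setT (EFin \o f) -> (forall x, 0 <= f x) ->
  (forall x, A x -> c <= f x) -> c * m <= Rintegral mu setT f.
Proof.
move=> mA vA fi f0 le.
have IA : (\int[mu]_x (\1_A x : R)%:E)%E = m%:E by rewrite -vA integral_indic// setIT.
have iA : mu.-integrable setT (EFin \o (\1_A : T -> R)).
  apply/integrableP; split; first exact/measurable_EFinP.
  by under eq_integral do rewrite /= ger0_norm//; rewrite IA ltry.
have -> : c * m = Rintegral mu setT (fun x => c * \1_A x).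
  by rewrite RintegralZl// /Rintegral IA.
apply: le_Rintegral => //; first exact: (integrableZl measurableT c iA).
move=> x _; have [Ax|nAx] := pselect (A x).
  by rewrite indicE mem_set// mulr1 le.
by rewrite indicE memNset// mulr0.
Qed.

(** * Bump functions whose transforms do not vanish at low frequency *)

Section Bumps.
Context {R : realType}.
Implicit Types (x a xi : R3 R) (d : R).

Definition bump_fun a d x :=
  flat 0 (d - (x.1.1 - a.1.1)) * flat 0 (d + (x.1.1 - a.1.1)) *
  (flat 0 (d - (x.1.2 - a.1.2)) * flat 0 (d + (x.1.2 - a.1.2))) *
  (flat 0 (d - (x.2 - a.2)) * flat 0 (d + (x.2 - a.2))).

Lemma bump_smooth a d : smooth (bump_fun a d).
Proof.
apply: elementary_smooth.
have e w (b : R) (f : R3 R -> R) : (forall x, f x = dot w x + b) -> elementary (fun x => flat 0 (f x)).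
  move=> fE; rewrite (_ : (fun x => _) = fun x => flat 0 (dot w x + b)); first exact: elementary_flat.
  by apply/funext => x; rewrite fE.
apply: elementaryM; first apply: elementaryM; apply: elementaryM.
- by apply: (e (-1, 0, 0) (d + a.1.1)) => x; rewrite /dot /=; ring.
- by apply: (e (1, 0, 0) (d - a.1.1)) => x; rewrite /dot /=; ring.
- by apply: (e (0, -1, 0) (d + a.1.2)) => x; rewrite /dot /=; ring.
- by apply: (e (0, 1, 0) (d - a.1.2)) => x; rewrite /dot /=; ring.
- by apply: (e (0, 0, -1) (d + a.2)) => x; rewrite /dot /=; ring.
- by apply: (e (0, 0, 1) (d - a.2)) => x; rewrite /dot /=; ring.
Qed.

Lemma mulf_neq0E (y z : R) : (y * z != 0) = (y != 0) && (z != 0).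
Proof. by rewrite mulf_eq0 negb_or. Qed.

Lemma bump_neq0 a d x : (bump_fun a d x != 0) = (`|x - a| < d).
Proof.
have f0 (t : R) : (flat 0 t != 0) = (0 < t) by rewrite -flat_gt0 lt0r flat_ge0 andbT.
have h (t : R) : (flat 0 (d - t) * flat 0 (d + t) != 0) = (`|t| < d).
  rewrite mulf_eq0 negb_or !f0 ltr_norml subr_gt0 andbC; congr (_ && _).
  by apply/idP/idP => ?; lra.
by rewrite /bump_fun mulf_neq0E mulf_neq0E !h normR3E /= !gt_max.
Qed.

Lemma bump_support a d : compact (closure [set x | bump_fun a d x != 0]).
Proof.
pose I (t : R) : set R := `[t - d, t + d]%classic.
have cI : compact (I a.1.1 `*` I a.1.2 `*` I a.2).
  by apply: compact_setX; [apply: compact_setX|]; exact: segment_compact.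
apply: (subclosed_compact (@closed_closure _ _) cI).
rewrite [X in _ `<=` X](closure_id _).1; last exact: (compact_closed (@norm_hausdorff R (R3 R)) cI).
apply: closureS => x /=.
rewrite bump_neq0 normR3E /= !gt_max => /andP[/andP[h1 h2] h3].
by split; first split; rewrite /= /I /= in_itv /=; move: h1 h2 h3; rewrite !ltr_norml; lra.
Qed.

Definition bump a d : test R := Test (@bump_smooth a d) (@bump_support a d).

Lemma bump_ge0 a d x : 0 <= bump a d x.
Proof. by rewrite /= /bump_fun !mulr_ge0// flat_ge0. Qed.

Lemma bump_translate a d x : bump a d x = bump 0 d (x - a).
Proof. by rewrite /= /bump_fun /= !subr0. Qed.

(** Consequently the pairings of a function with all translates of one bump form the Fourier
    transform of that function times a fixed factor. *)
Lemma inv_fourier_bump a d xi :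
  inv_fourier_test (bump a d) xi = cis (dot a xi) * inv_fourier_test (bump 0 d) xi.
Proof.
rewrite !inv_fourier_testE mulrCA; congr (_ * _).
have i0 : cintegrable vol setT (fun x => (bump 0 d x)%:C * cis (dot x xi)).
  by have := cintegrable_cis xi (cintegrable_test (bump 0 d)); under eq_fun do rewrite dotC.
rewrite -cintegralZ//.
have m : cmeasurable (fun x => cis (dot a xi) * ((bump 0 d x)%:C * cis (dot x xi))).
  exact: cintegrable_cmeasurable (cintegrableZ _ i0).
rewrite -(preserving_cintegral (preserving_translation (- a)) m).
by apply: eq_cintegral => x; rewrite (bump_translate a) mulrCA -cisD -dotDl (addrC a) subrK.
Qed.

Lemma vol_cube a (r : R) : 0 <= r -> vol [set x | `|x - a| <= r] = ((2 * r) ^+ 3)%:E.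
Proof.
move=> r0; pose I (t : R) : set (measurableTypeR R) := `[t - r, t + r]%classic.
have -> : [set x | `|x - a| <= r] = I a.1.1 `*` I a.1.2 `*` I a.2.
  apply/seteqP; split=> x; rewrite /I /= normR3E /= !ge_max !ler_norml !in_itv/=.
    by move=> /andP[/andP[/andP[? ?] /andP[? ?]] /andP[? ?]]; split; first split; lra.
  by move=> [[/andP[? ?] /andP[? ?]] /andP[? ?]]; lra.
have mI t : measurable (I t) by exact: measurable_itv.
have lI t : lebesgue_measure (I t) = (2 * r)%:E.
  by rewrite lebesgue_measure_itv/= lte_fin; case: ifPn => [_|]; [congr (_%:E); lra|rewrite -leNgt => ?; congr (_%:E); lra].
have -> : vol (I a.1.1 `*` I a.1.2 `*` I a.2) =
    (lebesgue_measure (I a.1.1) * lebesgue_measure (I a.1.2) * lebesgue_measure (I a.2))%E.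
  by rewrite -product_measure1E// -product_measure1E//; exact: measurableX.
by rewrite !lI -!EFinM; congr (_%:E); ring.
Qed.

Lemma abs_dot_le x y : `|dot x y| <= 3 * (`|x| * `|y|).
Proof.
have h (s t : R) : `|s| <= `|x| -> `|t| <= `|y| -> `|s * t| <= `|x| * `|y|.
  by move=> *; rewrite normrM ler_pM.
have := h _ _ (norm_c1 x) (norm_c1 y); have := h _ _ (norm_c2 x) (norm_c2 y).
have := h _ _ (norm_c3 x) (norm_c3 y); rewrite /dot => h3 h2 h1.
rewrite (le_trans (ler_normD _ _))//.
have := ler_normD (x.1.1 * y.1.1) (x.1.2 * y.1.2); lra.
Qed.

Lemma measurable_cube a (r : R) : measurable [set x | `|x - a| <= r].
Proof.
have m := measurableT_comp measurable_norm3 (proj1 (preserving_translation (- a))).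
have := measurable_fun_ler m (@measurable_cst _ _ (R3 R) R setT r).
rewrite -[X in measurable X]setTI => h; exact: (h measurableT [set true]).
Qed.

(** On the support, [|dot x xi|] is at most [3 * d * (6 * d)^-1 = 1 / 2], so the cosine stays above
    [1 / 2] and the real part of the integral is positive. *)
Lemma inv_fourier_bump_neq0 d xi : 0 < d -> `|xi| <= (6 * d)^-1 ->
  inv_fourier_test (bump 0 d) xi != 0.
Proof.
move=> d0 xid; rewrite inv_fourier_testE mulf_neq0//.
  by apply/eqP => /(congr1 (@complex.Re R)) /= /eqP; rewrite gt_eqF// fourier_cst_gt0.
apply/eqP => /(congr1 (@complex.Re R)) /= /eqP; rewrite gt_eqF//.
have e x : bump 0 d x * cos (dot x xi) - 0 * sin (dot x xi) = bump 0 d x * cos (dot x xi).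
  by rewrite mul0r subr0.
under eq_Rintegral do rewrite e.
have cosge x : `|x| <= d -> 2^-1 <= cos (dot x xi).
  move=> xd; have := cos_lipschitz (dot x xi) 0; rewrite cos0 subr0 => h.
  have : `|dot x xi| <= 2^-1.
    rewrite (le_trans (abs_dot_le _ _))// (le_trans (y := 3 * (d * (6 * d)^-1)))//.
      by rewrite ler_wpM2l// ler_pM.
    have -> : d / (6 * d) = 6^-1 by field; rewrite gt_eqF.
    lra.
  by move: h; rewrite ler_norml => /andP[h1 h2]; lra.
have i : vol.-integrable setT (EFin \o (fun x => bump 0 d x * cos (dot x xi))).
  have [+ _] := cintegrable_cis xi (cintegrable_test (bump 0 d)).
  by under eq_fun do rewrite /= mul0r subr0 dotC.
have g0 x : 0 <= bump 0 d x * cos (dot x xi).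
  have [xd|dx] := ltP `|x| d.
    rewrite mulr_ge0 ?bump_ge0// (le_trans _ (cosge x (ltW xd)))//.
  have : bump_fun 0 d x == 0 by rewrite -[_ == _]negbK bump_neq0 subr0 -leNgt.
  by rewrite /= => /eqP ->; rewrite mul0r.
have v := vol_cube 0 (ltW (divr_gt0 d0 (ltr0Sn R 1))).
(* On the cube of half the size each of the six factors of the bump is at least
   [expR (- (d / 2)^-1)]; the last [2^-1] is the lower bound of the cosine. *)
pose c : R := expR (- (d / 2)^-1) ^+ 6 * 2^-1.
have := Rintegral_ge_set (measurable_cube 0 (d / 2)) v i g0 (c := c).
move=> h; apply: (lt_le_trans _ (h _)).
  have d2 : 0 < 2 * (d / 2) by lra.
  by rewrite mulr_gt0 ?(exprn_gt0 _ d2)// mulr_gt0 ?invr_gt0 ?ltr0n ?exprn_gt0 ?expR_gt0.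
move=> x /=; rewrite subr0 => xd.
have fl (t : R) : d / 2 <= t -> expR (- (d / 2)^-1) <= flat 0 t.
  move=> dt; have d20 : 0 < d / 2 by rewrite divr_gt0.
  rewrite /flat ifT; last by rewrite (lt_le_trans d20).
  rewrite expr0 mul1r ler_expR lerN2 lef_pV2 ?posrE// (lt_le_trans d20)//.
have E0 : 0 <= expR (- (d / 2)^-1) by exact: expR_ge0.
have f2 (t : R) : `|t| <= `|x| -> expR (- (d / 2)^-1) ^+ 2 <= flat 0 (d - (t - 0)) * flat 0 (d + (t - 0)).
  move=> tx; have : `|t| <= d / 2 by exact: le_trans xd.
  rewrite ler_norml => /andP[t1 t2]; rewrite subr0 expr2 ler_pM// fl//; lra.
rewrite /c ler_pM ?exprn_ge0//; last first.
  by apply: cosge; rewrite (le_trans xd)//; lra.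
rewrite /= /bump_fun -[6%N]/(2 + 2 + 2)%N !exprD.
have q0 : 0 <= expR (- (d / 2)^-1) ^+ 2 by exact: exprn_ge0.
apply: ler_pM; [exact: mulr_ge0|by []| |exact: (f2 _ (norm_c3 x))].
by apply: ler_pM; [by []|by []|exact: (f2 _ (norm_c1 x))|exact: (f2 _ (norm_c2 x))].
Qed.

End Bumps.

(** * Uniqueness of the Fourier transform *)

Section NullIntegrals.
Context {R : realType}.
Variable h : R3 R -> R.
Hypothesis ih : vol.-integrable setT (EFin \o h).

Definition null_on (E : set (R3 R)) := (\int[vol]_(x in E) (h x)%:E = 0)%E.

(** A Dynkin argument along one map [phi], within a fixed [E]. Applied to one coordinate after
    another, it replaces a generating family by all measurable sets. *)
Lemma null_on_dynkin d (T : measurableType d) (G : set (set T)) (phi : R3 R -> T)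
    (E : set (R3 R)) : measurable_fun setT phi -> measurable E ->
  @measurable _ T = <<s G >> -> setI_closed G -> null_on E ->
  (forall A, G A -> null_on (phi @^-1` A `&` E)) ->
  forall A, measurable A -> null_on (phi @^-1` A `&` E).
Proof.
move=> mphi mE GE GI nE nG A; rewrite GE.
have mA B : measurable B -> measurable (phi @^-1` B `&` E).
  by move=> mB; apply: measurableI => //; rewrite -[X in measurable X]setTI; exact: mphi.
apply: (@dynkin_induction _ T G (fun A => null_on (phi @^-1` A `&` E))) => //.
- by rewrite preimage_setT setTI.
- move=> B mB nB; have mB' := mA _ mB; have mB'' := mA _ (measurableC mB).
  have EU : E = (phi @^-1` B `&` E) `|` (phi @^-1` (~` B) `&` E).
    by rewrite -setIUl preimage_setC setUCr setTI.
  have := nE; rewrite /null_on {1}EU integral_setU//.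
  + by rewrite nB add0e.
  + by apply: measurable_funTS; exact: measurable_int ih.
  + by apply/disj_set2P; rewrite -setIIl preimage_setC setICr set0I.
move=> F mF tF nF.
have -> : phi @^-1` (\bigcup_k F k) `&` E = \bigcup_k (phi @^-1` (F k) `&` E).
  by rewrite preimage_bigcup setI_bigcupl.
rewrite /null_on integral_bigcup//.
- by apply: eseries0 => k _ _; exact: nF.
- move=> i j _ _ [x [[xi _] [xj _]]]; apply: (tF i j) => //; by exists (phi x).
- by move=> k; exact: mA.
- apply: (integrableS measurableT) => //; apply: bigcupT_measurable => k; exact: mA.
Qed.

(** Sets whose indicator is a pointwise limit of bounded Lipschitz functions. Vanishing of integrals
    against Lipschitz functions passes to them by dominated convergence, and the open rays among
    them generate the Borel sets. *)
Definition cutoff_approximable (B : set R) := measurable (B : set (measurableTypeR R)) /\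
  exists c : nat -> R -> R,
  [/\ forall n t, 0 <= c n t <= 1,
      forall n, exists L : R, forall s t, `|c n s - c n t| <= L * `|s - t|
    & forall t, c n t @[n --> \oo] --> (\1_B t : R)].

Lemma approximableT : cutoff_approximable setT.
Proof.
split=> //; exists (fun _ _ => 1); split=> [n t|n|t]; first by rewrite ler01 lexx.
  by exists 0 => s t; rewrite subrr normr0 mul0r.
by rewrite indicT; exact: cvg_cst.
Qed.

Lemma approximable_ray (a : R) : cutoff_approximable `]-oo, a[%classic.
Proof.
split; first exact: measurable_itv.
exists (fun n t => Num.min 1 (Num.max 0 (n%:R * (a - t)))); split.
- move=> n t; rewrite le_min ler01 ge_min lexx/= le_max lexx andbT//.
- move=> n; exists n%:R => s t.
  have n0 : 0 <= n%:R :> R by [].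
  have -> : `|s - t| = `|(a - s) - (a - t)| by rewrite -normrN; congr `|_|; ring.
  move: (a - s) (a - t) => u v.
  have : `|n%:R * u - n%:R * v| = n%:R * `|u - v| by rewrite -mulrBr normrM ger0_norm.
  move=> <-; move: (n%:R * u) (n%:R * v) => {}u {}v.
  rewrite /Num.min /Num.max.
  have h1 := ler_norm (u - v); have h2 := ler_norm (v - u); rewrite distrC in h2.
  by case: (ltP 0 u) => ?; case: (ltP 0 v) => ?; rewrite ?ltr10; case: (ltP 1 u) => ?; case: (ltP 1 v) => ?; rewrite ler_norml; lra.
move=> t; apply/cvgrPdist_le => e e0.
rewrite indicE mem_setE in_itv/=.
have [ta|at_] := ltP t a; last first.
  near=> n; rewrite max_l; last by rewrite mulr_ge0_le0// subr_le0.
  by rewrite min_r ?ler01// subrr normr0 ltW.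
near=> n; have h1 : 1 <= n%:R * (a - t).
  rewrite -ler_pdivrMr ?subr_gt0// mul1r; near: n; exact: nbhs_infty_ger.
by rewrite max_r ?(le_trans ler01)// min_l// subrr normr0 ltW.
Unshelve. all: end_near. Qed.

(** One factor of the box is released at a time, the others still being approximable; then
    rectangles give way to arbitrary sets, first in the plane and then in space. *)
Lemma null_on_measurable : null_on setT ->
  (forall B1 B2 B3, cutoff_approximable B1 -> cutoff_approximable B2 ->
    cutoff_approximable B3 -> null_on (B1 `*` B2 `*` B3)) ->
  forall E, measurable E -> null_on E.
Proof.
move=> nT n3.
have GI : setI_closed (@RGenInftyO.G R).
  move=> _ _ [a ->] [b ->]; exists (Num.min a b); apply/seteqP; split=> x /=; rewrite !in_itv/= lt_min.
    by move=> [-> ->].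
  by move/andP.
have mG := RGenInftyO.measurableE R.
have mapp B : RGenInftyO.G B -> cutoff_approximable B by move=> [a ->]; exact: approximable_ray.
have mX (A1 A2 A3 : set (measurableTypeR R)) : measurable A1 -> measurable A2 -> measurable A3 ->
    measurable (A1 `*` A2 `*` A3 : set (R3 R)).
  by move=> m1 m2 m3; apply: measurableX => //; exact: measurableX.
have mT : measurable (setT : set (measurableTypeR R)) by [].
have s1 (A1 : set (measurableTypeR R)) B2 B3 : measurable A1 -> cutoff_approximable B2 ->
    cutoff_approximable B3 -> null_on (A1 `*` B2 `*` B3).
  move=> m1 a2 a3.
  have E1 (A : set R) : A `*` B2 `*` B3 = ((fun x : R3 R => x.1.1) @^-1` A) `&` (setT `*` B2 `*` B3).
    by apply/seteqP; split=> x /=; [move=> [[? ?] ?]|move=> [? [[_ ?] ?]]].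
  rewrite E1; apply: (null_on_dynkin measurable_c1 _ mG GI) => //.
  - by apply: mX => //; [case: a2|case: a3].
  - by apply: n3 => //; exact: approximableT.
  - by move=> A /mapp a1; rewrite -E1; exact: n3.
have s2 (A1 A2 : set (measurableTypeR R)) B3 : measurable A1 -> measurable A2 ->
    cutoff_approximable B3 -> null_on (A1 `*` A2 `*` B3).
  move=> m1 m2 a3.
  have E1 (A : set R) : A1 `*` A `*` B3 = ((fun x : R3 R => x.1.2) @^-1` A) `&` (A1 `*` setT `*` B3).
    by apply/seteqP; split=> x /=; [move=> [[? ?] ?]|move=> [? [[? _] ?]]].
  rewrite E1; apply: (null_on_dynkin measurable_c2 _ mG GI) => //.
  - by apply: mX => //; case: a3.
  - by apply: s1 => //; exact: approximableT.
  - by move=> A /mapp a1; rewrite -E1; exact: s1.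
have s3 (A1 A2 A3 : set (measurableTypeR R)) : measurable A1 -> measurable A2 ->
    measurable A3 -> null_on (A1 `*` A2 `*` A3).
  move=> m1 m2 m3.
  have E1 (A : set R) : A1 `*` A2 `*` A = ((fun x : R3 R => x.2) @^-1` A) `&` (A1 `*` A2 `*` setT).
    by apply/seteqP; split=> x /=; [move=> [[? ?] ?]|move=> [? [[? ?] _]]].
  rewrite E1; apply: (null_on_dynkin measurable_c3 _ mG GI) => //.
  - exact: mX.
  - by apply: s2 => //; exact: approximableT.
  - by move=> A /mapp a1; rewrite -E1; exact: s2.
have XI (S1 S2 : Type) (M1 : set (set S1)) (M2 : set (set S2)) : setI_closed M1 -> setI_closed M2 ->
    setI_closed [set A `*` B | A in M1 & B in M2].
  move=> c1 c2 _ _ [A mA [B mB <-]] [A' mA' [B' mB' <-]].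
  by rewrite -setXI; exists (A `&` A'); [exact: c1|exists (B `&` B'); [exact: c2|]].
have s4 (A : set (measurableTypeR R * measurableTypeR R)) (A3 : set (measurableTypeR R)) :
    measurable A -> measurable A3 -> null_on (A `*` A3).
  move=> mA m3.
  have E1 (B : set (R * R)) : B `*` A3 = (fst @^-1` B) `&` ([set: R * R] `*` A3).
    by apply/seteqP; split=> x /=; [move=> [? ?]|move=> [? [_ ?]]].
  rewrite E1; apply: (null_on_dynkin measurable_fst _ (measurable_prod_measurableType _ _) (XI _ _ _ _ (@measurableI _ _) (@measurableI _ _))) => //.
  - exact: measurableX.
  - by rewrite -setXTT; exact: s3.
  - by move=> _ [A1 m1 [A2 m2 <-]]; rewrite -E1; exact: s3.
move=> E mE; rewrite (_ : E = id @^-1` E `&` setT); last by rewrite setIT.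
apply: (null_on_dynkin (@measurable_id _ _ setT) _ (measurable_prod_measurableType _ _) (XI _ _ _ _ (@measurableI _ _) (@measurableI _ _))) => //.
by move=> _ [A1 m1 [A2 m2 <-]]; rewrite setIT; exact: s4.
Qed.

End NullIntegrals.

Lemma measurable_funD3 (R : realType) d (T : measurableType d) (f g : T -> R3 R) :
  measurable_fun setT f -> measurable_fun setT g -> measurable_fun setT (fun t => f t + g t).
Proof.
move=> mf mg; have := measurable_funB3 mf (measurableT_comp (@measurable_opp3 R) mg).
by under eq_fun do rewrite /= opprK.
Qed.

(** * An integrable function whose Fourier transform vanishes is zero almost everywhere *)

Section GaussianSmoothing.
Context {R : realType}.
Variable H : R3 R -> R[i].
Hypothesis iH : cintegrable vol setT H.
Hypothesis H0 : forall a, cintegral vol setT (fun xi => H xi * cis (dot a xi)) = 0.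

(** [cintegral_gauss3_conv] is applied with parameter [(4 * p)^-1], for which the Gaussian on the
    other side has parameter [p]; the translation by [z] only multiplies the vanishing transform by
    a phase. *)
Lemma cintegral_gauss3_null p z : 0 < p ->
  cintegral vol setT (fun y => (gauss3 p y)%:C * H (y + z)) = 0.
Proof.
move=> p0; pose A y := H (y + z).
have iA : cintegrable vol setT A by exact: (preserving_cintegrable (preserving_translation z) iH).
have q0 : 0 < (4 * p)^-1 by rewrite invr_gt0 mulr_gt0.
have := cintegral_gauss3_conv 0 iA q0.
have A0 y : cintegral vol setT (fun h => A h * cis (dot y h)) = 0.
  have m : cmeasurable (fun x => cis (- dot y z) * (H x * cis (dot y x))).
    exact: cintegrable_cmeasurable (cintegrableZ _ (cintegrable_cis _ iH)).
  have := preserving_cintegral (preserving_translation z) m.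
  rewrite [X in _ = X]cintegralZ ?H0 ?mulr0; last exact: cintegrable_cis.
  move=> <-; apply: eq_cintegral => x.
  by rewrite dotDr cisD mulrCA [cis (- _) * _]mulrC -mulrA -cisD subrr cis0 mulr1.
rewrite (eq_cintegral _ (g := fun=> 0)); last by move=> y; rewrite A0 mulr0.
have -> : (4 * (4 * p)^-1)^-1 = p by field; rewrite gt_eqF.
set C := Num.sqrt _ ^+ 3 => E.
have C0 : C%:C != 0.
  by apply/eqP => /(congr1 (@complex.Re R)) /= /eqP; rewrite gt_eqF// exprn_gt0// sqrtr_gt0 divr_gt0// pi_gt0.
have ig : cintegrable vol setT (fun h => (gauss3 p h)%:C * A h).
  apply: (cintegrable_bound _ (cintegrable_normc iA)).
    by apply: cmeasurableM; [exact: (cmeasurable_real (measurable_gauss3 p))|exact: (cintegrable_cmeasurable iA)].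
  move=> h; rewrite normcM normc_real ger0_norm ?gauss3_ge0// ler_piMl ?normc_ge0// gauss3_le1// ltW//.
apply: (mulfI C0); rewrite mulr0 -cintegralZ//.
transitivity (cintegral vol [set: R3 R] (fun=> 0 : R[i])).
  rewrite E; apply: eq_cintegral => h.
  have -> : dot 0 h = 0 by rewrite /dot /= !mul0r !addr0.
  by rewrite cis0 mulr1 (realCM C) -mulrA.
rewrite /cintegral /= /Rintegral integral0; exact: complex_eqP.
Qed.

(** The first moment of a concentrated Gaussian is small: [|y| <= e + dot y y / e], and half of the
    exponent absorbs the quadratic term, leaving the factor [2 / (p * e)]. *)
Lemma norm_gauss3_le (e p : R) (y : R3 R) : 0 < e -> 0 < p ->
  `|y| * gauss3 p y <= e * gauss3 p y + 2 / (p * e) * gauss3 (p / 2) y.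
Proof.
move=> e0 p0; have d0 := dot_ge0 y.
have yd : `|y| ^+ 2 <= dot y y by rewrite -sqr_eucl ler_pXn2r ?nnegrE ?eucl_ge0// norm_le_eucl.
have h1 : `|y| <= e + dot y y / e.
  have [le|/ltW le] := leP `|y| e; first by rewrite (le_trans le)// lerDl divr_ge0// ltW.
  rewrite (le_trans (y := dot y y / e))//; last by rewrite lerDr ltW.
  by rewrite ler_pdivlMr// (le_trans _ yd)// expr2 ler_wpM2l.
rewrite (le_trans (ler_wpM2r (gauss3_ge0 p y) h1))// mulrDl lerD2l.
rewrite !gauss3E; set D := dot y y in d0 *.
have -> : expR (- (p * D)) = expR (- (p / 2 * D)) / expR (p / 2 * D).
  by rewrite -expRN -expRD; congr expR; field.
have h2 := expR_ge1Dx (p / 2 * D).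
rewrite mulrCA mulrC ler_wpM2r ?expR_ge0// ler_pdivrMr ?expR_gt0//.
apply: (le_trans (y := 2 / (p * e) * (p / 2 * D))).
  by rewrite le_eqVlt; apply/orP; left; apply/eqP; field; rewrite !gt_eqF.
by rewrite ler_wpM2l ?divr_ge0 ?mulr_ge0 ?(ltW p0) ?(ltW e0)//; lra.
Qed.

(** [K y] integrates [H] against [chi] shifted by [y]. Its Gaussian averages vanish by Fubini and
    [cintegral_gauss3_null], while [K] is Lipschitz; as the Gaussian concentrates, [K 0] is forced
    to vanish. *)
Lemma cintegral_lipschitz_null (chi : R3 R -> R) (L : R) : measurable_fun setT chi -> 0 <= L ->
  (forall x, `|chi x| <= 1) -> (forall x y, `|chi x - chi y| <= L * `|x - y|) ->
  cintegral vol setT (fun xi => (chi xi)%:C * H xi) = 0.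
Proof.
move=> mchi L0 c1 cL.
have mH := cintegrable_cmeasurable iH.
have nH := cintegrable_normc iH.
set N := Rintegral vol setT (fun x => normc (H x)).
have N0 : 0 <= N by apply: Rintegral_ge0 => x _; exact: normc_ge0.
pose K (y : R3 R) := cintegral vol setT (fun x : R3 R => (chi (x + y))%:C * H x).
have mT (y : R3 R) : measurable_fun setT (fun x : R3 R => chi (x + y)).
  exact: (measurableT_comp mchi (proj1 (preserving_translation y))).
have iK (y : R3 R) : cintegrable vol setT (fun x : R3 R => (chi (x + y))%:C * H x).
  apply: (cintegrable_bound _ nH); first by apply: cmeasurableM => //; exact: cmeasurable_real.
  by move=> x; rewrite normcM normc_real ler_piMl ?normc_ge0.
have KL (y : R3 R) : normc (K 0 - K y) <= 2 * (L * `|y| * N).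
  rewrite -cintegralB// /N -RintegralZl//.
  apply: normc_cintegral; [exact: cintegrableB|exact: (integrableZl measurableT _ nH)|].
  move=> x; rewrite -mulrBl normcM ler_wpM2r ?normc_ge0//.
  have -> : (chi (x + 0))%:C - (chi (x + y))%:C = (chi (x + 0) - chi (x + y))%:C.
    by apply: complex_eqP; rewrite /= ?subr0.
  by rewrite normc_real (le_trans (cL _ _))// addr0 opprD addrA subrr add0r normrN.
have mg (p : R) : cmeasurable (fun y : R3 R => (gauss3 p y)%:C) by exact: (cmeasurable_real (measurable_gauss3 p)).
have ig (p : R) : 0 < p -> cintegrable vol setT (fun y : R3 R => (gauss3 p y)%:C).
  move=> p0; apply: (cintegrable_bound (mg p) (integrable_gauss3 p0)) => y.
  by rewrite normc_real ger0_norm ?gauss3_ge0.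
have i2 (p : R) : 0 < p -> cintegrable (vol \x vol)%E setT
    (fun z : R3 R * R3 R => (chi z.2)%:C * ((gauss3 p z.1)%:C * H (z.2 - z.1))).
  move=> p0; have i := cintegrable_prod_shift (ig _ p0) iH.
  apply: (cintegrable_bound _ (cintegrable_normc i)).
    apply: cmeasurableM; last exact: cintegrable_cmeasurable i.
    exact: (cmeasurable_comp (cmeasurable_real mchi) measurable_snd).
  by move=> z; rewrite normcM normc_real ler_piMl ?normc_ge0.
have EK (p : R) : 0 < p -> cintegral vol setT (fun y => (gauss3 p y)%:C * K y) = 0.
  move=> p0; transitivity (cintegral vol setT (fun y => cintegral vol setT
      (fun x : R3 R => (chi x)%:C * ((gauss3 p y)%:C * H (x - y))))).
    apply: eq_cintegral => y; rewrite -cintegralZ//.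
    have m : cmeasurable (fun x : R3 R => (chi x)%:C * ((gauss3 p y)%:C * H (x - y))).
      exact: (cmeasurable_pairl y (cintegrable_cmeasurable (i2 _ p0))).
    rewrite -(preserving_cintegral (preserving_translation y) m).
    by apply: eq_cintegral => x; rewrite addrK mulrCA.
  rewrite (cfubini (i2 _ p0)); transitivity (cintegral vol [set: R3 R] (fun=> 0 : R[i])).
    apply: eq_cintegral => x /=.
    have i : cintegrable vol setT (fun y : R3 R => (gauss3 p y)%:C * H (x - y)).
      apply: (@cintegrable_bound _ _ _ vol _ (fun y : R3 R => normc (H ((x : R3 R) - y)))).
      - apply: cmeasurableM => //; apply: (cmeasurable_comp mH).
        by apply: measurable_funB3 => //; exact: measurable_cst.
      - have nH' := preserving_integrable (preserving_translation x) nH.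
        have := preserving_integrable preserving_reflection nH'.
        by under eq_fun do rewrite addrC.
      - by move=> y; rewrite normcM normc_real ger0_norm ?gauss3_ge0// ler_piMl ?normc_ge0// gauss3_le1// ltW.
    rewrite cintegralZ//; apply/eqP; rewrite mulf_eq0; apply/orP; right; apply/eqP.
    rewrite -(preserving_cintegral preserving_reflection (cintegrable_cmeasurable i)).
    rewrite -[RHS](cintegral_gauss3_null x p0); apply: eq_cintegral => y.
    by rewrite gauss3N opprK addrC.
  rewrite /cintegral /= /Rintegral integral0; exact: complex_eqP.
have mK : cmeasurable K.
  apply: (@cmeasurable_cintegral _ _ (R3 R) (R3 R) R vol (fun z => (chi (z.2 + z.1))%:C * H z.2)).
  apply: cmeasurableM; last exact: (cmeasurable_comp mH measurable_snd).
  apply: cmeasurable_real; apply: (measurableT_comp mchi).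
  exact: (measurable_funD3 measurable_snd measurable_fst).
have K0 (e : R) : 0 < e -> normc (K 0) <= 2 * (2 * L * N) * (2 * e).
  (* With this [p] one has [2 / (p * e) * 8 = e], so both terms of the moment bound are at most [e]
     times the Gaussian mass; 8 is a rough bound for the factor [2 ^ (3 / 2)] by which halving [p]
     increases that mass. *)
  move=> e0; pose p := 16 / e ^+ 2.
  have p0 : 0 < p by rewrite divr_gt0// exprn_gt0.
  have p20 : 0 < p / 2 by rewrite divr_gt0.
  pose G := Rintegral vol setT (gauss3 p).
  have GE : G = Num.sqrt (pi / p) ^+ 3 by rewrite /G /Rintegral integral_gauss3.
  have G0 : 0 < G by rewrite GE exprn_gt0// sqrtr_gt0 divr_gt0// pi_gt0.
  have G2 : Rintegral vol setT (gauss3 (p / 2)) <= 8 * G.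
    have -> : 8 * G = (2 * Num.sqrt (pi / p)) ^+ 3 by rewrite GE exprMn; congr (_ * _); ring.
    rewrite /Rintegral integral_gauss3//= lerXn2r ?nnegrE ?mulr_ge0 ?sqrtr_ge0//.
    have {1}-> : pi / (p / 2) = 2 * (pi / p) by field; rewrite gt_eqF.
    have pp : 0 <= pi / p by rewrite divr_ge0 ?pi_ge0 ?ltW.
    have -> : 2 * Num.sqrt (pi / p) = Num.sqrt (2 ^+ 2 * (pi / p)).
      by rewrite [RHS]sqrtrM ?sqrtr_sqr ?ger0_norm.
    rewrite ler_sqrt; last by rewrite mulr_ge0// exprn_ge0.
    by move: pp; move: (pi / p) => u u0; rewrite expr2; lra.
  have ib : vol.-integrable setT (EFin \o (fun y => 2 * L * N * (e * gauss3 p y + 2 / (p * e) * gauss3 (p / 2) y))).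
    apply: (integrableZl measurableT (2 * L * N) (f := fun y => (e * gauss3 p y + 2 / (p * e) * gauss3 (p / 2) y)%:E)).
    under eq_fun do rewrite EFinD.
    apply: integrableD => //.
      exact: (integrableZl measurableT _ (integrable_gauss3 p0)).
    exact: (integrableZl measurableT _ (integrable_gauss3 p20)).
  have le y : normc ((gauss3 p y)%:C * (K 0 - K y)) <=
      2 * L * N * (e * gauss3 p y + 2 / (p * e) * gauss3 (p / 2) y).
    rewrite normcM normc_real ger0_norm ?gauss3_ge0//.
    rewrite (le_trans (ler_wpM2l (gauss3_ge0 p y) (KL y)))//.
    rewrite [leLHS](_ : _ = 2 * L * N * (`|y| * gauss3 p y)); last by ring.
    by rewrite ler_wpM2l ?norm_gauss3_le// !mulr_ge0.
  have iD : cintegrable vol setT (fun y => (gauss3 p y)%:C * (K 0 - K y)).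
    apply: (cintegrable_bound _ ib).
      by apply: cmeasurableM => //; apply: cmeasurableB => //; exact: cmeasurable_cst.
    exact: le.
  have : normc (cintegral vol setT (fun y => (gauss3 p y)%:C * (K 0 - K y))) <=
      2 * Rintegral vol setT (fun y => 2 * L * N * (e * gauss3 p y + 2 / (p * e) * gauss3 (p / 2) y)).
    exact: normc_cintegral.
  have iG0 : cintegrable vol setT (fun y => (gauss3 p y)%:C * K 0).
    by under eq_fun do rewrite mulrC; apply: cintegrableZ; exact: ig.
  have -> : cintegral vol setT (fun y => (gauss3 p y)%:C * (K 0 - K y)) = G%:C * K 0.
    apply/eqP; rewrite -subr_eq0 -opprB oppr_eq0; apply/eqP.
    rewrite -[RHS](EK _ p0) -cintegral_real -cintegralZr; last exact: ig.
    rewrite -cintegralB//; apply: eq_cintegral => y; ring.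
  have i1 : vol.-integrable setT (EFin \o (fun y => e * gauss3 p y)).
    exact: (integrableZl measurableT _ (integrable_gauss3 p0)).
  have i3 : vol.-integrable setT (EFin \o (fun y => 2 / (p * e) * gauss3 (p / 2) y)).
    exact: (integrableZl measurableT _ (integrable_gauss3 p20)).
  have i4 : vol.-integrable setT (EFin \o (fun y => e * gauss3 p y + 2 / (p * e) * gauss3 (p / 2) y)).
    rewrite /comp; under eq_fun do rewrite EFinD; exact: integrableD.
  rewrite normcM normc_real ger0_norm ?(ltW G0)// RintegralZl//.
  rewrite (RintegralD measurableT i1 i3) (RintegralZl e measurableT (integrable_gauss3 p0)) (RintegralZl _ measurableT (integrable_gauss3 p20)).
  rewrite -/G => h; rewrite -(ler_pM2l G0) (le_trans h)//.
  rewrite [leRHS](_ : _ = 2 * (2 * L * N * (e * G + e * G))); last by ring.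
  apply: ler_wpM2l => //; apply: ler_wpM2l; first by rewrite !mulr_ge0.
  rewrite lerD2l.
  have pe : 0 <= 2 / (p * e) by apply: divr_ge0 => //; apply: mulr_ge0; exact: ltW.
  rewrite (le_trans (ler_wpM2l pe G2))//.
  by rewrite le_eqVlt; apply/orP; left; apply/eqP; rewrite /p; field; rewrite gt_eqF.
have : K 0 = 0.
  apply: eq0_normc; apply/eqP; rewrite eq_le normc_ge0 andbT; apply/ler_addgt0Pl => e e0.
  rewrite addr0; have A0 : 0 < 2 * (2 * L * N) * 2 + 1 by rewrite ltr_pwDr// !mulr_ge0.
  have := K0 _ (divr_gt0 e0 A0); move/le_trans; apply.
  move: A0; set A := 2 * (2 * L * N) => A0.
  by rewrite (mulrA A) (mulrA (A * 2)) ler_pdivrMr// mulrC ler_wpM2l ?(ltW e0)// lerDl.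
by rewrite /K; under eq_cintegral do rewrite addr0.
Qed.

(** Products of one-variable cutoffs are bounded and Lipschitz, and they converge to the indicator
    of the box; the limit is taken by dominated convergence with majorant [|h|]. *)
Lemma null_on_boxes (h : R3 R -> R) (B1 B2 B3 : set R) :
  (h = (fun x => complex.Re (H x)) \/ h = (fun x => complex.Im (H x))) ->
  cutoff_approximable B1 -> cutoff_approximable B2 -> cutoff_approximable B3 ->
  null_on h (B1 `*` B2 `*` B3).
Proof.
move=> hH [m1 [c1 [b1 l1 v1]]] [m2 [c2 [b2 l2 v2]]] [m3 [c3 [b3 l3 v3]]].
have ih : vol.-integrable setT (EFin \o h) by case: iH => i1 i2; case: hH => ->.
pose chi n (x : R3 R) := c1 n x.1.1 * c2 n x.1.2 * c3 n x.2.
have nb (c : nat -> R -> R) : (forall n t, 0 <= c n t <= 1) -> forall n t, `|c n t| <= 1.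
  by move=> b n t; have /andP[t0 t1] := b n t; rewrite ger0_norm.
have lip (c : nat -> R -> R) : (forall n, exists L : R, forall s t, `|c n s - c n t| <= L * `|s - t|) ->
    forall n, exists2 L : R, 0 <= L & forall s t, `|c n s - c n t| <= L * `|s - t|.
  move=> l n; have [L hL] := l n; exists `|L| => // s t.
  by rewrite (le_trans (hL s t))// ler_wpM2r// ler_norm.
have mc (c : nat -> R -> R) n : (forall n, exists L : R, forall s t, `|c n s - c n t| <= L * `|s - t|) ->
    measurable_fun setT (c n : measurableTypeR R -> R).
  move=> /lip /(_ n)[L L0 hL]; apply: continuous_measurable_fun => t.
  have L1 : 0 < L + 1 by rewrite ltr_wpDl.
  apply/cvgrPdist_le => e e0; have e1 : 0 < (L + 1)^-1 * e by rewrite mulr_gt0 ?invr_gt0.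
  near=> s; rewrite (le_trans (hL t s))//.
  rewrite (le_trans (y := (L + 1) * `|t - s|))//; first by rewrite ler_wpM2r// lerDl.
  rewrite -ler_pdivlMl//; near: s; exact: (cvgr_dist_le (@cvg_id _ (t : R)) e1).
have mchi n : measurable_fun setT (chi n).
  by apply: measurable_funM; [apply: measurable_funM|];
    [exact: (measurableT_comp (mc _ _ l1) measurable_c1)|exact: (measurableT_comp (mc _ _ l2) measurable_c2)|
     exact: (measurableT_comp (mc _ _ l3) measurable_c3)].
have chi1 n x : `|chi n x| <= 1.
  by rewrite /chi !normrM !mulr_ile1// nb.
have chiL n : exists2 L : R, 0 <= L & forall x y, `|chi n x - chi n y| <= L * `|x - y|.
  have [L1 L10 h1] := lip _ l1 n; have [L2 L20 h2] := lip _ l2 n; have [L3 L30 h3] := lip _ l3 n.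
  exists (L1 + L2 + L3) => [|x y]; first by rewrite !addr_ge0.
  have -> : chi n x - chi n y = (c1 n x.1.1 - c1 n y.1.1) * (c2 n x.1.2 * c3 n x.2) +
    (c2 n x.1.2 - c2 n y.1.2) * (c1 n y.1.1 * c3 n x.2) +
    (c3 n x.2 - c3 n y.2) * (c1 n y.1.1 * c2 n y.1.2) by rewrite /chi; ring.
  have P (L a b u v : R) : 0 <= L -> `|a| <= L * `|b| -> `|b| <= `|x - y| -> `|u| <= 1 -> `|v| <= 1 ->
      `|a * (u * v)| <= L * `|x - y|.
    move=> L0 ab bxy u1 v1'; rewrite normrM (le_trans (ler_piMr _ _))// ?normrM ?mulr_ile1//.
    by rewrite (le_trans ab)// ler_wpM2l.
  have H1 : `|(c1 n x.1.1 - c1 n y.1.1) * (c2 n x.1.2 * c3 n x.2)| <= L1 * `|x - y|.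
    by apply: (P _ _ (x.1.1 - y.1.1)) => //; rewrite ?nb// ?h1// (norm_c1 (x - y)).
  have H2 : `|(c2 n x.1.2 - c2 n y.1.2) * (c1 n y.1.1 * c3 n x.2)| <= L2 * `|x - y|.
    by apply: (P _ _ (x.1.2 - y.1.2)) => //; rewrite ?nb// ?h2// (norm_c2 (x - y)).
  have H3 : `|(c3 n x.2 - c3 n y.2) * (c1 n y.1.1 * c2 n y.1.2)| <= L3 * `|x - y|.
    by apply: (P _ _ (x.2 - y.2)) => //; rewrite ?nb// ?h3// (norm_c3 (x - y)).
  rewrite (mulrDl (L1 + L2)) (mulrDl L1) (le_trans (ler_normD _ _))// lerD//.
  by rewrite (le_trans (ler_normD _ _))// lerD.
have chi0 n : (\int[vol]_x (chi n x * h x)%:E = 0)%E.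
  have [L L0 hL] := chiL n.
  have := cintegral_lipschitz_null (mchi n) L0 (chi1 n) hL.
  have ic : vol.-integrable setT (EFin \o (fun x => chi n x * h x)).
    apply: (integrable_bound _ (integrable_norm ih)).
      by apply: measurable_funM => //; apply/measurable_EFinP; exact: measurable_int ih.
    by move=> x; rewrite normrM ler_piMl.
  move=> E; rewrite -(fineK (integrable_fin_num measurableT ic)); congr (_%:E).
  rewrite -/(Rintegral vol setT (fun x => chi n x * h x)).
  case: hH => hE.
    transitivity (complex.Re (cintegral vol setT (fun x => (chi n x)%:C * H x))); last by rewrite E.
    by rewrite hE /cintegral [RHS]/=; apply: eq_Rintegral => x _; rewrite ReM /= mul0r subr0.
  transitivity (complex.Im (cintegral vol setT (fun x => (chi n x)%:C * H x))); last by rewrite E.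
  by rewrite hE /cintegral [RHS]/=; apply: eq_Rintegral => x _; rewrite ImM /= mul0r addr0.
rewrite /null_on integral_mkcond.
have mB : measurable (B1 `*` B2 `*` B3 : set (R3 R)).
  by apply: measurableX => //; exact: measurableX.
have mh : measurable_fun setT h by apply/measurable_EFinP; exact: measurable_int ih.
have hB x : ((EFin \o h) \_ (B1 `*` B2 `*` B3)) x = (\1_B1 x.1.1 * \1_B2 x.1.2 * \1_B3 x.2 * h x)%:E.
  rewrite patchE !indicE; case: ifPn => [/set_mem[[/= b1' b2'] b3']|/negP nb'].
    by rewrite !mem_set// !mul1r.
  have [b1'|b1'] := boolP (x.1.1 \in B1); last by rewrite !mul0r.
  have [b2'|b2'] := boolP (x.1.2 \in B2); last by rewrite mulr0 !mul0r.
  have [b3'|b3'] := boolP (x.2 \in B3); last by rewrite mulr0 !mul0r.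
  by case: nb'; apply/mem_set; split; [split|]; exact: set_mem.
have [|||||_ _] := @dominated_convergence _ _ _ vol setT measurableT (fun n x => (chi n x * h x)%:E)
  ((EFin \o h) \_ (B1 `*` B2 `*` B3)) (fun x => `|h x|%:E).
- by move=> n; apply/measurable_EFinP; exact: measurable_funM.
- by apply/(measurable_restrictT _ mB); apply: measurable_funTS; exact/measurable_EFinP.
- apply: aeW => x _; rewrite hB; apply: cvg_EFin; first exact: nearW.
  apply: cvgM; last exact: cvg_cst.
  by apply: cvgM; [apply: cvgM; [exact: v1|exact: v2]|exact: v3].
- exact: (integrable_norm ih).
- apply: aeW => x n _; rewrite lee_fin normrM ler_piMl//.
under eq_fun do rewrite chi0; move=> lim.
by rewrite -(cvg_lim (@ereal_hausdorff R) lim); exact: lim_cst.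
Unshelve. all: end_near. Qed.

Lemma ae_null : {ae vol, forall x, H x = 0}.
Proof.
have n0 (h : R3 R -> R) : (h = (fun x => complex.Re (H x)) \/ h = (fun x => complex.Im (H x))) ->
    ae_eq vol setT (EFin \o h) (fun=> 0).
  move=> hH; have ih : vol.-integrable setT (EFin \o h) by case: iH => i1 i2; case: hH => ->.
  apply: (integral_ae_eq measurableT ih (@measurable_cst _ _ _ _ _ _)).
  move=> E _ mE; rewrite integral0; apply: (null_on_measurable ih) => //; last first.
    by move=> B1 B2 B3; exact: null_on_boxes.
  by rewrite -setXTT -setXTT; apply: null_on_boxes => //; exact: approximableT.
apply: filterS2 (n0 _ (or_introl erefl)) (n0 _ (or_intror erefl)) => x /= h1 h2.
by apply: complex_eqP; [have [] := h1 I|have [] := h2 I].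
Qed.

End GaussianSmoothing.

(** * Sobolev norms and uniqueness of the Fourier representative *)

Section WeightedNorms.
Context {R : realType}.
Implicit Types (F G : R3 R -> R[i]) (x xi : R3 R) (s k : R) (S : distr R).

Definition sobw s xi : R := (1 + eucl xi ^+ 2) `^ s.

(** The square of the weighted norm, kept apart because integral estimates are easier before the
    root is taken. *)
Definition sqint s F : \bar R := (\int[vol]_xi (sobw s xi * normc (F xi) ^+ 2)%:E)%E.

Lemma one_le_sob xi : 1 <= 1 + eucl xi ^+ 2.
Proof. by rewrite lerDl sqr_ge0. Qed.

Lemma sobw_gt0 s xi : 0 < sobw s xi.
Proof. by rewrite powR_gt0// (lt_le_trans ltr01)// one_le_sob. Qed.

Lemma sobwN s xi : sobw (- s) xi = (sobw s xi)^-1.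
Proof. by rewrite /sobw powRN. Qed.

Lemma measurable_sobw s : measurable_fun setT (sobw s).
Proof.
rewrite /sobw; under eq_fun do rewrite sqr_eucl.
apply: (measurableT_comp (measurable_powR s)).
apply: measurable_funD; first exact: measurable_cst.
exact: (measurable_dot (@measurable_id _ _ _) (@measurable_id _ _ _)).
Qed.

Lemma sobw_le s : exists n : nat, forall xi, sobw s xi <= 4 ^+ n * (1 + `|xi|) ^+ (2 * n).
Proof.
have [n sn] : exists n : nat, s <= n%:R.
  exists (Num.truncn `|s|).+1; rewrite (le_trans (ler_norm s))// ltW//.
  by rewrite truncnS_gt.
exists n => xi; rewrite (le_trans (ler_powR (one_le_sob xi) sn))//.
have w0 := le_trans ler01 (one_le_sob xi); rewrite powR_mulrn// exprM -exprMn.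
have q0 : 0 <= 4 * (1 + `|xi|) ^+ 2 by apply: mulr_ge0 => //; apply: exprn_ge0; exact: ltW (norm1_gt0 xi).
apply: lerXn2r => //; rewrite ?nnegrE//.
have := eucl_le xi; have := eucl_ge0 xi; have := normr_ge0 xi => n0 e0 e1.
have : eucl xi ^+ 2 <= (2 * `|xi|) ^+ 2 by rewrite lerXn2r ?nnegrE ?mulr_ge0.
by rewrite exprMn !expr2; nra.
Qed.

Lemma weighted_L2_normE s F : weighted_L2_norm s F = (sqint s F `^ 2^-1)%E.
Proof.
transitivity ((\int[vol]_xi (`|(sobw (s / 2) xi * normc (F xi))%:E| `^ 2)) `^ 2^-1)%E.
  by rewrite /weighted_L2_norm unlock.
congr (_ `^ _)%E; apply: eq_integral => xi _; rewrite abse_EFin poweR_EFin; congr (_%:E).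
rewrite powR_mulrn// real_normK ?num_real//.
rewrite exprMn; congr (_ * _); rewrite -powR_mulrn ?powR_ge0// -powRrM.
by congr (_ `^ _); field.
Qed.

Lemma sqint_ge0 s F : (0 <= sqint s F)%E.
Proof. by apply: integral_ge0 => xi _; rewrite lee_fin mulr_ge0 ?(ltW (sobw_gt0 _ _))// sqr_ge0. Qed.

Lemma weighted_L2_norm_ge0 s F : (0 <= weighted_L2_norm s F)%E.
Proof. by rewrite weighted_L2_normE poweR_ge0. Qed.

Lemma weighted_L2_norm_le s F (m : R) : 0 <= m ->
  (weighted_L2_norm s F <= m%:E)%E = (sqint s F <= (m ^+ 2)%:E)%E.
Proof.
move=> m0; have := sqint_ge0 s F; rewrite weighted_L2_normE.
case: (sqint s F) => [a|_|//]; last first.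
  by rewrite poweRyr ?invr_neq0// !leye_eq.
rewrite lee_fin => a0; have -> : (a%:E `^ 2^-1)%E = (Num.sqrt a)%:E by rewrite /= powR12_sqrt.
rewrite !lee_fin.
apply/idP/idP => h.
  by rewrite -(sqr_sqrtr a0) lerXn2r ?nnegrE// sqrtr_ge0.
by rewrite -(ger0_norm m0) -sqrtr_sqr ler_sqrt// sqr_ge0.
Qed.

Lemma eq_ae_sqint s F G : cmeasurable F -> cmeasurable G -> {ae vol, forall x, F x = G x} ->
  sqint s F = sqint s G.
Proof.
have mm H : cmeasurable H -> measurable_fun setT (fun xi => (sobw s xi * normc (H xi) ^+ 2)%:E).
  move=> mH; apply/measurable_EFinP; apply: measurable_funM; first exact: measurable_sobw.
  by apply: measurable_funX; exact: measurable_normc.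
move=> mF mG FG; apply: ae_eq_integral => //; [exact: mm|exact: mm|].
by apply: filterS FG => x -> _.
Qed.

Lemma test_sobw_wgt s (eta : test R) : exists2 M : R, 0 <= M &
  forall xi, sobw s xi * normc (inv_fourier_test eta xi) ^+ 2 <= M * wgt xi.
Proof.
(* After squaring, [2 * n] of the powers compensate the Sobolev weight and the remaining six produce
   [wgt]. *)
have [n hn] := sobw_le s; have [M M0 hM] := test_decay (n + 3)%N eta.
exists (4 ^+ n * M ^+ 2) => [|xi]; first by rewrite mulr_ge0 ?exprn_ge0.
set N := normc _; have N0 : 0 <= N by exact: normc_ge0.
rewrite /wgt ler_pdivlMr ?exprn_gt0 ?norm1_gt0//.
have B0 := norm1_gt0 xi; set B := 1 + `|xi| in B0.
have sN : 0 <= N ^+ 2 * B ^+ 6 by rewrite mulr_ge0 ?exprn_ge0// ltW.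
rewrite -mulrA (le_trans (ler_wpM2r sN (hn xi)))// -/B -!mulrA ler_wpM2l ?exprn_ge0//.
rewrite [leLHS](_ : _ = (B ^+ (n + 3) * N) ^+ 2).
  by rewrite lerXn2r ?nnegrE ?mulr_ge0 ?exprn_ge0 ?hM// ltW.
have -> : (B ^+ (n + 3) * N) ^+ 2 = B ^+ (2 * n + 6) * N ^+ 2.
  by rewrite exprMn -exprM mulnDl (mulnC n).
by rewrite exprD; ring.
Qed.

Lemma measurable_sqint s F : cmeasurable F ->
  measurable_fun setT (fun xi => sobw s xi * normc (F xi) ^+ 2).
Proof.
move=> mF; apply: measurable_funM; first exact: measurable_sobw.
by apply: measurable_funX; exact: measurable_normc.
Qed.

Lemma integrable_sqint s F : cmeasurable F -> (sqint s F < +oo)%E ->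
  vol.-integrable setT (EFin \o (fun xi => sobw s xi * normc (F xi) ^+ 2)).
Proof.
move=> mF fin; apply/integrableP; split; first by apply/measurable_EFinP; exact: measurable_sqint.
rewrite (eq_integral (fun xi => (sobw s xi * normc (F xi) ^+ 2)%:E)) => [//|xi _].
by rewrite /= ger0_norm// mulr_ge0 ?sqr_ge0// ltW// sobw_gt0.
Qed.

Lemma cmeasurable_inv_fourier (eta : test R) : cmeasurable (inv_fourier_test eta).
Proof.
have := cmeasurable_ift (cmeasurable_real (measurable_test eta)).
have -> : inv_fourier_test eta = ift (fun x => (eta x)%:C); last by [].
apply/funext => xi; rewrite inv_fourier_testE /ift.
by under eq_cintegral do rewrite dotC.
Qed.

(** Cauchy-Schwarz in the form of a weighted inequality [a * b <= t * a ^+ 2 + t^-1 * b ^+ 2]. The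
    choice [t = w / m] balances the two terms, each integrating to a multiple of [m]. *)
Lemma pairing_bound s (eta : test R) : exists2 C : R, 0 <= C & forall F (m : R),
  cmeasurable F -> 0 < m -> (sqint s F <= (m ^+ 2)%:E)%E ->
  cintegrable vol setT (fun xi => F xi * inv_fourier_test eta xi) /\
  normc (cintegral vol setT (fun xi => F xi * inv_fourier_test eta xi)) <= C * m.
Proof.
have [M M0 hM] := test_sobw_wgt (- s) eta.
pose W := Rintegral vol setT (@wgt R).
have W0 : 0 <= W by apply: Rintegral_ge0 => x _; exact: wgt_ge0.
exists (2 * (1 + M * W)) => [|F m mF m0 Fm]; first by rewrite mulr_ge0// addr_ge0// mulr_ge0.
have fin : (sqint s F < +oo)%E by rewrite (le_lt_trans Fm)// ltry.
have i1 := integrable_sqint mF fin.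
have le xi : normc (F xi * inv_fourier_test eta xi) <=
    m^-1 * (sobw s xi * normc (F xi) ^+ 2) + m * M * wgt xi.
  rewrite normcM; set a := normc _; set b := normc _.
  have a0 : 0 <= a by exact: normc_ge0.
  have b0 : 0 <= b by exact: normc_ge0.
  have w0 := sobw_gt0 s xi; set w := sobw s xi in w0.
  have h := hM xi; rewrite sobwN -/w -/b in h.
  rewrite (le_trans (y := m^-1 * (w * a ^+ 2) + m * (w^-1 * b ^+ 2)))//; last first.
    by rewrite lerD2l -mulrA ler_wpM2l// ltW.
  pose t := w / m.
  have t0 : 0 < t by rewrite divr_gt0.
  have -> : m^-1 * (w * a ^+ 2) = t * a ^+ 2 by rewrite /t; ring.
  have -> : m * (w^-1 * b ^+ 2) = t^-1 * b ^+ 2 by rewrite /t invf_div; ring.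
  have h2 : 0 <= (t * a - b) ^+ 2 / t by rewrite divr_ge0 ?sqr_ge0// ltW.
  have e : (t * a - b) ^+ 2 / t = t * a ^+ 2 - 2 * (a * b) + t^-1 * b ^+ 2 by field; rewrite gt_eqF.
  have := mulr_ge0 a0 b0; rewrite e in h2; lra.
have i2 : vol.-integrable setT (EFin \o (fun xi => m * M * wgt xi)).
  exact: (integrableZl measurableT _ (@integrable_wgt R)).
have i3 : vol.-integrable setT (EFin \o (fun xi => m^-1 * (sobw s xi * normc (F xi) ^+ 2))).
  exact: (integrableZl measurableT _ i1).
have i4 : vol.-integrable setT (EFin \o (fun xi => m^-1 * (sobw s xi * normc (F xi) ^+ 2) + m * M * wgt xi)).
  by rewrite /comp; under eq_fun do rewrite EFinD; exact: integrableD.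
have iFe : cintegrable vol setT (fun xi => F xi * inv_fourier_test eta xi).
  by apply: (cintegrable_bound _ i4 le); apply: cmeasurableM => //; exact: cmeasurable_inv_fourier.
split=> //; apply: (le_trans (normc_cintegral iFe i4 le)).
rewrite (RintegralD measurableT i3 i2) (RintegralZl _ measurableT i1) (RintegralZl _ measurableT (@integrable_wgt R)) -/W.
have : Rintegral vol setT (fun xi => sobw s xi * normc (F xi) ^+ 2) <= m ^+ 2.
  by rewrite -lee_fin /Rintegral fineK ?(integrable_fin_num measurableT i1).
move=> h; rewrite -(mulrA 2) ler_wpM2l//.
rewrite (le_trans (y := m^-1 * m ^+ 2 + m * M * W))//; first by rewrite lerD2r ler_wpM2l// invr_ge0 ltW.
by rewrite expr2 mulKf ?gt_eqF// mulrDl mul1r lerD2l -mulrA mulrC.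
Qed.

Lemma cintegrable_pairing s F (eta : test R) : cmeasurable F -> (weighted_L2_norm s F < +oo)%E ->
  cintegrable vol setT (fun xi => F xi * inv_fourier_test eta xi).
Proof.
move=> mF fin; have [C C0 hC] := pairing_bound s eta.
pose m := fine (weighted_L2_norm s F) + 1.
have w0 := weighted_L2_norm_ge0 s F.
have f0 : 0 <= fine (weighted_L2_norm s F) by exact: fine_ge0.
have m0 : 0 < m by rewrite ltr_pwDr.
have [|//] := hC F m mF m0.
rewrite -weighted_L2_norm_le ?(ltW m0)// -(@fineK _ (weighted_L2_norm s F)); last by rewrite ge0_fin_numE.
by rewrite lee_fin lerDl.
Qed.

(** Pairings with all translates of one bump say that the transform of [F - G] times the transform
    of that bump vanishes, hence this product is zero almost everywhere. With width [n.+1%:R^-1] the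
    second factor has no zero where [|xi| <= n.+1%:R / 6], and countably many widths exhaust all
    frequencies. *)
Lemma fourier_unique F G s k : cmeasurable F -> cmeasurable G ->
  (weighted_L2_norm s F < +oo)%E -> (weighted_L2_norm k G < +oo)%E ->
  (forall a d, cintegral vol setT (fun xi => F xi * inv_fourier_test (bump a d) xi) =
    cintegral vol setT (fun xi => G xi * inv_fourier_test (bump a d) xi)) ->
  {ae vol, forall xi, F xi = G xi}.
Proof.
move=> mF mG fF fG E.
have N0 n : {ae vol, forall xi, (F xi - G xi) * inv_fourier_test (bump 0 n.+1%:R^-1) xi = 0}.
  have iF a := cintegrable_pairing (bump a n.+1%:R^-1) mF fF.
  have iG a := cintegrable_pairing (bump a n.+1%:R^-1) mG fG.
  apply: ae_null => [|a].
    under eq_fun do rewrite mulrBl; exact: cintegrableB.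
  transitivity (cintegral vol setT (fun xi => F xi * inv_fourier_test (bump a n.+1%:R^-1) xi -
      G xi * inv_fourier_test (bump a n.+1%:R^-1) xi)).
    by apply: eq_cintegral => xi; rewrite (inv_fourier_bump a); ring.
  by rewrite cintegralB// E subrr.
have := ae_foralln N0.
apply: filterS => xi h; apply/eqP; rewrite -subr_eq0.
have [n nx] : exists n : nat, `|xi| <= (6 * n.+1%:R^-1)^-1.
  exists (Num.truncn (6 * `|xi|)); rewrite invf_div ler_pdivlMr// mulrC.
  by rewrite ltW// truncnS_gt.
have := h n; move/eqP; rewrite mulf_eq0 => /orP[//|/negPn].
by rewrite inv_fourier_bump_neq0// invr_gt0.
Qed.

Lemma has_fourier_unique S F G : has_fourier S F -> has_fourier S G ->
  {ae vol, forall xi, F xi = G xi}.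
Proof.
move=> [mF [k fF] eF] [mG [l fG] eG]; apply: (fourier_unique mF mG fF fG) => a d.
by rewrite -[LHS]eF -[RHS]eG.
Qed.

Lemma fourierP S F : has_fourier S F -> has_fourier S (fourier S).
Proof. by move=> SF; apply: (@xgetPex _ (fun=> 0) [set F | has_fourier S F]); exists F. Qed.

(** A lower bound for the infimum: every representative of [S] equals [F] almost everywhere. This is
    how an upper bound on the norm of a differential, known only through its values, reaches the
    weighted norm of an explicit function. *)
Lemma le_Hs_norm s k S F : cmeasurable F -> (weighted_L2_norm k F < +oo)%E ->
  (forall a d, S (bump a d) = cintegral vol setT (fun xi => F xi * inv_fourier_test (bump a d) xi)) ->
  (weighted_L2_norm s F <= Hs_norm s S)%E.
Proof.
move=> mF fF SF; apply: le_ereal_inf_tmp => _ [G [mG [l fG] eG] <-].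
rewrite !weighted_L2_normE (@eq_ae_sqint s F G)//.
by apply: (fourier_unique mF mG fF fG) => a d; rewrite -SF eG.
Qed.

Lemma Hs_norm_le s S F : has_fourier S F -> (Hs_norm s S <= weighted_L2_norm s F)%E.
Proof. by move=> SF; apply: ereal_inf_lbound; exists F. Qed.

Lemma Hs_norm_ge0 s S : (0 <= Hs_norm s S)%E.
Proof. by apply: le_ereal_inf_tmp => _ [F _ <-]; exact: weighted_L2_norm_ge0. Qed.

(** Evaluation at a test function is continuous for the Sobolev norm, which reduces statements about
    differentials to statements about scalars. *)
Lemma distr_bound s (eta : test R) : exists2 C : R, 0 <= C & forall S (m : R), 0 < m ->
  (Hs_norm s S < m%:E)%E -> normc (S eta) <= C * m.
Proof.
have [C C0 hC] := pairing_bound s eta; exists C => // S m m0.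
move/ereal_inf_lt => [_ [F [mF _ eF] <-] lt]; rewrite eF.
by apply: (hC F m mF m0 _).2; rewrite -weighted_L2_norm_le ?(ltW m0)// ltW.
Qed.

End WeightedNorms.

(** * The integral equation *)

Section TrilinearEstimates.
Context {R : realType}.
Variable alpha : R.
Hypotheses (alpha1 : 1 < alpha) (alpha2 : alpha <= 2).
Notation leb := (@lebesgue_measure R).
Implicit Types (P Q F G : R3 R -> R[i]) (x xi : R3 R) (M D beta : R).

Definition dominated beta M F := cmeasurable F /\ forall x, normc (F x) <= M * vwgt beta x.

(** Telescoping: the first factor is changed while the second is kept, then the second is
    changed. *)
Lemma normc_conv_sub (C beta M1 M2 D1 D2 : R) (k : R3 R -> R) P Q P' Q' :
  kernel_bound C k -> 0 <= beta -> 0 <= M1 -> 0 <= M2 -> 0 <= D1 -> 0 <= D2 ->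
  cmeasurable P -> cmeasurable Q -> cmeasurable P' -> cmeasurable Q' ->
  (forall x, normc (P x) <= M1 * (k x * vwgt beta x)) ->
  (forall x, normc (P' x) <= M1 * (k x * vwgt beta x)) ->
  (forall x, normc (P x - P' x) <= D1 * (k x * vwgt beta x)) ->
  (forall x, normc (Q x) <= M2 * vwgt beta x) ->
  (forall x, normc (Q' x) <= M2 * vwgt beta x) ->
  (forall x, normc (Q x - Q' x) <= D2 * vwgt beta x) ->
  forall x, normc (conv P Q x - conv P' Q' x) <= convC * C * (D1 * M2 + M1 * D2) * vwgt beta x.
Proof.
move=> kb b0 M10 M20 D10 D20 mP mQ mP' mQ' leP leP' leD leQ leQ' leE x.
have mD := cmeasurableB mP mP'; have mE := cmeasurableB mQ mQ'.
have -> : conv P Q x - conv P' Q' x =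
    conv (fun y => P y - P' y) Q x + conv P' (fun y => Q y - Q' y) x.
  rewrite /conv -cintegralB; last 2 first.
  - exact: (cintegrable_conv_integrand kb b0 M10 M20 mP mQ leP leQ).
  - exact: (cintegrable_conv_integrand kb b0 M10 M20 mP' mQ' leP' leQ').
  rewrite -cintegralD; last 2 first.
  - exact: (cintegrable_conv_integrand kb b0 D10 M20 mD mQ leD leQ).
  - exact: (cintegrable_conv_integrand kb b0 M10 D20 mP' mE leP' leE).
  by apply: eq_cintegral => y; ring.
have h1 := normc_conv kb b0 D10 M20 mD mQ leD leQ x.
have h2 := normc_conv kb b0 M10 D20 mP' mE leP' leE x.
rewrite (le_trans (le_normcD _ _))// [leRHS](_ : _ = convC * C * D1 * M2 * vwgt beta x + convC * C * M1 * D2 * vwgt beta x); last by ring.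
exact: lerD.
Qed.

Definition nonlinC : R := convC * kernC alpha * (convC * pi ^+ 3).

Lemma nonlinC_ge0 : 0 <= nonlinC.
Proof.
have [_ k0 kb] := kern_bound alpha1 alpha2.
have kC : 0 <= kernC alpha.
  rewrite -lee_fin (le_trans _ (kb 0))//; apply: integral_ge0 => x _.
  by rewrite lee_fin mulr_ge0 ?wgt_ge0.
have p3 : 0 <= pi ^+ 3 :> R by rewrite exprn_ge0 ?pi_ge0.
by rewrite /nonlinC; apply: mulr_ge0; apply: mulr_ge0 => //; exact: convC_ge0.
Qed.

Lemma dominated_nonlin beta M F : 0 <= beta -> 0 <= M -> dominated beta M F ->
  dominated beta (nonlinC * M ^+ 3) (nonlin alpha F).
Proof.
move=> b0 M0 [mF leF]; split; first exact: cmeasurable_nonlin.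
move=> x; have := normc_nonlin alpha1 alpha2 b0 M0 mF leF x.
by rewrite /nonlinC !mulrA !exprS expr0 mulr1 !mulrA.
Qed.

(** The 3 counts the factors of the trilinear expression, each replaced in turn. *)
Lemma nonlin_sub beta M D F G : 0 <= beta -> 0 <= M -> 0 <= D ->
  dominated beta M F -> dominated beta M G -> (forall x, normc (F x - G x) <= D * vwgt beta x) ->
  forall x, normc (nonlin alpha F x - nonlin alpha G x) <= 3 * nonlinC * M ^+ 2 * D * vwgt beta x.
Proof.
move=> b0 M0 D0 [mF leF] [mG leG] leD.
have one x (y : R) : y = 1 * y by rewrite mul1r.
have leT x : normc (tilde F x - tilde G x) <= D * vwgt beta x.
  by rewrite /tilde -rmorphB normc_conj -(vwgtN _ x).
have mTF := cmeasurable_tilde mF; have mTG := cmeasurable_tilde mG.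
have leC x : normc (corr F x - corr G x) <= convC * pi ^+ 3 * (D * M + M * D) * vwgt beta x.
  by apply: (normc_conv_sub kernel_bound1 b0 M0 M0 D0 D0 mF mTF mG mTG) => //;
    [move=> y; rewrite mul1r..|exact: normc_tilde|exact: normc_tilde].
have [mk k0 _] := kern_bound alpha1 alpha2.
have A0 : 0 <= convC * pi ^+ 3 * M * M by rewrite !mulr_ge0 ?exprn_ge0 ?pi_ge0 ?convC_ge0.
have A1 : 0 <= convC * pi ^+ 3 * (D * M + M * D).
  by rewrite !mulr_ge0 ?exprn_ge0 ?pi_ge0 ?convC_ge0 ?addr_ge0 ?mulr_ge0.
have mkc H : cmeasurable H -> cmeasurable (fun h => (kern alpha h)%:C * corr H h).
  by move=> mH; apply: cmeasurableM; [exact: cmeasurable_real|exact: cmeasurable_corr].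
have lek H x : dominated beta M H ->
    normc ((kern alpha x)%:C * corr H x) <= convC * pi ^+ 3 * M * M * (kern alpha x * vwgt beta x).
  move=> [mH leH]; rewrite normcM normc_real ger0_norm// mulrCA ler_wpM2l//.
  exact: (normc_corr b0 M0 mH leH).
move=> x.
have := normc_conv_sub (kern_bound alpha1 alpha2) b0 A0 M0 A1 D0 (mkc _ mF) mF (mkc _ mG) mG
  (lek F ^~ (conj mF leF)) (lek G ^~ (conj mG leG)) _ leF leG leD x.
move=> /(_ _)/le_trans; apply.
  move=> y; rewrite -mulrBr normcM normc_real ger0_norm// mulrCA ler_wpM2l//.
rewrite le_eqVlt; apply/orP; left; apply/eqP; rewrite /nonlinC; ring.
Qed.

(** With the sign convention of the equation, the free evolution over time [t] is multiplication by
    [phase (- t)]. *)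
Definition phase (t : R) xi : R[i] := cis (t * eucl xi `^ alpha).

(* In the interaction picture [W t = phase t * F t], the equation is
   [dW/dt = i sigma (duhamel_integrand W)]. *)
Definition duhamel_integrand (W : R * R3 R -> R[i]) (z : R * R3 R) : R[i] :=
  phase z.1 z.2 * nonlin alpha (fun xi => phase (- z.1) xi * W (z.1, xi)) z.2.

Lemma normc_phase t xi : normc (phase t xi) = 1. Proof. exact: normc_cis. Qed.

Lemma phaseD t t' xi : phase (t + t') xi = phase t xi * phase t' xi.
Proof. by rewrite /phase mulrDl cisD. Qed.

Lemma phase0 xi : phase 0 xi = 1. Proof. by rewrite /phase mul0r cis0. Qed.

Lemma measurable_symbol : measurable_fun setT (fun xi : R3 R => eucl xi `^ alpha).
Proof. exact: (measurableT_comp (measurable_powR alpha) measurable_eucl). Qed.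

Lemma cmeasurable_phase d (T : measurableType d) (f : T -> measurableTypeR R) (g : T -> R3 R) :
  measurable_fun setT f -> measurable_fun setT g -> cmeasurable (fun z => phase (f z) (g z)).
Proof.
move=> mf mg; apply: cmeasurable_cis; apply: measurable_funM => //.
exact: (measurableT_comp measurable_symbol mg).
Qed.

Definition dominated2 beta M (W : measurableTypeR R * R3 R -> R[i]) := cmeasurable W /\ forall z, normc (W z) <= M * vwgt beta z.2.

Lemma dominated_slice M W t : dominated2 1 M W -> dominated 1 M (fun xi => W (t, xi)).
Proof.
move=> [mW le]; split; first exact: (cmeasurable_pairl (t : measurableTypeR R) mW).
by move=> x; exact: (le (t, x)).
Qed.

Lemma dominated_phase beta M F t : dominated beta M F -> dominated beta M (fun xi => phase t xi * F xi).
Proof.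
move=> [mF le]; split; last by move=> x; rewrite normcM normc_phase mul1r.
by apply: cmeasurableM => //; apply: cmeasurable_phase => //; exact: measurable_cst.
Qed.

Lemma cmeasurable_nonlin2 d (T : measurableType d) (W : T * R3 R -> R[i]) : cmeasurable W ->
  cmeasurable (fun z : T * R3 R => nonlin alpha (fun xi => W (z.1, xi)) z.2).
Proof.
move=> mW; have [mk _ _] := kern_bound alpha1 alpha2.
have mT : cmeasurable (fun z : T * R3 R => tilde (fun xi => W (z.1, xi)) z.2).
  apply: cmeasurable_conj; apply: (cmeasurable_comp mW).
  exact: (measurable_fun_pair measurable_fst (measurableT_comp (@measurable_opp3 R) measurable_snd)).
have mC := cmeasurable_conv2 mW mT.
apply: (@cmeasurable_conv2 _ _ _ (fun z => (kern alpha z.2)%:C * corr (fun xi => W (z.1, xi)) z.2) W) => //.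
apply: cmeasurableM => //; apply: cmeasurable_real.
exact: (measurableT_comp mk measurable_snd).
Qed.

Lemma dominated2_duhamel_integrand M W : 0 <= M -> dominated2 1 M W ->
  dominated2 1 (nonlinC * M ^+ 3) (duhamel_integrand W).
Proof.
move=> M0 dW; have [mW _] := dW; split.
  apply: cmeasurableM; first exact: (cmeasurable_phase measurable_fst measurable_snd).
  apply: (@cmeasurable_nonlin2 _ (measurableTypeR R) (fun z => phase (- z.1) z.2 * W z)).
  apply: cmeasurableM => //; apply: cmeasurable_phase measurable_snd.
  exact: measurableT_comp measurable_fst.
move=> z; rewrite normcM normc_phase mul1r.
exact: (dominated_nonlin ler01 M0 (dominated_phase _ (dominated_slice _ dW))).2.
Qed.

Lemma duhamel_integrand_sub M D W W' : 0 <= M -> 0 <= D -> dominated2 1 M W -> dominated2 1 M W' ->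
  (forall z, normc (W z - W' z) <= D * vwgt 1 z.2) ->
  forall z, normc (duhamel_integrand W z - duhamel_integrand W' z) <= 3 * nonlinC * M ^+ 2 * D * vwgt 1 z.2.
Proof.
move=> M0 D0 dW dW' le z; rewrite -mulrBr normcM normc_phase mul1r.
have d1 := dominated_phase (- z.1) (dominated_slice z.1 dW).
have d2 := dominated_phase (- z.1) (dominated_slice z.1 dW').
apply: (nonlin_sub ler01 M0 D0 d1 d2) => x.
by rewrite -mulrBr normcM normc_phase mul1r; exact: (le (z.1, x)).
Qed.

(** * Integration in time *)

Section Time.
Variable T : R.
Hypothesis T0 : 0 < T.

(* Integrating up to [min t T] defines [primitive] for every real time. *)
Definition clip (t tau : R) : R := \1_`[0, Num.min t T] tau.

Definition primitive (K : R * R3 R -> R[i]) (z : R * R3 R) : R[i] :=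
  cintegral leb setT (fun tau => (clip z.1 tau)%:C * K (tau, z.2)).

Lemma clip_ge0 t tau : 0 <= clip t tau.
Proof. by rewrite /clip indicE; case: (_ \in _). Qed.

Lemma integrable_indic_itv (a b : R) : leb.-integrable setT (EFin \o (\1_`[a, b] : R -> R)).
Proof.
apply/integrableP; split; first by apply/measurable_EFinP; exact: measurable_indic.
rewrite (eq_integral (fun y : measurableTypeR R => (\1_`[a, b] (y : R))%:E)) => [|y _]; last by rewrite /= ger0_norm.
by rewrite integral_indic// setIT/= lebesgue_measure_itv/=; case: ifP; rewrite ?ltry.
Qed.

Lemma Rintegral_indic_itv (a b c : R) : 0 <= c -> b - a <= c -> Rintegral leb setT (\1_`[a, b] : R -> R) <= c.
Proof.
move=> c0 ab; rewrite /Rintegral integral_indic// setIT/= lebesgue_measure_itv/= lte_fin.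
by case: ltP => //= ba.
Qed.

Lemma measurable_clip2 : measurable_fun setT (fun z : measurableTypeR R * measurableTypeR R => clip z.1 z.2).
Proof.
rewrite (_ : (fun z => _) = fun z : measurableTypeR R * measurableTypeR R =>
   if (0 <= z.2) && (z.2 <= Num.min z.1 T) then 1 else 0); last first.
  by apply/funext => z; rewrite /clip indicE mem_setE in_itv/=; case: (_ && _).
apply: measurable_fun_ifT => //.
have m1 : measurable_fun setT (fun z : measurableTypeR R * measurableTypeR R => 0 <= z.2).
  by apply: measurable_fun_ler => //; exact: measurable_snd.
have m2 : measurable_fun setT (fun z : measurableTypeR R * measurableTypeR R => z.2 <= Num.min z.1 T).
  by apply: measurable_fun_ler; [exact: measurable_snd|apply: measurable_minr => //; exact: measurable_fst].
exact: measurable_and.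
Qed.

Lemma measurable_clip t : measurable_fun setT (clip t : measurableTypeR R -> R).
Proof. exact: (measurable_pairl (t : measurableTypeR R) measurable_clip2). Qed.

Lemma cmeasurable_slice2 K xi : cmeasurable (K : measurableTypeR R * R3 R -> R[i]) ->
  cmeasurable (fun tau : measurableTypeR R => K (tau, xi)).
Proof. exact: cmeasurable_pairr. Qed.

Lemma cintegrable_primitive beta M K t xi : dominated2 beta M K ->
  cintegrable leb setT (fun tau => (clip t tau)%:C * K (tau, xi)).
Proof.
move=> [mK leK].
have i : leb.-integrable setT (EFin \o (fun tau => M * vwgt beta xi * clip t tau)).
  exact: (integrableZl measurableT (M * vwgt beta xi) (integrable_indic_itv 0 (Num.min t T))).
apply: (cintegrable_bound _ i).
  by apply: cmeasurableM; [apply: cmeasurable_real; exact: measurable_clip|exact: cmeasurable_slice2].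
move=> tau; rewrite normcM normc_real ger0_norm ?clip_ge0// mulrC ler_wpM2r ?clip_ge0//.
Qed.

Lemma normc_primitive beta M K z : 0 <= M -> dominated2 beta M K ->
  normc (primitive K z) <= 2 * T * M * vwgt beta z.2.
Proof.
move=> M0 dK; have [mK leK] := dK; case: z => t xi.
have B0 : 0 <= M * vwgt beta xi by rewrite mulr_ge0 ?vwgt_ge0.
have i0 := integrable_indic_itv 0 (Num.min t T).
have i : leb.-integrable setT (EFin \o (fun tau => M * vwgt beta xi * clip t tau)).
  exact: (integrableZl measurableT (M * vwgt beta xi) i0).
apply: (le_trans (normc_cintegral (cintegrable_primitive t xi dK) i _)).
  move=> tau; rewrite normcM normc_real ger0_norm ?clip_ge0// mulrC ler_wpM2r ?clip_ge0//.
rewrite (RintegralZl _ measurableT i0) [leRHS](_ : _ = 2 * (M * vwgt beta xi * T)); last by rewrite /=; ring.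
apply: ler_wpM2l => //; apply: ler_wpM2l => //.
by apply: Rintegral_indic_itv; [exact: ltW|rewrite subr0 ge_min lexx orbT].
Qed.

Lemma cmeasurable_primitive K : cmeasurable (K : measurableTypeR R * R3 R -> R[i]) ->
  cmeasurable (primitive K : measurableTypeR R * R3 R -> R[i]).
Proof.
move=> mK.
apply: (@cmeasurable_cintegral _ _ (measurableTypeR R * R3 R)%type (measurableTypeR R) R leb
  (fun w => (clip w.1.1 w.2)%:C * K (w.2, w.1.2))).
have m11 : measurable_fun setT (fun w : measurableTypeR R * R3 R * measurableTypeR R => w.1.1).
  exact: (measurableT_comp measurable_fst measurable_fst).
have m12 : measurable_fun setT (fun w : measurableTypeR R * R3 R * measurableTypeR R => w.1.2).
  exact: (measurableT_comp measurable_snd measurable_fst).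
apply: cmeasurableM.
  apply: cmeasurable_real.
  exact: (measurableT_comp measurable_clip2 (measurable_fun_pair m11 measurable_snd)).
exact: (cmeasurable_comp mK (measurable_fun_pair measurable_snd m12)).
Qed.

Lemma clip_lipschitz t t' tau : t <= t' -> `|clip t tau - clip t' tau| <= \1_`[t, t'] tau.
Proof.
move=> tt'; rewrite /clip !indicE !mem_setE !in_itv/= !le_min.
have [h0|h0] := leP 0 tau => /=; last by rewrite subrr normr0.
have [hT|hT] := leP tau T => /=; last by rewrite !andbF subrr normr0.
rewrite !andbT; have [h|h] := leP tau t.
  by rewrite (le_trans h tt') subrr normr0.
have [h'|h'] := leP tau t'; last by rewrite subrr normr0.
by rewrite (ltW h) sub0r normrN normr1.
Qed.

Lemma primitive_lipschitz beta M K t t' xi : 0 <= M -> dominated2 beta M K ->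
  normc (primitive K (t, xi) - primitive K (t', xi)) <= 2 * `|t - t'| * M * vwgt beta xi.
Proof.
move=> M0 dK; have [mK leK] := dK; wlog tt' : t t' / t <= t'.
  move=> H; have [|/ltW] := leP t t'; first exact: H.
  by move=> /H; rewrite -normcN opprB distrC.
have B0 : 0 <= M * vwgt beta xi by rewrite mulr_ge0 ?vwgt_ge0.
have i0 := integrable_indic_itv t t'.
have i : leb.-integrable setT (EFin \o (fun tau => M * vwgt beta xi * \1_`[t, t'] tau)).
  exact: (integrableZl measurableT (M * vwgt beta xi) i0).
have i1 := cintegrable_primitive t xi dK; have i2 := cintegrable_primitive t' xi dK.
rewrite /primitive /= -cintegralB//.
apply: (le_trans (normc_cintegral (cintegrableB i1 i2) i _)).
  move=> tau; rewrite -mulrBl normcM -[X in normc X](_ : (clip t tau - clip t' tau)%:C = _); last first.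
    by apply: complex_eqP; rewrite /= ?subr0.
  rewrite normc_real mulrC ler_pM ?normc_ge0 ?clip_lipschitz//.
rewrite (RintegralZl _ measurableT i0) [leRHS](_ : _ = 2 * (M * vwgt beta xi * `|t - t'|)); last by ring.
apply: ler_wpM2l => //; apply: ler_wpM2l => //.
by apply: Rintegral_indic_itv => //; rewrite distrC ger0_norm ?subr_ge0.
Qed.

End Time.

End TrilinearEstimates.

(** * Sequences with geometrically small increments *)

Section GeometricConvergence.
Context {R : realType}.

(** [g n] is the sum of all the remaining bounds, so adding it makes the sequence nonincreasing and
    subtracting it nondecreasing. Monotone convergence yields the limit, squeezed with explicit
    error. *)
Lemma geometric_cvg (x : nat -> R) (c : R) : (forall n, `|x n.+1 - x n| <= c * 2^-1 ^+ n) ->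
  exists L : R, x n @[n --> \oo] --> L /\ forall n, `|x n - L| <= 2 * c * 2^-1 ^+ n.
Proof.
move=> hx; pose g n : R := 2 * c * 2^-1 ^+ n.
have gS n : g n = g n.+1 + c * 2^-1 ^+ n by rewrite /g exprS; field.
have dec : {homo (fun n => x n + g n) : n m / (n <= m)%N >-> m <= n}.
  by apply/nonincreasing_seqP => n; have := hx n; rewrite ler_norml (gS n); lra.
have inc : {homo (fun n => x n - g n) : n m / (n <= m)%N >-> n <= m}.
  by apply/nondecreasing_seqP => n; have := hx n; rewrite ler_norml (gS n); lra.
have c0 : 0 <= c by have := hx 0%N; rewrite expr0 mulr1; apply: le_trans.
have g0 n : 0 <= g n by rewrite !mulr_ge0// exprn_ge0.
have cg : g n @[n --> \oo] --> 0.
  by apply: (@cvg_geometric R (2 * c) 2^-1); rewrite ger0_norm// invf_lt1// ltr1n.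
have cv1 : cvgn (fun n => x n + g n).
  apply: nonincreasing_is_cvgn => //; exists (x 0%N - g 0%N) => _ [n _ <-].
  have := inc 0%N n (leq0n n); have := g0 n; lra.
have cv2 : cvgn (fun n => x n - g n).
  apply: nondecreasing_is_cvgn => //; exists (x 0%N + g 0%N) => _ [n _ <-].
  have := dec 0%N n (leq0n n); have := g0 n; lra.
pose L := limn (fun n => x n + g n).
have cx : x n @[n --> \oo] --> L.
  rewrite -(subr0 L) (_ : x = fun n => (x n + g n) - g n); last by apply/funext => n; rewrite addrK.
  exact: cvgB.
have L2 : limn (fun n => x n - g n) = L.
  by apply/cvg_lim => //; rewrite -(subr0 L); exact: cvgB.
exists L; split => // n.
have := nonincreasing_cvgn_ge dec cv1 n; have := nondecreasing_cvgn_le inc cv2 n.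
by rewrite L2 -/L ler_norml -/(g n); lra.
Qed.

Lemma le_geometric (x y c : R) : (forall n, x <= y + c * 2^-1 ^+ n) -> x <= y.
Proof.
move=> h; have cg : (y + c * 2^-1 ^+ n) @[n --> \oo] --> y.
  rewrite -[X in _ --> X]addr0; apply: cvgD; first exact: cvg_cst.
  by apply: (@cvg_geometric R c 2^-1); rewrite ger0_norm// invf_lt1// ltr1n.
rewrite -(cvg_lim (@Rhausdorff R) cg); apply: limr_ge; first by apply/cvg_ex; exists y.
exact: nearW.
Qed.

End GeometricConvergence.

Lemma mulr_subD (C : comPzRingType) (a b c d : C) : (a + c * b) - (a + c * d) = c * (b - d).
Proof. ring. Qed.

Lemma mulr_subD' (C : comPzRingType) (a b c d : C) : a + b * c - a - b * d = b * (c - d).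
Proof. ring. Qed.

Ltac nonneg := repeat first [assumption | exact: vwgt_ge0 | exact: normr_ge0 | exact: ler0n |
  (apply: ltW; assumption) | (rewrite invr_ge0; exact: ler0n) | apply: exprn_ge0 | apply: mulr_ge0].

(** * Radial symmetry *)

Section Rotations.
Context {R : realType}.
Variable alpha : R.
Implicit Types (x xi : R3 R) (F P Q : R3 R -> R[i]) (rho : R3 R -> R3 R).

(** Exactly the properties under which convolutions and inverse transforms of invariant functions
    stay invariant. *)
Definition rotation rho := [/\ preserving vol rho,
  forall x y, rho (x - y) = rho x - rho y & forall x y, dot (rho x) (rho y) = dot x y].

Definition invariant_under rho F := forall x, F (rho x) = F x.

Lemma rotation0 rho : rotation rho -> rho 0 = 0.
Proof. by move=> [_ l _]; have := l 0 0; rewrite !subrr. Qed.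

Lemma rotationN rho x : rotation rho -> rho (- x) = - rho x.
Proof. by move=> r; have [_ l _] := r; rewrite -[- x]sub0r l rotation0// sub0r. Qed.

Lemma eucl_rotation rho x : rotation rho -> eucl (rho x) = eucl x.
Proof. by move=> [_ _ d]; rewrite /eucl d. Qed.

Lemma rotation_rot12 c s : c ^+ 2 + s ^+ 2 = 1 -> rotation (@rot12 R c s).
Proof.
move=> cs; split; first exact: preserving_rot12.
  by move=> [[x1 x2] x3] [[y1 y2] y3]; congr (_, _, _); rewrite /=; ring.
move=> [[x1 x2] x3] [[y1 y2] y3]; rewrite /dot /=.
have -> : x1 * y1 + x2 * y2 = (c ^+ 2 + s ^+ 2) * (x1 * y1 + x2 * y2) by rewrite cs mul1r.
ring.
Qed.

Lemma rotation_rot13 c s : c ^+ 2 + s ^+ 2 = 1 -> rotation (@rot13 R c s).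
Proof.
move=> cs; split; first exact: preserving_rot13.
  by move=> [[x1 x2] x3] [[y1 y2] y3]; congr (_, _, _); rewrite /=; ring.
move=> [[x1 x2] x3] [[y1 y2] y3]; rewrite /dot /=.
have -> : x1 * y1 + x2 * y2 + x3 * y3 = (c ^+ 2 + s ^+ 2) * (x1 * y1 + x3 * y3) + x2 * y2 by rewrite cs mul1r; ring.
ring.
Qed.

(** Two plane rotations, the first annihilating the second coordinate and the next the third. *)
Lemma rotate_to_axis x : exists c s c' s' : R,
  [/\ c ^+ 2 + s ^+ 2 = 1, c' ^+ 2 + s' ^+ 2 = 1 & rot13 c' s' (rot12 c s x) = (eucl x, 0, 0)].
Proof.
have plane (a b : R) : exists c s : R, [/\ c ^+ 2 + s ^+ 2 = 1,
    c * a + s * b = Num.sqrt (a ^+ 2 + b ^+ 2) & - s * a + c * b = 0].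
  set r := Num.sqrt _; have r2 : r ^+ 2 = a ^+ 2 + b ^+ 2.
    by rewrite sqr_sqrtr// addr_ge0// sqr_ge0.
  have [r0|r0] := eqVneq r 0.
    move/eqP: r2; rewrite r0 expr0n eq_sym paddr_eq0 ?sqr_ge0// !sqrf_eq0 => /andP[/eqP -> /eqP ->].
    by exists 1, 0; split; ring.
  exists (a / r), (b / r); split.
  - by rewrite !expr_div_n -mulrDl -r2 divff// expf_neq0.
  - have -> : a / r * a + b / r * b = (a ^+ 2 + b ^+ 2) / r by ring.
    by rewrite -r2 expr2 mulfK.
  - by ring.
case: x => -[x1 x2] x3.
have [c [s [cs e1 e2]]] := plane x1 x2.
have [c' [s' [cs' e3 e4]]] := plane (c * x1 + s * x2) x3.
exists c, s, c', s'; split=> //; rewrite /rot12 /rot13 /=.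
have e5 : c * x2 - s * x1 = 0 by rewrite -e2; ring.
rewrite e5 e3 e1 sqr_sqrtr ?addr_ge0 ?sqr_ge0// /eucl /dot /= -!expr2; congr (_, _, _).
by rewrite -e4 e1; ring.
Qed.

Lemma conv_invariant rho P Q : rotation rho -> cmeasurable P -> cmeasurable Q ->
  invariant_under rho P -> invariant_under rho Q -> invariant_under rho (conv P Q).
Proof.
move=> [p l _] mP mQ iP iQ x; rewrite /conv.
have m : cmeasurable (fun y => P y * Q (rho x - y)).
  by apply: cmeasurableM => //; apply: (cmeasurable_comp mQ); apply: measurable_funB3 => //; exact: measurable_cst.
by rewrite -(preserving_cintegral p m); apply: eq_cintegral => y; rewrite iP -l iQ.
Qed.

Lemma ift_invariant rho F : rotation rho -> cmeasurable F ->
  invariant_under rho F -> invariant_under rho (ift F).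
Proof.
move=> [p _ d] mF iF x; rewrite /ift; congr (_ * _).
have m : cmeasurable (fun y => F y * cis (dot (rho x) y)).
  by apply: cmeasurableM => //; exact: cmeasurable_cis_dot.
by rewrite -(preserving_cintegral p m); apply: eq_cintegral => y; rewrite iF d.
Qed.

Lemma kern_rotation rho x : rotation rho -> kern alpha (rho x) = kern alpha x.
Proof.
move=> [_ _ d]; rewrite /kern; congr (_ * _); apply: eq_Rintegral => v _.
by rewrite /heat !gauss3E d.
Qed.

Lemma nonlin_invariant rho F : 1 < alpha -> alpha <= 2 -> rotation rho -> cmeasurable F ->
  invariant_under rho F -> invariant_under rho (nonlin alpha F).
Proof.
move=> a1 a2 r mF iF; have [mk _ _] := kern_bound a1 a2.
have mT := cmeasurable_tilde mF.
have iT : invariant_under rho (tilde F) by move=> x; rewrite /tilde -rotationN// iF.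
apply: conv_invariant => //.
  by apply: cmeasurableM; [exact: cmeasurable_real|exact: cmeasurable_corr].
have iC := conv_invariant r mF mT iF iT.
by move=> x; rewrite kern_rotation//; congr (_ * _); exact: iC.
Qed.

(** The profile is the restriction of [F] to the first axis, onto which [rotate_to_axis] carries
    every point. *)
Lemma radial_invariant F : (forall rho, rotation rho -> invariant_under rho F) -> radial_function F.
Proof.
move=> iF; exists (fun r => F (r, 0, 0)); apply: aeW => x.
have [c [s [c' [s' [cs cs' <-]]]]] := rotate_to_axis x.
by rewrite (iF _ (rotation_rot13 cs')) (iF _ (rotation_rot12 cs)).
Qed.

Lemma phase_rotation rho t x : rotation rho -> phase alpha t (rho x) = phase alpha t x.
Proof. by move=> r; rewrite /phase eucl_rotation. Qed.

Lemma duhamel_integrand_invariant rho (W : measurableTypeR R * R3 R -> R[i]) : 1 < alpha -> alpha <= 2 -> rotation rho ->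
  cmeasurable W -> (forall t x, W (t, rho x) = W (t, x)) ->
  forall t x, duhamel_integrand alpha W (t, rho x) = duhamel_integrand alpha W (t, x).
Proof.
move=> a1 a2 r mW iW t x; pose G xi := phase alpha (- t) xi * W (t, xi).
rewrite -[LHS]/(phase alpha t (rho x) * nonlin alpha G (rho x)).
rewrite -[RHS]/(phase alpha t x * nonlin alpha G x).
have mt := cmeasurable_pairl (t : measurableTypeR R) mW.
have mG : cmeasurable G.
  by apply: cmeasurableM => //; apply: cmeasurable_phase => //; exact: measurable_cst.
have iG : invariant_under rho G by move=> y; rewrite /G (phase_rotation _ _ r) iW.
by rewrite (phase_rotation _ _ r) (nonlin_invariant a1 a2 r mG iG).
Qed.

End Rotations.

(** * Picard iteration in the weighted space *)

Section Picard.
Context {R : realType}.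
Variables (alpha sigma T : R).
Hypotheses (alpha1 : 1 < alpha) (alpha2 : alpha <= 2) (T0 : 0 < T).
Implicit Types (W K : R * R3 R -> R[i]) (M D beta : R) (xi : R3 R).

Lemma primitive_sub beta M D K K' : 0 <= D -> dominated2 beta M K -> dominated2 beta M K' ->
  (forall z, normc (K z - K' z) <= D * vwgt beta z.2) ->
  forall z, normc (primitive T K z - primitive T K' z) <= 2 * T * D * vwgt beta z.2.
Proof.
move=> D0 dK dK' le z; have [mK _] := dK; have [mK' _] := dK'.
have -> : primitive T K z - primitive T K' z = primitive T (fun z => K z - K' z) z.
  rewrite /primitive -cintegralB; [|exact: (cintegrable_primitive _ _ _ dK)|exact: (cintegrable_primitive _ _ _ dK')].
  by apply: eq_cintegral => tau; rewrite mulrBr.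
by apply: normc_primitive => //; split=> //; exact: cmeasurableB.
Qed.

Variables (eps : R) (phi : R3 R -> R[i]).
Hypotheses (eps0 : 0 <= eps) (dphi : dominated 1 eps phi).
(** Among functions dominated with constant [2 * eps], the iteration has Lipschitz constant [24 *
    |sigma| * T * nonlinC alpha * eps ^+ 2], where [24 = 2 * 3 * 2 ^ 2]. The hypothesis brings it
    down to one half, and it also keeps the iterates in that set. *)
Hypothesis small : 48 * `|sigma| * T * nonlinC alpha * eps ^+ 2 <= 1.

Let duhamel W := primitive T (duhamel_integrand alpha W).
Let step W (z : R * R3 R) : R[i] := phi z.2 + 'i * sigma%:C * duhamel W z.

Let N0 := nonlinC_ge0 alpha1 alpha2.
Let e20 : 0 <= 2 * eps. Proof. exact: mulr_ge0. Qed.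

Let normc_is : normc ('i * sigma%:C) = `|sigma|.
Proof.
have ni : normc ('i : R[i]) = 1 by rewrite /normc /= expr0n expr1n add0r sqrtr1.
by rewrite normcM ni mul1r normc_real.
Qed.

Let stepE W z : normc (step W z - phi z.2) <= `|sigma| * normc (duhamel W z).
Proof. by rewrite /step addrC addKr normcM normc_is. Qed.

Let step_sub D W W' : 0 <= D -> dominated2 1 (2 * eps) W -> dominated2 1 (2 * eps) W' ->
  (forall z, normc (W z - W' z) <= D * vwgt 1 z.2) ->
  forall z, normc (duhamel W z - duhamel W' z) <= 24 * T * nonlinC alpha * eps ^+ 2 * D * vwgt 1 z.2.
Proof.
move=> D0 dW dW' le z.
have d1 := dominated2_duhamel_integrand alpha1 alpha2 e20 dW.
have d2 := dominated2_duhamel_integrand alpha1 alpha2 e20 dW'.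
have D20 : 0 <= 3 * nonlinC alpha * (2 * eps) ^+ 2 * D by nonneg.
have := primitive_sub D20 d1 d2 (duhamel_integrand_sub alpha1 alpha2 e20 D0 dW dW' le) z.
by move/le_trans; apply; rewrite le_eqVlt; apply/orP; left; apply/eqP; ring.
Qed.

Let step_sub2 D W W' : 0 <= D -> dominated2 1 (2 * eps) W -> dominated2 1 (2 * eps) W' ->
  (forall z, normc (W z - W' z) <= D * vwgt 1 z.2) ->
  forall z, normc (step W z - step W' z) <= 2^-1 * D * vwgt 1 z.2.
Proof.
move=> D0 dW dW' le z.
have -> : step W z - step W' z = 'i * sigma%:C * (duhamel W z - duhamel W' z) by exact: mulr_subD.
rewrite normcM normc_is (le_trans (ler_wpM2l (normr_ge0 _) (step_sub D0 dW dW' le z)))//.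
rewrite [leLHS](_ : _ = 48 * `|sigma| * T * nonlinC alpha * eps ^+ 2 * (2^-1 * D * vwgt 1 z.2)); last by field.
by apply: ler_piMl small; nonneg.
Qed.

Let step_phi W : dominated2 1 (2 * eps) W ->
  forall z, normc (step W z - phi z.2) <= 16 * `|sigma| * T * nonlinC alpha * eps ^+ 3 * vwgt 1 z.2.
Proof.
move=> dW z; have d1 := dominated2_duhamel_integrand alpha1 alpha2 e20 dW.
have D20 : 0 <= nonlinC alpha * (2 * eps) ^+ 3 by nonneg.
rewrite (le_trans (stepE W z))// (le_trans (ler_wpM2l (normr_ge0 _) (normc_primitive T0 z D20 d1)))//.
by rewrite le_eqVlt; apply/orP; left; apply/eqP; ring.
Qed.

Let small3 : 16 * `|sigma| * T * nonlinC alpha * eps ^+ 3 <= eps.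
Proof.
have h : 0 <= `|sigma| * T * nonlinC alpha * eps ^+ 2 by nonneg.
rewrite [leLHS](_ : _ = 16 * (`|sigma| * T * nonlinC alpha * eps ^+ 2) * eps); last by ring.
rewrite ler_piMl//; move: small; rewrite -!mulrA; move: h; rewrite -!mulrA; lra.
Qed.

Let dominated_near W : cmeasurable W -> (forall z, normc (W z - phi z.2) <= eps * vwgt 1 z.2) ->
  dominated2 1 (2 * eps) W.
Proof.
move=> mW le; split=> // z; have [_ lephi] := dphi.
have := le_normcD (W z - phi z.2) (phi z.2); rewrite subrK.
by have := le z; have := lephi z.2; lra.
Qed.

Let cmeasurable_step W : dominated2 1 (2 * eps) W -> cmeasurable (step W : measurableTypeR R * R3 R -> _).
Proof.
move=> dW; have [mphi _] := dphi.
apply: cmeasurableD; first exact: (cmeasurable_comp mphi measurable_snd).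
apply: cmeasurableM; first exact: cmeasurable_cst.
apply: cmeasurable_primitive.
by have [] := dominated2_duhamel_integrand alpha1 alpha2 e20 dW.
Qed.

Let dominated_step W : dominated2 1 (2 * eps) W -> dominated2 1 (2 * eps) (step W).
Proof.
move=> dW; apply: dominated_near; first exact: cmeasurable_step.
by move=> z; apply: (le_trans (step_phi dW z)); apply: ler_wpM2r small3; exact: vwgt_ge0.
Qed.

Let iter n : R * R3 R -> R[i] := ssrnat.iter n step (fun z => phi z.2).

Let dominated_iter n : dominated2 1 (2 * eps) (iter n).
Proof.
elim: n => [|n IH]; last exact: dominated_step.
apply: dominated_near; first by have [mphi _] := dphi; exact: (cmeasurable_comp mphi measurable_snd).
move=> z; rewrite /iter /= subrr -[X in normc X]/(0%:C) normc_real normr0 mulr_ge0 ?vwgt_ge0//.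
Qed.

Let iter_sub n z : normc (iter n.+1 z - iter n z) <= eps * vwgt 1 z.2 * 2^-1 ^+ n.
Proof.
have h : forall z, normc (iter n.+1 z - iter n z) <= (eps * 2^-1 ^+ n) * vwgt 1 z.2.
  elim: n => [|n IH] {}z.
    rewrite expr0 mulr1 (le_trans (step_phi (dominated_iter 0) z))//.
    by apply: ler_wpM2r small3; exact: vwgt_ge0.
  have -> : eps * 2^-1 ^+ n.+1 = 2^-1 * (eps * 2^-1 ^+ n) by rewrite exprS mulrCA.
  have e0 : 0 <= eps * 2^-1 ^+ n by nonneg.
  exact: (step_sub2 e0 (dominated_iter n.+1) (dominated_iter n) IH z).
by have := h z; rewrite mulrAC.
Qed.

Let invariant_iter rho n : rotation rho -> invariant_under rho phi ->
  forall t x, iter n (t, rho x) = iter n (t, x).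
Proof.
move=> r iphi; elim: n => [|n IH] t x; first exact: iphi.
rewrite -[LHS]/(phi (rho x) + 'i * sigma%:C * duhamel (iter n) (t, rho x)).
rewrite -[RHS]/(phi x + 'i * sigma%:C * duhamel (iter n) (t, x)) iphi.
have [mW _] := dominated_iter n.
have E := duhamel_integrand_invariant alpha1 alpha2 r mW IH.
have -> : duhamel (iter n) (t, rho x) = duhamel (iter n) (t, x); last by [].
by apply: eq_cintegral => tau; rewrite [in LHS]E.
Qed.

(** The iterates converge pointwise at rate [2^-1 ^+ n], and symmetry and measurability pass to the
    limit. The last clause replaces [W] by [phi] inside the nonlinearity: [W - phi] is of order
    [eps ^+ 3], the Lipschitz constant brings [eps ^+ 2], and [384 = 24 * 16]. *)
Lemma picard : exists W, [/\ dominated2 1 (2 * eps) W,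
  forall rho, rotation rho -> invariant_under rho phi -> forall t x, W (t, rho x) = W (t, x),
  forall z, W z = phi z.2 + 'i * sigma%:C * primitive T (duhamel_integrand alpha W) z,
  forall z, normc (W z - phi z.2) <= 16 * `|sigma| * T * nonlinC alpha * eps ^+ 3 * vwgt 1 z.2 &
  forall z, normc (W z - phi z.2 - 'i * sigma%:C *
      primitive T (duhamel_integrand alpha (fun z => phi z.2)) z) <=
    384 * (`|sigma| * T * nonlinC alpha) ^+ 2 * eps ^+ 5 * vwgt 1 z.2].
Proof.
pose c (z : R * R3 R) : R := eps * vwgt 1 z.2.
have cRe z : exists L : R, complex.Re (iter n z) @[n --> \oo] --> L /\
    forall n, `|complex.Re (iter n z) - L| <= 2 * c z * 2^-1 ^+ n.
  apply: geometric_cvg => n; rewrite -ReN -ReD; exact: (le_trans (normr_Re_le _) (iter_sub n z)).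
have cIm z : exists L : R, complex.Im (iter n z) @[n --> \oo] --> L /\
    forall n, `|complex.Im (iter n z) - L| <= 2 * c z * 2^-1 ^+ n.
  apply: geometric_cvg => n; rewrite -ImN -ImD; exact: (le_trans (normr_Im_le _) (iter_sub n z)).
have [A hA] := choice cRe; have [B hB] := choice cIm.
pose W z : R[i] := A z +i* B z.
have lW n z : normc (iter n z - W z) <= 4 * c z * 2^-1 ^+ n.
  rewrite (le_trans (normc_le_ReIm _))// ReD ReN ImD ImN /=.
  by have := (hA z).2 n; have := (hB z).2 n; lra.
have mW : cmeasurable (W : measurableTypeR R * R3 R -> R[i]).
  split.
    apply: (@measurable_fun_cvg _ _ _ _ (fun n z => complex.Re (iter n z))) => [n|z _].
      by have [[]] := dominated_iter n.
    exact: (hA z).1.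
  apply: (@measurable_fun_cvg _ _ _ _ (fun n z => complex.Im (iter n z))) => [n|z _].
    by have [[]] := dominated_iter n.
  exact: (hB z).1.
have dW : dominated2 1 (2 * eps) W.
  split=> // z; apply: (@le_geometric _ _ _ (4 * c z)) => n.
  have [_ le] := dominated_iter n.
  have := le_normcD (iter n z) (W z - iter n z); rewrite addrC subrK.
  have := lW n z; rewrite -normcN opprB; have := le z; lra.
have fixW z : W z = step W z.
  apply/eqP; rewrite -subr_eq0; apply/eqP; apply: eq0_normc; apply/eqP.
  rewrite eq_le normc_ge0 andbT; apply: (@le_geometric _ _ _ (4 * c z)) => n; rewrite add0r.
  have e40 : 0 <= 4 * eps * 2^-1 ^+ n by nonneg.
  have h : forall z, normc (iter n z - W z) <= (4 * eps * 2^-1 ^+ n) * vwgt 1 z.2.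
    by move=> z'; have := lW n z'; rewrite /c mulrA [in leRHS]mulrAC.
  have h1 := step_sub2 e40 (dominated_iter n) dW h z.
  have h2 := lW n.+1 z; rewrite -normcN opprB in h2.
  have -> : W z - step W z = (W z - iter n.+1 z) + (step (iter n) z - step W z).
    by rewrite addrA subrK.
  rewrite (le_trans (le_normcD _ _))//.
  have -> : 4 * c z * 2^-1 ^+ n = 4 * c z * 2^-1 ^+ n.+1 + 2^-1 * (4 * eps * 2^-1 ^+ n) * vwgt 1 z.2.
    by rewrite /c exprS; field.
  exact: lerD.
have le1 z : normc (W z - phi z.2) <= 16 * `|sigma| * T * nonlinC alpha * eps ^+ 3 * vwgt 1 z.2.
  by rewrite {1}fixW; exact: step_phi.
exists W; split=> // [rho r iphi t x|z].
  have EA n := invariant_iter n r iphi t x.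
  apply: complex_eqP; rewrite /=.
    apply: (cvg_unique (@Rhausdorff R) (hA (t, rho x)).1).
    rewrite (_ : (fun n => _) = fun n => complex.Re (iter n (t, x))); first exact: (hA (t, x)).1.
    by apply/funext => n; rewrite -EA.
  apply: (cvg_unique (@Rhausdorff R) (hB (t, rho x)).1).
  rewrite (_ : (fun n => _) = fun n => complex.Im (iter n (t, x))); first exact: (hB (t, x)).1.
  by apply/funext => n; rewrite -EA.
have D0 : 0 <= 16 * `|sigma| * T * nonlinC alpha * eps ^+ 3 by nonneg.
have h := step_sub D0 dW (dominated_iter 0) le1 z.
have -> : W z - phi z.2 - 'i * sigma%:C * primitive T (duhamel_integrand alpha (fun z => phi z.2)) z =
    'i * sigma%:C * (duhamel W z - duhamel (iter 0) z).
  by have := mulr_subD' (phi z.2) ('i * sigma%:C) (duhamel W z) (duhamel (iter 0) z); rewrite -[phi z.2 + _]/(step W z) -fixW.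
rewrite normcM normc_is (le_trans (ler_wpM2l (normr_ge0 _) h))//.
by rewrite le_eqVlt; apply/orP; left; apply/eqP; ring.
Qed.

End Picard.

(** * Regular solutions *)

Section Distribution.
Context {R : realType}.
Implicit Types (F G : R3 R -> R[i]) (x xi : R3 R) (s k M beta : R) (S : distr R).

(* The distribution with Fourier transform [F]. *)
Definition dist F : distr R := fun eta => cintegral vol setT (fun xi => F xi * inv_fourier_test eta xi).

(** [1 + y] is at most a constant times [expR (c * y)]; with [c = beta / m.+1%:R] the power [m] uses
    less than the available rate [beta]. *)
Lemma poly_exp_le (m : nat) beta : 0 < beta -> exists2 C : R, 0 <= C &
  forall y : R, 0 <= y -> (1 + y) ^+ m * expR (- (beta * y)) <= C.
Proof.
move=> b0; pose c := beta / m.+1%:R; have c0 : 0 < c by rewrite divr_gt0.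
exists ((1 + c^-1) ^+ m); first by rewrite exprn_ge0// addr_ge0// invr_ge0 ltW.
move=> y y0; rewrite expRN ler_pdivrMr ?expR_gt0//.
have h : 1 + y <= (1 + c^-1) * expR (c * y).
  have h1 : 1 + y <= (1 + c^-1) * (1 + c * y).
    have -> : (1 + c^-1) * (1 + c * y) = 1 + y + (c^-1 + c * y) by field; rewrite gt_eqF.
    have ci : 0 <= c^-1 by rewrite invr_ge0 ltW.
    have cy : 0 <= c * y by apply: mulr_ge0 => //; exact: ltW.
    by rewrite lerDl addr_ge0.
  rewrite (le_trans h1)// ler_wpM2l ?expR_ge1Dx//.
  by rewrite addr_ge0// invr_ge0 ltW.
have y1 : 0 <= 1 + y by rewrite addr_ge0.
have h2 : (1 + y) ^+ m <= ((1 + c^-1) * expR (c * y)) ^+ m.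
  by rewrite lerXn2r ?nnegrE// (le_trans y1).
rewrite (le_trans h2)// exprMn ler_wpM2l ?exprn_ge0 ?addr_ge0 ?invr_ge0 ?(ltW c0)//.
rewrite -expRM_natl ler_expR mulrA ler_wpM2r// /c mulrCA ler_piMr ?(ltW b0)//.
by rewrite ler_pdivrMr// mul1r ler_nat.
Qed.

(** The exponential factor of the weight beats the Sobolev weight of any order [k]. This is what
    makes the constructed solutions regular. *)
Lemma sqint_dominated k beta : 0 < beta -> exists2 C : R, 0 <= C & forall F M, 0 <= M ->
  dominated beta M F -> (sqint k F <= (C * M ^+ 2)%:E)%E.
Proof.
move=> b0; have [n hn] := sobw_le k.
have [C0 C00 hC] := @poly_exp_le (2 * n)%N beta b0.
pose W := Rintegral vol setT (@wgt R).
have W0 : 0 <= W by apply: Rintegral_ge0 => x _; exact: wgt_ge0.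
exists (4 ^+ n * C0 * W) => [|F M M0 [mF le]]; first by rewrite !mulr_ge0 ?exprn_ge0.
have i := integrableZl measurableT (4 ^+ n * C0 * M ^+ 2) (@integrable_wgt R).
have pt xi : sobw k xi * normc (F xi) ^+ 2 <= 4 ^+ n * C0 * M ^+ 2 * wgt xi.
  have w0 := ltW (sobw_gt0 k xi); have n0 := normc_ge0 (F xi).
  have v0 := vwgt_ge0 beta xi; have g0 := wgt_ge0 xi.
  have h1 : normc (F xi) ^+ 2 <= (M * vwgt beta xi) ^+ 2 by rewrite lerXn2r ?nnegrE ?mulr_ge0.
  have h2 : vwgt beta xi ^+ 2 <= expR (- (beta * `|xi|)) * wgt xi.
    rewrite expr2 {1}/vwgt -mulrA ler_wpM2l ?expR_ge0// ler_piMr//.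
    by rewrite (le_trans (vwgt_le _ (ltW b0)))// wgt_le1.
  have B0 : 0 <= (1 + `|xi|) ^+ (2 * n) by rewrite exprn_ge0// ltW// norm1_gt0.
  have M20 : 0 <= M ^+ 2 by rewrite sqr_ge0.
  rewrite (le_trans (ler_wpM2l w0 h1))// exprMn.
  rewrite (le_trans (ler_wpM2l w0 (ler_wpM2l M20 h2)))//.
  have e0 := expR_ge0 (- (beta * `|xi|)).
  have q0 : 0 <= M ^+ 2 * (expR (- (beta * `|xi|)) * wgt xi) by rewrite !mulr_ge0.
  rewrite (le_trans (ler_wpM2r q0 (hn xi)))//.
  rewrite [leLHS](_ : _ = 4 ^+ n * M ^+ 2 * wgt xi * ((1 + `|xi|) ^+ (2 * n) * expR (- (beta * `|xi|)))); last by ring.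
  rewrite [leRHS](_ : _ = 4 ^+ n * M ^+ 2 * wgt xi * C0); last by ring.
  by rewrite ler_wpM2l ?hC// !mulr_ge0 ?exprn_ge0.
apply: (@le_trans _ _ (\int[vol]_x (4 ^+ n * C0 * M ^+ 2 * wgt x)%:E)%E).
  apply: ge0_le_integral => //.
  - by move=> xi _; rewrite lee_fin mulr_ge0 ?sqr_ge0// ltW// sobw_gt0.
  - by apply/measurable_EFinP; exact: measurable_sqint.
  - by apply/measurable_EFinP; apply: measurable_funM => //; exact: measurable_wgt.
  - by move=> xi _; rewrite lee_fin.
have -> : (\int[vol]_x (4 ^+ n * C0 * M ^+ 2 * wgt x)%:E)%E = (4 ^+ n * C0 * M ^+ 2 * W)%:E.
  rewrite /W -RintegralZl//; last exact: integrable_wgt.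
  by rewrite /Rintegral fineK//; exact: (integrable_fin_num measurableT i).
by rewrite lee_fin le_eqVlt; apply/orP; left; apply/eqP; ring.
Qed.

Lemma weighted_L2_dominated k beta : 0 < beta -> exists2 C : R, 0 <= C & forall F M, 0 <= M ->
  dominated beta M F -> (weighted_L2_norm k F <= (C * M)%:E)%E.
Proof.
move=> b0; have [C C0 h] := sqint_dominated k b0.
exists (Num.sqrt C) => [|F M M0 dF]; first exact: sqrtr_ge0.
by rewrite weighted_L2_norm_le ?mulr_ge0 ?sqrtr_ge0// exprMn sqr_sqrtr// h.
Qed.

Lemma weighted_L2_dominated_lty k beta F M : 0 < beta -> 0 <= M -> dominated beta M F ->
  (weighted_L2_norm k F < +oo)%E.
Proof.
move=> b0 M0 dF; have [C C0 h] := weighted_L2_dominated k b0.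
by rewrite (le_lt_trans (h _ _ M0 dF))// ltry.
Qed.

Lemma has_fourier_dist beta M F : 0 < beta -> 0 <= M -> dominated beta M F -> has_fourier (dist F) F.
Proof.
move=> b0 M0 dF; have [mF _] := dF; split=> //.
by exists 0; exact: (weighted_L2_dominated_lty _ b0 M0 dF).
Qed.

Lemma cintegrable_dist beta M F (eta : test R) : 0 < beta -> 0 <= M -> dominated beta M F ->
  cintegrable vol setT (fun xi => F xi * inv_fourier_test eta xi).
Proof.
move=> b0 M0 dF; have [mF _] := dF.
exact: (cintegrable_pairing _ mF (weighted_L2_dominated_lty 0 b0 M0 dF)).
Qed.

Lemma distB beta M M' F G : 0 < beta -> 0 <= M -> 0 <= M' -> dominated beta M F -> dominated beta M' G ->
  dist F - dist G = dist (fun xi => F xi - G xi).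
Proof.
move=> b0 M0 M'0 dF dG; apply/funext => eta; rewrite -[LHS]/(dist F eta - dist G eta) /dist.
rewrite -cintegralB; [|exact: (cintegrable_dist _ b0 M0 dF)|exact: (cintegrable_dist _ b0 M'0 dG)].
by apply: eq_cintegral => xi; rewrite mulrBl.
Qed.

Lemma dominatedB beta M M' F G : dominated beta M F -> dominated beta M' G ->
  dominated beta (M + M') (fun xi => F xi - G xi).
Proof.
move=> [mF lF] [mG lG]; split; first exact: cmeasurableB.
by move=> x; rewrite (le_trans (normcB _ _))// mulrDl lerD.
Qed.

Lemma dominated_integrable beta M F : 0 <= beta -> dominated beta M F -> cintegrable vol setT F.
Proof. by move=> b0 [mF le]; exact: (cintegrable_vwgt b0 mF le). Qed.

Lemma represents_dist beta M F : 0 < beta -> 0 <= M -> dominated beta M F -> represents (dist F) (ift F).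
Proof.
move=> b0 M0 dF; have [mF _] := dF; have iF := dominated_integrable (ltW b0) dF.
split; first exact: cmeasurable_ift.
move=> eta; split.
  have i := integrableZl measurableT (ift_bound F) (integrable_norm (integrable_test eta)).
  apply: (cintegrable_bound _ i).
    by apply: cmeasurableM; [exact: cmeasurable_ift|apply: cmeasurable_real; exact: measurable_test].
  by move=> x; rewrite normcM normc_real ler_wpM2r// normc_ift.
rewrite /dist leb3E (ift_pairing iF (cintegrable_test eta)).
by apply: eq_cintegral => xi; rewrite inv_fourier_testE.
Qed.

(** The distribution is itself a radial function, so it can be its own approximation in the closure
    that defines [Hs_rad]. *)
Lemma Hs_rad_dist k beta M F : 0 < beta -> 0 <= M -> dominated beta M F ->
  (forall rho, rotation rho -> invariant_under rho F) -> Hs_rad k (dist F).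
Proof.
move=> b0 M0 dF iF; have [mF _] := dF.
have HF : Hs k (dist F).
  rewrite /Hs /= (le_lt_trans (Hs_norm_le k (has_fourier_dist b0 M0 dF)))//.
  exact: (weighted_L2_dominated_lty _ b0 M0 dF).
split=> // e e0; exists (dist F); split=> //.
  exists (ift F); first exact: (represents_dist b0 M0 dF).
  by apply: radial_invariant => rho r; apply: ift_invariant => //; exact: iF.
have dD := dominatedB dF dF.
rewrite (distB b0 M0 M0 dF dF) (le_lt_trans (Hs_norm_le k (has_fourier_dist b0 (addr_ge0 M0 M0) dD)))//.
have d0 : dominated beta 0 (fun xi => F xi - F xi).
  split; first exact: cmeasurableB.
  by move=> x; rewrite subrr mul0r -[X in normc X]/(0%:C) normc_real normr0.
have [C C0 h] := weighted_L2_dominated k b0.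
by rewrite (le_lt_trans (h _ _ (lexx 0) d0))// mulr0 lte_fin.
Qed.

(** [frac_laplacian] is written with a chosen representative [fourier]; uniqueness identifies that
    choice with [F] almost everywhere. *)
Lemma fourier_dist beta M F : 0 < beta -> 0 <= M -> dominated beta M F ->
  cmeasurable (fourier (dist F)) /\ {ae vol, forall xi, fourier (dist F) xi = F xi}.
Proof.
move=> b0 M0 dF; have hF := has_fourier_dist b0 M0 dF; have hf := fourierP hF.
by have [mf _ _] := hf; split=> //; exact: (has_fourier_unique hf hF).
Qed.

Lemma ae_eq_cintegral F G : cmeasurable F -> cmeasurable G -> {ae vol, forall xi, F xi = G xi} ->
  cintegral vol setT F = cintegral vol setT G.
Proof.
move=> [m1 m2] [m3 m4] FG; rewrite /cintegral /Rintegral; congr (fine _ +i* fine _).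
  by apply: ae_eq_integral => //; [exact/measurable_EFinP|exact/measurable_EFinP|apply: filterS FG => x -> _].
by apply: ae_eq_integral => //; [exact/measurable_EFinP|exact/measurable_EFinP|apply: filterS FG => x -> _].
Qed.

Lemma frac_laplacian_dist alpha beta M F eta : 0 < beta -> 0 <= M -> dominated beta M F ->
  frac_laplacian alpha (dist F) eta = dist (fun xi => (eucl xi `^ alpha)%:C * F xi) eta.
Proof.
move=> b0 M0 dF; have [mF _] := dF; have [mf ae] := fourier_dist b0 M0 dF.
have ms : cmeasurable (fun xi : R3 R => (eucl xi `^ alpha)%:C).
  apply: cmeasurable_real; exact: measurable_symbol.
have me := cmeasurable_inv_fourier eta.
apply: ae_eq_cintegral; [by apply: cmeasurableM => //; exact: cmeasurableM|by apply: cmeasurableM => //; exact: cmeasurableM|].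
by apply: filterS ae => xi ->.
Qed.

End Distribution.

(** * From the integral equation to a regular solution *)

Section Evolution.
Context {R : realType}.
Variables (alpha sigma T : R).
Hypotheses (alpha1 : 1 < alpha) (alpha2 : alpha <= 2) (T0 : 0 < T).
Notation leb := (@lebesgue_measure R).
Implicit Types (x xi : R3 R) (M beta : R).

Lemma Rintegral_indic_derive (f F : R -> R) (a b : R) : a <= b -> continuous f ->
  (forall y : R, is_derive y 1 F (f y)) ->
  Rintegral leb setT (fun y => \1_`[a, b] y * f y) = F b - F a.
Proof.
move=> ab cf dF.
have -> : Rintegral leb setT (fun y => \1_`[a, b] y * f y) = Rintegral leb `[a, b] f.
  rewrite [RHS]Rintegral_mkcond; apply: eq_Rintegral => x _; rewrite patchE indicE.
  by case: (x \in _); rewrite ?mul1r ?mul0r.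
move: ab; rewrite le_eqVlt => /predU1P[->|ab].
  by rewrite set_itv1 Rintegral_set1 subrr.
have cF : continuous F.
  by move=> x; apply: differentiable_continuous; apply/derivable1_diffP; have [] := dF x.
rewrite /Rintegral (continuous_FTC2 ab (F := F))//.
- exact: continuous_subspaceT.
- split=> [x _||]; first by have [] := dF x.
    by apply: cvg_at_right_filter; exact: cF.
  by apply: cvg_at_left_filter; exact: cF.
- by move=> x _; rewrite derive1E; have [_ ->] := dF x.
Qed.

(** ['i] times the free phase is an antiderivative in time of the symbol times the free phase. *)
Lemma cintegral_phase xi (rho t : R) : rho <= t ->
  cintegral leb setT (fun tau => (\1_`[rho, t] tau)%:C * ((eucl xi `^ alpha)%:C * phase alpha (- tau) xi)) =
  'i * (phase alpha (- t) xi - phase alpha (- rho) xi).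
Proof.
move=> rt; rewrite /phase; set a := eucl xi `^ alpha.
have dl (tau : R) : is_derive tau 1 (fun tau : R => - tau * a) (- a).
  by apply: is_derive_eq; rewrite /GRing.scale /=; ring.
have ds (tau : R) : is_derive tau 1 (fun tau : R => - sin (- tau * a)) (a * cos (- tau * a)).
  have := @is_derive1_comp R (@sin R) (fun h : R => - h * a) tau _ _ (is_derive_sin _) (dl tau).
  by move=> /is_deriveN /is_derive_eq; apply; ring.
have dc (tau : R) : is_derive tau 1 (fun tau : R => cos (- tau * a)) (a * sin (- tau * a)).
  have := @is_derive1_comp R (@cos R) (fun h : R => - h * a) tau _ _ (is_derive_cos _) (dl tau).
  by move=> /is_derive_eq; apply; ring.
have cl : continuous (fun tau : R => - tau * a).
  by move=> tau; apply: differentiable_continuous; apply/derivable1_diffP; have [] := dl tau.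
have cc : continuous (fun tau : R => a * cos (- tau * a)).
  move=> tau; apply: cvgM; first exact: cvg_cst.
  exact: (@continuous_comp _ _ _ (fun tau : R => - tau * a) (@cos R) tau (cl tau) (@continuous_cos R _)).
have cs : continuous (fun tau : R => a * sin (- tau * a)).
  move=> tau; apply: cvgM; first exact: cvg_cst.
  exact: (@continuous_comp _ _ _ (fun tau : R => - tau * a) (@sin R) tau (cl tau) (@continuous_sin R _)).
have h1 := Rintegral_indic_derive rt cc ds; have h2 := Rintegral_indic_derive rt cs dc.
rewrite /cintegral; apply: complex_eqP.
  rewrite [LHS]/=.
  transitivity (Rintegral leb setT (fun tau => \1_`[rho, t] tau * (a * cos (- tau * a)))).
    by apply: eq_Rintegral => tau _; rewrite /=; ring.
  by rewrite h1 /=; ring.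
rewrite [LHS]/=.
transitivity (Rintegral leb setT (fun tau => \1_`[rho, t] tau * (a * sin (- tau * a)))).
  by apply: eq_Rintegral => tau _; rewrite /=; ring.
by rewrite h2 /=; ring.
Qed.

Lemma cintegral_itv (t : R) (g : R -> R[i]) : t <= T ->
  cintegral leb `[0, t] g = cintegral leb setT (fun tau => (clip T t tau)%:C * g tau).
Proof.
move=> tT; rewrite /cintegral; congr (_ +i* _); rewrite Rintegral_mkcond; apply: eq_Rintegral => tau _;
  rewrite patchE /clip min_l// indicE ?ReM ?ImM /=.
  by case: (_ \in _); rewrite /= ?mul1r ?mul0r ?subr0.
by case: (_ \in _); rewrite /= ?mul1r ?mul0r ?addr0.
Qed.

Lemma primitive0 beta M K xi : 0 <= M -> dominated2 beta M K -> primitive T K (0, xi) = 0.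
Proof.
move=> M0 dK; have [mK leK] := dK.
have B0 : 0 <= M * vwgt beta xi by rewrite mulr_ge0 ?vwgt_ge0.
have i0 := integrable_indic_itv 0 (Num.min 0 T : R).
have i : leb.-integrable setT (EFin \o (fun tau => M * vwgt beta xi * clip T 0 tau)).
  exact: (integrableZl measurableT (M * vwgt beta xi) i0).
apply: eq0_normc; apply/eqP; rewrite eq_le normc_ge0 andbT.
apply: (le_trans (normc_cintegral (cintegrable_primitive T 0 xi dK) i _)).
  move=> tau; rewrite normcM normc_real ger0_norm ?clip_ge0// mulrC ler_wpM2r ?clip_ge0//.
rewrite (RintegralZl _ measurableT i0) mulr_ge0_le0// mulr_ge0_le0//.
by apply: Rintegral_indic_itv => //; rewrite subr0 ge_min lexx.
Qed.

Lemma dist_primitive beta M K (t : R) (eta : test R) : 0 < beta -> 0 <= M -> dominated2 beta M K -> t <= T ->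
  cintegral leb `[0, t] (fun tau => dist (fun xi => K (tau, xi)) eta) =
  dist (fun xi => primitive T K (t, xi)) eta.
Proof.
move=> b0 M0 dK tT; have [mK leK] := dK; rewrite cintegral_itv// /dist.
have [C C0 hC] := test_decay 0 eta.
have me := cmeasurable_inv_fourier eta.
have dKt tau : dominated beta M (fun xi => K (tau, xi)).
  by split=> [|x]; [exact: (cmeasurable_pairl (tau : measurableTypeR R) mK)|exact: (leK (tau, x))].
have i2 : cintegrable (leb \x vol)%E setT (fun z : measurableTypeR R * R3 R =>
    (clip T t z.1)%:C * (K z * inv_fourier_test eta z.2)).
  have iw := integrableZl measurableT (M * C) (integrable_vwgt (ltW b0)).
  apply: (cintegrable_bound _ (integrable_prodM (integrable_indic_itv 0 (Num.min t T)) iw)).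
    apply: cmeasurableM; last by apply: cmeasurableM => //; exact: (cmeasurable_comp me measurable_snd).
    by apply: (cmeasurable_comp (cmeasurable_real (measurable_clip T t))); exact: measurable_fst.
  move=> z; rewrite normcM (normcM (K z)) normc_real ger0_norm ?clip_ge0// ler_wpM2l ?clip_ge0//.
  rewrite [leRHS](_ : _ = M * vwgt beta z.2 * C); last by ring.
  by rewrite ler_pM ?normc_ge0 ?leK//; have := hC z.2; rewrite expr0 mul1r.
transitivity (cintegral leb setT (fun tau => cintegral vol setT (fun xi =>
    (clip T t tau)%:C * (K (tau, xi) * inv_fourier_test eta xi)))).
  by apply: eq_cintegral => tau; rewrite cintegralZ//; exact: (cintegrable_dist _ b0 M0 (dKt tau)).
have := cfubini i2 => /= ->; apply: eq_cintegral => xi.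
rewrite /primitive -cintegralZr; last exact: (cintegrable_primitive _ _ _ dK).
by apply: eq_cintegral => tau; rewrite mulrA.
Qed.

Lemma symbol_le xi : eucl xi `^ alpha <= 4 * (1 + `|xi|) ^+ 2.
Proof.
have e0 := eucl_ge0 xi; have e1 := eucl_le xi; have n0 := normr_ge0 xi.
have h1 : eucl xi `^ alpha <= 1 + eucl xi ^+ 2.
  have [le|/ltW ge] := leP (eucl xi) 1.
    rewrite (le_trans (y := 1))//; last by rewrite lerDl sqr_ge0.
    have <- : 1 `^ alpha = 1 :> R by rewrite powR1.
    by apply: ge0_ler_powR; rewrite ?nnegrE// (le_trans _ (ltW alpha1)).
  rewrite (le_trans (ler_powR ge alpha2))// powR_mulrn// lerDr//.
rewrite (le_trans h1)//; have : eucl xi ^+ 2 <= (2 * `|xi|) ^+ 2 by rewrite lerXn2r ?nnegrE ?mulr_ge0.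
by rewrite exprMn !expr2; nra.
Qed.

(** The symbol grows polynomially, which costs half of the exponential rate; weights of rate [2^-1]
    appear wherever the symbol has been applied. *)
Lemma symbol_vwgt : exists2 A : R, 0 <= A & forall xi, eucl xi `^ alpha * vwgt 1 xi <= A * vwgt 2^-1 xi.
Proof.
have h0 : 0 < 2^-1 :> R by rewrite invr_gt0.
have [C C0 hC] := poly_exp_le 2 h0.
exists (4 * C) => [|xi]; first by rewrite mulr_ge0.
have -> : vwgt 1 xi = expR (- (2^-1 * `|xi|)) * vwgt 2^-1 xi.
  by rewrite /vwgt mulrA -expRD; congr (expR _ * _); field.
rewrite mulrA ler_wpM2r ?vwgt_ge0//.
rewrite (le_trans (ler_wpM2r (expR_ge0 _) (symbol_le xi)))//.
by rewrite -mulrA ler_wpM2l// hC.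
Qed.

Lemma vwgt_half xi : vwgt 1 xi <= vwgt 2^-1 xi.
Proof.
rewrite /vwgt ler_wpM2r ?wgt_ge0// ler_expR lerN2 ler_wpM2r//.
by rewrite invf_le1// ler1n.
Qed.


Variables (eps : R) (phi : R3 R -> R[i]) (W : measurableTypeR R * R3 R -> R[i]).
Hypotheses (eps0 : 0 <= eps) (dphi : dominated 1 eps phi) (dW : dominated2 1 (2 * eps) W).
Hypothesis fixW : forall z, W z = phi z.2 + 'i * sigma%:C * primitive T (duhamel_integrand alpha W) z.

Definition evolution (t : R) xi : R[i] := phase alpha (- t) xi * W (t, xi).

Let K := duhamel_integrand alpha W.
Let MK := nonlinC alpha * (2 * eps) ^+ 3.
Let e20 : 0 <= 2 * eps. Proof. exact: mulr_ge0. Qed.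
Let MK0 : 0 <= MK. Proof. by have N0 := nonlinC_ge0 alpha1 alpha2; rewrite /MK; nonneg. Qed.
Let dK : dominated2 1 MK K. Proof. exact: dominated2_duhamel_integrand. Qed.
Let N (z : measurableTypeR R * R3 R) := phase alpha (- z.1) z.2 * K z.

Let NE t xi : N (t, xi) = nonlin alpha (evolution t) xi.
Proof.
rewrite /N /K -[duhamel_integrand alpha W (t, xi)]/(phase alpha t xi * nonlin alpha (evolution t) xi).
by rewrite mulrA -phaseD addNr phase0 mul1r.
Qed.

Lemma dominated2_phase beta M (V : measurableTypeR R * R3 R -> R[i]) : dominated2 beta M V ->
  dominated2 beta M (fun z => phase alpha (- z.1) z.2 * V z).
Proof.
move=> [mV leV]; split; last by move=> z; rewrite normcM normc_phase mul1r.
apply: cmeasurableM => //; apply: cmeasurable_phase measurable_snd.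
exact: (measurableT_comp (@oppr_measurable R _) measurable_fst).
Qed.

Let dN : dominated2 1 MK N. Proof. exact: dominated2_phase. Qed.

Lemma dominated_evolution t : dominated 1 (2 * eps) (evolution t).
Proof. exact: (dominated_phase _ _ (dominated_slice _ dW)). Qed.

Let V (z : measurableTypeR R * R3 R) : R[i] := (eucl z.2 `^ alpha)%:C * (phase alpha (- z.1) z.2 * W z).

Let dV : exists2 M : R, 0 <= M & dominated2 2^-1 M V.
Proof.
have [A A0 hA] := symbol_vwgt; exists (A * (2 * eps)); first exact: mulr_ge0.
have [m le] := dominated2_phase dW; split.
  apply: cmeasurableM => //; apply: cmeasurable_real.
  exact: (measurableT_comp (measurable_symbol alpha) measurable_snd).
move=> z; rewrite normcM normc_real ger0_norm ?powR_ge0//.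
rewrite (le_trans (ler_wpM2l (powR_ge0 _ _) (le z)))//.
rewrite [leLHS](_ : _ = 2 * eps * (eucl z.2 `^ alpha * vwgt 1 z.2)); last by ring.
rewrite [leRHS](_ : _ = 2 * eps * (A * vwgt 2^-1 z.2)); last by ring.
by rewrite ler_wpM2l.
Qed.

Lemma evolution0 xi : evolution 0 xi = phi xi.
Proof. by rewrite /evolution oppr0 phase0 mul1r fixW /= (primitive0 _ MK0 dK) mulr0 addr0. Qed.

(** Exchange of the order of two time integrals: the domain is [0 <= rho <= tau <= t], so for fixed
    [rho] the time [tau] runs over [[rho, t]], where [cintegral_phase] applies. *)
Let inner t xi rho : t <= T ->
  cintegral leb setT (fun tau => (clip T t tau)%:C * ((eucl xi `^ alpha)%:C * phase alpha (- tau) xi) *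
    ((clip T tau rho)%:C * K (rho, xi))) =
  (clip T t rho)%:C * K (rho, xi) * ('i * (phase alpha (- t) xi - phase alpha (- rho) xi)).
Proof.
move=> tT; set A := (eucl xi `^ alpha)%:C.
have E tau : clip T t tau * clip T tau rho = clip T t rho * \1_`[rho, t] tau.
  rewrite /clip !indicE !mem_setE !in_itv/= (min_l tT).
  have [r0|r0] := leP 0 rho => /=; last by rewrite mulr0 mul0r.
  have [rt|tr] := leP rho t => /=; last first.
    rewrite mul0r; have [t0|t0] := leP 0 tau => /=; last by rewrite mul0r.
    have [tt|tt] := leP tau t => /=; last by rewrite mul0r.
    by rewrite le_min [rho <= tau](_ : _ = false) ?mulr0//; apply/negbTE; rewrite -ltNge (le_lt_trans tt).
  rewrite mul1r le_min (le_trans rt tT) andbT.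
  have [rta|tar] := leP rho tau => /=; last by rewrite mulr0.
  by rewrite (le_trans r0 rta) /= mulr1.
have [rt|tr] := leP rho t; last first.
  have c0 : clip T t rho = 0.
    rewrite /clip indicE mem_setE in_itv/= (min_l tT) [rho <= t](_ : _ = false) ?andbF//.
    by apply/negbTE; rewrite -ltNge.
  rewrite c0 !mul0r; transitivity (cintegral leb setT (fun _ : measurableTypeR R => (0%:C : R[i]))).
    apply: eq_cintegral => tau.
    rewrite [LHS](_ : _ = (clip T t tau)%:C * (clip T tau rho)%:C * (A * phase alpha (- tau) xi * K (rho, xi))); last by ring.
    by rewrite -realCM E c0 !mul0r.
  by rewrite cintegral_real /Rintegral integral0.
rewrite -(cintegral_phase xi rt) -cintegralZ; last first.
  have i := integrableZl measurableT (eucl xi `^ alpha) (integrable_indic_itv rho t).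
  apply: (cintegrable_bound _ i).
    apply: cmeasurableM; first by apply: cmeasurable_real; exact: measurable_indic.
    apply: cmeasurableM; first exact: cmeasurable_cst.
    by apply: cmeasurable_phase; [exact: (@oppr_measurable R _)|exact: measurable_cst].
  move=> tau; rewrite !normcM normc_phase mulr1 !normc_real (ger0_norm (powR_ge0 _ _)) ger0_norm//.
  by rewrite mulrC.
apply: eq_cintegral => tau.
rewrite [LHS](_ : _ = (clip T t tau)%:C * (clip T tau rho)%:C * (A * phase alpha (- tau) xi * K (rho, xi))); last by ring.
by rewrite -realCM E realCM; ring.
Qed.

(** Nothing is differentiated in time. The fixed point equation is inserted into the time integral
    of the symbol term; [E1] evaluates the part from the datum and [E2] the Duhamel part. All
    boundary terms cancel against the evolution, and ['i * 'i = -1] leaves the nonlinearity. *)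
Lemma evolution_equation t xi : t \in `[0, T] ->
  - 'i * (evolution t xi - evolution 0 xi) + primitive T V (t, xi) = sigma%:C * primitive T N (t, xi).
Proof.
rewrite in_itv/= => /andP[t0 tT].
pose e (tau : R) := phase alpha (- tau) xi; pose c := 'i * sigma%:C : R[i].
pose A := (eucl xi `^ alpha)%:C : R[i].
pose g (tau : measurableTypeR R) := (clip T t tau)%:C * (A * e tau).
have me : cmeasurable (e : measurableTypeR R -> R[i]).
  by apply: cmeasurable_phase; [exact: (@oppr_measurable R _)|exact: measurable_cst].
have mg : cmeasurable g.
  apply: cmeasurableM; first by apply: cmeasurable_real; exact: measurable_clip.
  by apply: cmeasurableM => //; exact: cmeasurable_cst.
have ng tau : normc (g tau) <= eucl xi `^ alpha * clip T t tau.
  by rewrite /g !normcM normc_phase mulr1 !normc_real (ger0_norm (powR_ge0 _ _)) ger0_norm ?clip_ge0// mulrC.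
have ig : cintegrable leb setT g.
  exact: (cintegrable_bound mg (integrableZl measurableT _ (integrable_indic_itv 0 (Num.min t T))) ng).
have [mK leK] := dK.
have mKx : cmeasurable (fun rho : measurableTypeR R => K (rho, xi)) by exact: cmeasurable_slice2.
have nk (z : R * R) : normc ((clip T z.1 z.2)%:C * K (z.2, xi)) <= MK * vwgt 1 xi * \1_`[0, T] z.2.
  rewrite normcM normc_real (ger0_norm (clip_ge0 _ _ _)) mulrC.
  apply: ler_pM; [exact: normc_ge0|exact: clip_ge0|exact: (leK (z.2, xi))|].
  rewrite /clip !indicE !mem_setE !in_itv/= le_min.
  by rewrite ler_nat; case: (0 <= z.2); case: (z.2 <= z.1); case: (z.2 <= T).
have i2 : cintegrable (leb \x leb)%E setT (fun z : measurableTypeR R * measurableTypeR R =>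
    g z.1 * ((clip T z.1 z.2)%:C * K (z.2, xi))).
  have j1 := integrableZl measurableT (eucl xi `^ alpha) (integrable_indic_itv 0 (Num.min t T)).
  have j2 := integrableZl measurableT (MK * vwgt 1 xi) (integrable_indic_itv 0 T).
  apply: (cintegrable_bound _ (integrable_prodM j1 j2)).
    apply: cmeasurableM; first exact: (cmeasurable_comp mg measurable_fst).
    apply: cmeasurableM; last exact: (cmeasurable_comp mKx measurable_snd).
    by apply: cmeasurable_real; exact: measurable_clip2.
  by move=> z; rewrite normcM; apply: ler_pM; [exact: normc_ge0|exact: normc_ge0|exact: ng|exact: nk].
have E1 : cintegral leb setT g = 'i * (e t - 1).
  have := cintegral_phase xi t0; rewrite oppr0 phase0 => <-; apply: eq_cintegral => tau.
  by rewrite /g /clip (min_l tT).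
have iKt := cintegrable_primitive T t xi dK.
have iNt := cintegrable_primitive T t xi dN.
have E2 : cintegral leb setT (fun tau => g tau * primitive T K (tau, xi)) =
    'i * e t * primitive T K (t, xi) - 'i * primitive T N (t, xi).
  transitivity (cintegral leb setT (fun tau => cintegral leb setT (fun rho =>
      g tau * ((clip T tau rho)%:C * K (rho, xi))))).
    by apply: eq_cintegral => tau; rewrite /primitive cintegralZ//; exact: (cintegrable_primitive _ _ _ dK).
  have := cfubini i2 => /= ->.
  transitivity (cintegral leb setT (fun rho => 'i * e t * ((clip T t rho)%:C * K (rho, xi)) -
      'i * ((clip T t rho)%:C * N (rho, xi)))).
    by apply: eq_cintegral => rho; have := inner xi rho tT; rewrite /g /N /=; move=> ->; rewrite /e; ring.
  by rewrite cintegralB ?cintegralZ//; apply: cintegrableZ.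
have iP : cintegrable leb setT (fun tau => g tau * primitive T K (tau, xi)).
  have -> : (fun tau => g tau * primitive T K (tau, xi)) = fun tau : measurableTypeR R =>
      cintegral leb setT (fun rho : measurableTypeR R => g tau * ((clip T tau rho)%:C * K (rho, xi))).
    apply/funext => tau; rewrite /primitive [RHS]cintegralZ//; exact: (cintegrable_primitive _ _ _ dK).
  exact: (cintegrable1 i2).
have EV : primitive T V (t, xi) = phi xi * ('i * (e t - 1)) +
    c * ('i * e t * primitive T K (t, xi) - 'i * primitive T N (t, xi)).
  rewrite -E1 -E2 -!cintegralZ// -cintegralD; [|exact: cintegrableZ|exact: cintegrableZ].
  by apply: eq_cintegral => tau; rewrite /V /g /e /c /A /= fixW /=; ring.
rewrite evolution0 /evolution fixW EV /c -/K -/(e t) /=.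
have ii : ('i : R[i]) * 'i = -1 by rewrite -expr2 sqr_i.
rewrite [LHS](_ : _ = - ('i * 'i) * sigma%:C * primitive T N (t, xi)); last by ring.
by rewrite ii opprK mul1r.
Qed.

(** The phase varies at a rate given by the symbol, hence the weight of half rate; the slow unknown
    [W] varies at the rate of the nonlinearity. *)
Lemma evolution_lipschitz : exists2 L : R, 0 <= L & forall t t' xi,
  normc (evolution t xi - evolution t' xi) <= L * `|t - t'| * vwgt 2^-1 xi.
Proof.
have [A A0 hA] := symbol_vwgt; have [_ leW] := dW.
exists (4 * eps * A + 2 * `|sigma| * MK) => [|t t' xi]; first by nonneg; rewrite addr_ge0//; nonneg.
have -> : evolution t xi - evolution t' xi = (phase alpha (- t) xi - phase alpha (- t') xi) * W (t, xi) +
    phase alpha (- t') xi * (W (t, xi) - W (t', xi)) by rewrite /evolution; ring.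
rewrite (le_trans (le_normcD _ _))// !normcM normc_phase mul1r.
have h1 : normc (phase alpha (- t) xi - phase alpha (- t') xi) <= 2 * (eucl xi `^ alpha * `|t - t'|).
  rewrite /phase (le_trans (cis_lipschitz _ _))// ler_wpM2l// -mulrBl normrM mulrC.
  by rewrite (ger0_norm (powR_ge0 _ _)) -normrN opprB opprK addrC.
have h2 : normc (W (t, xi) - W (t', xi)) <= `|sigma| * (2 * `|t - t'| * MK * vwgt 1 xi).
  have -> : W (t, xi) - W (t', xi) = 'i * sigma%:C * (primitive T K (t, xi) - primitive T K (t', xi)).
    by rewrite !fixW; exact: mulr_subD.
  have ni : normc ('i : R[i]) = 1 by rewrite /normc /= expr0n expr1n add0r sqrtr1.
  rewrite normcM normcM ni mul1r normc_real ler_wpM2l//.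
  exact: primitive_lipschitz.
have h3 := ler_pM (normc_ge0 _) (normc_ge0 _) h1 (leW (t, xi)).
rewrite (le_trans (lerD h3 h2))//=.
have a0 : 0 <= 2 * `|t - t'| * (2 * eps) by nonneg.
have b0 : 0 <= `|sigma| * 2 * `|t - t'| * MK by nonneg.
have := ler_wpM2l a0 (hA xi); have := ler_wpM2l b0 (vwgt_half xi).
move: (eucl xi `^ alpha) (vwgt 1 xi) (vwgt 2^-1 xi) => u v w g1 g2.
rewrite [leLHS](_ : _ = 2 * `|t - t'| * (2 * eps) * (u * v) + `|sigma| * 2 * `|t - t'| * MK * v); last by ring.
rewrite [leRHS](_ : _ = 2 * `|t - t'| * (2 * eps) * (A * w) + `|sigma| * 2 * `|t - t'| * MK * w); last by ring.
exact: lerD.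
Qed.

Hypothesis invW : forall rho, rotation rho -> forall t x, W (t, rho x) = W (t, x).

Lemma evolution_invariant t rho : rotation rho -> invariant_under rho (evolution t).
Proof. by move=> r x; rewrite /evolution phase_rotation// invW. Qed.

Lemma dominated_half M F : 0 <= M -> dominated 1 M F -> dominated 2^-1 M F.
Proof. by move=> M0 [mF le]; split=> // x; rewrite (le_trans (le x))// ler_wpM2l// vwgt_half. Qed.

Lemma CHs_rad_evolution k : CHs_rad k T (fun t => dist (evolution t)).
Proof.
have h0 : 0 < 2^-1 :> R by rewrite invr_gt0.
split=> [t _|t _ e e0].
  by apply: (Hs_rad_dist k ltr01 e20 (dominated_evolution t)) => rho; exact: evolution_invariant.
have [L L0 hL] := evolution_lipschitz; have [C C0 hC] := weighted_L2_dominated k h0.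
have D0 : 0 < C * L + 1 by rewrite ltr_wpDl// mulr_ge0.
exists (e / (C * L + 1)) => [|t' _ tt']; first by rewrite divr_gt0.
have d1 := dominated_half e20 (dominated_evolution t'); have d2 := dominated_half e20 (dominated_evolution t).
have M0 : 0 <= L * `|t' - t| by nonneg.
have d : dominated 2^-1 (L * `|t' - t|) (fun xi => evolution t' xi - evolution t xi).
  by split=> [|xi]; [exact: (cmeasurableB d1.1 d2.1)|exact: hL].
rewrite (distB h0 e20 e20 d1 d2) (le_lt_trans (Hs_norm_le k (has_fourier_dist h0 M0 d)))//.
rewrite (le_lt_trans (hC _ _ M0 d))// lte_fin mulrA.
rewrite (le_lt_trans (y := (C * L + 1) * `|t' - t|))//; first by rewrite ler_wpM2r// lerDl.
by rewrite mulrC -ltr_pdivlMr.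
Qed.

Lemma cmeasurable_evolution : cmeasurable (fun z : measurableTypeR R * R3 R => evolution z.1 z.2).
Proof.
have [m _] := dominated2_phase dW.
by rewrite (_ : (fun z => _) = fun z => phase alpha (- z.1) z.2 * W z)//; apply/funext => -[t xi].
Qed.

(** A Fourier formula for the potential, jointly measurable in time and space. *)
Let pot (z : measurableTypeR R * R3 R) : R[i] :=
  cintegral vol setT (fun h => (kern alpha h)%:C * corr (evolution z.1) h * cis (dot z.2 h)).

Let cmeasurable_pot : cmeasurable pot.
Proof.
have [mk _ _] := kern_bound alpha1 alpha2.
have mE := cmeasurable_evolution.
have mT : cmeasurable (fun z : measurableTypeR R * R3 R => tilde (evolution z.1) z.2).
  apply: cmeasurable_conj.
  have mp : measurable_fun setT (fun z : measurableTypeR R * R3 R => (z.1, - z.2)).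
    exact: (measurable_fun_pair measurable_fst (measurableT_comp (@measurable_opp3 R) measurable_snd)).
  exact: (cmeasurable_comp mE mp).
have mC := cmeasurable_conv2 mE mT.
have m11 : measurable_fun setT (fun w : measurableTypeR R * R3 R * R3 R => w.1.1).
  exact: (measurableT_comp measurable_fst measurable_fst).
have m12 : measurable_fun setT (fun w : measurableTypeR R * R3 R * R3 R => w.1.2).
  exact: (measurableT_comp measurable_snd measurable_fst).
apply: (@cmeasurable_cintegral _ _ (measurableTypeR R * R3 R)%type (R3 R) R vol
  (fun w => (kern alpha w.2)%:C * corr (evolution w.1.1) w.2 * cis (dot w.1.2 w.2))).
apply: cmeasurableM; last first.
  by apply: cmeasurable_cis; apply: measurable_dot => //; exact: measurable_snd.
apply: cmeasurableM.
  by apply: cmeasurable_real; exact: (measurableT_comp mk measurable_snd).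
exact: (cmeasurable_comp mC (measurable_fun_pair m11 measurable_snd)).
Qed.

(** A bound uniform in time and space, so that the finiteness of the space-time integral against a
    test function reduces to the integrability of that test function. *)
Lemma potential_evolution_bound : exists2 C : R, 0 <= C & forall t x,
  potential alpha (ift (evolution t)) x = (complex.Re (pot (t, x)))%:E /\ 0 <= complex.Re (pot (t, x)) <= C.
Proof.
have [mk k0 kb] := kern_bound alpha1 alpha2.
pose C := convC * pi ^+ 3 * (2 * eps) * (2 * eps) : R.
have C0 : 0 <= C by rewrite /C !mulr_ge0 ?exprn_ge0 ?pi_ge0 ?convC_ge0.
have ik : vol.-integrable setT (EFin \o (fun x => kern alpha x * wgt (x - 0))).
  apply/integrableP; split.
    apply/measurable_EFinP; apply: measurable_funM => //.
    by apply: (measurableT_comp (@measurable_wgt R)); exact: measurable_funB3.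
  rewrite (eq_integral (fun x => (kern alpha x * wgt (x - 0))%:E)) => [|x _]; last first.
    by rewrite /= ger0_norm// mulr_ge0 ?wgt_ge0.
  by rewrite (le_lt_trans (kb 0))// ltry.
pose I := Rintegral vol setT (fun x => kern alpha x * wgt (x - 0)).
have I0 : 0 <= I by apply: Rintegral_ge0 => x _; rewrite mulr_ge0 ?wgt_ge0.
exists (2 * (C * I)) => [|t x]; first by nonneg.
have [mE leE] := dominated_evolution t.
have [v pE VE] := potential_ift alpha1 alpha2 ler01 e20 mE leE x.
have PV : pot (t, x) = v%:C by rewrite VE.
have RV : complex.Re (pot (t, x)) = v by rewrite PV.
rewrite RV pE; split=> //; apply/andP; split.
  rewrite -lee_fin -pE; apply: integral_ge0 => y _.
  by rewrite lee_fin mulr_ge0 ?powR_ge0 ?sqr_ge0.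
have : normc v%:C <= 2 * (C * I).
  rewrite VE /I -RintegralZl//; apply: normc_cintegral; last first.
  - move=> h; rewrite !normcM normc_cis mulr1 normc_real ger0_norm// mulrCA ler_wpM2l//.
    rewrite (le_trans (normc_corr ler01 e20 mE leE h))// subr0 ler_wpM2l// vwgt_le//.
  - exact: (integrableZl measurableT _ ik).
  apply: (cintegrable_bound _ (integrableZl measurableT C ik)).
    apply: cmeasurableM; last exact: cmeasurable_cis_dot.
    by apply: cmeasurableM; [exact: cmeasurable_real|exact: cmeasurable_corr].
  move=> h; rewrite !normcM normc_cis mulr1 normc_real ger0_norm// mulrCA ler_wpM2l//.
  by rewrite (le_trans (normc_corr ler01 e20 mE leE h))// subr0 ler_wpM2l// vwgt_le//.
by rewrite normc_real; apply: le_trans; exact: ler_norm.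
Qed.

Lemma evolution_finite (eta : test R) :
  (\int[leb]_(t in `[0%R, T]) \int[leb3]_x
    (potential alpha (ift (evolution t)) x * (normc (ift (evolution t) x) * `|eta x|)%:E) < +oo)%E.
Proof.
have [C C0 hC] := potential_evolution_bound.
have mp : measurable_fun setT (fun z : measurableTypeR R * R3 R => complex.Re (pot z)) by case: cmeasurable_pot.
have mi : cmeasurable (fun z : measurableTypeR R * R3 R => ift (evolution z.1) z.2).
  exact: (cmeasurable_ift2 cmeasurable_evolution).
pose f (z : measurableTypeR R * R3 R) : R := complex.Re (pot z) * (normc (ift (evolution z.1) z.2) * `|eta z.2|).
have mfr : measurable_fun setT f.
  apply: measurable_funM => //; apply: measurable_funM.
    exact: measurable_normc.
  apply: measurableT_comp => //; exact: (measurableT_comp (measurable_test eta) measurable_snd).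
have mf : measurable_fun setT (EFin \o f) by exact/measurable_EFinP.
have f0 z : (0 <= (EFin \o f) z)%E.
  case: z => t x; rewrite lee_fin /f mulr_ge0 ?mulr_ge0 ?normc_ge0//.
  by have [_ /andP[]] := hC t x.
pose I := Rintegral vol setT (@vwgt R 1).
have I0 : 0 <= I by apply: Rintegral_ge0 => x _; exact: vwgt_ge0.
pose B : R := 2 * fourier_cst * (2 * eps * I).
have fc0 := ltW (@fourier_cst_gt0 R).
have B0 : 0 <= B by rewrite /B; nonneg.
have fb t x : normc (ift (evolution t) x) <= B.
  have dE := dominated_evolution t; have iE := dominated_integrable ler01 dE.
  rewrite (le_trans (normc_ift x iE))// /ift_bound /B; apply: ler_wpM2l; first by nonneg.
  rewrite /I -RintegralZl//; last exact: integrable_vwgt.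
  apply: le_Rintegral => //.
  - exact: (cintegrable_normc iE).
  - exact: (integrableZl measurableT _ (integrable_vwgt ler01)).
  - by move=> xi _; exact: (dE.2 xi).
have iz := integrable_norm (integrable_test eta).
have ic : vol.-integrable setT (fun x => (C * B * `|eta x|)%:E).
  exact: (integrableZl measurableT (C * B) iz).
pose J := Rintegral vol setT (fun x => C * B * `|eta x|).
have le t : (\int[vol]_x (f (t, x))%:E <= J%:E)%E.
  rewrite /J /Rintegral fineK; last exact: (integrable_fin_num measurableT ic).
  apply: ge0_le_integral => //.
  - by move=> x _; exact: (f0 (t, x)).
  - by apply/measurable_EFinP; exact: (measurable_pairl (t : measurableTypeR R) mfr).
  - exact: measurable_int ic.
  - move=> x _; rewrite lee_fin /f mulrA ler_wpM2r//.
    have [_ /andP[p0 p1]] := hC t x.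
    by apply: ler_pM; [exact: p0|exact: normc_ge0|exact: p1|exact: fb].
rewrite (eq_integral (fun t : measurableTypeR R => (\int[vol]_x (f (t, x))%:E)%E)); last first.
  move=> t _; apply: eq_integral => x _.
  by have [-> _] := hC t x; rewrite -EFinM.
apply: (@le_lt_trans _ _ (\int[leb]_(t in `[0%R, T]) J%:E)%E).
  apply: ge0_le_integral => //.
  - by move=> t _; apply: integral_ge0 => x _; exact: (f0 (t, x)).
  - apply: measurable_funTS; exact: (measurable_fun_fubini_tonelli_F (m2 := vol) _ mf f0).
rewrite integral_cst//= lebesgue_measure_itv/= lte_fin T0 -EFinB -EFinM ltry//.
Qed.

Lemma regular_solution_evolution s : regular_solution alpha sigma s T (dist phi) (fun t => dist (evolution t)).
Proof.
have dE := dominated_evolution; have h0 : 0 < 2^-1 :> R by rewrite invr_gt0.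
split; last exact: CHs_rad_evolution.
  split; first exact: CHs_rad_evolution.
  exists (fun t => ift (evolution t)); split.
  - exact: (cmeasurable_ift2 cmeasurable_evolution).
  - by apply: aeW => t _; exact: (represents_dist ltr01 e20 (dE t)).
  - exact: evolution_finite.
  move=> eta t tT; have [t0 tT'] : 0 <= t /\ t <= T by move: tT; rewrite in_itv => /andP[].
  have [M M0 dV'] := dV.
  have EV : cintegral leb `[0, t] (fun tau => frac_laplacian alpha (dist (evolution tau)) eta) =
      dist (fun xi => primitive T V (t, xi)) eta.
    rewrite -(dist_primitive _ h0 M0 dV' tT').
    have -> // : (fun tau => frac_laplacian alpha (dist (evolution tau)) eta) =
        fun tau => dist (fun xi => V (tau, xi)) eta.
    by apply/funext => tau; rewrite (frac_laplacian_dist _ _ ltr01 e20 (dE tau)).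
  have EN : cintegral leb `[0, t] (fun tau => cintegral leb3 setT
      (fun x => hartree alpha (ift (evolution tau)) x * (eta x)%:C)) =
      dist (fun xi => primitive T N (t, xi)) eta.
    rewrite -(dist_primitive _ ltr01 MK0 dN tT').
    have -> // : (fun tau => cintegral leb3 setT (fun x => hartree alpha (ift (evolution tau)) x * (eta x)%:C)) =
        fun tau => dist (fun xi => N (tau, xi)) eta.
    apply/funext => tau; rewrite leb3E; have [mE leE] := dE tau.
    have dn := dominated_nonlin alpha1 alpha2 ler01 e20 (dE tau).
    transitivity (cintegral vol setT (fun x => ift (nonlin alpha (evolution tau)) x * (eta x)%:C)).
      by apply: eq_cintegral => x; rewrite (hartree_ift alpha1 alpha2 ler01 e20 mE leE).
    rewrite (ift_pairing (dominated_integrable ler01 dn) (cintegrable_test eta)).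
    by apply: eq_cintegral => xi; rewrite NE inv_fourier_testE.
  rewrite EV EN.
  have dP beta' M' K' : 0 <= M' -> dominated2 beta' M' K' -> dominated beta' (2 * T * M') (fun xi => primitive T K' (t, xi)).
    move=> M'0 dK'; split=> [|xi]; last exact: (normc_primitive T0 (t, xi) M'0 dK').
    exact: (cmeasurable_pairl (t : measurableTypeR R) (cmeasurable_primitive T dK'.1)).
  have TM M' : 0 <= M' -> 0 <= 2 * T * M' by move=> ?; nonneg.
  have i1 := cintegrable_dist eta ltr01 e20 (dE t); have i2 := cintegrable_dist eta ltr01 e20 (dE 0).
  have i3 := cintegrable_dist eta h0 (TM _ M0) (dP _ _ _ M0 dV').
  have i4 := cintegrable_dist eta ltr01 (TM _ MK0) (dP _ _ _ MK0 dN).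
  rewrite /dist -cintegralB// -!cintegralZ//; last exact: cintegrableB.
  rewrite -cintegralD//; last by apply: cintegrableZ; exact: cintegrableB.
  by apply: eq_cintegral => xi; rewrite mulrA -(evolution_equation _ tT); ring.
apply/funext => eta; apply: eq_cintegral => xi; by rewrite evolution0.
Qed.

End Evolution.

(** * The third differential of the flow *)

Section Taylor.
Context {R : realType}.
Implicit Types (f g : R -> R) (d e : R).

Lemma is_derive_first_order f (x : R) d :
  (forall e, 0 < e -> exists2 delta : R, 0 < delta & forall h : R, `|h| < delta ->
     `|f (x + h) - f x - h * d| <= e * `|h|) -> is_derive x 1 f d.
Proof.
move=> H.
have c : h^-1 *: ((f \o shift x) (h *: 1) - f x) @[h --> 0^'] --> (d : R).
  apply/cvgrPdist_le => e e0; have [delta d0 hd] := H e e0.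
  near=> h; have h0 : h != 0 by near: h; exact: nbhs_dnbhs_neq.
  have hlt : `|h| < delta.
    near: h; apply: dnbhs0_lt => //.
  have := hd h hlt; rewrite /= [h *: 1]mulr1 /GRing.scale /= (addrC h x) => le.
  rewrite -(ler_pM2r (x := `|h|)) ?normr_gt0// -normrM.
  rewrite (_ : (d - h^-1 * (f (x + h) - f x)) * h = - (f (x + h) - f x - h * d)) ?normrN//.
  by field.
by apply: DeriveDef; [apply/cvg_ex; exists d; exact: c|apply/cvg_lim => //; exact: c].
Unshelve. all: end_near. Qed.

(** One use of the mean value theorem raises the order of vanishing by one. *)
Lemma is_derive_bound f g delta e (n : nat) : 0 <= e ->
  (forall x : R, 0 <= x < delta -> is_derive x 1 f (g x)) -> f 0 = 0 ->
  (forall x : R, 0 <= x < delta -> `|g x| <= e * x ^+ n) ->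
  forall x : R, 0 <= x < delta -> `|f x| <= e * x ^+ n.+1.
Proof.
move=> e0 df f0 hg x /andP[]; rewrite le_eqVlt => /predU1P[<- _|x0 xd].
  by rewrite f0 normr0 expr0n mulr0.
have inx (y : R) : y \in `[0, x] -> 0 <= y < delta.
  by rewrite in_itv/= => /andP[-> yx] /=; rewrite (le_lt_trans yx).
have cf : {within `[0, x], continuous f}.
  apply: continuous_in_subspaceT => y; rewrite inE => /inx/df [dy _].
  by apply: differentiable_continuous; exact/derivable1_diffP.
have dfo (y : R) : y \in `]0, x[ -> is_derive y 1 f (g y).
  by move=> y0; apply: df; apply: inx; exact: subset_itv_oo_cc.
have [c] := MVT x0 dfo cf.
rewrite in_itv/= f0 !subr0 => /andP[c0 cx] ->.
have cd : 0 <= c < delta by rewrite (ltW c0) (lt_trans cx).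
rewrite normrM (gtr0_norm x0) exprSr mulrA ler_wpM2r ?(ltW x0)//.
rewrite (le_trans (hg c cd))// ler_wpM2l// lerXn2r ?nnegrE ?(ltW c0) ?(ltW x0) ?(ltW cx)//.
Qed.

Lemma cubic_coefficient (a b c k : R) :
  (forall e, 0 < e -> exists2 delta : R, 0 < delta & forall x : R, 0 < x < delta ->
     `|a + b * x + c * x ^+ 2 + k * x ^+ 3| <= e * x ^+ 3) -> k = 0.
Proof.
move=> H; apply/eqP; rewrite -normr_le0; apply/ler_addgt0Pl => e e0; rewrite addr0.
(* The four evaluations enter with total weight [64 + 3 * 27 + 3 * 8 + 1 = 170], which is at most
   [6 * 29]; hence the accuracy [e / 29]. *)
have [delta d0 hd] := H _ (divr_gt0 e0 (ltr0Sn R 28)).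
(* A fifth, so that [4 * x] still lies below [delta]. *)
pose x := delta / 5; have x0 : 0 < x by rewrite divr_gt0.
have xd (m : R) : 0 < m -> m <= 4 -> 0 < m * x < delta.
  move=> m0 m4; rewrite mulr_gt0//= /x; have := ler_wpM2r (ltW x0) m4; rewrite /x; lra.
have h1 := hd _ (xd 1 ltr01 ltac:(lra)); have h2 := hd _ (xd 2 ltac:(lra) ltac:(lra)).
have h3 := hd _ (xd 3 ltac:(lra) ltac:(lra)); have h4 := hd _ (xd 4 ltac:(lra) ltac:(lra)).
have x3 : 0 < x ^+ 3 by rewrite exprn_gt0.
move: h1 h2 h3 h4; set p1 := _ + k * _; set p2 := _ + k * (2 * x) ^+ 3.
set p3 := _ + k * (3 * x) ^+ 3; set p4 := _ + k * (4 * x) ^+ 3 => h1 h2 h3 h4.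
(* the third finite difference kills the terms of degree less than 3 *)
have E : 6 * k * x ^+ 3 = p4 - 3 * p3 + 3 * p2 - p1 by rewrite /p1 /p2 /p3 /p4; ring.
have : `|6 * k * x ^+ 3| <= 6 * e * x ^+ 3.
  rewrite E; move: h1 h2 h3 h4; rewrite !exprMn !ler_norml; lra.
by rewrite (normrM (6 * k)) (normrM 6) (gtr0_norm x3) (ger0_norm (ler0n _ 6)) ler_pM2r// ler_pM2l.
Qed.

(* The derivative of [g''] is only known at [0]: its Peano remainder is integrated
   twice by the mean value theorem. *)
Lemma third_derivative (g g' g'' : R -> R) (l d c1 c3 C : R) : 0 < d -> 0 <= C ->
  (forall x : R, `|x| < d -> is_derive x 1 g (g' x)) ->
  (forall x : R, `|x| < d -> is_derive x 1 g' (g'' x)) ->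
  (forall e, 0 < e -> exists2 delta : R, 0 < delta & forall h : R, `|h| < delta ->
     `|g'' h - g'' 0 - h * l| <= e * `|h|) ->
  (forall x : R, `|x| < d -> `|g x - (x * c1 + x ^+ 3 * c3)| <= C * `|x| ^+ 5) ->
  l = 6 * c3.
Proof.
move=> d0 C0 dg dg' dg'' gE.
pose r2 (x : R) := g'' x - g'' 0 - x * l.
pose r1 (x : R) := g' x - g' 0 - x * g'' 0 - x ^+ 2 * (l / 2).
pose r0 (x : R) := g x - g 0 - x * g' 0 - x ^+ 2 * (g'' 0 / 2) - x ^+ 3 * (l / 6).
have dr1 (x : R) : `|x| < d -> is_derive x 1 r1 (r2 x).
  move=> xd; have h := dg' x xd.
  have -> : r1 = g' - cst (g' 0) - id * cst (g'' 0) - id * id * cst (l / 2).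
    by apply/funext => y; rewrite /r1 expr2.
  by apply: is_derive_eq; rewrite /r2 /GRing.scale /= !fctE; field.
have dr0 (x : R) : `|x| < d -> is_derive x 1 r0 (r1 x).
  move=> xd; have h := dg x xd.
  have -> : r0 = g - cst (g 0) - id * cst (g' 0) - id * id * cst (g'' 0 / 2) -
      id * id * id * cst (l / 6).
    by apply/funext => y; rewrite /r0 !fctE /=; ring.
  by apply: is_derive_eq; rewrite /r1 /GRing.scale /= !fctE; field.
suff : l / 6 - c3 = 0 by move=> h; lra.
(* The Taylor polynomial with coefficient [l / 6] and the given expansion with coefficient [c3]
   differ by [o(x ^+ 3)], so their cubic coefficients agree. *)
apply: (@cubic_coefficient (g 0) (g' 0 - c1) (g'' 0 / 2)) => e e0.
have e20 : 0 < e / 2 by rewrite divr_gt0.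
have [delta de hd] := dg'' _ e20.
have C1 : 0 < C + 1 by rewrite ltr_wpDl.
(* Half of [e] goes to the Taylor remainder. The bounds 1 and [e / 2 / (C + 1)] on [x] make the
   quintic error at most the other half. *)
pose m := Num.min (Num.min d delta) (Num.min 1 (e / 2 / (C + 1))).
have m0 : 0 < m by rewrite !lt_min d0 de ltr01 divr_gt0.
exists m => // x /andP[x0]; rewrite !lt_min => /andP[/andP[xd xdel] /andP[x1 xe]].
have lt (D y : R) : 0 <= y < D -> `|y| < D by move=> /andP[y0 yD]; rewrite ger0_norm.
pose D := Num.min d delta.
have Dd (y : R) : 0 <= y < D -> 0 <= y < d by rewrite lt_min => /and3P[-> ->].
have b2 (y : R) : 0 <= y < D -> `|r2 y| <= e / 2 * y ^+ 1.
  rewrite lt_min => /and3P[y0 yd ydel]; have := hd y; rewrite ger0_norm// expr1; exact.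
have r10 : r1 0 = 0 by rewrite /r1; ring.
have r00 : r0 0 = 0 by rewrite /r0; ring.
have b1 := is_derive_bound (ltW e20) (fun y yD => dr1 y (lt _ _ (Dd y yD))) r10 b2.
have b0 := is_derive_bound (ltW e20) (fun y yD => dr0 y (lt _ _ (Dd y yD))) r00 b1.
have xD : 0 <= x < D by rewrite (ltW x0) lt_min xd.
have h0 := b0 x xD; have hg := gE x (lt _ _ (Dd x xD)).
have -> : g 0 + (g' 0 - c1) * x + g'' 0 / 2 * x ^+ 2 + (l / 6 - c3) * x ^+ 3 =
    (g x - (x * c1 + x ^+ 3 * c3)) - r0 x by rewrite /r0; ring.
rewrite (le_trans (ler_normB _ _))//.
have h5 : C * `|x| ^+ 5 <= e / 2 * x ^+ 3.
  rewrite (gtr0_norm x0) -[5%N]/(2 + 3)%N exprD mulrA ler_wpM2r ?exprn_ge0 ?(ltW x0)//.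
  have h6 : x * (C + 1) < e / 2 by rewrite -ltr_pdivlMr.
  have h7 : x ^+ 2 <= x by rewrite expr2 ler_piMl ?(ltW x0) ?(ltW x1).
  have := ler_wpM2l C0 h7; nra.
lra.
Qed.

End Taylor.

(** * Expansion of the regular solutions in the size of the datum *)

Section Cubic.
Context {R : realType}.
Variables (alpha sigma T : R).
Hypotheses (alpha1 : 1 < alpha) (alpha2 : alpha <= 2) (T0 : 0 < T).
Implicit Types (x xi : R3 R) (M beta e : R) (F phi : R3 R -> R[i]).

Lemma conv_scale (a b : R) (P Q : R3 R -> R[i]) x :
  cintegrable vol setT (fun y => P y * Q (x - y)) ->
  conv (fun y => a%:C * P y) (fun y => b%:C * Q y) x = (a * b)%:C * conv P Q x.
Proof.
move=> i; rewrite /conv -cintegralZ//; apply: eq_cintegral => y; rewrite realCM; ring.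
Qed.

Lemma nonlin_scale beta M F e : 0 <= beta -> 0 <= M -> dominated beta M F ->
  forall x, nonlin alpha (fun y => e%:C * F y) x = (e ^+ 3)%:C * nonlin alpha F x.
Proof.
move=> b0 M0 [mF leF].
have mT := cmeasurable_tilde mF; have leT := normc_tilde leF.
have leF1 x : normc (F x) <= M * (1 * vwgt beta x) by rewrite mul1r.
have ET : tilde (fun y => e%:C * F y) = (fun y => e%:C * tilde F y).
  by apply/funext => y; rewrite /tilde conjcM (_ : (e%:C)^* = e%:C)//; apply: complex_eqP; rewrite /= ?oppr0.
have EC h : corr (fun y => e%:C * F y) h = (e * e)%:C * corr F h.
  rewrite /corr ET conv_scale//.
  exact: (cintegrable_conv_integrand kernel_bound1 b0 M0 M0 mF mT leF1 leT).
have [mk k0 _] := kern_bound alpha1 alpha2.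
have A0 : 0 <= convC * pi ^+ 3 * M * M :> R by rewrite !mulr_ge0 ?exprn_ge0 ?pi_ge0 ?convC_ge0.
have mk1 : cmeasurable (fun h => (kern alpha h)%:C * corr F h).
  by apply: cmeasurableM; [exact: cmeasurable_real|exact: cmeasurable_corr].
have lek x : normc ((kern alpha x)%:C * corr F x) <= convC * pi ^+ 3 * M * M * (kern alpha x * vwgt beta x).
  rewrite normcM normc_real ger0_norm// mulrCA ler_wpM2l//.
  exact: (normc_corr b0 M0 mF leF).
move=> x; rewrite /nonlin.
have -> : (fun h => (kern alpha h)%:C * corr (fun y => e%:C * F y) h) =
    (fun h => (e * e)%:C * ((kern alpha h)%:C * corr F h)).
  by apply/funext => h; rewrite EC mulrCA.
rewrite conv_scale; last exact: (cintegrable_conv_integrand (kern_bound alpha1 alpha2) b0 A0 M0 mk1 mF lek leF).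
by rewrite (_ : e * e * e = e ^+ 3)//; ring.
Qed.

(** The first Duhamel correction, computed from the free evolution of the datum and brought back
    from the interaction picture. *)
Definition cubic_term phi (t : R) xi : R[i] := phase alpha (- t) xi *
  ('i * sigma%:C * primitive T (duhamel_integrand alpha (fun z => phi z.2)) (t, xi)).

Lemma dominated2_cst M phi : dominated 1 M phi ->
  dominated2 1 M (fun z : measurableTypeR R * R3 R => phi z.2).
Proof.
by move=> [mp lep]; split; [exact: (cmeasurable_comp mp measurable_snd)|move=> z; exact: lep].
Qed.

Lemma duhamel_integrand_scale M phi e z : 0 <= M -> dominated 1 M phi ->
  duhamel_integrand alpha (fun z => e%:C * phi z.2) z =
  (e ^+ 3)%:C * duhamel_integrand alpha (fun z => phi z.2) z.
Proof.
move=> M0 dp; rewrite /duhamel_integrand [RHS]mulrCA; congr (_ * _).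
rewrite -(nonlin_scale _ ler01 M0 (dominated_phase alpha (- z.1) dp)).
have -> : (fun xi => phase alpha (- z.1) xi * (e%:C * phi (z.1, xi).2)) =
    (fun y => e%:C * (phase alpha (- z.1) y * phi y)) by apply/funext => y; rewrite mulrCA.
by [].
Qed.

Lemma primitive_scale M phi e z : 0 <= M -> dominated 1 M phi ->
  primitive T (duhamel_integrand alpha (fun z => e%:C * phi z.2)) z =
  (e ^+ 3)%:C * primitive T (duhamel_integrand alpha (fun z => phi z.2)) z.
Proof.
move=> M0 dp; have dK := dominated2_duhamel_integrand alpha1 alpha2 M0 (dominated2_cst dp).
rewrite /primitive -cintegralZ; last exact: (cintegrable_primitive T z.1 z.2 dK).
by apply: eq_cintegral => tau; rewrite (duhamel_integrand_scale e (tau, z.2) M0 dp) mulrCA.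
Qed.

Lemma dominated_scale beta M phi e : dominated beta M phi ->
  dominated beta (`|e| * M) (fun xi => e%:C * phi xi).
Proof.
move=> [mp lep]; split; first by apply: cmeasurableM => //; exact: cmeasurable_cst.
by move=> x; rewrite normcM normc_real -mulrA ler_wpM2l.
Qed.

Lemma cubic_term_dominated phi M : 0 <= M -> dominated 1 M phi ->
  exists2 K, 0 <= K & forall t, dominated 1 K (cubic_term phi t).
Proof.
move=> M0 dp; have dK := dominated2_duhamel_integrand alpha1 alpha2 M0 (dominated2_cst dp).
have N0 : 0 <= nonlinC alpha * M ^+ 3 by rewrite mulr_ge0 ?exprn_ge0 ?nonlinC_ge0.
exists (`|sigma| * (2 * T * (nonlinC alpha * M ^+ 3))).
  by rewrite mulr_ge0// mulr_ge0// mulr_ge0// ltW.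
move=> t; apply: dominated_phase; split.
  apply: cmeasurableM; first exact: cmeasurable_cst.
  exact: (cmeasurable_pairl (t : measurableTypeR R) (cmeasurable_primitive T dK.1)).
move=> x; rewrite normcM normcM normc_real (_ : normc 'i = 1) ?mul1r; last first.
  by rewrite /normc /= expr0n expr1n add0r sqrtr1.
by rewrite -[leRHS]mulrA (ler_wpM2l (normr_ge0 _))//; exact: (normc_primitive T0 (t, x) N0 dK).
Qed.

Lemma cubic_expansion (s : R) phi M : 0 <= M -> dominated 1 M phi ->
  (forall rho, rotation rho -> invariant_under rho phi) ->
  exists2 e0 : R, 0 < e0 & exists2 C, 0 <= C & forall e, `|e| < e0 ->
  exists2 F : R -> R3 R -> R[i],
    regular_solution alpha sigma s T (dist (fun xi => e%:C * phi xi)) (fun t => dist (F t)) &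
    forall t, dominated 1 (2 * (`|e| * M)) (F t) /\ forall xi,
      normc (F t xi - (e%:C * (phase alpha (- t) xi * phi xi) + (e ^+ 3)%:C * cubic_term phi t xi))
        <= C * `|e| ^+ 5 * vwgt 1 xi.
Proof.
move=> M0 dp invp.
have N0 := nonlinC_ge0 alpha1 alpha2.
pose K := 48 * `|sigma| * T * nonlinC alpha * M ^+ 2.
have K0 : 0 <= K by rewrite mulr_ge0 ?exprn_ge0// mulr_ge0// mulr_ge0 ?(ltW T0)// mulr_ge0.
have K1 : 0 < 1 + K by rewrite ltr_wpDr.
(* Below this threshold both [|e|] and [|e| * K] are at most 1, hence so is their product, which is
   the smallness quantity of [picard]. *)
exists (1 + K)^-1; first by rewrite invr_gt0.
exists (384 * (`|sigma| * T * nonlinC alpha) ^+ 2 * M ^+ 5).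
  exact: (mulr_ge0 (mulr_ge0 (ler0n _ 384) (sqr_ge0 _)) (exprn_ge0 5 M0)).
move=> e; rewrite -[X in _ < X]mul1r ltr_pdivlMr// => he.
have eM0 : 0 <= `|e| * M by rewrite mulr_ge0.
have small : 48 * `|sigma| * T * nonlinC alpha * (`|e| * M) ^+ 2 <= 1.
  have -> : 48 * `|sigma| * T * nonlinC alpha * (`|e| * M) ^+ 2 = `|e| * (`|e| * K) by rewrite /K; ring.
  have h0 : 0 <= `|e| by []. have h1 : 0 <= `|e| * K by rewrite mulr_ge0.
  by rewrite mulr_ile1//; move: he; rewrite mulrDr mulr1; lra.
have de := dominated_scale e dp.
have [W [dW invW fixW _ leW]] := picard alpha1 alpha2 T0 eM0 de small.
exists (evolution alpha W).
  apply: (regular_solution_evolution alpha1 alpha2 T0 eM0 dW fixW _ s) => rho rr t x.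
  by apply: invW => // y; rewrite (invp _ rr).
move=> t; split; first exact: dominated_evolution.
move=> xi; rewrite /evolution /cubic_term.
have := leW (t, xi); rewrite (primitive_scale e (t, xi) M0 dp).
set P := primitive _ _ _; rewrite -[(t, xi).2]/xi => h.
have -> : phase alpha (- t) xi * W (t, xi) - (e%:C * (phase alpha (- t) xi * phi xi) +
    (e ^+ 3)%:C * (phase alpha (- t) xi * ('i * sigma%:C * P))) =
  phase alpha (- t) xi * (W (t, xi) - e%:C * phi xi - 'i * sigma%:C * ((e ^+ 3)%:C * P)) by ring.
rewrite normcM normc_phase mul1r (le_trans h)//.
by rewrite [(`|e| * M) ^+ 5]exprMn (mulrC (`|e| ^+ 5)) [_ * (M ^+ 5 * _)]mulrA.
Qed.

End Cubic.

Section DistScale.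
Context {R : realType}.
Implicit Types (F G : R3 R -> R[i]).

Lemma distZ beta M F (c : R[i]) : 0 < beta -> 0 <= M -> dominated beta M F ->
  dist (fun xi => c * F xi) = c *: dist F.
Proof.
move=> b0 M0 dF; apply/funext => eta; rewrite /dist fctE.
rewrite -[RHS]/(c * _) -cintegralZ; last exact: (cintegrable_dist eta b0 M0 dF).
by apply: eq_cintegral => xi; rewrite mulrA.
Qed.

Lemma dist_ext (F G : R3 R -> R[i]) : F =1 G -> dist F = dist G.
Proof. by move=> /funext ->. Qed.

Lemma Hs_norm_dist s beta : 0 < beta -> exists2 C : R, 0 <= C & forall F M,
  0 <= M -> dominated beta M F -> (Hs_norm s (dist F) <= (C * M)%:E)%E.
Proof.
move=> b0; have [C C0 H] := @weighted_L2_dominated R s beta b0; exists C => // F M M0 dF.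
exact: (le_trans (Hs_norm_le s (has_fourier_dist b0 M0 dF)) (H _ _ M0 dF)).
Qed.

(** The closed form of [distr_bound], with [x = 0] allowed, is the one that fits remainder
    estimates. *)
Lemma distr_le s (eta : test R) : exists2 C : R, 0 <= C & forall (S : distr R) (x : R),
  0 <= x -> (Hs_norm s S <= x%:E)%E -> normc (S eta) <= C * x.
Proof.
have [C C0 H] := distr_bound s eta; exists C => // S x x0 le.
apply/ler_addgt0Pl => e e0; have C1 : 0 < C + 1 by rewrite ltr_wpDl.
have d0 : 0 < e / (C + 1) by rewrite divr_gt0.
have /H : 0 < x + e / (C + 1) by rewrite ltr_wpDl.
move=> /(_ S); rewrite (le_lt_trans le) ?lte_fin ?ltrDl// => /(_ isT)/le_trans; apply.
rewrite mulrDr addrC lerD2r mulrCA ler_piMr ?(ltW e0)//.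
by rewrite ler_pdivrMr// mul1r lerDl.
Qed.

Lemma CHs_norm_at s T (u : R -> distr R) t (x : \bar R) : t \in `[0, T] -> (CHs_norm s T u <= x)%E ->
  (Hs_norm s (u t) <= x)%E.
Proof. by move=> tT; apply: le_trans; apply: ereal_sup_ubound; exists t. Qed.

End DistScale.

Section RealLinear.
Context {R : realType} {V W : lmodType R[i]}.
Variables (X : set V) (A : V -> W).
Hypotheses (linA : real_linear_on X A) (X0 : X 0).

Lemma real_linear0 : A 0 = 0.
Proof.
have := linA 1 X0 X0; rewrite !scale1r addr0 => /esym/eqP.
by rewrite -subr_eq0 addrK => /eqP.
Qed.

Lemma real_linearZ (a : R) h : X h -> A (a%:C *: h) = a%:C *: A h.
Proof. by move=> Xh; have := linA a Xh X0; rewrite real_linear0 !addr0. Qed.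

End RealLinear.

(** * The flow restricted to a line through the origin *)

Section Line.
Context {R : realType}.
Variables (alpha sigma s T r : R) (Phi : distr R -> R -> distr R).
Hypotheses (alpha1 : 1 < alpha) (alpha2 : alpha <= 2) (T0 : 0 < T) (r0 : 0 < r).
Hypothesis flow : flow_map alpha sigma s T r Phi.
Variables (phi : R3 R -> R[i]) (M : R).
Hypotheses (M0 : 0 <= M) (dp : dominated 1 M phi).
Hypothesis invp : forall rho, rotation rho -> invariant_under rho phi.
Implicit Types (e : R) (eta : test R).

Lemma line_dist e : e%:C *: dist phi = dist (fun xi => e%:C * phi xi).
Proof. by rewrite (distZ e%:C ltr01 M0 dp). Qed.

Lemma line_Hs_rad e : Hs_rad s (e%:C *: dist phi).
Proof.
rewrite line_dist; apply: (Hs_rad_dist s ltr01 _ (dominated_scale e dp)); first by rewrite mulr_ge0.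
by move=> rho rr x; rewrite (invp rr).
Qed.

Lemma line_norm : exists2 m : R, 0 < m & forall e, (Hs_norm s (e%:C *: dist phi) <= (`|e| * m)%:E)%E.
Proof.
have [C C0 H] := @Hs_norm_dist R s 1 ltr01; exists (C * M + 1); first by rewrite ltr_wpDl ?mulr_ge0.
move=> e; rewrite line_dist (le_trans (H _ _ _ (dominated_scale e dp))) ?mulr_ge0// lee_fin.
by rewrite mulrCA ler_wpM2l// lerDl.
Qed.

(** Here the uniqueness clause of [flow_map] enters: [Phi] has to select the regular solution just
    constructed, so its values inherit the cubic expansion. *)
Lemma flow_cubic t eta : t \in `[0, T] -> exists2 d : R, 0 < d & exists2 C : R, 0 <= C & forall e, `|e| < d ->
  normc (Phi (e%:C *: dist phi) t eta - (e%:C * dist (fun xi => phase alpha (- t) xi * phi xi) eta +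
     (e ^+ 3)%:C * dist (cubic_term alpha sigma T phi t) eta)) <= C * `|e| ^+ 5.
Proof.
move=> tT; have [e0 e00 [C C0 H]] := cubic_expansion sigma alpha1 alpha2 T0 s M0 dp invp.
have [m m0 lem] := line_norm; have [C1 C10 H1] := @Hs_norm_dist R s 1 ltr01.
have [C2 C20 H2] := distr_le s eta.
have [K K0 dB] := cubic_term_dominated sigma alpha1 alpha2 T0 M0 dp.
(* The second bound keeps the datum inside the ball of radius [r] on which [Phi] is a flow map. *)
exists (Num.min e0 (r / m)); first by rewrite lt_min e00 divr_gt0.
exists (C2 * (C1 * C)); first by rewrite !mulr_ge0.
move=> e; rewrite lt_min ltr_pdivlMr// => /andP[ee0 er].
have [F regF HF] := H e ee0.
have nr : (Hs_norm s (e%:C *: dist phi) < r%:E)%E by rewrite (le_lt_trans (lem e))// lte_fin.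
have [_ /(_ (fun t => dist (F t)))] := flow (line_Hs_rad e) nr.
rewrite {1}line_dist => /(_ regF) uF; rewrite (uF t tT).
have [dF leF] := HF t.
have dq : dominated 1 (`|e| * M) (fun xi => e%:C * (phase alpha (- t) xi * phi xi)).
  exact: (dominated_scale e (dominated_phase alpha (- t) dp)).
have dc := dominated_scale (e ^+ 3) (dB t).
have e3 : 0 <= `|e ^+ 3| * K by rewrite mulr_ge0.
have eM : 0 <= `|e| * M by rewrite mulr_ge0.
have eM2 : 0 <= 2 * (`|e| * M) by rewrite mulr_ge0.
have dFq := dominatedB dF dq.
have E : dist (F t) eta - (e%:C * dist (fun xi => phase alpha (- t) xi * phi xi) eta +
     (e ^+ 3)%:C * dist (cubic_term alpha sigma T phi t) eta) =
   dist (fun xi => F t xi - e%:C * (phase alpha (- t) xi * phi xi) -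
     (e ^+ 3)%:C * cubic_term alpha sigma T phi t xi) eta.
  rewrite -(distB ltr01 (addr_ge0 eM2 eM) e3 dFq dc) -(distB ltr01 eM2 eM dF dq).
  rewrite (distZ e%:C ltr01 M0 (dominated_phase alpha (- t) dp)) (distZ _ ltr01 K0 (dB t)).
  by rewrite !fctE opprD addrA.
rewrite E.
have dD : dominated 1 (C * `|e| ^+ 5) (fun xi => F t xi - e%:C * (phase alpha (- t) xi * phi xi) -
     (e ^+ 3)%:C * cubic_term alpha sigma T phi t xi).
  split; first by have [] := dominatedB dFq dc.
  by move=> xi; have := leF xi; rewrite opprD addrA.
have C5 : 0 <= C * `|e| ^+ 5 by rewrite mulr_ge0 ?exprn_ge0.
rewrite (le_trans (H2 _ _ _ (H1 _ _ C5 dD))) ?mulr_ge0//.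
by rewrite -!mulrA.
Qed.

(** Paired with [eta] at time [t], the flow and its differentials along the line become a function
    of one variable and its successive derivatives. [third_derivative] then compares with the
    expansion of [flow_cubic]; 6 is the factorial of 3. *)
Lemma third_variation rho (D1 : distr R -> distr R -> R -> distr R)
    (D2 : distr R -> distr R -> distr R -> R -> distr R)
    (D3 : distr R -> distr R -> distr R -> distr R -> R -> distr R) :
  0 < rho ->
  (forall phi, Hs_rad s phi -> (Hs_norm s phi < rho%:E)%E ->
      [/\ bounded_linear (Hs_rad s) (Hs_norm s) (CHs_norm s T) (D1 phi),
          bounded_bilinear (Hs_rad s) (Hs_norm s) (CHs_norm s T) (D2 phi),
          bounded_trilinear (Hs_rad s) (Hs_norm s) (CHs_norm s T) (D3 phi)
        & forall eps : R, 0 < eps -> exists2 delta : R, 0 < delta &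
            forall h, Hs_rad s h -> (Hs_norm s h < delta%:E)%E ->
            [/\ (CHs_norm s T (Phi (phi + h)%R - Phi phi - D1 phi h)%R
                   <= eps%:E * Hs_norm s h)%E,
                forall k, Hs_rad s k ->
                  (CHs_norm s T (D1 (phi + h)%R k - D1 phi k - D2 phi h k)%R
                     <= eps%:E * (Hs_norm s h * Hs_norm s k))%E
              & forall k l, Hs_rad s k -> Hs_rad s l ->
                  (CHs_norm s T (D2 (phi + h)%R k l - D2 phi k l - D3 phi h k l)%R
                     <= eps%:E * (Hs_norm s h * Hs_norm s k * Hs_norm s l))%E]]) ->
  forall t eta, t \in `[0, T] ->
    D3 0 (dist phi) (dist phi) (dist phi) t eta = 6 * dist (cubic_term alpha sigma T phi t) eta.
Proof.
move=> rho0 H t eta tT; set S := dist phi.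
have [m m0 lem] := line_norm; have Xl := line_Hs_rad; rewrite -/S in lem Xl.
have S1 : 1%:C *: S = S by rewrite scale1r.
have S0 : 0%:C *: S = 0 by rewrite scale0r.
have XS : Hs_rad s S by rewrite -S1.
have X0 : Hs_rad s (0 : distr R) by rewrite -S0.
have nS : (Hs_norm s S <= m%:E)%E by have := lem 1; rewrite S1 normr1 mul1r.
have [d1 d10 [C C0 HC]] := flow_cubic eta tT; rewrite -/S in HC.
have [C2 C20 H2] := distr_le s eta.
pose d := Num.min d1 (rho / m); have d0 : 0 < d by rewrite lt_min d10 divr_gt0.
have Sadd x h : x%:C *: S + h%:C *: S = (x + h)%:C *: S by rewrite -scalerDl -rmorphD.
have near0 x : `|x| < d -> (Hs_norm s (x%:C *: S) < rho%:E)%E.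
  by rewrite lt_min ltr_pdivlMr// => /andP[_ xr]; rewrite (le_lt_trans (lem x))// lte_fin.
have C21 : 0 < C2 + 1 by rewrite ltr_wpDl.
(* A remainder that is small in the norm of the target, with [n] copies of the norm along the line,
   yields a scalar remainder [e * |h|]. *)
have key (n : nat) e : 0 < e -> exists2 e' : R, 0 < e' & forall (u : R -> distr R) (h : R) (y : \bar R),
    (CHs_norm s T u <= e'%:E * y)%E -> (y <= (`|h| * m ^+ n)%:E)%E ->
    normc (u t eta) <= e * `|h|.
  move=> e0; have mn : 0 < m ^+ n by rewrite exprn_gt0.
  exists (e / ((C2 + 1) * m ^+ n)); first by rewrite divr_gt0// mulr_gt0.
  move=> u h y ule yle; have p0 : 0 <= e / ((C2 + 1) * m ^+ n) by rewrite divr_ge0 ?(ltW e0)// ltW// mulr_gt0.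
  have := CHs_norm_at tT (le_trans ule (lee_wpmul2l _ yle)); rewrite lee_fin => /(_ p0).
  rewrite -EFinM => hu; apply: (le_trans (H2 _ _ _ hu)); first exact: (mulr_ge0 p0 (mulr_ge0 (normr_ge0 h) (ltW mn))).
  have -> : C2 * (e / ((C2 + 1) * m ^+ n) * (`|h| * m ^+ n)) = (C2 / (C2 + 1)) * (e * `|h|).
    by field; rewrite !gt_eqF.
  by rewrite ler_piMl ?mulr_ge0 ?(ltW e0)// ler_pdivrMr// mul1r lerDl.
have n1 h : (Hs_norm s (h%:C *: S) <= (`|h| * m ^+ 1)%:E)%E by rewrite expr1.
have n2 h : (Hs_norm s (h%:C *: S) * Hs_norm s S <= (`|h| * m ^+ 2)%:E)%E.
  by rewrite expr2 mulrA EFinM lee_pmul ?Hs_norm_ge0.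
have n3 h : (Hs_norm s (h%:C *: S) * Hs_norm s S * Hs_norm s S <= (`|h| * m ^+ 3)%:E)%E.
  by rewrite exprSr mulrA (EFinM (`|h| * _)) lee_pmul ?mule_ge0 ?Hs_norm_ge0.
have small (de : R) h : 0 < de -> `|h| < de / m -> (Hs_norm s (h%:C *: S) < de%:E)%E.
  by move=> de0; rewrite ltr_pdivlMr// => hd; rewrite (le_lt_trans (lem h))// lte_fin.
have d0lt : `|0 : R| < d by rewrite normr0.
(* [P] stands for the real or the imaginary part; the calculus lemmas are about real functions. *)
have HP (P : R[i] -> R) : (forall z w, P (z - w) = P z - P w) -> (forall (a : R) z, P (a%:C * z) = a * P z) ->
   (forall z, `|P z| <= normc z) -> P (D3 0 S S S t eta) = 6 * P (dist (cubic_term alpha sigma T phi t) eta).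
  move=> PB PZ Pn.
  apply: (@third_derivative R (fun x => P (Phi (x%:C *: S) t eta)) (fun x => P (D1 (x%:C *: S) S t eta))
    (fun x => P (D2 (x%:C *: S) S S t eta)) _ d (P (dist (fun xi => phase alpha (- t) xi * phi xi) eta))
    (P (dist (cubic_term alpha sigma T phi t) eta)) C d0 C0).
  - move=> x xd; apply: is_derive_first_order => e e0; have [e' e'0 ke] := key 1%N e e0.
    have [[lin _] _ _ /(_ e' e'0)[de de0 hd]] := H _ (Xl x) (near0 x xd).
    exists (de / m) => [|h hh]; first by rewrite divr_gt0.
    have [+ _ _] := hd _ (Xl h) (small de h de0 hh).
    move=> /ke/(_ (n1 h)); rewrite Sadd; apply: le_trans.
    rewrite (real_linearZ lin X0 h XS) -PZ -!PB; exact: Pn.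
  - move=> x xd; apply: is_derive_first_order => e e0; have [e' e'0 ke] := key 2%N e e0.
    have [_ [_ lin _] _ /(_ e' e'0)[de de0 hd]] := H _ (Xl x) (near0 x xd).
    exists (de / m) => [|h hh]; first by rewrite divr_gt0.
    have [_ /(_ S XS) + _] := hd _ (Xl h) (small de h de0 hh).
    move=> /ke/(_ (n2 h)); rewrite Sadd; apply: le_trans.
    rewrite (real_linearZ (lin S XS) X0 h XS) -PZ -!PB; exact: Pn.
  - move=> e e0; have [e' e'0 ke] := key 3%N e e0.
    have [_ _ [_ _ lin _] /(_ e' e'0)[de de0 hd]] := H _ (Xl 0) (near0 0 d0lt).
    exists (de / m) => [|h hh]; first by rewrite divr_gt0.
    have [_ _ /(_ S S XS XS)] := hd _ (Xl h) (small de h de0 hh).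
    move=> /ke/(_ (n3 h)); rewrite Sadd add0r; apply: le_trans.
    rewrite -S0 (real_linearZ (lin S S XS XS) X0 h XS) -PZ -!PB; exact: Pn.
  - move=> x; rewrite lt_min => /andP[xd1 _]; apply: le_trans (HC x xd1).
    rewrite (le_trans _ (Pn _))// PB -!PZ.
    have PN w : P (- w) = - P w.
      by rewrite -mulN1r (_ : -1 = (-1)%:C) ?PZ ?mulN1r// rmorphN1.
    by rewrite -[X in P (_ + X)]opprK (PB _ (- _)) PN opprK.
have E6 : 6 = 6%:C :> R[i] by rewrite rmorph_nat.
have ZRe (a : R) (z : R[i]) : complex.Re (a%:C * z) = a * complex.Re z.
  by case: z => x y /=; rewrite mul0r subr0.
have ZIm (a : R) (z : R[i]) : complex.Im (a%:C * z) = a * complex.Im z.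
  by case: z => x y /=; rewrite mul0r addr0.
rewrite E6; apply: complex_eqP.
  rewrite (HP (@complex.Re R))//.
  - by move=> z w; rewrite ReD ReN.
  - exact: normr_Re_le.
rewrite (HP (@complex.Im R))//.
- by move=> z w; rewrite ImD ImN.
- exact: normr_Im_le.
Qed.

End Line.

(** * The trilinear bound that a flow of class C^3 would give *)

Section Trilinear.
Context {R : realType}.
Variables (alpha sigma s T r : R) (Phi : distr R -> R -> distr R).
Hypotheses (alpha1 : 1 < alpha) (alpha2 : alpha <= 2) (T0 : 0 < T) (r0 : 0 < r).

(** The bound on the third differential at the origin, evaluated on the diagonal. [K] comes from
    [D3] alone, so it does not depend on the datum, nor on the constant [M] with which the datum is
    dominated. *)
Lemma cubic_term_bound : flow_map alpha sigma s T r Phi ->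
  C3_at_origin (Hs_rad s) (Hs_norm s) (CHs_norm s T) Phi ->
  exists2 K : R, 0 <= K & forall (phi : R3 R -> R[i]) (M m t : R), 0 <= M -> dominated 1 M phi ->
    (forall rho, rotation rho -> invariant_under rho phi) -> 0 <= m ->
    (weighted_L2_norm s phi <= m%:E)%E -> t \in `[0, T] ->
    (weighted_L2_norm s (cubic_term alpha sigma T phi t) <= (K * m ^+ 3)%:E)%E.
Proof.
move=> flow [rho rho0 [D1 [D2 [D3 [H _]]]]].
have dz : dominated 1 0 (fun=> 0 : R[i]).
  by split; [exact: cmeasurable_cst|move=> x; rewrite normc0 mul0r].
have Z : dist (fun=> 0) = 0 :> distr R.
  have := distZ 0 ltr01 (lexx 0) dz; rewrite scale0r => <-.
  by apply: dist_ext => x; rewrite mul0r.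
have X0 : Hs_rad s (0 : distr R) by rewrite -Z; exact: (Hs_rad_dist s ltr01 (lexx 0) dz).
have n0 : (Hs_norm s (0%R : distr R) < rho%:E)%E.
  have [C C0 h] := @Hs_norm_dist R s 1 ltr01; have := h _ _ (lexx 0) dz; rewrite Z mulr0 => /le_lt_trans; apply.
  by rewrite lte_fin.
have [_ _ [_ _ _ [K HK]] _] := H 0 X0 n0.
exists `|K| => // phi M m t M0 dp invp m0 lem tT.
have V eta := @third_variation R alpha sigma s T r Phi alpha1 alpha2 T0 r0 flow phi M M0 dp invp _ D1 D2 D3 rho0 H t eta tT.
have XS : Hs_rad s (dist phi) by exact: (Hs_rad_dist s ltr01 M0 dp invp).
have nS : (Hs_norm s (dist phi) <= m%:E)%E.
  exact: (le_trans (Hs_norm_le s (has_fourier_dist ltr01 M0 dp))).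
have [Kc Kc0 dc] := cubic_term_dominated sigma alpha1 alpha2 T0 M0 dp.
pose G xi := 6%:C * cubic_term alpha sigma T phi t xi.
have d6 : dominated 1 (`|6| * Kc) G.
  exact: dominated_scale.
have bound : (Hs_norm s (D3 0%R (dist phi) (dist phi) (dist phi) t) <= (`|K| * m ^+ 3)%:E)%E.
  apply: (CHs_norm_at tT); apply: (le_trans (HK _ _ _ XS XS XS)).
  have p3 : (0 <= Hs_norm s (dist phi) * Hs_norm s (dist phi) * Hs_norm s (dist phi))%E.
    by rewrite !mule_ge0 ?Hs_norm_ge0.
  apply: (@le_trans _ _ (`|K|%:E * (Hs_norm s (dist phi) * Hs_norm s (dist phi) * Hs_norm s (dist phi)))%E).
    by apply: lee_wpmul2r => //; rewrite lee_fin ler_norm.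
  rewrite EFinM; apply: lee_wpmul2l; first by rewrite lee_fin.
  by rewrite exprSr expr2 !EFinM; apply: lee_pmul; rewrite ?mule_ge0 ?Hs_norm_ge0//; apply: lee_pmul; rewrite ?Hs_norm_ge0.
have k0 : 0 <= `|6 : R| * Kc by rewrite mulr_ge0.
have le6 := @le_Hs_norm R s s (D3 0 (dist phi) (dist phi) (dist phi) t) _ d6.1
  (weighted_L2_dominated_lty s ltr01 k0 d6) _.
have h6 : (weighted_L2_norm s G <= (`|K| * m ^+ 3)%:E)%E.
  apply: (le_trans _ bound); apply: le6 => a d.
  rewrite V -[RHS]/(dist G (bump a d)).
  by rewrite (distZ 6%:C ltr01 Kc0 (dc t)) -[RHS]/(_ * _) rmorph_nat.
(* The factor 6 is at least 1 and may be dropped. *)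
apply: (le_trans _ h6); rewrite !weighted_L2_normE; apply: gt0_ler_poweR; rewrite ?invr_ge0//.
- by rewrite in_itv/= sqint_ge0 leey.
- by rewrite in_itv/= sqint_ge0 leey.
rewrite /sqint; apply: ge0_le_integral => //.
- by move=> x _; rewrite lee_fin mulr_ge0 ?exprn_ge0 ?(ltW (sobw_gt0 _ _)) ?normc_ge0.
- by apply/measurable_EFinP; apply: measurable_sqint; exact: (dc t).1.
- by apply/measurable_EFinP; apply: measurable_sqint; exact: d6.1.
move=> x _; rewrite lee_fin ler_wpM2l ?(ltW (sobw_gt0 _ _))// lerXn2r ?nnegrE ?normc_ge0//.
have -> : normc (G x) = `|6| * normc (cubic_term alpha sigma T phi t x) by rewrite -normc_real -normcM.
by rewrite ler_peMl ?normc_ge0// ger0_norm//; lra.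
Qed.

End Trilinear.

(** * Norm inflation *)

Section KernelLower.
Context {R : realType}.
Variable alpha : R.
Hypotheses (alpha1 : 1 < alpha) (alpha2 : alpha <= 2).
Notation leb := (@lebesgue_measure R).
Implicit Types (h x : R3 R) (v lambda : R).

(** Away from the origin the integral over the scales converges: the power decays for large [v], and
    for very negative [v] the Gaussian exponent [c * expR (- v)] takes over, through the bound of
    [x ^+ 2 * expR (- x)] by 4. Otherwise the value of [kern] would be a default and no lower bound
    could follow. *)
Lemma integrable_heat h : h != 0 -> leb.-integrable setT (EFin \o (fun v => heat alpha v h)).
Proof.
move=> h0; pose c : R := dot h h / 4.
have c0 : 0 < c.
  by rewrite divr_gt0// -sqr_eucl exprn_gt0// lt_neqAle eucl_ge0 andbT eq_sym eucl_eq0.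
have c2 : 0 <= 4 / c ^+ 2 by rewrite divr_ge0// exprn_ge0// ltW.
apply: (@integrable_bound _ _ _ leb _ (fun v => (1 + 4 / c ^+ 2) * (8 * cauchy v))).
- exact: (measurable_pairl (h : R3 R) (measurable_heat2 alpha)).
- exact: (integrableZl measurableT (1 + 4 / c ^+ 2) (integrableZl measurableT 8 integrable_cauchy)).
move=> v; rewrite ger0_norm ?heat_ge0//.
apply: (le_trans _ (ler_wpM2l _ (expR_norm_cauchy v))); last by rewrite addr_ge0.
rewrite /heat gauss3E (_ : expR (- v) / 4 * dot h h = c * expR (- v)); last by rewrite /c; field.
have [v0|v0] := leP 0 v.
  have a1 : expR (v * ((alpha - 3) / 2)) <= expR (- (v / 2)).
    rewrite ler_expR; have : v * (alpha - 2) <= 0 by rewrite mulr_ge0_le0// subr_le0.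
    lra.
  have a2 : expR (- (c * expR (- v))) <= 1.
    by rewrite -expR0 ler_expR oppr_le0 mulr_ge0 ?expR_ge0// ltW.
  rewrite (le_trans (ler_pM _ _ a1 a2)) ?expR_ge0// mulr1 ger0_norm//.
  by rewrite ler_peMl ?expR_ge0// lerDl.
rewrite ltr0_norm// (_ : - (- v / 2) = v / 2); last by field.
set x := c * expR (- v).
have x0 : 0 < x by rewrite mulr_gt0 ?expR_gt0.
have b1 : x * expR (- (x / 2)) <= 2.
  rewrite expRN ler_pdivrMr ?expR_gt0//; have := expR_ge1Dx (x / 2); lra.
have b2 : x ^+ 2 * expR (- x) <= 4.
  have -> : x ^+ 2 * expR (- x) = (x * expR (- (x / 2))) ^+ 2.
    by rewrite [RHS]exprMn -expRM_natl (_ : 2%:R * - (x / 2) = - x)//; field.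
  have p0 : 0 <= x * expR (- (x / 2)) by rewrite mulr_ge0 ?expR_ge0// ltW.
  nra.
have b3 : expR (- x) <= 4 / c ^+ 2 * expR (2 * v).
  rewrite mulrAC ler_pdivlMr ?exprn_gt0// -(ler_pM2r (x := expR (2 * - v))) ?expR_gt0//.
  rewrite -[leRHS]mulrA -expRD (_ : 2 * v + 2 * - v = 0); last by ring.
  rewrite expR0 mulr1 (_ : expR (- x) * c ^+ 2 * expR (2 * - v) = x ^+ 2 * expR (- x))//.
  have -> : x ^+ 2 = c ^+ 2 * expR (2 * - v) by rewrite /x exprMn -expRM_natl.
  by ring.
have b4 : expR (v * ((alpha - 3) / 2)) * expR (2 * v) <= expR (v / 2).
  rewrite -expRD ler_expR; have : v * alpha <= v * 1 by rewrite ler_nM2l// ltW.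
  have : v * 1 <= 0 by rewrite mulr1 ltW.
  have : 0 <= v * (alpha - 2) by rewrite mulr_le0// ?subr_le0// ltW.
  nra.
rewrite (le_trans (ler_wpM2l (expR_ge0 _) b3))// mulrCA.
rewrite (le_trans (ler_wpM2l c2 b4))// ler_wpM2r ?expR_ge0//; lra.
Qed.

(** On the retained scales the power loses at most a factor [e] and the Gaussian at most another,
    whence [expR (- 2)]. *)
Lemma kern_lower lambda h : 1 <= lambda -> h != 0 -> `|h| <= lambda / 20 ->
  kern_cst alpha * expR (- 2) * lambda `^ (alpha - 3) <= kern alpha h.
Proof.
move=> l1 h0 hl; have l0 : 0 < lambda by rewrite (lt_le_trans ltr01).
rewrite /kern -mulrA ler_pM2l ?kern_cst_gt0//.
(* only the scales [expR v] between [lambda ^+ 2] and [e * lambda ^+ 2] are kept *)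
pose a := 2 * ln lambda.
have E : expR (- 2) * lambda `^ (alpha - 3) = expR ((alpha - 3) * ln lambda - 2).
  by rewrite /powR gt_eqF// expRD mulrC.
rewrite E -[leLHS]mulr1.
apply: (@Rintegral_ge_set _ _ _ leb _ `[a, a + 1]%classic _ 1 _ _ (integrable_heat h0)).
- exact: measurable_itv.
- have m1 : lebesgue_measure (`[a, a + 1]%classic : set R) = 1%E.
    by rewrite lebesgue_measure_itv/= lte_fin ltrDl ltr01 -EFinB addrAC subrr add0r.
  exact: m1.
- by move=> v; exact: heat_ge0.
have lin (w L g : R) : 0 <= (w - 2 * L - 1) * (alpha - 3) -> g <= 1 ->
    (alpha - 3) * L - 2 <= w * ((alpha - 3) / 2) - g by move=> h1 h2; have a1 := alpha1; nra.
move=> v /=; rewrite in_itv/= => /andP[av va]; rewrite /heat gauss3E -expRD ler_expR.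
have hD : dot h h <= lambda ^+ 2.
  rewrite -sqr_eucl lerXn2r ?nnegrE ?eucl_ge0 ?(ltW l0)//.
  by rewrite (le_trans (eucl_le h))//; lra.
have ev : expR (- v) * lambda ^+ 2 <= 1.
  have -> : lambda ^+ 2 = expR a by rewrite /a expRM_natl lnK.
  by rewrite -expRD -expR0 ler_expR addrC subr_le0.
have v1 : v - a - 1 <= 0 by rewrite lerBlDr add0r lerBlDl.
have a3 : alpha - 3 <= 0 by rewrite subr_le0 (le_trans alpha2)// ler_nat.
apply: (lin _ _ _ (mulr_le0 v1 a3)).
have := ler_wpM2l (expR_ge0 (- v)) hD; have := dot_ge0 h; have := expR_ge0 (- v); nra.
Qed.

End KernelLower.

Section RealBounds.
Context {R : realType}.
Implicit Types (a b c d B : R).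

Lemma alternating_le a b c d B : 0 <= a -> a <= B -> 0 <= b -> b <= B -> 0 <= c -> c <= B ->
  0 <= d -> d <= B -> `|a - b - c + d| <= 2 * B.
Proof. by move=> *; rewrite ler_norml; apply/andP; split; lra. Qed.

Lemma quarter_le a B : 4 * a * B <= 1 -> a * (2 * B) <= 1 / 2.
Proof. lra. Qed.

Lemma cos_lower a : `|a| <= 1 / 2 -> 1 / 2 <= cos a.
Proof.
move=> ha; have := cos_lipschitz a 0; rewrite cos0 subr0 => /le_trans/(_ ha).
by rewrite ler_norml => /andP[]; lra.
Qed.

End RealBounds.

(** * The datum concentrated on a shell, and its phases *)

Section Annulus.
Context {R : realType}.
Variables (alpha lambda : R).
Hypotheses (alpha1 : 1 < alpha) (alpha2 : alpha <= 2) (lambda1 : 1 <= lambda).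
Notation leb := (@lebesgue_measure R).
Implicit Types (x y h xi : R3 R) (s tau t : R).

Definition shell : set (R3 R) := [set x | lambda <= eucl x <= 2 * lambda].
Definition annulus x : R := \1_shell x.
Definition center : R3 R := (3 / 2 * lambda, 0, 0).

Let lambda0 : 0 < lambda. Proof. exact: lt_le_trans lambda1. Qed.

Lemma annulus_ge0 x : 0 <= annulus x.
Proof. by rewrite /annulus indicE; case: (_ \in _). Qed.

Lemma annulusE x : annulus x = if lambda <= eucl x <= 2 * lambda then 1 else 0.
Proof.
rewrite /annulus indicE (_ : (x \in shell) = (lambda <= eucl x <= 2 * lambda)); last by rewrite mem_setE.
by case: ifP.
Qed.

Lemma measurable_annulus : measurable_fun setT annulus.
Proof.
apply: measurable_indic.
have -> : shell = (fun x : R3 R => eucl x) @^-1` `[lambda, 2 * lambda]%classic.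
  by apply/seteqP; split=> x; rewrite /shell /preimage/= in_itv.
rewrite -[X in measurable X]setTI; exact: measurable_eucl.
Qed.

(** The constant bounds the inverse weight on the ball of radius [2 * lambda]. Its enormous size
    does no harm: domination is used qualitatively, and only the Sobolev norm of the datum enters
    the final inequality. *)
Lemma dominated_annulus : dominated 1 (expR (2 * lambda) * (1 + 2 * lambda) ^+ 6) (fun x => (annulus x)%:C).
Proof.
split; first by apply: cmeasurable_real; exact: measurable_annulus.
move=> x; rewrite normc_real ger0_norm ?annulus_ge0// annulusE.
have l2 : 0 <= 2 * lambda by rewrite mulr_ge0// ltW.
have p0 : 0 <= expR (2 * lambda) * (1 + 2 * lambda) ^+ 6 by rewrite mulr_ge0 ?expR_ge0// exprn_ge0// addr_ge0.
case: (boolP (lambda <= eucl x <= 2 * lambda)) => [/andP[_ h]|_]; last exact: (mulr_ge0 p0 (vwgt_ge0 _ _)).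
have xl : `|x| <= 2 * lambda by rewrite (le_trans (norm_le_eucl x)).
have w1 := norm1_gt0 x; have w6 : 0 < (1 + `|x|) ^+ 6 by rewrite exprn_gt0.
rewrite /vwgt /wgt mul1r mulrA ler_pdivlMr// mul1r mulrAC -expRD.
have -> : (1 + `|x|) ^+ 6 = 1 * (1 + `|x|) ^+ 6 by rewrite mul1r.
apply: (ler_pM ler01 (ltW w6)).
  by rewrite -[X in X <= _]expR0 ler_expR subr_ge0.
by apply: lerXn2r; rewrite ?nnegrE ?addr_ge0 ?lerD2l.
Qed.

Lemma annulus_rotation rho : rotation rho -> invariant_under rho (fun x => (annulus x)%:C).
Proof. by move=> r x; rewrite !annulusE eucl_rotation. Qed.

Lemma annulus_near x : `|x - center| <= lambda / 10 -> annulus x = 1.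
Proof.
rewrite annulusE normR3E /center => h.
have [/andP[h1 h2] h3] : (`|x.1.1 - 3 / 2 * lambda| <= lambda / 10) && (`|x.1.2| <= lambda / 10) /\ `|x.2| <= lambda / 10.
  by move: h; rewrite !ge_max /= !subr0 => /andP[-> ->].
have [a1 a2] := andP (etrans (esym (ler_norml _ _)) h1).
have b2 : x.1.2 ^+ 2 <= (lambda / 10) ^+ 2 by rewrite -real_normK ?num_real// lerXn2r// nnegrE divr_ge0// ltW.
have b3 : x.2 ^+ 2 <= (lambda / 10) ^+ 2 by rewrite -real_normK ?num_real// lerXn2r// nnegrE divr_ge0// ltW.
have e0 := eucl_ge0 x.
have := sqr_eucl x; rewrite /dot -!expr2 => E.
have l0 := lambda0.
have -> : lambda <= eucl x.
  rewrite -(@ler_pXn2r _ 2) ?nnegrE ?(ltW lambda0)// E.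
  have := sqr_ge0 x.1.2; have := sqr_ge0 x.2; nra.
have -> //: eucl x <= 2 * lambda.
have l2 : 0 <= 2 * lambda by rewrite mulr_ge0// ltW.
rewrite -(@ler_pXn2r _ 2) ?nnegrE// E; nra.
Qed.

Lemma annulus_le xi : annulus xi != 0 -> 0 <= eucl xi `^ alpha <= (2 * lambda) `^ alpha.
Proof.
rewrite annulusE; case: (boolP (_ <= _ <= _)) => [/andP[_ h] _|]; last by rewrite eqxx.
rewrite powR_ge0 ge0_ler_powR ?nnegrE ?eucl_ge0 ?mulr_ge0 ?(ltW lambda0)//.
by rewrite (le_trans _ (ltW alpha1)).
Qed.

(** The four symbols lie between 0 and [(2 * lambda) ^ alpha], so their alternating sum is at most
    twice that in absolute value; times [tau] it is at most [1 / 2], and the cosine stays above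
    [1 / 2]. *)
Lemma Re_resonance tau xi x y z : 0 <= tau -> 4 * tau * (2 * lambda) `^ alpha <= 1 -> annulus xi = 1 ->
  1 / 2 * (annulus x * annulus y * annulus z) <= complex.Re (phase alpha tau xi *
    (phase alpha (- tau) x * (annulus x)%:C) *
    (phase alpha (- tau) y * (annulus y)%:C * (phase alpha (- tau) z * (annulus z)%:C)^*)).
Proof.
move=> tau0 small axi.
have -> : phase alpha tau xi * (phase alpha (- tau) x * (annulus x)%:C) *
    (phase alpha (- tau) y * (annulus y)%:C * (phase alpha (- tau) z * (annulus z)%:C)^*) =
    (annulus x * annulus y * annulus z)%:C *
    cis (tau * (eucl xi `^ alpha - eucl x `^ alpha - eucl y `^ alpha + eucl z `^ alpha)).
  rewrite conjcM (_ : ((annulus z)%:C)^* = (annulus z)%:C); last by apply: complex_eqP; rewrite /= ?oppr0.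
  rewrite /phase -cisN !realCM; move: (eucl xi `^ alpha) (eucl x `^ alpha) (eucl y `^ alpha) (eucl z `^ alpha) => a b c d.
  rewrite (_ : tau * (a - b - c + d) = tau * a + (- tau * b + (- tau * c + - (- tau * d)))); last by ring.
  rewrite !cisD; move: (cis _) (cis _) (cis _) (cis _) => a' b' c' d'; ring.
have ZRe (a b : R) : complex.Re (a%:C * cis b) = a * cos b by rewrite /= mul0r subr0.
rewrite ZRe.
have [x0|x0] := eqVneq (annulus x) 0; first by rewrite x0 !mul0r mulr0.
have [y0|y0] := eqVneq (annulus y) 0; first by rewrite y0 mulr0 !mul0r mulr0.
have [z0|z0] := eqVneq (annulus z) 0; first by rewrite z0 !mulr0 mul0r.
rewrite mulrC ler_wpM2l ?mulr_ge0 ?annulus_ge0//; apply: cos_lower.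
have /annulus_le/andP[p1 q1] : annulus xi != 0 by rewrite axi oner_neq0.
have /annulus_le/andP[p2 q2] := x0; have /annulus_le/andP[p3 q3] := y0.
have /annulus_le/andP[p4 q4] := z0.
rewrite normrM (ger0_norm tau0).
apply: (le_trans _ (quarter_le small)); apply: (ler_wpM2l tau0); exact: (alternating_le p1 q1 p2 q2 p3 q3 p4 q4).
Qed.

End Annulus.

Section LowerBound.
Context {R : realType}.
Variables (alpha lambda : R).
Hypotheses (alpha1 : 1 < alpha) (alpha2 : alpha <= 2) (lambda1 : 1 <= lambda).
Notation leb := (@lebesgue_measure R).
Notation a0 := (center lambda).
Implicit Types (x y h xi : R3 R) (s tau t : R).

Let lambda0 : 0 < lambda. Proof. exact: lt_le_trans lambda1. Qed.

(** The factors are, in order: the cosine bound times the volume of a cube for [y], the lower bound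
    of the kernel, and the volume of a cube for [h]. *)
Definition resonance_bound : R :=
  (1 / 2 * (lambda / 10) ^+ 3) * (kern_cst alpha * expR (- 2) * lambda `^ (alpha - 3)) * (lambda / 40) ^+ 3.

Lemma resonance_bound_ge0 : 0 <= resonance_bound.
Proof.
have l0 : 0 <= lambda by exact: ltW.
have h1 : 0 <= 1 / 2 * (lambda / 10) ^+ 3 by rewrite mulr_ge0// exprn_ge0// divr_ge0.
have h2 : 0 <= kern_cst alpha * expR (- 2) * lambda `^ (alpha - 3).
  exact: (mulr_ge0 (mulr_ge0 (ltW (kern_cst_gt0 alpha1 alpha2)) (expR_ge0 _)) (powR_ge0 _ _)).
have h3 : 0 <= (lambda / 40) ^+ 3 by rewrite exprn_ge0// divr_ge0.
exact: (mulr_ge0 (mulr_ge0 h1 h2) h3).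
Qed.

(** Every contribution has nonnegative real part, so the integrals may be restricted. With [xi] and
    [y] within [lambda / 20] of the centre and [|h| <= lambda / 20], the points [y], [xi - h] and
    [y - h] are within [lambda / 10] of it, where the indicator is 1. *)
Lemma Re_duhamel_integrand tau xi : 0 <= tau -> 4 * tau * (2 * lambda) `^ alpha <= 1 ->
  `|xi - a0| <= lambda / 20 -> resonance_bound <=
  complex.Re (duhamel_integrand alpha (fun z => (annulus lambda z.2)%:C) (tau, xi)).
Proof.
move=> tau0 small hxi.
have near x : `|x - a0| <= lambda / 10 -> annulus lambda x = 1 by exact: annulus_near.
have axi : annulus lambda xi = 1.
  apply: near; apply: (le_trans hxi); rewrite ler_pM2l// lef_pV2 ?posrE// ler_nat//.
pose F x := phase alpha (- tau) x * (annulus lambda x)%:C.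
have dF := dominated_phase alpha (- tau) (dominated_annulus lambda1); rewrite -/F in dF.
set M := expR _ * _ in dF.
have M0 : 0 <= M by rewrite mulr_ge0 ?expR_ge0// exprn_ge0// addr_ge0// mulr_ge0// ltW.
have [mF leF] := dF; have b0 : 0 <= 1 :> R := ler01.
have mT := cmeasurable_tilde mF; have leT := normc_tilde leF.
have leF1 x : normc (F x) <= M * (1 * vwgt 1 x) by rewrite mul1r.
have [mk k0 _] := kern_bound alpha1 alpha2.
have iC h := cintegrable_conv_integrand kernel_bound1 b0 M0 M0 mF mT leF1 leT h.
have A0 : 0 <= convC * pi ^+ 3 * M * M :> R.
  exact: (mulr_ge0 (mulr_ge0 (mulr_ge0 convC_ge0 (exprn_ge0 _ (pi_ge0 _))) M0) M0).
have mk1 : cmeasurable (fun h => (kern alpha h)%:C * corr F h).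
  by apply: cmeasurableM; [exact: cmeasurable_real|exact: cmeasurable_corr].
have lek x : normc ((kern alpha x)%:C * corr F x) <= convC * pi ^+ 3 * M * M * (kern alpha x * vwgt 1 x).
  rewrite normcM normc_real ger0_norm// mulrCA ler_wpM2l//.
  exact: (normc_corr b0 M0 mF leF).
have iO := cintegrable_conv_integrand (kern_bound alpha1 alpha2) b0 A0 M0 mk1 mF lek leF xi.
have -> : duhamel_integrand alpha (fun z => (annulus lambda z.2)%:C) (tau, xi) =
    cintegral vol setT (fun h => phase alpha tau xi * ((kern alpha h)%:C * corr F h * F (xi - h))).
  by rewrite cintegralZ.
pose J h := cintegral vol setT (fun y => phase alpha tau xi * F (xi - h) * (F y * tilde F (h - y))).
have EJ h : phase alpha tau xi * ((kern alpha h)%:C * corr F h * F (xi - h)) = (kern alpha h)%:C * J h.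
  by rewrite /J (cintegralZ _ (iC h)) -[cintegral _ _ _]/(corr F h); ring.
rewrite (eq_cintegral _ EJ).
have iJ : cintegrable vol setT (fun h => (kern alpha h)%:C * J h).
  have := cintegrableZ (phase alpha tau xi) iO.
  by rewrite (_ : (fun x => _ * _) = (fun h => (kern alpha h)%:C * J h))//; apply/funext.
have ReJ h y : 1 / 2 * (annulus lambda (xi - h) * annulus lambda y * annulus lambda (- (h - y))) <=
    complex.Re (phase alpha tau xi * F (xi - h) * (F y * tilde F (h - y))).
  exact: Re_resonance.
have J0 h y : 0 <= complex.Re (phase alpha tau xi * F (xi - h) * (F y * tilde F (h - y))).
  apply: le_trans (ReJ h y); rewrite mulr_ge0// !mulr_ge0 ?annulus_ge0//.
have ER h : complex.Re ((kern alpha h)%:C * J h) = kern alpha h * complex.Re (J h).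
  by rewrite ReM -[complex.Re _%:C]/(kern alpha h) -[complex.Im _%:C]/(0 : R) mul0r subr0.
have JE h : complex.Re (J h) = Rintegral vol setT (fun y => complex.Re (phase alpha tau xi * F (xi - h) * (F y * tilde F (h - y)))) by [].
have J1 h : 0 <= complex.Re (J h) by rewrite JE; apply: Rintegral_ge0 => y _; exact: J0.
(* the cube around [b] avoids the singularity of [kern] at the origin *)
pose b : R3 R := (lambda / 40, 0, 0).
rewrite -[X in _ <= X]/(Rintegral vol setT (fun h => complex.Re ((kern alpha h)%:C * J h))).
have r1 : 0 <= lambda / 80 by rewrite divr_ge0// ltW.
have r2 : 0 <= lambda / 20 by rewrite divr_ge0// ltW.
rewrite /resonance_bound (_ : lambda / 40 = 2 * (lambda / 80)); last by field.
apply: (Rintegral_ge_set (measurable_cube b (lambda / 80)) (vol_cube b r1) iJ.1).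
  by move=> h; rewrite ER mulr_ge0.
move=> h; rewrite -[X in X -> _]/(is_true (`|h - b| <= lambda / 80)) => hb.
have hn : `|h| <= lambda / 20.
  rewrite -[h](subrK b) (le_trans (ler_normD _ _))// (_ : lambda / 20 = lambda / 80 + lambda * 3 / 80); last by field.
  rewrite lerD// /b normR3E /= normr0 !max_l// ?normr_ge0// ger0_norm ?divr_ge0 ?(ltW lambda0)//.
  by have := lambda0; lra.
have h0 : h != 0.
  apply: contraTneq hb => ->; rewrite sub0r normrN -ltNge /b normR3E /= normr0 !max_l// ?normr_ge0//.
  by rewrite ger0_norm ?divr_ge0 ?(ltW lambda0)//; have := lambda0; lra.
rewrite ER mulrC; apply: ler_pM => //.
- exact: (mulr_ge0 (mulr_ge0 (ltW (kern_cst_gt0 alpha1 alpha2)) (expR_ge0 _)) (powR_ge0 _ _)).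
- by rewrite mulr_ge0// exprn_ge0// divr_ge0// ltW.
- exact: kern_lower.
rewrite JE (_ : lambda / 10 = 2 * (lambda / 20)); last by field.
have iR := (cintegrableZ (phase alpha tau xi * F (xi - h)) (iC h)).1.
apply: (Rintegral_ge_set (measurable_cube a0 (lambda / 20)) (vol_cube a0 r2) iR) => // y.
rewrite -[X in X -> _]/(is_true (`|y - a0| <= lambda / 20)) => hy.
have add : lambda / 20 + lambda / 20 = lambda / 10 by field.
have l20 : lambda / 20 <= lambda / 10 by have := lambda0; lra.
apply: le_trans (ReJ h y); rewrite (near (xi - h)) ?(near y) ?(near (- (h - y))) ?mulr1//.
- by rewrite opprB addrAC (le_trans (ler_normB _ _))// -add lerD.
- exact: le_trans l20.
- by rewrite addrAC (le_trans (ler_normB _ _))// -add lerD.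
Qed.

End LowerBound.

(** * Norms of the datum and of the cubic term at frequency [lambda] *)

Section Inflation.
Context {R : realType}.
Variables (alpha sigma lambda : R).
Hypotheses (alpha1 : 1 < alpha) (alpha2 : alpha <= 2) (lambda1 : 1 <= lambda).
Notation leb := (@lebesgue_measure R).
Notation a0 := (center lambda).
Notation phi := (fun x => (annulus lambda x)%:C).
Implicit Types (x y h xi : R3 R) (s tau t : R).

Let lambda0 : 0 < lambda. Proof. exact: lt_le_trans lambda1. Qed.

Lemma cubic_term_lower T t xi : 0 < t -> t <= T -> 4 * t * (2 * lambda) `^ alpha <= 1 ->
  `|xi - a0| <= lambda / 20 ->
  `|sigma| * (resonance_bound alpha lambda * t) <= normc (cubic_term alpha sigma T phi t xi).
Proof.
move=> t0 tT small hxi.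
rewrite /cubic_term normcM normc_phase mul1r normcM normcM normc_real.
rewrite (_ : normc 'i = 1) ?mul1r; last by rewrite /normc /= expr0n expr1n add0r sqrtr1.
apply: ler_wpM2l => //; apply: le_trans (normr_Re_le _); apply: le_trans (ler_norm _).
pose K := duhamel_integrand alpha (fun z => phi z.2).
have dp := dominated_annulus lambda1; set M := expR _ * _ in dp.
have M0 : 0 <= M by rewrite mulr_ge0 ?expR_ge0// exprn_ge0// addr_ge0// mulr_ge0// ltW.
have dK := dominated2_duhamel_integrand alpha1 alpha2 M0 (dominated2_cst dp).
have iK := (cintegrable_primitive T t xi dK).1.
rewrite -[X in _ <= X]/(Rintegral leb setT (fun tau => complex.Re ((clip T t tau)%:C * K (tau, xi)))).
have ER tau : complex.Re ((clip T t tau)%:C * K (tau, xi)) = clip T t tau * complex.Re (K (tau, xi)).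
  by rewrite ReM -[complex.Re _%:C]/(clip T t tau) -[complex.Im _%:C]/(0 : R) mul0r subr0.
have low tau : 0 <= tau <= t -> resonance_bound alpha lambda <= complex.Re (K (tau, xi)).
  move=> /andP[tau0 taut]; apply: Re_duhamel_integrand => //.
  by apply: le_trans small; rewrite ler_wpM2r ?powR_ge0// ler_wpM2l.
have rb := resonance_bound_ge0 alpha1 alpha2 lambda1.
have clipE tau : clip T t tau = if 0 <= tau <= t then 1 else 0.
  by rewrite /clip min_l// indicE mem_setE in_itv; case: ifP.
have mt : lebesgue_measure (`[0, t]%classic : set R) = t%:E.
  by rewrite lebesgue_measure_itv/= lte_fin t0 oppr0 adde0.
apply: (@Rintegral_ge_set _ _ _ leb _ `[0, t]%classic _ t _ _ iK).
- exact: measurable_itv.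
- exact: mt.
- move=> tau; rewrite ER clipE; case: ifP => [/low h|_]; last by rewrite mul0r.
  by rewrite mul1r (le_trans rb).
- move=> tau itau; have h : 0 <= tau <= t by move: itau; rewrite /= in_itv.
  rewrite ER clipE h mul1r; exact: low.
Qed.

Lemma powR_antitone s (x y : R) : s <= 0 -> 0 < x -> x <= y -> y `^ s <= x `^ s.
Proof.
move=> s0 x0 xy; have y0 := lt_le_trans x0 xy.
rewrite -[s]opprK !(powRN _ (- s)) lef_pV2 ?posrE ?powR_gt0//.
by rewrite ge0_ler_powR ?oppr_ge0// nnegrE ltW.
Qed.

(** The shell lies in a cube of side [4 * lambda], and since [s <= 0] the weight is largest at the
    inner radius. *)
Lemma sqint_annulus s : s <= 0 -> (sqint s phi <= ((lambda ^+ 2) `^ s * (4 * lambda) ^+ 3)%:E)%E.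
Proof.
move=> s0; pose Q : set (R3 R) := [set x | `|x - 0| <= 2 * lambda].
have l2 : 0 <= 2 * lambda by rewrite mulr_ge0// ltW.
have mQ : measurable Q := measurable_cube 0 (2 * lambda).
have vQ : vol Q = ((4 * lambda) ^+ 3)%:E by rewrite (vol_cube 0 l2) mulrA -natrM.
have IQ : (\int[vol]_x (\1_Q x : R)%:E)%E = ((4 * lambda) ^+ 3)%:E by rewrite -vQ integral_indic// setIT.
have q0 : 0 <= (lambda ^+ 2) `^ s := powR_ge0 _ _.
apply: (@le_trans _ _ (\int[vol]_x (((lambda ^+ 2) `^ s)%:E * (\1_Q x : R)%:E))%E); last first.
  rewrite ge0_integralZl//; last by apply/measurable_EFinP; exact: measurable_indic.
  by rewrite IQ -EFinM.
apply: ge0_le_integral => //.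
- by move=> x _; rewrite lee_fin mulr_ge0 ?sqr_ge0 ?(ltW (sobw_gt0 _ _)).
- by apply/measurable_EFinP; apply: measurable_sqint; exact: (dominated_annulus lambda1).1.
- by apply/measurable_EFinP; apply: measurable_funM => //; exact: measurable_indic.
move=> x _; rewrite -EFinM lee_fin normc_real ger0_norm ?annulus_ge0// annulusE.
case: ifP => [/andP[h1 h2]|_]; last by rewrite expr0n mulr0 mulr_ge0// indicE ler0n.
have Qx : Q x by rewrite /Q /= subr0 (le_trans (norm_le_eucl x)).
rewrite expr1n indicE mem_set// !mulr1 /sobw powR_antitone ?exprn_gt0//.
have : lambda ^+ 2 <= eucl x ^+ 2 by rewrite lerXn2r ?nnegrE ?eucl_ge0 ?(ltW lambda0).
lra.
Qed.

(** Restriction to the cube about the centre; there [1 + eucl x ^+ 2] is at most [5 * lambda ^+ 2],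
    which bounds the weight from below because [s <= 0]. *)
Lemma sqint_cubic_term_lower s T t (X : R) : s <= 0 -> 0 < t -> t <= T -> 4 * t * (2 * lambda) `^ alpha <= 1 ->
  (sqint s (cubic_term alpha sigma T phi t) <= X%:E)%E ->
  (5 * lambda ^+ 2) `^ s * (`|sigma| * (resonance_bound alpha lambda * t)) ^+ 2 * (lambda / 10) ^+ 3 <= X.
Proof.
move=> s0 t0 tT small le.
have T0 := lt_le_trans t0 tT.
have dp := dominated_annulus lambda1; set M := expR _ * _ in dp.
have M0 : 0 <= M by rewrite mulr_ge0 ?expR_ge0// exprn_ge0// addr_ge0// mulr_ge0// ltW.
have [C C0 dC] := cubic_term_dominated sigma alpha1 alpha2 T0 M0 dp.
have iB := integrable_sqint (dC t).1 (le_lt_trans le (ltry _)).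
rewrite -lee_fin; apply: le_trans le.
have -> : sqint s (cubic_term alpha sigma T phi t) =
    (Rintegral vol setT (fun xi => sobw s xi * normc (cubic_term alpha sigma T phi t xi) ^+ 2))%:E.
  by rewrite /Rintegral fineK//; exact: (integrable_fin_num measurableT iB).
have r2 : 0 <= lambda / 20 by rewrite divr_ge0// ltW.
rewrite lee_fin (_ : lambda / 10 = 2 * (lambda / 20)); last by field.
apply: (Rintegral_ge_set (measurable_cube a0 (lambda / 20)) (vol_cube a0 r2) iB).
  by move=> x; rewrite mulr_ge0 ?sqr_ge0 ?(ltW (sobw_gt0 _ _)).
move=> x; rewrite -[X in X -> _]/(is_true (`|x - a0| <= lambda / 20)) => hx.
have rb := resonance_bound_ge0 alpha1 alpha2 lambda1.
apply: ler_pM; rewrite ?powR_ge0 ?sqr_ge0//.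
  have : annulus lambda x = 1.
    apply: annulus_near => //; apply: (le_trans hx); have := lambda0; lra.
  rewrite annulusE; case: ifP => [/andP[_ h] _|_ /eqP]; last by rewrite eq_sym oner_eq0.
  rewrite /sobw powR_antitone//; first by have := sqr_ge0 (eucl x); lra.
  have : eucl x ^+ 2 <= (2 * lambda) ^+ 2.
    by rewrite lerXn2r ?nnegrE ?eucl_ge0// mulr_ge0// ltW.
  have : 1 <= lambda ^+ 2 by rewrite exprn_ege1.
  by rewrite exprMn; lra.
rewrite lerXn2r ?nnegrE ?normc_ge0//; last exact: cubic_term_lower.
exact: (mulr_ge0 (normr_ge0 _) (mulr_ge0 rb (ltW t0))).
Qed.

End Inflation.

(** The second requirement ensures that the time scale of the resonance fits into [[0, T]], the
    third makes the contradiction; negativity of [s] is what lets the power be small. *)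
Lemma exists_frequency (R : realType) (s T e : R) : s < 0 -> 0 < T -> 0 < e ->
  exists lambda : R, [/\ 1 <= lambda, T^-1 <= lambda & (lambda ^+ 2) `^ s <= e].
Proof.
move=> s0 T0 e0; have p0 : 0 < e `^ s^-1 by rewrite powR_gt0.
have iT : 0 < T^-1 by rewrite invr_gt0.
(* One positive summand for each of the three requirements. *)
pose lambda := 1 + T^-1 + e `^ s^-1.
have l1 : 1 <= lambda by rewrite /lambda; lra.
exists lambda; split=> //; first by rewrite /lambda; lra.
rewrite -[leRHS](powRr1 (ltW e0)) -(mulVf (ltr0_neq0 s0)) powRrM.
apply: powR_antitone => //; first exact: ltW.
have h1 : e `^ s^-1 <= lambda by rewrite /lambda; lra.
apply: (le_trans h1); rewrite expr2 ler_peMr//; lra.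
Qed.

(** Two volumes give [lambda ^+ 6], the kernel [lambda ^ (alpha - 3)] and the time
    [lambda ^ (- alpha)]. *)
Lemma resonance_scaling (R : realType) (alpha lambda : R) : 0 < lambda ->
  resonance_bound alpha lambda / (4 * (2 * lambda) `^ alpha) =
  resonance_bound alpha 1 / (4 * 2 `^ alpha) * lambda ^+ 3.
Proof.
move=> l0; rewrite /resonance_bound powRM ?ler0n ?(ltW l0)// powR1.
have -> : lambda `^ (alpha - 3) = lambda `^ alpha / lambda ^+ 3.
  rewrite powRB; last by apply/implyP => _; rewrite gt_eqF.
  by rewrite (powR_mulrn 3 (ltW l0)).
have h1 : 2 `^ alpha != 0 :> R by rewrite gt_eqF// powR_gt0.
have h2 : lambda `^ alpha != 0 by rewrite gt_eqF// powR_gt0.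
by field; rewrite h1 h2 gt_eqF.
Qed.

Lemma resonance_bound_gt0 (R : realType) (alpha : R) : 1 < alpha -> alpha <= 2 -> 0 < resonance_bound alpha 1.
Proof.
move=> alpha1 alpha2; rewrite /resonance_bound powR1 mulr1.
have h1 : 0 < 1 / 2 * (1 / 10) ^+ 3 :> R by rewrite mulr_gt0 ?exprn_gt0 ?divr_gt0.
have h2 : 0 < (1 / 40) ^+ 3 :> R by rewrite exprn_gt0 ?divr_gt0.
exact: (mulr_gt0 (mulr_gt0 h1 (mulr_gt0 (kern_cst_gt0 alpha1 alpha2) (expR_gt0 _))) h2).
Qed.

Theorem theorem1p3 (R : realType) (alpha sigma s T r : R)
    (Phi : distr R -> R -> distr R) :
  1 < alpha -> alpha <= 2 -> sigma != 0 -> s < 0 -> 0 < T -> 0 < r ->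
  flow_map alpha sigma s T r Phi ->
  ~ C3_at_origin (Hs_rad s) (Hs_norm s) (CHs_norm s T) Phi.
Proof.
move=> alpha1 alpha2 sigma0 s0 T0 r0 flow c3.
have [K K0 HK] := cubic_term_bound alpha1 alpha2 T0 r0 flow c3.
pose c := resonance_bound alpha 1 / (4 * 2 `^ alpha).
have c0 : 0 < c.
  by rewrite divr_gt0 ?resonance_bound_gt0// mulr_gt0 ?powR_gt0.
(* [A] and [B] are what remains of the lower and of the upper bound once the powers of [lambda] are
   taken out. *)
pose A := 5 `^ s * (`|sigma| * c) ^+ 2 * (1 / 10) ^+ 3.
have A0 : 0 < A.
  have sc : 0 < `|sigma| * c by rewrite mulr_gt0 ?normr_gt0.
  by apply: mulr_gt0; [apply: mulr_gt0; [exact: powR_gt0|exact: exprn_gt0]|rewrite exprn_gt0 ?divr_gt0].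
pose B := K ^+ 2 * 64 ^+ 3.
have B0 : 0 <= B by rewrite mulr_ge0 ?sqr_ge0 ?exprn_ge0.
(* With [q <= e], the bound 1 gives [q ^+ 2 <= q], and the other gives [B * q <= A / 2]; together
   they exclude [A <= B * q ^+ 2]. *)
pose e := Num.min 1 (A / (B + 1) / 2).
have e0 : 0 < e by rewrite lt_min ltr01 !divr_gt0// ltr_wpDl.
have [lambda [l1 lT qe]] := exists_frequency s0 T0 e0.
have l0 : 0 < lambda := lt_le_trans ltr01 l1.
have q0 : 0 < (lambda ^+ 2) `^ s by rewrite powR_gt0// exprn_gt0.
set q := (lambda ^+ 2) `^ s in qe q0.
have D0 : 0 < 4 * (2 * lambda) `^ alpha by rewrite mulr_gt0// powR_gt0// mulr_gt0.
(* The longest time for which the phase condition holds. *)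
pose t := (4 * (2 * lambda) `^ alpha)^-1.
have t0 : 0 < t by rewrite invr_gt0.
have tT : t <= T.
  rewrite -[T]invrK lef_pV2 ?posrE ?invr_gt0// (le_trans lT)//.
  have h : 2 * lambda <= (2 * lambda) `^ alpha by rewrite le1r_powR// ?ltW//; lra.
  lra.
have small : 4 * t * (2 * lambda) `^ alpha <= 1 by rewrite mulrAC divff ?gt_eqF.
have m20 : 0 <= q * (4 * lambda) ^+ 3 by rewrite mulr_ge0 ?(ltW q0)// exprn_ge0// mulr_ge0// ltW.
pose m := Num.sqrt (q * (4 * lambda) ^+ 3).
have dp := dominated_annulus l1.
have M0 : 0 <= expR (2 * lambda) * (1 + 2 * lambda) ^+ 6.
  by rewrite mulr_ge0 ?expR_ge0// exprn_ge0// addr_ge0// mulr_ge0// ltW.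
have lem : (weighted_L2_norm s (fun x => (annulus lambda x)%:C) <= m%:E)%E.
  by rewrite weighted_L2_norm_le ?sqrtr_ge0// sqr_sqrtr//; apply: sqint_annulus => //; exact: ltW.
have tI : t \in `[0, T] by rewrite in_itv/= (ltW t0).
have := HK _ _ _ _ M0 dp (@annulus_rotation _ lambda) (sqrtr_ge0 _) lem tI.
rewrite weighted_L2_norm_le; last by rewrite mulr_ge0// exprn_ge0// sqrtr_ge0.
move=> /(sqint_cubic_term_lower alpha1 alpha2 l1 (ltW s0) t0 tT small).
have Em : (K * m ^+ 3) ^+ 2 = K ^+ 2 * (q * (4 * lambda) ^+ 3) ^+ 3.
  by rewrite exprMn -exprM mulnC exprM /m sqr_sqrtr.
rewrite -/m Em.
rewrite /t resonance_scaling// -/c.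
rewrite powRM ?ler0n ?sqr_ge0// -/q => main.
have l9 : 0 < lambda ^+ 9 by rewrite exprn_gt0.
(* Both sides contain [q * lambda ^+ 9], and the right-hand side keeps two further factors [q], the
   power that decays. *)
have : A * (q * lambda ^+ 9) <= B * q ^+ 2 * (q * lambda ^+ 9).
  by move: main; rewrite /A /B; congr (_ <= _); ring.
rewrite ler_pM2r ?mulr_gt0// leNgt => /negP; apply.
have q1 : q <= 1 by rewrite (le_trans qe)// /e ge_min lexx.
have q2 : q <= A / (B + 1) / 2 by rewrite (le_trans qe)// /e ge_min lexx orbT.
have h1 : q * (B + 1) <= A / 2.
  by rewrite -ler_pdivlMr ?ltr_wpDl// mulrAC.
have h2 : q ^+ 2 <= q by rewrite expr2 ler_piMl// ltW.
have := ler_wpM2l B0 h2; lra.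
Qed.
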